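(* There exists a constant $c$ such that C2E \textsc{Nondeterministic Constraint Logic} is $\mathsf{PSPACE}$-complete even when restricted to planar constraint graphs of bandwidth at most $c$ (and hence treewidth at most $c$) in which every vertex is an AND vertex or an OR vertex.
   Context: A constraint graph is an undirected graph with a positive integer weight on every edge and a nonnegative integer weight (its minimum inflow) on every vertex. A legal configuration is an assignment of an orientation to every edge such that for every vertex, the total weight of the edges oriented into that vertex is at least that vertex's minimum inflow. An OR vertex is a vertex of minimum inflow $2$ with exactly three incident edges, all of weight $2$. An AND vertex is a vertex of minimum inflow $2$ with exactly three incident edges, two of weight $1$ and one of weight $2$. C2E \textsc{Nondeterministic Constraint Logic}: given a constraint graph $G$, a target edge $e$ of $G$ and a legal configuration $C_1$ of $G$, is there a sequence of legal configurations starting at $C_1$, each obtained from the previous one by reversing the orientation of exactly one edge, such that eventually $e$ is reversed (relative to its orientation in $C_1$)? The bandwidth of a graph $G=(V,E)$ is the minimum, over all bijections $f:V\to\{1,\dots,|V|\}$, of $\max_{\{u,v\}\in E}|f(u)-f(v)|$. *)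

(* Defs.v *)
From HB Require Import structures.
From mathcomp Require Import all_boot all_order all_algebra.
From mathcomp Require Import all_classical reals topology normedtype.

Set Implicit Arguments.
Unset Strict Implicit.
Unset Printing Implicit Defensive.

Import Order.TTheory GRing.Theory Num.Theory numFieldNormedType.Exports.

(** * Turing machines, PSPACE and polynomial-time reductions *)

Inductive direction := GoLeft | GoRight | Stay.

(* Deterministic machines with one two-way infinite tape. The tape alphabet is
   [option (bool + tm_aux)]: [None] is the blank, [Some (inl b)] is the input
   bit [b], and [Some (inr a)] is an auxiliary symbol. The machine halts when
   [tm_delta] returns [None]. *)
Record tm := TM {
  tm_state : finType;
  tm_aux : finType;
  tm_start : tm_state;
  tm_accept : pred tm_state;
  tm_delta : tm_state -> option (bool + tm_aux) ->
             option (tm_state * option (bool + tm_aux) * direction)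
}.

Notation tm_sym M := (option (bool + tm_aux M)).

(* [tape_left] lists the visited cells to the left of the head, nearest cell
   first, and [tape_right] those to the right, nearest cell first; all the
   other cells are blank. *)
Record tm_conf (M : tm) := TMConf {
  conf_state : tm_state M;
  tape_left : seq (tm_sym M);
  tape_head : tm_sym M;
  tape_right : seq (tm_sym M)
}.

Definition tm_word (M : tm) (w : seq bool) : seq (tm_sym M) :=
  [seq Some (inl b) | b <- w].

Definition tm_init (M : tm) (w : seq bool) : tm_conf M :=
  TMConf (tm_start M) [::] (head None (tm_word M w)) (behead (tm_word M w)).

Definition tm_next (M : tm) (c : tm_conf M) : option (tm_conf M) :=
  let: TMConf q l x r := c in
  if tm_delta q x is Some (q', y, d) then
    Some (match d with
          | GoLeft => TMConf q' (behead l) (head None l) (y :: r)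
          | GoRight => TMConf q' (y :: l) (head None r) (behead r)
          | Stay => TMConf q' l y r
          end)
  else None.

Definition tm_halted (M : tm) (c : tm_conf M) : bool := ~~ isSome (tm_next c).

Definition tm_run (M : tm) (w : seq bool) (t : nat) : tm_conf M :=
  iter t (fun c => odflt c (tm_next c)) (tm_init M w).

Definition tm_tape (M : tm) (c : tm_conf M) : seq (tm_sym M) :=
  rev (tape_left c) ++ tape_head c :: tape_right c.

Definition tm_space (M : tm) (c : tm_conf M) : nat := size (tm_tape c).

(* Every polynomial is bounded by [poly_bound k] for some [k]. *)
Definition poly_bound (k n : nat) : nat := k * n ^ k + k.

Definition language := seq bool -> Prop.

Definition PSPACE (L : language) : Prop :=
  exists (M : tm) (k : nat), forall w : seq bool, exists t : nat,
    [/\ tm_halted (tm_run M w t),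
        tm_accept (conf_state (tm_run M w t)) <-> L w
      & forall i, i <= t -> tm_space (tm_run M w i) <= poly_bound k (size w)].

(* On input [w] the machine halts with exactly [f w] written on its otherwise
   blank tape. *)
Definition poly_time (f : seq bool -> seq bool) : Prop :=
  exists (M : tm) (k : nat), forall w : seq bool, exists t : nat,
    [/\ t <= poly_bound k (size w),
        tm_halted (tm_run M w t)
      & exists a b : nat, tm_tape (tm_run M w t) =
          nseq a None ++ tm_word M (f w) ++ nseq b None].

(** * Decision problems *)

Record problem := Problem {
  instance :> Type;
  encode : instance -> seq bool;
  yes : instance -> Prop
}.

Definition restrict (P : problem) (K : P -> Prop) : problem :=
  @Problem {x : P | K x} (fun x => encode (sval x)) (fun x => yes (sval x)).

(* The answer of the machine only matters on encodings of instances. *)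
Definition in_PSPACE (P : problem) : Prop :=
  exists2 L : language, PSPACE L & forall x : P, L (encode x) <-> yes x.

(* A reduction maps every word to the encoding of an instance. *)
Definition PSPACE_hard (P : problem) : Prop :=
  forall L : language, PSPACE L ->
  exists2 f : seq bool -> seq bool, poly_time f &
    forall w, exists2 x : P, encode x = f w & (L w <-> yes x).

Definition PSPACE_complete (P : problem) : Prop :=
  in_PSPACE P /\ PSPACE_hard P.

(** * Bandwidth and treewidth *)

Section Width.
Variables (T : finType) (adj : rel T).

(* The positions are 0, ..., #|T| - 1 instead of 1, ..., #|T|, which leaves the
   differences unchanged; by cardinality, injective numberings are bijective. *)
Definition stretch (f : {ffun T -> 'I_#|T|}) : nat :=
  \max_(p : T * T | adj p.1 p.2) `|f p.1 - f p.2|%N.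

Definition bandwidth : nat :=
  stretch [arg min_(f < [ffun x => enum_rank x] | injectiveb f) stretch f].

Definition is_tree (t : rel T) : Prop :=
  [/\ 0 < #|T|, symmetric t, irreflexive t, forall i j, connect t i j
    & forall s : seq T, 2 < size s -> ~ ucycle t s].

End Width.

Definition tree_decomposition (T : finType) (adj : rel T)
    (I : finType) (t : rel I) (bag : I -> {set T}) : Prop :=
  [/\ is_tree t,
      forall x, exists i, x \in bag i,
      forall x y, adj x y -> exists i, (x \in bag i) && (y \in bag i)
    & forall x i j, x \in bag i -> x \in bag j ->
        connect [rel a b | [&& t a b, x \in bag a & x \in bag b]] i j].

Definition treewidth_at_most (T : finType) (adj : rel T) (k : nat) : Prop :=
  exists (I : finType) (t : rel I) (bag : I -> {set T}),
    tree_decomposition adj t bag /\ forall i, #|bag i| <= k.+1.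

(** * Constraint graphs *)

(* The order in which the two endpoints [src e] and [dst e] of an edge are
   listed carries no meaning; it only serves to name the two orientations. *)
Record cgraph := CGraph {
  nv : nat;
  ne : nat;
  src : 'I_ne -> 'I_nv;
  dst : 'I_ne -> 'I_nv;
  weight : 'I_ne -> nat;
  inflow : 'I_nv -> nat;
  no_loop : forall e, src e != dst e;
  no_multi_edge : injective (fun e => [set src e; dst e]);
  weight_gt0 : forall e, 0 < weight e
}.

Section ConstraintGraph.
Variable G : cgraph.

Definition adjacent : rel 'I_(nv G) :=
  [rel u v | [exists e : 'I_(ne G), [set src e; dst e] == [set u; v]]].

(* [C e] is true when [e] is oriented from [src e] to [dst e]. *)
Definition config := {ffun 'I_(ne G) -> bool}.

Definition edge_head (C : config) (e : 'I_(ne G)) : 'I_(nv G) :=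
  if C e then dst e else src e.

Definition legal (C : config) : bool :=
  [forall v, inflow v <= \sum_(e | edge_head C e == v) weight e].

Definition one_reversal : rel config :=
  fun C C' => #|[set e | C e != C' e]| == 1.

Definition incident (v : 'I_(nv G)) : {set 'I_(ne G)} :=
  [set e | v \in [set src e; dst e]].

Definition or_vertex (v : 'I_(nv G)) : Prop :=
  [/\ inflow v = 2, #|incident v| = 3
    & forall e, e \in incident v -> weight e = 2].

Definition and_vertex (v : 'I_(nv G)) : Prop :=
  [/\ inflow v = 2, #|incident v| = 3,
      #|[set e in incident v | weight e == 1]| = 2
    & #|[set e in incident v | weight e == 2]| = 1].

End ConstraintGraph.

Section Planarity.
Local Open Scope ring_scope.

(* A drawing in the plane without crossings: the vertices are distinct points
   and the edges are simple arcs that meet vertices and other arcs only at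
   their endpoints. *)
Definition plane_drawing (R : realType) (G : cgraph)
    (pt : 'I_(nv G) -> R * R) (arc : 'I_(ne G) -> R -> R * R) : Prop :=
  [/\ injective pt,
      forall e, [/\ {within `[0, 1], continuous (arc e)}%classic,
                    {in `[0, 1] &, injective (arc e)},
                    arc e 0 = pt (src e) & arc e 1 = pt (dst e)],
      forall e v s, s \in `]0, 1[ -> arc e s <> pt v
    & forall e f s t, e != f -> s \in `]0, 1[ -> t \in `]0, 1[ ->
        arc e s <> arc f t].

Definition planar (R : realType) (G : cgraph) : Prop :=
  exists pt arc, @plane_drawing R G pt arc.

End Planarity.

(** * Nondeterministic constraint logic, configuration-to-edge *)

Record c2e_instance := C2EInstance {
  c2e_graph :> cgraph;
  c2e_target : 'I_(ne c2e_graph);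
  c2e_start : config c2e_graph;
  c2e_start_legal : legal c2e_start
}.

Definition c2e_yes (x : c2e_instance) : Prop :=
  exists s : seq (config x),
    [/\ path (@one_reversal x) (c2e_start x) s, all (@legal x) s
      & last (c2e_start x) s (c2e_target x) != c2e_start x (c2e_target x)].

(* Self-delimiting binary: each digit, least significant first, is preceded by
   [true], and [false] marks the end. *)
Definition encode_nat (n : nat) : seq bool :=
  flatten [seq [:: true; odd (n %/ 2 ^ i)] | i <- iota 0 (trunc_log 2 n).+1]
    ++ [:: false].

Definition c2e_encode (x : c2e_instance) : seq bool :=
  encode_nat (nv x) ++ encode_nat (ne x)
  ++ flatten [seq encode_nat (inflow v) | v <- enum 'I_(nv x)]
  ++ flatten [seq encode_nat (src e) ++ encode_nat (dst e)
                  ++ encode_nat (weight e) ++ [:: c2e_start x e]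
             | e <- enum 'I_(ne x)]
  ++ encode_nat (c2e_target x).

Definition C2E_NCL : problem := Problem c2e_encode c2e_yes.

(* Main.v *)
(* Membership follows Savitch: that the target edge can be reversed within
   [2 ^ k] moves is a quantified boolean formula of polynomial size, which a
   depth-first traversal evaluates in polynomial space.

   For hardness, the run of a Turing machine in bounded space is a sequence of
   rewritings of words in which a single letter changes at a time and adjacent
   letters always remain compatible. Words of [m] letters from an alphabet of
   [n] letters are represented by [m * n] lines, one for each position and
   letter, that turn around and cross within a band of width [O(n)]: some line
   of each position must be advanced, and a crossing gadget forbids advancing
   two lines of adjacent positions whose letters are incompatible. The result
   is a planar circuit of AND and OR vertices of bandwidth [O(n)].

   The alphabet depends on the machine, so this alone gives no constant. But
   the machine of the membership part is universal for the problem: reduce a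
   language to constraint logic through its own machine, with unbounded
   alphabet, and then reduce the language of this one fixed machine again. *)

(* Two obstacles shape the development. The definitions speak of actual Turing machines, so the
   quantifier traversal and the printing of circuits must both become machines. Both rest on
   expressions of a small language with unary values and truncated recursion, whose values and
   evaluation times are polynomial by construction; they compile to stack programs, and these to a
   one-tape machine. Secondly, constraint logic is reversible while a machine is not: backward moves
   reach words that never occur in the run. Determinism repairs this. A word from which the halting
   configuration is reached has at most one forward step, so the set of such words is closed in both
   directions, and acceptance depends on the halting configuration alone. The tiles come as tables
   of edges, states, reversal sequences and coordinates, certified by evaluation. The machine that
   is universal decides all AND/OR graphs, without any bound on bandwidth; hence the intermediate
   instances may be arbitrarily wide. *)
Require Import Defs.
From HB Require Import structures.
From mathcomp Require Import all_boot all_order all_algebra.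
From mathcomp Require Import boolp reals topology normedtype.
From mathcomp Require Import zify ring lra.

Set Implicit Arguments.
Unset Strict Implicit.
Unset Printing Implicit Defensive.

(** * Stack programs *)

Section StackPrograms.
Variable B : finType.
Notation A := (bool + B)%type.

Inductive cmd : Type :=
| Skip
| Push of nat & A
| Pop of nat
| Seq of cmd & cmd
| Case of nat & (option A -> cmd)
| While of nat & pred (option A) & cmd.

Definition store := seq (seq A).
Definition stk (s : store) (i : nat) : seq A := nth [::] s i.
Definition upd (s : store) (i : nat) (l : seq A) : store := set_nth [::] s i l.

(* [exec m c s t s']: from [s], the program [c] stops in [s'] after [t] steps,
   no stack ever growing beyond [m] symbols. *)
Inductive exec (m : nat) : cmd -> store -> nat -> store -> Prop :=
| XSkip s : exec m Skip s 0 s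
| XPush i a s : i < size s -> size (stk s i) < m ->
    exec m (Push i a) s 1 (upd s i (a :: stk s i))
| XPop i s : i < size s -> exec m (Pop i) s 1 (upd s i (behead (stk s i)))
| XSeq c1 c2 s t1 s1 t2 s2 : exec m c1 s t1 s1 -> exec m c2 s1 t2 s2 ->
    exec m (Seq c1 c2) s (t1 + t2) s2
| XCase i (f : option A -> cmd) s t s' : i < size s -> exec m (f (ohead (stk s i))) s t s' ->
    exec m (Case i f) s t.+1 s'
| XWhileF i (p : pred (option A)) c s : i < size s -> ~~ p (ohead (stk s i)) ->
    exec m (While i p c) s 1 s
| XWhileT i (p : pred (option A)) c s t1 s1 t2 s2 : i < size s -> p (ohead (stk s i)) ->
    exec m c s t1 s1 -> exec m (While i p c) s1 t2 s2 ->
    exec m (While i p c) s (t1 + t2).+1 s2.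

(** * Flattening programs into finite control *)

Inductive instr (Q : Type) : Type :=
| IPush of nat & A & option Q
| IPop of nat & option Q
| ITest of nat & (option A -> option Q).

Definition instr_map (Q Q' : Type) (g : option Q -> option Q') (x : instr Q) :=
  match x with
  | IPush i a o => IPush i a (g o)
  | IPop i o => IPop i (g o)
  | ITest i f => ITest i (g \o f)
  end.

(** The control points are computed from the syntax, so that their finiteness holds by construction.
    A successor [None] means that the program has ended. *)
Fixpoint pc (c : cmd) : finType :=
  match c with
  | Skip => void
  | Push _ _ => unit
  | Pop _ => unit
  | Seq c1 c2 => (pc c1 + pc c2)%type
  | Case _ f => option {x : option A & pc (f x)}
  | While _ _ c => option (pc c)
  end.

Fixpoint pc0 (c : cmd) : option (pc c) :=
  match c with
  | Skip => None
  | Push _ _ => Some tt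
  | Pop _ => Some tt
  | Seq c1 c2 => if pc0 c1 is Some q then Some (inl q) else omap inr (pc0 c2)
  | Case _ _ => Some None
  | While _ _ _ => Some None
  end.

Fixpoint code (c : cmd) : pc c -> instr (pc c) :=
  match c return pc c -> instr (pc c) with
  | Skip => fun q => match q with end
  | Push i a => fun _ => IPush i a None
  | Pop i => fun _ => IPop i None
  | Seq c1 c2 => fun q => match q with
      | inl q => instr_map (fun o => if o is Some q' then Some (inl q')
                                     else omap inr (pc0 c2)) (code q)
      | inr q => instr_map (omap inr) (code q)
      end
  | Case i f => fun q => match q with
      | None => ITest i (fun x => omap (fun q' => Some (existT _ x q'))
                                       (pc0 (f x)))
      | Some (existT x q) => instr_map
          (omap (fun q' => Some (existT (fun x => pc (f x) : Type) x q')))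
          (code q)
      end
  | While i p c => fun q => match q with
      | None => ITest i (fun x => if p x then Some (pc0 c) else None)
      | Some q => instr_map Some (code q)
      end
  end.

Inductive istep (m : nat) (Q : Type) :
    instr Q -> store -> option Q -> store -> Prop :=
| SPush i a o s : i < size s -> size (stk s i) < m ->
    istep m (IPush i a o) s o (upd s i (a :: stk s i))
| SPop i o s : i < size s ->
    istep m (IPop i o) s o (upd s i (behead (stk s i)))
| STest i f s : i < size s -> istep m (ITest i f) s (f (ohead (stk s i))) s.

Inductive isteps (m : nat) (Q : Type) (cd : Q -> instr Q) :
    option Q -> store -> nat -> option Q -> store -> Prop :=
| Steps0 o s : isteps m cd o s 0 o s
| StepsS q s o1 s1 t o2 s2 : istep m (cd q) s o1 s1 ->
    isteps m cd o1 s1 t o2 s2 -> isteps m cd (Some q) s t.+1 o2 s2.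

Lemma isteps_trans m Q (cd : Q -> instr Q) o s t o1 s1 t' o2 s2 :
  isteps m cd o s t o1 s1 -> isteps m cd o1 s1 t' o2 s2 ->
  isteps m cd o s (t + t') o2 s2.
Proof. by elim=> [//|q s' o' s1' t1 o3 s3 st _ IH /IH]; exact: StepsS st. Qed.

Lemma isteps_map m Q Q' (cd : Q -> instr Q) (cd' : Q' -> instr Q')
    (e : Q -> Q') (g : option Q -> option Q') :
  (forall q, g (Some q) = Some (e q)) ->
  (forall q, cd' (e q) = instr_map g (cd q)) ->
  forall o s t o' s', isteps m cd o s t o' s' ->
  isteps m cd' (g o) s t (g o') s'.
Proof.
move=> gS cdE o s t o' s'; elim=> [*|q s1 o1 s2 t1 o2 s3 st _ IH].
  exact: Steps0.
rewrite gS; apply: StepsS IH; rewrite cdE; case: st => [i a o0 s0 ? ?|i o0 s0 ?|i f s0 ?];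
  [exact: SPush|exact: SPop|].
by apply: (@STest m _ _ (g \o f)).
Qed.

(** The code of a compound program contains renamed copies of the codes of its parts, with the exit
    [None] redirected to what follows, so runs of the parts are transported by [isteps_map]. *)
Lemma exec_isteps m c s t s' :
  exec m c s t s' -> isteps m (@code c) (pc0 c) s t None s'.
Proof.
elim=> {c s t s'} /=.
- by move=> s; exact: Steps0.
- move=> i a s lti ltm; apply: StepsS (Steps0 _ _ _ _); exact: SPush.
- move=> i s lti; apply: StepsS (Steps0 _ _ _ _); exact: SPop.
- move=> c1 c2 s t1 s1 t2 s2 _ IH1 _ IH2; apply: isteps_trans.
    pose g (o : option (pc c1)) :=
      if o is Some q then Some (inl q) else omap inr (pc0 c2).
    exact: (isteps_map (e := inl) (g := g) _ _ IH1).
  exact: (isteps_map (e := inr) (g := omap inr) _ _ IH2).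
- move=> i f s t s' lti _ IH; eapply StepsS; [exact: STest|move=> /=].
  pose e q : pc (Case i f) :=
    Some (existT (fun x => pc (f x) : Type) (ohead (stk s i)) q).
  exact: (isteps_map (e := e) (g := omap e) _ _ IH).
- move=> i p c s lti np; eapply StepsS; [exact: STest|move=> /=].
  rewrite (negbTE np); exact: Steps0.
- move=> i p c s t1 s1 t2 s2 lti pi _ IH1 _ IH2.
  eapply StepsS; [exact: STest|move=> /=; rewrite pi].
  apply: isteps_trans IH2.
  exact: (isteps_map (e := Some) (g := Some) _ _ IH1).
Qed.

(** * Simulation by a single-tape machine *)

Variable K : nat.
Notation cell := {ffun 'I_K.+1 -> option A}.
Notation aux := (bool * cell)%type.
Notation sym := (option (bool + aux)).

(* Track [i] of cell [p] holds the [p]-th symbol, from the top, of stack [i];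
   the flag marks the origin. Raw bits are cells of the first track. *)
Definition cell0 : cell := [ffun=> None].
Definition blank : aux := (false, cell0).
Definition dec (x : sym) : aux :=
  match x with
  | None => blank
  | Some (inl b) => (false, [ffun i => if i == ord0 then Some (inl b) else None])
  | Some (inr y) => y
  end.
(** An empty unmarked cell is written as the blank, so that it looks the same whether visited or
    not. The final sweep stops at the first such cell. *)
Definition enc_cell (y : aux) : sym := if y == blank then None else Some (inr y).

Lemma encK : cancel enc_cell dec.
Proof. by move=> y; rewrite /enc_cell; case: eqP => [->|]. Qed.

Definition put_cell (y : cell) (i : 'I_K.+1) (x : option A) : cell :=
  [ffun j => if j == i then x else y j].

Variables (Q : finType) (cd : Q -> instr Q) (q0 : option Q).

(** A push walks right along its track carrying the displaced symbol ([PushR]) and returns to the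
    origin ([Ret]). A pop walks to the end of the track ([PopR]) and shifts it on the way back
    ([PopL]). [Fin] turns the cells into plain output symbols. *)
Inductive phase : Type :=
| Init
| Main of option Q
| PushR of option Q & 'I_K.+1 & option A
| PopR of option Q & 'I_K.+1
| PopL of option Q & 'I_K.+1 & option A
| Ret of option Q
| Fin of bool.

Definition phase_code (x : phase) :
  option (option Q + option Q * 'I_K.+1 * option A
  + (option Q * 'I_K.+1 + option Q * 'I_K.+1 * option A) + (option Q + bool)) :=
  match x with
  | Init => None
  | Main o => Some (inl (inl (inl o)))
  | PushR o i a => Some (inl (inl (inr (o, i, a))))
  | PopR o i => Some (inl (inr (inl (o, i))))
  | PopL o i a => Some (inl (inr (inr (o, i, a))))
  | Ret o => Some (inr (inl o))
  | Fin b => Some (inr (inr b))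
  end.
Definition phase_decode x : phase :=
  match x with
  | None => Init
  | Some (inl (inl (inl o))) => Main o
  | Some (inl (inl (inr (o, i, a)))) => PushR o i a
  | Some (inl (inr (inl (o, i)))) => PopR o i
  | Some (inl (inr (inr (o, i, a)))) => PopL o i a
  | Some (inr (inl o)) => Ret o
  | Some (inr (inr b)) => Fin b
  end.
Lemma phase_codeK : cancel phase_code phase_decode. Proof. by case. Qed.
HB.instance Definition _ := Equality.copy phase (can_type phase_codeK).
HB.instance Definition _ := Choice.copy phase (can_type phase_codeK).
HB.instance Definition _ := Countable.copy phase (can_type phase_codeK).
HB.instance Definition _ : isFinite phase := CanIsFinite phase_codeK.

Definition out_sym (y : cell) : sym :=
  if y ord0 is Some (inl b) then Some (inl b) else None.

Definition sim_delta (q : phase) (x : sym) : option (phase * sym * direction) :=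
  let: (fl, y) := dec x in
  match q with
  | Init => Some (Main q0, enc_cell (true, y), Stay)
  | Main None => Some (Fin (y ord0 == Some (inl true)), enc_cell (fl, y), Stay)
  | Main (Some q) =>
      match cd q with
      | IPush i a o => Some (PushR o (inord i) (Some a), enc_cell (fl, y), Stay)
      | IPop i o => Some (PopR o (inord i), enc_cell (fl, y), Stay)
      | ITest i f => Some (Main (f (y (inord i))), enc_cell (fl, y), Stay)
      end
  | PushR o i a =>
      if y i is Some b then Some (PushR o i (Some b), enc_cell (fl, put_cell y i a), GoRight)
      else Some (Ret o, enc_cell (fl, put_cell y i a), Stay)
  | PopR o i =>
      if y i is Some b then Some (PopR o i, enc_cell (fl, y), GoRight)
      else Some (PopL o i None, enc_cell (fl, y), Stay)
  | PopL o i a =>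
      if fl then Some (Main o, enc_cell (fl, put_cell y i a), Stay)
      else Some (PopL o i (y i), enc_cell (fl, put_cell y i a), GoLeft)
  | Ret o => if fl then Some (Main o, enc_cell (fl, y), Stay)
             else Some (Ret o, enc_cell (fl, y), GoLeft)
  | Fin b => if (fl, y) == blank then None else Some (Fin b, out_sym y, GoRight)
  end.

Definition sim : tm :=
  @TM phase aux Init (fun q => if q is Fin b then b else false) sim_delta.

Notation conf := (tm_conf sim).

Definition stp (c : conf) : conf := odflt c (tm_next c).

(* [at_ M q j cf c]: in [c] the state is [q], the head is on cell [j], and the
   tape, of at most [M] visited cells, has decoded contents [cf]. *)
Definition at_ (M : nat) (q : phase) (j : nat) (cf : nat -> aux) (c : conf) :=
  [/\ conf_state c = q, size (tape_left c) = j,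
      forall p, dec (nth None (tm_tape c) p) = cf p,
      forall p, cf p = blank -> nth None (tm_tape c) p = None
    & tm_space c <= M].

Definition go M q j cf t q' j' cf' := forall c, at_ M q j cf c ->
  at_ M q' j' cf' (iter t stp c) /\
  forall i, i <= t -> tm_space (iter i stp c) <= M.

Lemma at_ext M q j cf cf' c : cf =1 cf' -> at_ M q j cf c -> at_ M q j cf' c.
Proof.
move=> e [sc sl td tb ts]; split=> // p; first by rewrite -e.
by rewrite -e; exact: tb.
Qed.

Lemma go0 M q j cf cf' : cf =1 cf' -> go M q j cf 0 q j cf'.
Proof.
move=> e c ac; split; first exact: at_ext ac.
by case=> // _; case: ac.
Qed.

Lemma go_trans M q j cf t q1 j1 cf1 t' q2 j2 cf2 :
  go M q j cf t q1 j1 cf1 -> go M q1 j1 cf1 t' q2 j2 cf2 ->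
  go M q j cf (t + t') q2 j2 cf2.
Proof.
move=> g1 g2 c /g1[/g2[a2 s2] s1]; rewrite addnC iterD; split=> // i lei.
case: (leqP i t) => [/s1//|lti]; rewrite -(subnK (ltnW lti)) iterD.
by apply: s2; lia.
Qed.

Definition moved (d : direction) (j : nat) : nat :=
  match d with GoLeft => j.-1 | GoRight => j.+1 | Stay => j end.

Lemma go_step M q j cf q' y d cf' :
  (forall x, dec x = cf j -> sim_delta q x = Some (q', enc_cell y, d)) ->
  (forall p, cf' p = if p == j then y else cf p) ->
  (d = GoRight -> j.+1 < M) -> (d = GoLeft -> 0 < j) ->
  go M q j cf 1 q' (moved d j) cf'.
Proof.
move=> dE cfE dr dl [q1 l x r] [/= -> sl td tb ts].
have hx : dec x = cf j.
  by rewrite -td /tm_tape /= nth_cat size_rev sl ltnn subnn.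
have nE : stp (TMConf (q : tm_state sim) l x r) = match d with
    | GoLeft => @TMConf sim q' (behead l) (head None l) (enc_cell y :: r)
    | GoRight => @TMConf sim q' (enc_cell y :: l) (head None r) (behead r)
    | Stay => @TMConf sim q' l (enc_cell y) r end.
  by rewrite /stp /tm_next [tm_delta _ _](dE _ hx); case: (d).
have tE p : nth None (rev l ++ enc_cell y :: r) p =
    if p == j then enc_cell y else nth None (rev l ++ x :: r) p.
  rewrite !nth_cat size_rev sl; case: (ltngtP p j) => // [lt|->].
    by rewrite -subnSK.
  by rewrite subnn.
have {td tb}[td tb] : (forall p, dec (nth None (rev l ++ enc_cell y :: r) p) = cf' p) /\
    (forall p, cf' p = blank -> nth None (rev l ++ enc_cell y :: r) p = None).
  split=> p; rewrite tE cfE; case: eqP => // _.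
  - exact: encK.
  - by rewrite /enc_cell => ->; rewrite eqxx.
  - exact: tb.
have atd : at_ M q' (moved d j) cf' (stp (TMConf (q : tm_state sim) l x r)).
  rewrite nE; case: d dr dl {dE nE} => /= dr dl.
  - case: l sl ts td tb {tE} => [|z l] /= sl ts td tb.
      by move: (dl erefl); rewrite -sl.
    rewrite rev_cons cat_rcons in td tb.
    split=> //=; first by rewrite -sl.
    move: ts; rewrite /tm_space /tm_tape /= !size_cat !size_rev /=; lia.
  - have hr p : nth None (rev l ++ [:: enc_cell y, head None r & behead r]) p =
        nth None (rev l ++ enc_cell y :: r) p.
      case: (r) => //=; rewrite !nth_cat; case: ltnP => // h.
      by case: (p - size (rev l)) => [|[|n]] //=; rewrite nth_nil.
    split=> //=; first by rewrite sl.
    + by move=> p; rewrite /tm_tape /= rev_cons cat_rcons hr.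
    + by move=> p /tb; rewrite /tm_tape /= rev_cons cat_rcons hr.
    + move: ts (dr erefl); rewrite /tm_space /tm_tape /= !size_cat !size_rev /=.
      rewrite size_behead; case: (r) => /=; lia.
  - split=> //=.
    by move: ts; rewrite /tm_space /tm_tape /= !size_cat !size_rev.
split=> // i; case: i => [|[|//]] _ //=; by case: atd.
Qed.

Definition cellof (s : store) (p : nat) : cell :=
  [ffun i : 'I_K.+1 => onth (stk s i) p].
Definition cfs (s : store) (p : nat) : aux := (p == 0, cellof s p).

Lemma cellofE s p i : i < K.+1 -> cellof s p (inord i) = onth (stk s i) p.
Proof. by move=> h; rewrite ffunE inordK. Qed.

Lemma go_ret M o s j : go M (Ret o) j (cfs s) j.+1 (Main o) 0 (cfs s).
Proof.
elim: j => [|j IH].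
  apply: (go_step (y := cfs s 0) (d := Stay)) => // [x xE|p].
    by rewrite /sim_delta xE.
  by case: eqP => // ->.
apply: (go_trans (t := 1)) IH.
apply: (go_step (y := cfs s j.+1) (d := GoLeft)) => // [x xE|p].
  by rewrite /sim_delta xE.
by case: eqP => // ->.
Qed.

Lemma stk_upd (s : store) i l j :
  stk (upd s i l) j = if j == i then l else stk s j.
Proof. by rewrite /stk /upd nth_set_nth. Qed.

Lemma put_cellof s s' i p x : i < K.+1 ->
  (forall j, j < K.+1 -> j != i -> stk s' j = stk s j) -> x = onth (stk s' i) p ->
  put_cell (cellof s p) (inord i) x = cellof s' p.
Proof.
move=> lti h ->; apply/ffunP=> j; rewrite !ffunE.
case: eqP => [->|ne]; first by rewrite inordK.
by rewrite h //; apply/eqP=> ji; apply: ne; apply/val_inj; rewrite /= inordK.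
Qed.

(** The tape in the middle of a shift, as seen by a head that has arrived at cell [j]. *)
Definition mix s s' j p : aux := if p < j then cfs s' p else cfs s p.

Lemma go_push M o s i a : i < K.+1 -> size (stk s i) < M.-1 ->
  go M (PushR o (inord i) (Some a)) 0 (cfs s) (size (stk s i)).*2.+2
    (Main o) 0 (cfs (upd s i (a :: stk s i))).
Proof.
move=> lti; set l := stk s i; set s' := upd _ _ _ => ltM.
have hs' j : j < K.+1 -> j != i -> stk s' j = stk s j.
  by move=> _ /negbTE ne; rewrite stk_upd ne.
have s'i : stk s' i = a :: l by rewrite stk_upd eqxx.
(* One pass to the end of the track and one pass back. *)
have -> : (size l).*2.+2 = (size l).+1 + (size l).+1 by lia.
eapply go_trans; last exact: go_ret.
suff gen k j : k + j = size l -> go M (PushR o (inord i) (onth (a :: l) j)) j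
    (mix s s' j) k.+1 (Ret o) (size l) (cfs s').
  by move: (gen (size l) 0 (addn0 _)).
elim: k j => [|k IH] j /= kj.
  have jE : j = size l by [].
  rewrite -jE.
  apply: (go_step (y := cfs s' j) (d := Stay)) => // [x xE|p].
    rewrite /sim_delta xE /mix ltnn /cfs cellofE // onth_default ?jE //.
    by rewrite -jE (put_cellof (s' := s') (p := j)) // s'i.
  rewrite /mix; case: ltngtP => // [lt|->//].
  congr (_, _); apply/ffunP=> u; rewrite !ffunE.
  case: (eqVneq (u : nat) i) => [->|ne]; last by rewrite hs'.
  rewrite s'i !onth_default //= -?jE; lia.
apply: (go_trans (t := 1)) (IH j.+1 _); last by lia.
apply: (go_step (y := cfs s' j) (d := GoRight)) => // [x xE|p|_]; last by lia.
  have -> : onth (a :: l) j.+1 = onth l j by [].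
  have := onthTE l j; case e1: (onth l j) => [b|] /= lt; last by lia.
  rewrite /sim_delta xE /mix ltnn /cfs cellofE // -/l e1.
  by rewrite (put_cellof (s' := s') (p := j)) // s'i.
by rewrite /mix ltnS leq_eqVlt; case: eqP => //= ->.
Qed.

Lemma go_pop M o s i : i < K.+1 -> size (stk s i) < M.-1 ->
  go M (PopR o (inord i)) 0 (cfs s) (size (stk s i)).*2.+2
    (Main o) 0 (cfs (upd s i (behead (stk s i)))).
Proof.
move=> lti; set l := stk s i; set s' := upd _ _ _ => ltM.
have hs' j : j < K.+1 -> j != i -> stk s' j = stk s j.
  by move=> _ /negbTE ne; rewrite stk_upd ne.
have s'i : stk s' i = behead l by rewrite stk_upd eqxx.
have -> : (size l).*2.+2 = (size l).+1 + (size l).+1 by lia.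
apply: (@go_trans _ _ _ _ _ (PopL o (inord i) None) (size l) (cfs s)).
  suff gen k j : k + j = size l -> go M (PopR o (inord i)) j
      (cfs s) k.+1 (PopL o (inord i) None) (size l) (cfs s).
    by apply: gen; rewrite addn0.
  elim: k j => [|k IH] j /= kj.
    rewrite -kj add0n; apply: (go_step (y := cfs s j) (d := Stay)) => // [x xE|p].
      by rewrite /sim_delta xE /cfs cellofE // onth_default // -/l -kj add0n.
    by case: eqP => // ->.
  apply: (go_trans (t := 1)) (IH j.+1 _); last by lia.
  apply: (go_step (y := cfs s j) (d := GoRight)) => // [x xE|p|_]; last by lia.
    have := onthTE l j; case e1: (onth l j) => [b|] /= lt; last by lia.
    by rewrite /sim_delta xE /cfs cellofE // -/l e1.
  by case: eqP => // ->.
have -> : None = onth l (size l).+1 by rewrite onth_default.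
(* The cells beyond the track are empty before and after the pop, so the tape already has the mixed
   form from which the way back starts. *)
apply: (@go_trans _ _ _ _ 0 (PopL o (inord i) (onth l (size l).+1)) (size l)
  (mix s' s (size l).+1)).
  apply: go0 => p; rewrite /mix; case: ltnP => // lt.
  congr (_, _); apply/ffunP=> u; rewrite !ffunE.
  case: (eqVneq (u : nat) i) => [->|ne]; last by rewrite hs'.
  by rewrite s'i !onth_default // ?size_behead -/l; lia.
have pE j x : dec x = mix s' s j.+1 j -> dec x = cfs s j.
  by rewrite /mix ltnSn.
have oE j : onth l j.+1 = onth (behead l) j by case: (l) => //; rewrite !onth_default.
move: (size l) => j.
elim: j => [|j IH].
  apply: (go_step (y := cfs s' 0) (d := Stay)) => // [x /pE xE|p].
    by rewrite /sim_delta xE /cfs (put_cellof (s' := s')) // s'i oE.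
  by rewrite /mix; case: p.
apply: (go_trans (t := 1)) IH.
apply: (go_step (y := cfs s' j.+1) (d := GoLeft)) => // [x /pE xE|p].
  by rewrite /sim_delta xE /cfs cellofE // (put_cellof (s' := s')) // s'i -oE.
by rewrite /mix [p < j.+2]ltnS [p <= j.+1]leq_eqVlt; case: eqP => //= ->; rewrite ltnn.
Qed.

Definition fits m (s : store) := forall i, size (stk s i) <= m.

Lemma istep_fits m (x : instr Q) s o s' :
  istep m x s o s' -> fits m s -> size s = K.+1 -> fits m s' /\ size s' = K.+1.
Proof.
case=> {x s o s'} [i a o s lti ltm|i o s lti|//] fs sz; split.
- by move=> j; rewrite stk_upd; case: eqP.
- by rewrite size_set_nth sz; lia.
- by move=> j; rewrite stk_upd; case: eqP => // _; rewrite size_behead; have := fs i; lia.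
- by rewrite size_set_nth sz; lia.
Qed.

Lemma go_istep m q s o s' :
  istep m (cd q) s o s' -> fits m s -> size s = K.+1 ->
  exists2 t, t <= m.*2 + 4 & go m.+2 (Main (Some q)) 0 (cfs s) t (Main o) 0 (cfs s').
Proof.
move E: (cd q) => x st; case: st E => {x s o s'} [i a o s lti ltm|i o s lti|i f s lti] E fs sz.
- exists (1 + (size (stk s i)).*2.+2); first by have := fs i; lia.
  eapply go_trans; last by apply: go_push; rewrite -?sz //; have := fs i; lia.
  apply: (go_step (y := cfs s 0) (d := Stay)) => // [x xE|p].
    by rewrite /sim_delta xE /= E.
  by case: eqP => // ->.
- exists (1 + (size (stk s i)).*2.+2); first by have := fs i; lia.
  eapply go_trans; last by apply: go_pop; rewrite -?sz //; have := fs i; lia.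
  apply: (go_step (y := cfs s 0) (d := Stay)) => // [x xE|p].
    by rewrite /sim_delta xE /= E.
  by case: eqP => // ->.
- exists 1; first by lia.
  apply: (go_step (y := cfs s 0) (d := Stay)) => // [x xE|p].
    by rewrite /sim_delta xE /= E cellofE -?sz //; congr (Some (Main (f _), _, _)).
  by case: eqP => // ->.
Qed.

Lemma go_isteps m o s t o' s' :
  isteps m cd o s t o' s' -> fits m s -> size s = K.+1 ->
  [/\ fits m s', size s' = K.+1 & exists2 t', t' <= t * (m.*2 + 4) &
   go m.+2 (Main o) 0 (cfs s) t' (Main o') 0 (cfs s')].
Proof.
elim=> {o s t o' s'} [o s|q s o1 s1 t o2 s2 st _ IH] fs sz.
  by split=> //; exists 0 => //; exact: go0.
have [fs1 sz1] := istep_fits st fs sz; have [fs2 sz2 [t2 let2 g2]] := IH fs1 sz1.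
have [t1 let1 g1] := go_istep st fs sz.
split=> //; exists (t1 + t2); first by rewrite mulSn; lia.
exact: go_trans g1 g2.
Qed.

(** Cell 0 carries the flag and is never blank, and the other occupied cells form an initial
    segment. Hence the final pass halts exactly at cell [J], and [J] is positive even if all stacks
    are empty. *)
Lemma sweep M (s : store) b J k j l x r : size l = j -> j + k = J -> 0 < J -> J < M ->
  (forall p, J <= p -> cellof s p = cell0) ->
  (forall p, p < J -> 0 < p -> cellof s p != cell0) ->
  (forall p, j <= p -> dec (nth None (rev l ++ x :: r) p) = cfs s p) ->
  (forall p, J <= p -> nth None (rev l ++ x :: r) p = None) ->
  tm_space (@TMConf sim (Fin b) l x r) <= M ->
  let c := iter k stp (@TMConf sim (Fin b) l x r) in
  [/\ tm_halted c, conf_state c = Fin b,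
      exists d, tm_tape c =
        rev l ++ [seq out_sym (cellof s p) | p <- iota j k] ++ nseq d None
    & forall i, i <= k -> tm_space (iter i stp (@TMConf sim (Fin b) l x r)) <= M].
Proof.
elim: k j l x r => [|k IH] j l x r sl jk J0 JM z nz tp nb sp.
  have xE : x = None.
    by move: (nb J (leqnn J)); rewrite nth_cat size_rev sl -jk addn0 ltnn subnn.
  split=> //=.
  - by rewrite xE /tm_halted /= /sim_delta /= eqxx.
  - exists (size r).+1; rewrite /tm_tape /=; congr (_ ++ _).
    rewrite xE /=; congr (_ :: _); apply: (@eq_from_nth _ None) => [|i ir].
      by rewrite size_nseq.
    rewrite nth_nseq ir; have := nb (J + i.+1) (leq_addr _ _).
    by rewrite nth_cat size_rev sl -jk addn0 ltnNge leq_addr /= addKn.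
  - by case.
have hx : dec x = cfs s j.
  by rewrite -tp // nth_cat size_rev sl ltnn subnn.
have hd : sim_delta (Fin b) x = Some (Fin b, out_sym (cellof s j), GoRight).
  rewrite /sim_delta hx /cfs; case: eqP => // -[] j0 c0.
  have jlt : j < J by lia.
  by move: (nz j jlt); rewrite c0 eqxx lt0n j0 => /(_ isT).
have nE : stp (@TMConf sim (Fin b) l x r) = @TMConf sim (Fin b)
    (out_sym (cellof s j) :: l) (head None r) (behead r).
  by rewrite /stp /tm_next [tm_delta _ _]hd.
have tE p : j < p -> nth None (rev (out_sym (cellof s j) :: l) ++
    head None r :: behead r) p = nth None (rev l ++ x :: r) p.
  move=> jp; rewrite rev_cons cat_rcons !nth_cat size_rev sl ltnNge (ltnW jp) /=.
  by case E: (p - j) => [|[|i]] /=; [lia| |]; case: (r) => //=; rewrite nth_nil.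
have := IH j.+1 (out_sym (cellof s j) :: l) (head None r) (behead r).
rewrite /= sl; case=> //; first by lia.
- by move=> p jp; rewrite tE ?tp //; lia.
- by move=> p Jp; rewrite tE ?nb //; lia.
- move: sp; rewrite /tm_space /tm_tape /= !size_cat !size_rev /= size_behead.
  by case: (r) => /=; lia.
move=> h1 h2 [d h3] h4; rewrite -nE -iterSr in h1 h2 h3.
split=> //; first by exists d; rewrite h3 rev_cons cat_rcons.
by case=> // i lei; rewrite iterSr nE; apply: h4.
Qed.

(** * Complete runs of the simulating machine *)

Definition prog_init (w : seq bool) : store :=
  [seq inl b | b <- w] :: nseq K [::].

Definition sup (s : store) : nat := \max_(i < K.+1) size (stk s i).

Lemma sup_cell (s : store) : size s = K.+1 ->
  (forall p, maxn 1 (sup s) <= p -> cellof s p = cell0) /\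
  (forall p, p < maxn 1 (sup s) -> 0 < p -> cellof s p != cell0).
Proof.
move=> sz; split=> p.
  rewrite geq_max => /andP[_ h]; apply/ffunP=> i; rewrite !ffunE onth_default //.
  by apply: leq_trans h; rewrite /sup (bigD1 i) //= leq_maxl.
rewrite leq_max => /orP[|h] p0; first by lia.
case: (boolP [exists i : 'I_K.+1, p < size (stk s i)]) => [/existsP[i ip]|].
  apply/eqP=> /ffunP/(_ i); rewrite !ffunE => e.
  by have := onthTE (stk s i) p; rewrite e ip.
rewrite negb_exists => /forallP hp; suff: sup s <= p by lia.
by apply/bigmax_leqP=> i _; rewrite leqNgt; exact: hp.
Qed.

Lemma sim_correct m w t s : fits m (prog_init w) ->
  isteps m cd q0 (prog_init w) t None s ->
  exists T, [/\ T <= t * (m.*2 + 4) + m + 4,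
    tm_halted (tm_run sim w T),
    conf_state (tm_run sim w T) = Fin (ohead (stk s 0) == Some (inl true)),
    exists d, tm_tape (tm_run sim w T) =
      [seq out_sym (cellof s p) | p <- iota 0 (maxn 1 (sup s))] ++ nseq d None
    & forall i, i <= T -> tm_space (tm_run sim w i) <= m.+2].
Proof.
move=> fs st; have sz0 : size (prog_init w) = K.+1 by rewrite /= size_nseq.
have [fs' sz [t1 let1 g1]] := go_isteps st fs sz0.
pose J := maxn 1 (sup s); pose b := ohead (stk s 0) == Some (inl true).
have supm : sup s <= m by apply/bigmax_leqP.
pose cf0 p : aux := (false, cellof (prog_init w) p).
have g0 : go m.+2 Init 0 cf0 1 (Main q0) 0 (cfs (prog_init w)).
  apply: (go_step (y := cfs (prog_init w) 0) (d := Stay)) => // [x xE|p].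
    by rewrite /sim_delta xE.
  by rewrite /cfs; case: eqP => // ->.
have g2 : go m.+2 (Main None) 0 (cfs s) 1 (Fin b) 0 (cfs s).
  apply: (go_step (y := cfs s 0) (d := Stay)) => // [x xE|p].
    by rewrite /sim_delta xE /= ffunE; congr (Some (Fin _, _, _)).
  by case: eqP => // ->.
have wE : [:: head None (tm_word sim w) & behead (tm_word sim w)] =
    if w is [::] then [:: None] else tm_word sim w by case: (w).
have nthw p : nth None (tm_tape (tm_init sim w)) p = omap inl (onth w p).
  rewrite /tm_tape /= wE onthE -[omap _ _]/(_ (nth None _ p)).
  case: (w) p => [|a v] p; first by case: p => [|[]].
  elim: {a v}(a :: v) p => [|a v IH] [|p] //=; by rewrite -?IH ?nth_nil.
have a0 : at_ m.+2 Init 0 cf0 (tm_init sim w).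
  split=> //.
  - move=> p; rewrite nthw /cf0.
    have cE i : cellof (prog_init w) p i =
        if i == ord0 then omap inl (onth w p) else None.
      rewrite ffunE /stk; case: (unliftP ord0 i) => [j ->|->] /=.
        by rewrite nth_nseq if_same onth_default.
      by elim: (w) p => [|a v IH] [|p] //=.
    by case E: (onth w p) => [a|] /=; congr (_, _); apply/ffunP=> i;
      rewrite cE ffunE E //= if_same.
  - move=> p; rewrite nthw => -[] /ffunP/(_ ord0); rewrite !ffunE /stk /=.
    by elim: (w) p => [|a v IH] [|p] //=; apply: IH.
  - have := fs 0; rewrite /stk /= size_map /tm_space /tm_tape /= size_behead size_map.
    lia.
have [[sc sl td tb ts] sps] := go_trans (go_trans g0 g1) g2 a0.
set c := iter _ stp _ in sc sl td tb ts.
have [z nz] := sup_cell sz.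
have JM : J < m.+2 by rewrite /J; lia.
have cE : c = @TMConf sim (Fin b) [::] (tape_head c) (tape_right c).
  by move: sc sl; case: (c) => q [|//] x r /= ->.
have := @sweep m.+2 s b J J 0 [::] (tape_head c) (tape_right c) erefl (add0n _).
rewrite -cE; case=> //.
- by rewrite /J; lia.
- by move=> p _; rewrite -td cE.
- move=> p Jp; have := tb p; rewrite cE; apply; rewrite /cfs z //.
  by have -> : (p == 0) = false by move: Jp; rewrite /J; lia.
move=> h1 h2 [d h3] h4; exists (J + (1 + t1 + 1)); rewrite /tm_run -/stp.
rewrite -iterD in h1 h2 h3; split=> //.
- by rewrite /J; lia.
- by exists d.
- move=> i lei; case: (leqP i (1 + t1 + 1)) => [/sps//|lti].
  rewrite -(subnK (ltnW lti)) iterD; apply: h4; lia.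
Qed.

End StackPrograms.

(** * Polynomial bounds *)

Definition polyb (f : nat -> nat) : Prop := exists k, forall n, f n <= poly_bound k n.

Lemma poly_bound_mono k k' n n' : k <= k' -> n <= n' ->
  poly_bound k n <= poly_bound k' n'.
Proof.
rewrite /poly_bound => lek len; apply: leq_add => //.
apply: (@leq_trans (k * n' ^ k)); first by case: (k) => [|j] //; rewrite leq_mul2l leq_exp2r ?len ?orbT.
case: n' {len} => [|n'].
  by case: k lek => [|k] // _; rewrite exp0n // muln0.
by apply: leq_mul => //; rewrite leq_pexp2l.
Qed.

Lemma poly_bound0 k : poly_bound k 0 = k.
Proof. by rewrite /poly_bound; case: k => // k; rewrite exp0n // muln0. Qed.

Lemma polyb_le f g : (forall n, f n <= g n) -> polyb g -> polyb f.
Proof. by move=> fg [k gk]; exists k => n; apply: leq_trans (gk n). Qed.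

Lemma polyb_const c : polyb (fun=> c).
Proof. by exists c => n; rewrite /poly_bound; lia. Qed.

Lemma polyb_id : polyb id.
Proof. by exists 1 => n; rewrite /poly_bound mul1n expn1; lia. Qed.

Lemma polyb_add f g : polyb f -> polyb g -> polyb (fun n => f n + g n).
Proof.
move=> [k fk] [k' gk]; exists (k + k') => n; apply: leq_trans (leq_add (fk n) (gk n)) _.
case: n => [|n]; first by rewrite !poly_bound0.
rewrite /poly_bound mulnDl.
have : k * n.+1 ^ k <= k * n.+1 ^ (k + k') by rewrite leq_mul2l leq_pexp2l ?orbT ?leq_addr.
have : k' * n.+1 ^ k' <= k' * n.+1 ^ (k + k') by rewrite leq_mul2l leq_pexp2l ?orbT ?leq_addl.
lia.
Qed.

Lemma polyb_mul f g : polyb f -> polyb g -> polyb (fun n => f n * g n).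
Proof.
move=> [k fk] [k' gk]; exists (4 * (k * k') + k + k') => n.
apply: leq_trans (leq_mul (fk n) (gk n)) _.
set q := _ + _ + k'.
case: n => [|n]; first by rewrite !poly_bound0 /q; nia.
rewrite /poly_bound.
have hk j : j <= j * n.+1 ^ j by rewrite leq_pmulr // expn_gt0.
have : n.+1 ^ (k + k') <= n.+1 ^ q by rewrite leq_pexp2l //; lia.
rewrite expnD; move: (hk k) (hk k'); set a := n.+1 ^ k; set b := n.+1 ^ k'; set e := n.+1 ^ q.
move=> ha hb hab; apply: (@leq_trans (4 * (k * k') * e + q)).
  (* For a positive argument the powers are at least 1, so each factor is at most twice its leading
     term; this is the origin of the constant 4. *)
  have : (k * a + k) * (k' * b + k') <= (2 * (k * a)) * (2 * (k' * b)) by apply: leq_mul; lia.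
  have : 4 * (k * k') * (a * b) <= 4 * (k * k') * e by rewrite leq_mul2l hab orbT.
  nia.
by rewrite leq_add2r leq_mul2r /q; apply/orP; right; lia.
Qed.

Lemma polyb_exp f k : polyb f -> polyb (fun n => f n ^ k).
Proof.
move=> pf; elim: k => [|k IH]; first by apply: polyb_le (polyb_const 1) => n.
by apply: polyb_le (polyb_mul pf IH) => n; rewrite expnS.
Qed.

Lemma polyb_comp f g k : (forall n, f n <= poly_bound k n) -> polyb g ->
  polyb (fun n => f (g n)).
Proof.
move=> fk pg; apply: polyb_le (fun n => fk (g n)) _; rewrite /poly_bound.
apply: polyb_add (polyb_const k); exact: polyb_mul (polyb_const k) (polyb_exp k pg).
Qed.

Lemma prog_poly_time (B : finType) K (c : cmd B) (f : seq bool -> seq bool) (m T : nat -> nat) :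
  polyb m -> polyb T -> (forall w : seq bool, size w <= m (size w)) ->
  (forall w, exists t s, [/\ t <= T (size w), exec (m (size w)) c (prog_init B K w) t s
     & stk s 0 = [seq inl b | b <- f w]]) -> poly_time f.
Proof.
move=> pm pT mw run.
have [k hk] : polyb (fun n => T n * ((m n).*2 + 4) + m n + 4).
  apply: polyb_add (polyb_const 4); apply: polyb_add (pm); apply: polyb_mul (pT) _.
  apply: polyb_add (polyb_const 4); apply: polyb_le (polyb_add pm pm) => n.
  by rewrite addnn.
exists (sim K (@code B c) (pc0 c)), k => w.
have [t [s [let_ /exec_isteps st fE]]] := run w.
have fits0 : fits (m (size w)) (prog_init B K w).
  case=> [|i]; rewrite /stk /=; first by rewrite size_map.
  by rewrite nth_nseq if_same.
have [N [leN h sN [d tN] sp]] := sim_correct fits0 st.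
exists N; split=> //.
  apply: leq_trans leN (leq_trans _ (hk (size w))).
  by rewrite !leq_add2r leq_mul2r let_ orbT.
pose J := maxn 1 (sup K s); exists 0, (J - size (f w) + d); rewrite tN /=.
have leJ : size (f w) <= J.
  rewrite /J leq_max; apply/orP; right.
  have -> : size (f w) = size (stk s 0) by rewrite fE size_map.
  exact: (@leq_bigmax _ (fun i : 'I_K.+1 => size (stk s i)) ord0).
rewrite nseqD catA; congr (_ ++ _); apply: (@eq_from_nth _ None) => [|i].
  by rewrite size_cat !size_map size_iota size_nseq subnKC.
rewrite size_map size_iota => iJ; rewrite (nth_map 0) ?size_iota // nth_iota // add0n.
rewrite /out_sym ffunE fE nth_cat size_map; case: ltnP => ir.
  rewrite (nth_map false) // onthE; move: ir.
  by elim: (f w) i {iJ} => // a v IH [|i] //= /IH.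
by rewrite onth_default ?size_map // nth_nseq if_same.
Qed.

(** No bound on the number of steps is asked for: the quantifier traversal takes exponential time on
    stacks of polynomial height. *)
Lemma prog_PSPACE (B : finType) K (c : cmd B) (D : seq bool -> bool) (m : nat -> nat) :
  polyb m -> (forall w : seq bool, size w <= m (size w)) ->
  (forall w, exists t s, exec (m (size w)) c (prog_init B K w) t s
     /\ (ohead (stk s 0) == Some (inl true)) = D w) -> PSPACE D.
Proof.
move=> pm mw run.
have [k hk] := polyb_add pm (polyb_const 2).
exists (sim K (@code B c) (pc0 c)), k => w.
have [t [s [/exec_isteps st fE]]] := run w.
have fits0 : fits (m (size w)) (prog_init B K w).
  case=> [|i]; rewrite /stk /=; first by rewrite size_map.
  by rewrite nth_nseq if_same.
have [N [_ h sN _ sp]] := sim_correct fits0 st.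
exists N; split=> //; first by rewrite sN /= fE.
by move=> i /sp le_i; apply: leq_trans le_i _; rewrite -addn2.
Qed.

(** * A language of polynomially bounded arithmetic *)

Arguments upd : simpl never.
Arguments stk : simpl never.

Section Execution.
Variable B : finType.
Notation sym := (bool + B)%type.
Notation prog := (cmd B).
Notation Push := (@Push B).
Notation Pop := (@Pop B).
Notation Skip := (@Skip B).
Notation one := (inl true : sym).

(** Only time is recorded. A step adds at most one symbol, so [exec_bound] recovers a bound on the
    stacks from the running time. *)
Definition ext (c : prog) (s : store B) T s' := exists m t, t <= T /\ exec m c s t s'.

Lemma size_upd (s : store B) i l : size (upd s i l) = maxn i.+1 (size s).
Proof. by rewrite /upd size_set_nth. Qed.

Lemma stk_updE (s : store B) i l j : stk (upd s i l) j = if j == i then l else stk s j.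
Proof. by rewrite /stk /upd nth_set_nth. Qed.

Lemma store_ext (s s' : store B) : size s = size s' -> (forall j, stk s j = stk s' j) -> s = s'.
Proof. by move=> e h; apply: (@eq_from_nth _ [::]) => // i _; exact: h. Qed.

Lemma exec_mono m m' (c : prog) s t s' : m <= m' -> exec m c s t s' -> exec m' c s t s'.
Proof.
move=> le; elim=> [s0|i a s0 h1 h2|i s0 h1|c1 c2 s0 t1 s1 t2 s2 _ h1 _ h2|i f s0 t0 s1 h _ h1|i p c0 s0 h1 h2|i p c0 s0 t1 s1 t2 s2 h1 h2 _ h3 _ h4].
- exact: XSkip.
- by apply: XPush => //; exact: leq_trans le.
- exact: XPop.
- exact: XSeq h1 h2.
- exact: XCase.
- exact: XWhileF.
- exact: XWhileT h3 h4.
Qed.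

Lemma exec_bound m (c : prog) s t s' : exec m c s t s' ->
  (forall M, (forall i, size (stk s i) + t <= M) -> exec M c s t s') /\
  forall i, size (stk s' i) <= size (stk s i) + t.
Proof.
elim=> [s0|i a s0 h1 h2|i s0 h1|c1 c2 s0 t1 s1 t2 s2 _ [h1 g1] _ [h2 g2]|i f s0 t0 s1 h _ [h1 g1]|i p c0 s0 h1 h2|i p c0 s0 t1 s1 t2 s2 h1 h2 _ [h3 g3] _ [h4 g4]].
- by split=> [M _|i]; [exact: XSkip|rewrite addn0].
- split=> [M h|j]; first by apply: XPush => //; have := h i; lia.
  by rewrite stk_updE; case: eqP => [->|_] /=; lia.
- split=> [M h|j]; first exact: XPop.
  by rewrite stk_updE; case: eqP => [->|_] /=; rewrite ?size_behead; lia.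
- split=> [M h|j]; last by have := g1 j; have := g2 j; lia.
  by apply: XSeq (h1 _ _) (h2 _ _) => i; have := h i; have := g1 i; lia.
- split=> [M h2|j]; last by have := g1 j; lia.
  by apply: XCase => //; apply: h1 => j; have := h2 j; lia.
- by split=> [M _|j]; [exact: XWhileF|lia].
- split=> [M h|j]; last by have := g3 j; have := g4 j; lia.
  by apply: XWhileT (h3 _ _) (h4 _ _) => // i'; have := h i'; have := g3 i'; lia.
Qed.

Lemma ext_skip s T : ext Skip s T s.
Proof. by exists 0, 0; split=> //; exact: XSkip. Qed.

Lemma ext_push i a s T : i < size s -> 0 < T -> ext (Push i a) s T (upd s i (a :: stk s i)).
Proof. by move=> h T0; exists (size (stk s i)).+1, 1; split=> //; exact: XPush. Qed.

Lemma ext_pop i s T : i < size s -> 0 < T -> ext (Pop i) s T (upd s i (behead (stk s i))).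
Proof. by move=> h T0; exists 0, 1; split=> //; exact: XPop. Qed.

Lemma ext_seq c1 c2 s T1 s1 T2 s2 T : ext c1 s T1 s1 -> ext c2 s1 T2 s2 -> T1 + T2 <= T ->
  ext (Seq c1 c2) s T s2.
Proof.
move=> [m1 [t1 [l1 h1]]] [m2 [t2 [l2 h2]]] le; exists (m1 + m2), (t1 + t2); split; first lia.
by apply: XSeq (exec_mono _ h1) (exec_mono _ h2); lia.
Qed.

Lemma ext_case i f s T s' T' : i < size s -> ext (f (ohead (stk s i))) s T s' -> T < T' ->
  ext (Case i f) s T' s'.
Proof.
by move=> h [m [t [l e]]] lT; exists m, t.+1; split; [lia|exact: XCase].
Qed.

Lemma ext_le c s T T' s' : ext c s T s' -> T <= T' -> ext c s T' s'.
Proof. by move=> [m [t [l e]]] h; exists m, t; split=> //; lia. Qed.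

Lemma ext_while i (p : pred (option sym)) c (S : nat -> store B) n T T' :
  (forall k, k <= n -> i < size (S k)) ->
  (forall k, k < n -> p (ohead (stk (S k) i)) /\ ext c (S k) T (S k.+1)) ->
  ~~ p (ohead (stk (S n) i)) -> n * T.+1 < T' -> ext (While i p c) (S 0) T' (S n).
Proof.
move=> hi hs hn /(ext_le _); apply; elim: n S hi hs hn => [|n IH] S hi hs hn.
  by exists 0, 1; split; [lia|apply: XWhileF => //; exact: hi].
have [p0 [m1 [t1 [l1 e1]]]] := hs 0 isT.
have [|k kn|//|m2 [t2 [l2 e2]]] := IH (fun k => S k.+1).
- by move=> k kn; apply: hi.
- exact: hs.
exists (m1 + m2), (t1 + t2).+1; split; first nia.
by apply: XWhileT (exec_mono _ e1) (exec_mono _ e2) => //; [exact: hi|lia|lia].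
Qed.

Definition For i c : prog := While i isSome (Seq (Pop i) c).

Lemma ext_for i c (S : nat -> store B) n T T' :
  (forall k, k <= n -> i < size (S k) /\ stk (S k) i = nseq (n - k) one) ->
  (forall k, k < n -> ext c (upd (S k) i (nseq (n - k.+1) one)) T (S k.+1)) ->
  n * T.+2 < T' -> ext (For i c) (S 0) T' (S n).
Proof.
move=> hi hs; apply: ext_while => [k /hi[]//|k kn|].
  have [h1 h2] := hi k (ltnW kn); split; first by rewrite h2 -[n - k]prednK ?subn_gt0.
  apply: (@ext_seq _ _ _ 1 _ T); [by apply: ext_pop| |by []].
  by rewrite h2; have := hs k kn; rewrite subnS; case: (n - k).
by have [_ ->] := hi n (leqnn n); rewrite subnn.
Qed.

End Execution.

Ltac eqs := repeat match goal with |- context [if ?a == ?b then _ else _] =>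
  first [ replace (a == b) with false by (symmetry; apply/eqP; lia)
        | replace (a == b) with true by (symmetry; apply/eqP; lia)] end.
Ltac stks := rewrite ?stk_updE; eqs.
Ltac sto := apply: store_ext; [rewrite ?size_upd; lia|let j := fresh "j" in move=> j; rewrite ?stk_updE; eqs;
  repeat (let e := fresh "e" in case: eqP => e; [rewrite ?e|]; rewrite ?stk_updE; eqs)].

Lemma polyb_pb k g : polyb g -> polyb (fun n => poly_bound k (g n)).
Proof. exact: polyb_comp. Qed.

Ltac pb := repeat first [exact: polyb_id | exact: polyb_const | apply: polyb_pb
  | apply: polyb_add | apply: polyb_mul].

Section Language.
Variable B : finType.
Notation sym := (bool + B)%type.
Notation prog := (cmd B).
Notation Push := (@Push B).
Notation Pop := (@Pop B).
Notation Skip := (@Skip B).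
Notation one := (inl true : sym).

Definition clear i : prog := While i isSome (Pop i).

Lemma ext_clear i (s : store B) T : i < size s -> (size (stk s i)).*2 < T -> ext (clear i) s T (upd s i [::]).
Proof.
move=> h hT; pose S k := upd s i (drop k (stk s i)).
have -> : upd s i [::] = S (size (stk s i)) by rewrite /S drop_size.
have s0 : s = S 0 by rewrite /S drop0; sto.
rewrite [X in ext _ X]s0.
apply: (@ext_while B _ _ _ S _ 1) => [k _|k kn||]; rewrite /S ?size_upd ?stk_updE ?eqxx; try lia.
  rewrite (drop_nth one kn); split=> //.
  have h' : i < size (upd s i (nth one (stk s i) k :: drop k.+1 (stk s i))) by rewrite size_upd; lia.
  have := ext_pop h' (isT : 0 < 1); rewrite stk_updE eqxx /=.
  by rewrite [X in ext _ _ _ X -> _](_ : _ = upd s i (drop k.+1 (stk s i))) //; sto.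
by rewrite drop_size.
Qed.

Definition opush (x : option nat) : prog := if x is Some d then Push d one else Skip.

Definition move i j x : prog := While i isSome
  (Case i (fun o => if o is Some a then Seq (Pop i) (Seq (Push j a) (opush x)) else Skip)).

Definition oupd (s : store B) x n := if x is Some d then upd s d (nseq n one ++ stk s d) else s.

Lemma ext_move i j x (s : store B) T : i < size s -> j < size s -> i != j ->
  (if x is Some d then [&& d < size s, d != i & d != j] else true) -> 6 * size (stk s i) < T ->
  ext (move i j x) s T (oupd (upd (upd s i [::]) j (catrev (stk s i) (stk s j))) x (size (stk s i))).
Proof.
move=> hi hj ij hx hT.
pose S k := oupd (upd (upd s i (drop k (stk s i))) j (catrev (take k (stk s i)) (stk s j))) x k.
have sz k : size (S k) = size s.
  by rewrite /S /oupd; move: hx; destruct x as [d|] => hx; rewrite !size_upd; lia.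
have SE : S (size (stk s i)) = oupd (upd (upd s i [::]) j (catrev (stk s i) (stk s j))) x (size (stk s i)).
  by rewrite /S drop_size take_size.
have s0 : s = S 0.
  by rewrite /S drop0 take0 /oupd; move: hx; destruct x as [d|] => hx; sto.
rewrite -SE [X in ext _ X]s0.
have Si k : stk (S k) i = drop k (stk s i).
  by rewrite /S /oupd; move: hx; destruct x as [d|] => hx; stks.
apply: (@ext_while B _ _ _ S _ 5) => [k _|k kn||]; rewrite ?sz ?Si //; try lia; last first.
  by rewrite drop_size.
rewrite (drop_nth one kn); split=> //.
apply: (@ext_case B _ _ _ 4); rewrite ?sz ?Si ?(drop_nth one kn) //=.
apply: (@ext_seq B _ _ _ 1); [by apply: ext_pop; rewrite ?sz| |exact: (isT : 1 + 3 <= 4)].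
apply: (@ext_seq B _ _ _ 1); [by apply: ext_push; rewrite ?size_upd ?sz //; lia| |exact: (isT : 1 + 2 <= 3)].
rewrite Si (drop_nth one kn) /=.
have tk : take k.+1 (stk s i) = rcons (take k (stk s i)) (nth one (stk s i) k) by rewrite (take_nth one).
have cr l a l' : catrev (rcons l a) l' = a :: catrev l l' :> seq sym.
  by elim: l l' => //= b l IH l'; rewrite IH.
rewrite /opush /S /oupd; move: hx; destruct x as [d|] => hx.
  have -> : upd (upd (upd s i (drop k.+1 (stk s i))) j (catrev (take k.+1 (stk s i)) (stk s j))) d (nseq k.+1 one ++
    stk (upd (upd s i (drop k.+1 (stk s i))) j (catrev (take k.+1 (stk s i)) (stk s j))) d) =
    let s1 := upd (upd (S k) i (drop k.+1 (stk s i))) j (nth one (stk s i) k :: stk (upd (S k) i (drop k.+1 (stk s i))) j) in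
     upd s1 d (one :: stk s1 d).
    by rewrite /S /oupd /=; sto; rewrite ?tk ?cr.
  by apply: ext_push; rewrite ?size_upd; lia.
have <- : upd (upd (S k) i (drop k.+1 (stk s i))) j (nth one (stk s i) k :: stk (upd (S k) i (drop k.+1 (stk s i))) j) =
  upd (upd s i (drop k.+1 (stk s i))) j (catrev (take k.+1 (stk s i)) (stk s j)).
  by rewrite /S /oupd; sto; rewrite ?tk ?cr.
exact: ext_skip.
Qed.

Lemma nseq_cons n l : nseq n one ++ one :: l = one :: nseq n one ++ l.
Proof. by elim: n => //= n ->. Qed.

Lemma nseq_addl n m l : nseq n one ++ nseq m one ++ l = nseq (n + m) one ++ l.
Proof. by rewrite nseqD catA. Qed.

Notation code := (seq nat -> nat -> nat -> prog).

(** Stack 0 holds the input and stack 1 the oracle bits; [rho] assigns to each variable the stack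
    with its unary value. The stacks from [r] on are free as scratch space. *)
Definition represents (w b : seq bool) (rho env : seq nat) r (s : store B) : Prop :=
  [/\ stk s 0 = [seq inl x | x <- w], stk s 1 = [seq inl x | x <- b], size rho = size env,
      forall i, i < size env -> [/\ 1 < nth 0 rho i, nth 0 rho i < r
        & stk s (nth 0 rho i) = nseq (nth 0 env i) one]
    & forall i, r <= i -> stk s i = [::]].

(** The value is added on top of stack [d] and everything else is restored; a sum is then mere
    sequencing and a product a loop. A single parameter [M] dominates input, oracle and variables,
    so that bounds still compose when computed values enter the environment. *)
Definition computes (c : code) (f : seq bool -> seq bool -> seq nat -> nat) : Prop :=
  exists k need, forall w b env M, size w <= M -> size b <= M -> all (fun x => x <= M) env ->
    f w b env <= poly_bound k M /\
    forall rho d r s, represents w b rho env r s -> 1 < d < r -> d \notin rho -> r + need <= size s ->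
      ext (c rho d r) s (poly_bound k M) (upd s d (nseq (f w b env) one ++ stk s d)).

Lemma repr_upd w b rho env r r' d l s : represents w b rho env r s -> 1 < d < r' -> d \notin rho -> r <= r' ->
  represents w b rho env r' (upd s d l).
Proof.
move=> [h0 h1 h2 h3 h4] dr nd rr; split; rewrite ?stk_updE //; eqs => //.
- move=> i hi; have [a1 a2 a3] := h3 i hi; rewrite stk_updE; split=> //; first lia.
  by case: eqP => // e; move: nd; rewrite -e mem_nth // h2.
- by move=> i hi; rewrite stk_updE; eqs; apply: h4; lia.
Qed.

Lemma repr_le w b rho env r r' s : represents w b rho env r s -> r <= r' -> represents w b rho env r' s.
Proof.
move=> [h0 h1 h2 h3 h4] rr; split=> //; last by move=> i hi; apply: h4; lia.
by move=> i /h3[? ? ?]; split=> //; lia.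
Qed.

Lemma repr_notin w b rho env r d s : represents w b rho env r s -> r <= d -> d \notin rho.
Proof.
move=> [_ _ sz h _] rd; apply/negP => /(nthP 0)[i]; rewrite sz => /h[_ + _] e; rewrite e; lia.
Qed.

Lemma repr_cons w b rho env r x s n : represents w b rho env r s -> 1 < x < r -> stk s x = nseq n one ->
  represents w b (x :: rho) (n :: env) r s.
Proof.
move=> [h0 h1 h2 h3 h4] xr hx; split=> //=; first by rewrite h2.
by case=> [|i] /= hi; [split=> //; lia|exact: h3].
Qed.

Lemma repr_behead w b rho env r s : represents w b rho env r s -> represents w b (behead rho) (behead env) r s.
Proof.
move=> [h0 h1 h2 h3 h4]; split=> //; first by rewrite !size_behead h2.
by move=> i hi; rewrite !nth_behead; apply: h3; move: hi; rewrite size_behead; lia.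
Qed.

Lemma c_lit n : computes (fun _ d _ => iter n (Seq (Push d one)) Skip) (fun _ _ _ => n).
Proof.
have [k hk] : polyb (fun=> n) by pb.
exists k, 0 => w b env M _ _ _; split=> // rho d r s _ dr _ sz; apply: ext_le (hk M).
have {sz}: d < size s by lia.
elim: n s {hk} => [|n IH] s hd /=; first by have -> : upd s d (stk s d) = s; [sto|exact: ext_skip].
apply: (@ext_seq B _ _ _ 1 _ n); [by apply: ext_push| |by rewrite add1n].
have -> : upd s d (one :: nseq n one ++ stk s d) =
  upd (upd s d (one :: stk s d)) d (nseq n one ++ stk (upd s d (one :: stk s d)) d).
  by sto; rewrite ?nseq_cons.
by apply: IH; rewrite size_upd; lia.
Qed.

(** The contents go to the free stack [r] and back, two reversals that cancel; the first transfer
    counts them on [d]. *)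
Definition cnt i d r : prog := Seq (move i r (Some d)) (move r i None).

Lemma ext_cnt i d r (s : store B) T : i < size s -> r < size s -> d < size s -> i != d -> r != d -> i != r ->
  stk s r = [::] -> 12 * size (stk s i) + 1 < T ->
  ext (cnt i d r) s T (upd s d (nseq (size (stk s i)) one ++ stk s d)).
Proof.
move=> hi hr hd id rd ir r0 hT.
pose s1 := upd (upd (upd s i [::]) r (catrev (stk s i) (stk s r))) d (nseq (size (stk s i)) one ++ stk s d).
have m1 := @ext_move i r (Some d) s (6 * size (stk s i)).+1 hi hr ir.
apply: (@ext_seq B _ _ _ _ s1 (6 * size (stk s i)).+1).
- have m2 := m1 _ (leqnn _); have {m2}: [&& d < size s, d != i & d != r] by lia.
  by move/m1; move/(_ (leqnn _)); rewrite /= ?stk_updE; eqs; exact.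
- have -> : upd s d (nseq (size (stk s i)) one ++ stk s d) =
    oupd (upd (upd s1 r [::]) i (catrev (stk s1 r) (stk s1 i))) None (size (stk s1 r)).
    rewrite /s1 /oupd; stks; rewrite r0 !catrevE cats0 revK cats0; sto; by rewrite ?r0.
  apply: ext_move; rewrite ?size_upd //; try lia.
  by rewrite /s1; stks; rewrite r0 catrevE cats0 size_rev.
- by lia.
Qed.

Lemma ext_pour r d (s : store B) n T : r < size s -> d < size s -> r != d -> stk s r = nseq n one -> 3 * n < T ->
  ext (For r (Push d one)) s T (upd (upd s r [::]) d (nseq n one ++ stk s d)).
Proof.
move=> hr hd rd sr hT; pose S k := upd (upd s r (nseq (n - k) one)) d (nseq k one ++ stk s d).
have s0 : s = S 0 by rewrite /S subn0; sto.
have -> : upd (upd s r [::]) d (nseq n one ++ stk s d) = S n by rewrite /S subnn.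
rewrite [X in ext _ X]s0; apply: (@ext_for B _ _ _ _ 1) => [k kn|k kn|]; last lia.
  by rewrite /S !size_upd; stks; split=> //; lia.
have -> : S k.+1 = upd (upd (S k) r (nseq (n - k.+1) one)) d (one :: stk (upd (S k) r (nseq (n - k.+1) one)) d).
  by rewrite /S; sto.
by apply: ext_push => //; rewrite /S !size_upd; lia.
Qed.

Lemma repr_new w b rho env r s : represents w b rho env r s -> stk s r = [::].
Proof. by case=> _ _ _ _; apply. Qed.

Lemma repr_lt w b rho env r s i : represents w b rho env r s -> i < size env -> nth 0 rho i \in rho.
Proof. by case=> _ _ h _ _ hi; rewrite mem_nth // h. Qed.

Lemma c_len : computes (fun _ d r => cnt 0 d r) (fun w _ _ => size w).
Proof.
have [k hk] : polyb (fun M => M * 12 + 2) by pb.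
exists k, 1 => w b env M hw hb he; have := hk M; split=> [|rho d r s R dr nd sz]; first lia.
have [h0 _ _ _ _] := R.
have -> : size w = size (stk s 0) by rewrite h0 size_map.
apply: ext_cnt; try lia; first exact: repr_new R.
by rewrite h0 size_map; lia.
Qed.

Lemma c_var i : computes (fun rho d r => if i < size rho then cnt (nth 0 rho i) d r else Skip)
  (fun _ _ env => nth 0 env i).
Proof.
have [k hk] : polyb (fun M => M * 12 + 2) by pb.
exists k, 1 => w b env M hw hb he; have hkM := hk M.
have le : nth 0 env i <= M.
  by case: (ltnP i (size env)) => h; [apply: (allP he); exact: mem_nth|rewrite nth_default].
split=> [|rho d r s R dr nd sz]; first lia.
have [_ _ h2 h3 _] := R; rewrite h2; case: ltnP => hi.
  have [a1 a2 a3] := h3 i hi.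
  have sE : nth 0 env i = size (stk s (nth 0 rho i)) by rewrite a3 size_nseq.
  rewrite [X in nseq X]sE; apply: ext_cnt; try lia; last exact: repr_new R.
  by apply/eqP => e; move: nd; rewrite -e (repr_lt R).
rewrite nth_default //=; have -> : upd s d (stk s d) = s by sto.
exact: ext_skip.
Qed.

Definition getb (l : seq bool) (i : nat) : nat := if i < size l then (nth false l i).+1 else 0.

(** Stacks have no random access: the symbols above the wanted position are unloaded onto [r.+1] and
    put back after the test. *)
Definition c_fetch (i : nat) (ca : code) : code := fun rho d r =>
  Seq (ca rho r r.+1) (Seq (For r (Case i (fun o => if o is Some a then Seq (Pop i) (Push r.+1 a) else Skip)))
  (Seq (Case i (fun o => match o with Some (inl true) => Seq (Push d one) (Push d one)
      | Some (inl false) => Push d one | _ => Skip end)) (move r.+1 i None))).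

Lemma c_fetchP i ca fa : i < 2 -> computes ca fa ->
  computes (c_fetch i ca) (fun w b env => getb (if i == 0 then w else b) (fa w b env)).
Proof.
move=> i2 [k1 [n1 h1]]; have [k hk] : polyb (fun M => poly_bound k1 M * 8 + M * 6 + 12) by pb.
exists k, (n1 + 2) => w b env M hw hb he; have [v1 e1] := h1 _ _ _ M hw hb he; have hkM := hk M.
set l := if _ then w else b; have ll : size l <= M by rewrite /l; case: ifP.
split; first by rewrite /getb; case: ifP => //; case: nth => _; lia.
move=> rho d r s R dr nd sz; set n := fa w b env in v1 e1 *.
have sl : stk s i = [seq inl x | x <- l] by case: R => h0 h0' _ _ _; rewrite /l; move: i2; case: (i) => [|[]].
have r0 := repr_new R; have r1 : stk s r.+1 = [::] by case: R => _ _ _ _; apply.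
pose S k := upd (upd (upd s r (nseq (n - k) one)) i (drop k (stk s i))) r.+1 (rev (take k (stk s i))).
have E1 : ext (ca rho r r.+1) s (poly_bound k1 M) (S 0).
  have -> : S 0 = upd s r (nseq n one ++ stk s r) by rewrite /S subn0 drop0 take0 /= r0 cats0; sto.
  by apply: e1 => //; [exact: repr_le R _|lia|exact: (repr_notin R)|lia].
have szS j : size (S j) = size s by rewrite /S !size_upd; lia.
apply: (@ext_seq B _ _ _ _ _ (n * 7 + M * 6 + 12)); [exact: E1| |lia].
  apply: (@ext_seq B _ _ _ (n * 6 + 1) (S n) (4 + (6 * size l + 1))).
  - apply: (@ext_for B _ _ _ _ 4) => [j jn|j jn|]; rewrite ?szS.
    + by rewrite /S; stks; split=> //; lia.
    + apply: (@ext_case B _ _ _ 3); rewrite ?size_upd ?szS ?stk_updE; eqs; try lia.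
      case: (ltnP j (size (stk s i))) => js.
        rewrite (drop_nth one js) /=.
        apply: (@ext_seq B _ _ _ 1); [apply: ext_pop; rewrite ?size_upd ?szS //; lia| |exact: (isT : 1 + 1 <= 3)].
        have -> : S j.+1 = let s1 := upd (upd (S j) r (nseq (n - j.+1) one)) i (behead (stk (upd (S j) r (nseq (n - j.+1) one)) i)) in
          upd s1 r.+1 (nth one (stk s i) j :: stk s1 r.+1).
          by rewrite /S /=; sto; rewrite ?(take_nth one js) ?rev_rcons ?(drop_nth one js).
        by apply: ext_push => //; rewrite ?size_upd ?szS; lia.
      rewrite drop_oversize //=.
      have -> : S j.+1 = upd (S j) r (nseq (n - j.+1) one).
        by rewrite /S; sto; rewrite ?take_oversize ?drop_oversize //; lia.
      exact: ext_skip.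
    + by lia.
  - apply: (@ext_seq B _ _ _ 4 (upd (S n) d (nseq (getb l n) one ++ stk s d)) (6 * size l + 1)).
    + apply: (@ext_case B _ _ _ 2) => //; rewrite ?szS; try lia.
      have -> : stk (S n) i = drop n [seq inl x | x <- l] by rewrite /S; stks; rewrite sl.
      rewrite -map_drop /getb; case: ltnP => nl; last first.
        rewrite drop_oversize //=; have -> : upd (S n) d (stk s d) = S n by rewrite /S; sto.
        exact: ext_skip.
      rewrite (drop_nth false nl) /=; case: (nth false l n) => /=.
        apply: (@ext_seq B _ _ _ 1); [apply: ext_push; rewrite ?szS //; lia| |exact: (leqnn 2)].
        have -> : upd (S n) d (one :: one :: stk s d) = let s1 := upd (S n) d (one :: stk (S n) d) in
          upd s1 d (one :: stk s1 d) by rewrite /S /=; sto.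
        by apply: ext_push; rewrite ?size_upd ?szS //; lia.
      have -> : upd (S n) d (one :: stk s d) = upd (S n) d (one :: stk (S n) d) by rewrite /S; sto.
      by apply: ext_push; rewrite ?szS //; lia.
    + have -> : upd s d (nseq (getb l n) one ++ stk s d) =
        let s1 := upd (S n) d (nseq (getb l n) one ++ stk s d) in
        oupd (upd (upd s1 r.+1 [::]) i (catrev (stk s1 r.+1) (stk s1 i))) None (size (stk s1 r.+1)).
        rewrite /S /oupd /=; sto; rewrite ?subnn ?r0 ?r1 //.
        by rewrite catrevE revK cat_take_drop.
      apply: ext_move; rewrite ?size_upd ?szS //; try lia.
      rewrite /S; stks; rewrite size_rev size_take sl size_map; case: ifP => ?; lia.
    + exact: leqnn.
  - by lia.
Qed.

Definition c_add (ca cb : code) : code := fun rho d r => Seq (ca rho d r) (cb rho d r).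

Lemma c_addP ca cb fa fb : computes ca fa -> computes cb fb ->
  computes (c_add ca cb) (fun w b env => fa w b env + fb w b env).
Proof.
move=> [k1 [n1 h1]] [k2 [n2 h2]].
have [k hk] : polyb (fun M => poly_bound k1 M + poly_bound k2 M) by pb.
exists k, (n1 + n2) => w b env M hw hb he; have [v1 e1] := h1 _ _ _ M hw hb he.
have [v2 e2] := h2 _ _ _ M hw hb he; have hkM := hk M; split; first lia.
move=> rho d r s R dr nd sz; apply: ext_seq (e1 _ _ _ _ R dr nd _) _ hkM; first lia.
have -> : upd s d (nseq (fa w b env + fb w b env) one ++ stk s d) =
  let s1 := upd s d (nseq (fa w b env) one ++ stk s d) in
  upd s1 d (nseq (fb w b env) one ++ stk s1 d).
  by rewrite /=; sto; try done; rewrite nseq_addl addnC.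
by apply: e2 => //; [exact: repr_upd R _ _ _|rewrite size_upd; lia].
Qed.

(** [Pop] leaves an empty stack unchanged, which is why the loop computes the truncated
    difference. *)
Definition c_sub (ca cb : code) : code := fun rho d r =>
  Seq (ca rho r r.+1) (Seq (cb rho r.+1 r.+2) (Seq (For r.+1 (Pop r)) (For r (Push d one)))).

Lemma c_subP ca cb fa fb : computes ca fa -> computes cb fb ->
  computes (c_sub ca cb) (fun w b env => fa w b env - fb w b env).
Proof.
move=> [k1 [n1 h1]] [k2 [n2 h2]].
have [k hk] : polyb (fun M => poly_bound k1 M * 4 + poly_bound k2 M * 4 + 2) by pb.
exists k, (n1 + n2 + 3) => w b env M hw hb he; have [v1 e1] := h1 _ _ _ M hw hb he.
have [v2 e2] := h2 _ _ _ M hw hb he; have hkM := hk M; split; first lia.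
move=> rho d r s R dr nd sz; set na := fa w b env in v1 e1 *; set nb := fb w b env in v2 e2 *.
have r0 := repr_new R; have r1 : stk s r.+1 = [::] by case: R => _ _ _ _; apply.
pose S k := upd (upd s r.+1 (nseq (nb - k) one)) r (nseq (na - k) one).
have szS j : size (S j) = size s by rewrite /S !size_upd; lia.
pose s1 := upd s r (nseq na one).
apply: (@ext_seq B _ _ _ (poly_bound k1 M) s1 (poly_bound k2 M * 4 + na * 3 + 2)); last lia.
  have -> : s1 = upd s r (nseq na one ++ stk s r) by rewrite r0 cats0.
  by apply: e1 => //; [exact: repr_le R _|lia|exact: (repr_notin R)|lia].
apply: (@ext_seq B _ _ _ (poly_bound k2 M) (S 0) (nb * 3 + na * 3 + 2)); last lia.
  have -> : S 0 = upd s1 r.+1 (nseq nb one ++ stk s1 r.+1).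
    by rewrite /S /s1 !subn0; sto; rewrite ?r1 ?cats0.
  apply: e2 => //; [|lia|exact: (repr_notin R)|rewrite size_upd; lia].
  by apply: repr_upd R _ (repr_notin R (leqnn _)) _; lia.
apply: (@ext_seq B _ _ _ (nb * 3 + 1) (S nb) (na * 3 + 1)); last lia.
  apply: (@ext_for B _ _ _ _ 1) => [j jn|j jn|]; rewrite ?szS; [|  |lia].
    by rewrite /S; stks; split=> //; lia.
  have -> : S j.+1 = let s2 := upd (S j) r.+1 (nseq (nb - j.+1) one) in upd s2 r (behead (stk s2 r)).
    by rewrite /S /=; sto; try done; rewrite subnS; case: (na - j).
  by apply: ext_pop => //; rewrite size_upd szS; lia.
have -> : upd s d (nseq (na - nb) one ++ stk s d) =
   upd (upd (S nb) r [::]) d (nseq (na - nb) one ++ stk (S nb) d).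
  by rewrite /S subnn; sto; rewrite ?r0 ?r1.
by apply: ext_pour; rewrite ?szS; try lia; rewrite /S; stks.
Qed.

Definition c_mul (ca cb : code) : code := fun rho d r =>
  Seq (ca rho r r.+1) (For r (cb rho d r.+1)).

Lemma c_mulP ca cb fa fb : computes ca fa -> computes cb fb ->
  computes (c_mul ca cb) (fun w b env => fa w b env * fb w b env).
Proof.
move=> [k1 [n1 h1]] [k2 [n2 h2]].
have [k hk] : polyb (fun M => poly_bound k1 M * poly_bound k2 M + poly_bound k1 M * 3 + 1) by pb.
exists k, (n1 + n2 + 3) => w b env M hw hb he; have [v1 e1] := h1 _ _ _ M hw hb he.
have [v2 e2] := h2 _ _ _ M hw hb he; have hkM := hk M.
have vv : fa w b env * fb w b env <= poly_bound k1 M * poly_bound k2 M by exact: leq_mul.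
have vv' : fa w b env * poly_bound k2 M <= poly_bound k1 M * poly_bound k2 M by rewrite leq_mul2r v1 orbT.
split; first lia.
move=> rho d r s R dr nd sz; set na := fa w b env in v1 e1 vv vv' *; set nb := fb w b env in v2 e2 vv *.
have r0 := repr_new R.
pose S k := upd (upd s r (nseq (na - k) one)) d (nseq (k * nb) one ++ stk s d).
have szS j : size (S j) = size s by rewrite /S !size_upd; lia.
apply: (@ext_seq B _ _ _ (poly_bound k1 M) (S 0) (na * poly_bound k2 M + na * 2 + 1)); last lia.
  have -> : S 0 = upd s r (nseq na one ++ stk s r) by rewrite /S subn0 mul0n r0 cats0; sto.
  by apply: e1 => //; [exact: repr_le R _|lia|exact: (repr_notin R)|lia].
have -> : upd s d (nseq (na * nb) one ++ stk s d) = S na by rewrite /S subnn; sto; rewrite ?r0.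
apply: (@ext_for B _ _ _ _ (poly_bound k2 M)) => [j jn|j jn|]; rewrite ?szS; [| |lia].
  by rewrite /S; stks; split=> //; lia.
have -> : S j.+1 = let s2 := upd (S j) r (nseq (na - j.+1) one) in upd s2 d (nseq nb one ++ stk s2 d).
  by rewrite /S /=; sto; rewrite ?nseq_addl ?mulSn.
apply: e2 => //; [|lia|rewrite size_upd szS; lia].
have nr := repr_notin R (leqnn _).
apply: (@repr_upd _ _ _ _ r.+1) => //; last lia.
apply: (@repr_upd _ _ _ _ r.+1) => //; last lia.
apply: (@repr_upd _ _ _ _ r.+1) => //; [exact: repr_le R _|lia].
Qed.

Definition c_if (ca cb cc : code) : code := fun rho d r =>
  Seq (ca rho r r.+1) (Case r (fun o => if o is Some _ then Seq (clear r) (cb rho d r) else cc rho d r)).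

Lemma c_ifP ca cb cc fa fb fc : computes ca fa -> computes cb fb -> computes cc fc ->
  computes (c_if ca cb cc) (fun w b env => if fa w b env == 0 then fc w b env else fb w b env).
Proof.
move=> [k1 [n1 h1]] [k2 [n2 h2]] [k3 [n3 h3]].
have [k hk] : polyb (fun M => poly_bound k1 M * 3 + poly_bound k2 M + poly_bound k3 M + 3) by pb.
exists k, (n1 + n2 + n3 + 3) => w b env M hw hb he; have [v1 e1] := h1 _ _ _ M hw hb he.
have [v2 e2] := h2 _ _ _ M hw hb he; have [v3 e3] := h3 _ _ _ M hw hb he; have hkM := hk M.
split; first by case: ifP => _; lia.
move=> rho d r s R dr nd sz; set na := fa w b env in v1 e1 *.
have r0 := repr_new R; pose s1 := upd s r (nseq na one).
apply: (@ext_seq B _ _ _ (poly_bound k1 M) s1 (na * 2 + poly_bound k2 M + poly_bound k3 M + 3)); last lia.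
  have -> : s1 = upd s r (nseq na one ++ stk s r) by rewrite /s1 r0 cats0.
  by apply: e1 => //; [exact: repr_le R _|lia|exact: (repr_notin R)|lia].
apply: (@ext_case B _ _ _ (na * 2 + poly_bound k2 M + poly_bound k3 M + 2)); rewrite ?size_upd; [lia| |lia].
have sE : upd s1 r [::] = s by rewrite /s1; sto; rewrite ?r0.
have -> : stk s1 r = nseq na one by rewrite /s1 stk_updE eqxx.
case: eqP => na0.
  rewrite na0 /=; have -> : s1 = s by rewrite -sE /s1 na0; sto.
  by apply: ext_le (e3 _ _ _ _ R dr nd _) _; lia.
have -> : ohead (nseq na one) = Some one by case: (na) na0.
apply: (@ext_seq B _ _ _ (na * 2 + 1) s (poly_bound k2 M)); [|by apply: e2 => //; lia|lia].
rewrite -[X in ext _ _ _ X]sE; apply: ext_clear; rewrite ?size_upd; first lia.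
by rewrite /s1 stk_updE eqxx size_nseq; lia.
Qed.

Definition c_let (ca cb : code) : code := fun rho d r =>
  Seq (ca rho r r.+1) (Seq (cb (r :: rho) d r.+1) (clear r)).

Lemma c_letP ca cb fa fb : computes ca fa -> computes cb fb ->
  computes (c_let ca cb) (fun w b env => fb w b (fa w b env :: env)).
Proof.
move=> [k1 [n1 h1]] [k2 [n2 h2]].
have [k hk] : polyb (fun M => poly_bound k1 M * 3 + poly_bound k2 (M + poly_bound k1 M) + 3) by pb.
exists k, (n1 + n2 + 3) => w b env M hw hb he; have [v1 e1] := h1 _ _ _ M hw hb he.
set M' := M + poly_bound k1 M.
have [|||v2 e2] := h2 w b (fa w b env :: env) M'; rewrite /M'; try lia.
  apply/andP; split; first lia; apply: sub_all he => x; lia.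
have hkM := hk M; rewrite -/M' in hkM; split; first lia.
move=> rho d r s R dr nd sz; set na := fa w b env in v1 e1 v2 e2 *.
have r0 := repr_new R; pose s1 := upd s r (nseq na one).
have rr := repr_notin R (leqnn _).
apply: (@ext_seq B _ _ _ (poly_bound k1 M) s1 (poly_bound k2 M' + (na * 2 + 1))); last by lia.
  have -> : s1 = upd s r (nseq na one ++ stk s r) by rewrite /s1 r0 cats0.
  by apply: e1 => //; [exact: repr_le R _|lia|lia].
set nb := fb _ _ _ in v2 e2 *.
apply: (@ext_seq B _ _ _ (poly_bound k2 M') (upd s1 d (nseq nb one ++ stk s1 d)) (na * 2 + 1)); last lia.
  apply: e2; rewrite ?size_upd ?inE ?(negbTE nd) ?orbF; try lia.
  apply: repr_cons; [|lia|by rewrite /s1 stk_updE eqxx].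
  by apply: repr_upd R _ rr _; lia.
have -> : upd s d (nseq nb one ++ stk s d) = upd (upd s1 d (nseq nb one ++ stk s1 d)) r [::].
  by rewrite /s1; sto; rewrite ?r0.
apply: ext_clear; rewrite ?size_upd; first lia.
by rewrite stk_updE; eqs; rewrite /s1 stk_updE eqxx size_nseq; lia.
Qed.

Definition c_wk (ca : code) : code := fun rho d r => ca (behead rho) d r.

Lemma c_wkP ca fa : computes ca fa -> computes (c_wk ca) (fun w b env => fa w b (behead env)).
Proof.
move=> [k1 [n1 h1]]; exists k1, n1 => w b env M hw hb he.
have [|v1 e1] := h1 w b (behead env) M hw hb; first by case: env he => //= x l /andP[].
split=> // rho d r s R dr nd sz; apply: e1 => //; first exact: repr_behead.
by apply: contra nd; case: rho {R} => //= x l h; rewrite inE h orbT.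
Qed.

Definition c_min (ca cb : code) : code := c_sub ca (c_sub ca cb).

Lemma computes_ext c f g : (forall w b env, f w b env = g w b env) -> computes c f -> computes c g.
Proof.
by move=> e [k [n h]]; exists k, n => w b env M hw hb he; rewrite -e; exact: h.
Qed.

Lemma c_minP ca cb fa fb : computes ca fa -> computes cb fb ->
  computes (c_min ca cb) (fun w b env => minn (fa w b env) (fb w b env)).
Proof.
move=> ha hb; apply: computes_ext (c_subP ha (c_subP ha hb)) => w b env.
by rewrite minnE.
Qed.

(** Stack [r] counts down, [r + 1] holds the index, [r + 2] the accumulator and [r + 3] its next
    value. The bound is evaluated anew in every round, under the two variables of the loop. Without
    truncation, iterated multiplication would leave the polynomial range. *)
Definition c_rec (cn cd ca cf : code) : code := fun rho d r =>
  Seq (cn rho r (r + 4)) (Seq (c_min ca cd rho (r + 2) (r + 4))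
  (Seq (For r (Seq (c_min cf (c_wk (c_wk cd)) [:: r + 2, r + 1 & rho] (r + 3) (r + 4))
     (Seq (clear (r + 2)) (Seq (For (r + 3) (Push (r + 2) one)) (Push (r + 1) one)))))
  (Seq (clear (r + 1)) (For (r + 2) (Push d one))))).

Definition brec (n bd a : nat) (f : nat -> nat -> nat) : nat :=
  iteri n (fun i acc => minn (f i acc) bd) (minn a bd).

Lemma brec_le n bd a f : brec n bd a f <= bd.
Proof. by case: n => [|n]; exact: geq_minr. Qed.

Lemma c_recP cn cd ca cf fn fd fa ff : computes cn fn -> computes cd fd -> computes ca fa ->
  computes cf ff -> computes (c_rec cn cd ca cf) (fun w b env =>
    brec (fn w b env) (fd w b env) (fa w b env) (fun i acc => ff w b [:: acc, i & env])).
Proof.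
move=> [k1 [n1 h1]] hd ha hf; have [k0 [n0 h0]] := hd.
have [k2 [n2 h2]] := c_minP ha hd; have [k3 [n3 h3]] := c_minP hf (c_wkP (c_wkP hd)).
(* The index stays below the number of rounds and the accumulator below the truncation bound, so
   [Mf M] dominates the environments of all rounds at once. *)
pose Mf M := M + poly_bound k1 M + poly_bound k0 M.
have [k hk] : polyb (fun M => poly_bound k1 M * (poly_bound k3 (Mf M) + Mf M * 6 + 8) +
    poly_bound k2 M + Mf M * 6 + 8) by rewrite /Mf; pb.
exists k, (n1 + n2 + n3 + 8) => w b env M hw hb he; have [v1 e1] := h1 _ _ _ M hw hb he.
have [v0 _] := h0 _ _ _ M hw hb he; have [v2 e2] := h2 _ _ _ M hw hb he.
have hkM := hk M; set na := fn w b env in v1 e1 *; set nd := fd w b env in v0 v2 e2 *.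
pose val j := brec j nd (fa w b env) (fun i acc => ff w b [:: acc, i & env]).
have valM j : val j <= nd by exact: brec_le.
split; first by apply: leq_trans (brec_le _ _ _ _) _; rewrite /Mf in hkM; lia.
move=> rho d r s R dr ndr sz.
have st0 j : r <= j -> stk s j = [::] by case: R => _ _ _ _; apply.
pose s1 := upd s r (nseq na one).
apply: (@ext_seq B _ _ _ (poly_bound k1 M) s1
  (na * (poly_bound k3 (Mf M) + Mf M * 6 + 8) + poly_bound k2 M + Mf M * 5 + 8)); last first.
  apply: leq_trans hkM; have := leq_mul v1 (leqnn (poly_bound k3 (Mf M) + Mf M * 6 + 8)).
  have : poly_bound k1 M <= Mf M by rewrite /Mf; lia.
  by move: (Mf M); lia.
2: have -> : s1 = upd s r (nseq na one ++ stk s r) by rewrite /s1 st0 // cats0.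
2: by apply: e1; [apply: repr_le R _; lia|lia|exact: (repr_notin R)|lia].
pose S j := upd (upd (upd s r (nseq (na - j) one)) (r + 1) (nseq j one)) (r + 2) (nseq (val j) one).
have szS j : size (S j) = size s by rewrite /S !size_upd; lia.
apply: (@ext_seq B _ _ _ (poly_bound k2 M) (S 0)
  (na * (poly_bound k3 (Mf M) + Mf M * 6 + 8) + Mf M * 5 + 8)); last lia.
  have -> : S 0 = upd s1 (r + 2) (nseq (minn (fa w b env) nd) one ++ stk s1 (r + 2)).
    by rewrite /S /s1 subn0 /=; sto; try done; rewrite ?st0 ?cats0 //; lia.
  apply: e2; [|lia|apply: (repr_notin R); lia|rewrite size_upd; lia].
  by apply: repr_upd R _ (repr_notin R (leqnn _)) _; lia.
apply: (@ext_seq B _ _ _ (na * (poly_bound k3 (Mf M) + Mf M * 6 + 8) + 1) (S na) (na * 2 + nd * 3 + 2)); [| |by rewrite /Mf; lia].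
  apply: (@ext_for B _ _ _ _ (poly_bound k3 (Mf M) + Mf M * 6 + 6)) => [j jn|j jn|]; rewrite ?szS; [| |lia].
    by rewrite /S; stks; split=> //; lia.
  pose s2 := upd (S j) r (nseq (na - j.+1) one).
  have R2 : represents w b [:: r + 2, r + 1 & rho] [:: val j, j & env] (r + 4) s2.
    apply: repr_cons; [|lia|by rewrite /s2 /S; stks].
    apply: repr_cons; [|lia|by rewrite /s2 /S; stks].
    have nr q : r <= q -> q \notin rho by exact: repr_notin R.
    do 4 (apply: (@repr_upd _ _ _ _ (r + 4)); [|lia|by apply: nr; lia|lia]).
    by apply: repr_le R _; lia.
  have [|||v3 e3] := h3 w b [:: val j, j & env] (Mf M); rewrite /Mf; try lia.
    have := valM j; rewrite /= => hv; apply/and3P; split; try lia.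
    by apply: sub_all he => x; lia.
  rewrite -/(Mf M) /= in v3 e3 *.
  have vj : minn (ff w b [:: val j, j & env]) (fd w b env) = val j.+1 by [].
  rewrite vj in v3 e3.
  pose s3 := upd s2 (r + 3) (nseq (val j.+1) one).
  have szs2 : size s2 = size s by rewrite /s2 size_upd szS; lia.
  have szs3 : size s3 = size s by rewrite /s3 size_upd szs2; lia.
  have vM : val j <= Mf M /\ val j.+1 <= Mf M by have := valM j; have := valM j.+1; rewrite /Mf; lia.
  apply: (@ext_seq B _ _ _ (poly_bound k3 (Mf M)) s3 (Mf M * 6 + 6)); last lia.
    have -> : s3 = upd s2 (r + 3) (nseq (val j.+1) one ++ stk s2 (r + 3)).
      by rewrite /s3 /s2 /S; stks; rewrite st0 ?cats0 //; lia.
    apply: e3 => //; [lia| |rewrite szs2; lia].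
    by rewrite !inE !negb_or; apply/and3P; split; [lia|lia|apply: (repr_notin R); lia].
  apply: (@ext_seq B _ _ _ (val j * 2 + 1) (upd s3 (r + 2) [::]) (Mf M * 3 + 3)); last lia.
    apply: ext_clear; rewrite ?szs3; first lia.
    by rewrite /s3 /s2 /S; stks; rewrite size_nseq; lia.
  pose s4 := upd (upd s3 (r + 2) [::]) (r + 3) [::].
  apply: (@ext_seq B _ _ _ (val j.+1 * 3 + 1) (upd s4 (r + 2) (nseq (val j.+1) one)) 1); last lia.
    have -> : upd s4 (r + 2) (nseq (val j.+1) one) = upd s4 (r + 2) (nseq (val j.+1) one ++ stk (upd s3 (r + 2) [::]) (r + 2)).
      by rewrite /s4; stks; rewrite cats0.
    by apply: ext_pour; rewrite ?size_upd ?szs3; try lia; rewrite /s3; stks.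
  have -> : S j.+1 = let s5 := upd s4 (r + 2) (nseq (val j.+1) one) in upd s5 (r + 1) (one :: stk s5 (r + 1)).
    by rewrite /S /s4 /s3 /s2 /S /=; sto; try done; rewrite ?st0 //; lia.
  by apply: ext_push => //; rewrite ?size_upd ?szs3; lia.
apply: (@ext_seq B _ _ _ (na * 2 + 1) (upd (S na) (r + 1) [::]) (nd * 3 + 1)); last lia.
  apply: ext_clear; rewrite ?szS; first lia.
  by rewrite /S; stks; rewrite size_nseq; lia.
have -> : upd s d (nseq (val na) one ++ stk s d) =
   upd (upd (upd (S na) (r + 1) [::]) (r + 2) [::]) d (nseq (val na) one ++ stk (upd (S na) (r + 1) [::]) d).
  by rewrite /S subnn; sto; try done; rewrite ?st0 //; lia.
apply: ext_pour; rewrite ?size_upd ?szS; try lia; first by rewrite /S; stks.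
by have := valM na; lia.
Qed.

(* Variables are de Bruijn indices. Reading the input or the oracle bits yields
   0 past the end, 1 for [false] and 2 for [true]. Recursion ([ERec]) truncates
   the accumulator to its second argument, so that all values are polynomial. *)
Inductive expr : Type :=
| EVar of nat
| ELit of nat
| ELen
| EInp of expr
| EOra of expr
| EAdd of expr & expr
| ESub of expr & expr
| EMul of expr & expr
| EIf of expr & expr & expr
| ELet of expr & expr
| EWk of expr
| ERec of expr & expr & expr & expr.

Fixpoint eval (e : expr) (w b : seq bool) (env : seq nat) : nat :=
  match e with
  | EVar i => nth 0 env i
  | ELit n => n
  | ELen => size w
  | EInp e => getb w (eval e w b env)
  | EOra e => getb b (eval e w b env)
  | EAdd e f => eval e w b env + eval f w b env
  | ESub e f => eval e w b env - eval f w b env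
  | EMul e f => eval e w b env * eval f w b env
  | EIf e f g => if eval e w b env == 0 then eval g w b env else eval f w b env
  | ELet e f => eval f w b (eval e w b env :: env)
  | EWk e => eval e w b (behead env)
  | ERec n d a f => brec (eval n w b env) (eval d w b env) (eval a w b env)
                      (fun i acc => eval f w b [:: acc, i & env])
  end.

Fixpoint ecode (e : expr) : code :=
  match e with
  | EVar i => fun rho d r => if i < size rho then cnt (nth 0 rho i) d r else Skip
  | ELit n => fun _ d _ => iter n (Seq (Push d one)) Skip
  | ELen => fun _ d r => cnt 0 d r
  | EInp e => c_fetch 0 (ecode e)
  | EOra e => c_fetch 1 (ecode e)
  | EAdd e f => c_add (ecode e) (ecode f)
  | ESub e f => c_sub (ecode e) (ecode f)
  | EMul e f => c_mul (ecode e) (ecode f)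
  | EIf e f g => c_if (ecode e) (ecode f) (ecode g)
  | ELet e f => c_let (ecode e) (ecode f)
  | EWk e => c_wk (ecode e)
  | ERec n d a f => c_rec (ecode n) (ecode d) (ecode a) (ecode f)
  end.

Theorem ecodeP e : computes (ecode e) (eval e).
Proof.
elim: e => /= [i|n||e he|e he|e he f hf|e he f hf|e he f hf|e he f hf g hg|e he f hf|e he|n hn a ha d hd f hf].
- exact: c_var.
- exact: c_lit.
- exact: c_len.
- exact: (@c_fetchP 0 _ _ isT he).
- exact: (@c_fetchP 1 _ _ isT he).
- exact: c_addP he hf.
- exact: c_subP he hf.
- exact: c_mulP he hf.
- exact: c_ifP he hf hg.
- exact: c_letP he hf.
- exact: c_wkP he.
- exact: c_recP hn ha hd hf.
Qed.
End Language.

(** * Generators *)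

Section Generator.
Variable B : finType.
Notation sym := (bool + B)%type.
Notation prog := (cmd B).
Notation Push := (@Push B).
Notation Pop := (@Pop B).
Notation Skip := (@Skip B).
Notation one := (inl true : sym).

(** The run ends in the initial store of the output, with no residue on other stacks, and the number
    of stacks is left open. Both make programs composable. *)
Definition transduces (c : prog) (f : seq bool -> seq bool) : Prop :=
  exists k K0, forall w K, K0 <= K ->
    ext c (prog_init B K w) (poly_bound k (size w)) (prog_init B K (f w)).

Lemma stk_init K w i : stk (prog_init B K w) i = if i == 0 then [seq inl x | x <- w] else [::].
Proof. by case: i => [|i] //=; rewrite /stk /= nth_nseq if_same. Qed.

Lemma transduces_comp c d f g : transduces c f -> transduces d g -> transduces (Seq c d) (g \o f).
Proof.
move=> [k1 [K1 h1]] [k2 [K2 h2]].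
have [k hk] : polyb (fun n => poly_bound k1 n + poly_bound k2 (n + poly_bound k1 n)) by pb.
exists k, (K1 + K2) => w K hK; have e1 := h1 w K ltac:(lia).
apply: (@ext_seq B _ _ _ _ _ (poly_bound k2 (size w + poly_bound k1 (size w)))); [exact: e1| |exact: hk].
apply: ext_le (h2 _ _ _) _; first lia.
apply: poly_bound_mono => //; have [m [t [ht /exec_bound[_ /(_ 0)]]]] := e1.
by rewrite !stk_init !size_map; lia.
Qed.

Lemma transduces_poly_time c f : transduces c f -> poly_time f.
Proof.
move=> [k [K h]]; apply: (@prog_poly_time B K c f (fun n => n + poly_bound k n) (poly_bound k)); try by pb.
  by move=> w; lia.
move=> w; have [m [t [ht e]]] := h w K (leqnn K); exists t, (prog_init B K (f w)); split=> //.
have [eb _] := exec_bound e; apply: eb => i; rewrite stk_init.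
by case: eqP => _; rewrite ?size_map /=; lia.
Qed.

Inductive item := Bit of expr | Nat of expr.

Definition out_item (w : seq bool) (x : nat) (it : item) : seq bool :=
  match it with
  | Bit e => [:: eval e w [::] [:: x] != 0]
  | Nat e => encode_nat (eval e w [::] [:: x])
  end.

Definition out_block (w : seq bool) (bl : expr * seq item) : seq bool :=
  flatten [seq flatten [seq out_item w x it | it <- bl.2] | x <- iota 0 (eval bl.1 w [::] [::])].

Definition out (bls : seq (expr * seq item)) (w : seq bool) : seq bool :=
  flatten [seq out_block w bl | bl <- bls].

(** The digits in the order in which repeated halving emits them; [fuel] makes the recursion
    structural. *)
Fixpoint enc_tail fuel n : seq bool :=
  if fuel is f.+1 then if n == 0 then [::] else true :: odd n :: enc_tail f n./2 else [::].

Lemma encode_natE n : encode_nat n = [:: true; odd n] ++ enc_tail n n./2 ++ [:: false].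
Proof.
suff h f m : m <= f -> encode_nat m = [:: true; odd m] ++ enc_tail f m./2 ++ [:: false] by exact: h.
elim: f m => [|f IH] m le; first by have -> : m = 0 by lia.
rewrite /encode_nat; case: (ltnP 1 m) => m1; last first.
  by have [->|->] : m = 0 \/ m = 1 by lia.
rewrite trunc_log2S //.
have -> : iota 0 (trunc_log 2 m./2).+2 = 0 :: map (addn 1) (iota 0 (trunc_log 2 m./2).+1) by rewrite -iotaDl.
rewrite map_cons -map_comp divn1.
rewrite [enc_tail f.+1 m./2]/=; have -> : (m./2 == 0) = false by lia.
have -> : [seq ((fun i => [:: true; odd (m %/ 2 ^ i)]) \o addn 1) i | i <- iota 0 (trunc_log 2 m./2).+1] =
    [seq [:: true; odd (m./2 %/ 2 ^ i)] | i <- iota 0 (trunc_log 2 m./2).+1].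
  by apply: eq_map => i /=; rewrite expnD expn1 divnMA divn2.
have fl l ll : flatten (l :: ll) = l ++ flatten ll :> seq bool by [].
rewrite fl -catA.
by have := IH m./2 ltac:(lia); rewrite /encode_nat => ->.
Qed.

Definition pushs i (l : seq bool) (s : store B) := upd s i (catrev [seq inl x | x <- l] (stk s i)).

Lemma pushs_cat i l l' s : pushs i l' (pushs i l s) = pushs i (l ++ l') s.
Proof.
rewrite /pushs; sto; try done; rewrite map_cat.
by elim: l (stk s i) => //= a l IH q; rewrite IH.
Qed.

Lemma pushs0 i s : i < size s -> pushs i [::] s = s.
Proof. by move=> h; rewrite /pushs /=; sto. Qed.

Lemma stk_pushs i l s j : j != i -> stk (pushs i l s) j = stk s j.
Proof. by move=> h; rewrite /pushs; stks. Qed.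

Lemma size_pushs i l s : i < size s -> size (pushs i l s) = size s.
Proof. by move=> h; rewrite /pushs size_upd; lia. Qed.

(** The number on stack 5 is removed in pairs that are counted on stack 6; an unpaired unit goes to
    stack 7 and yields the digit. *)
Definition halve : prog := Seq (Push 4 one) (Seq
  (While 5 isSome (Seq (Pop 5) (Case 5 (fun o => if o is Some _ then Seq (Pop 5) (Push 6 one) else Push 7 one))))
  (Seq (Case 7 (fun o => if o is Some _ then Seq (Pop 7) (Push 4 one) else Push 4 (inl false)))
  (For 6 (Push 5 one)))).

Definition setv n (s : store B) := upd s 5 (nseq n one).

Lemma ext_halve s n : 8 < size s -> stk s 5 = nseq n one -> stk s 6 = [::] -> stk s 7 = [::] ->
  ext halve s (10 * n + 12) (pushs 4 [:: true; odd n] (setv n./2 s)).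
Proof.
move=> sz s5 s6 s7.
pose s1 := upd s 4 (one :: stk s 4).
pose S k := upd (upd (upd s1 5 (nseq (n - k.*2) one)) 6 (nseq (minn k n./2) one)) 7 (nseq (n < k.*2) one).
have szS k : size (S k) = size s by rewrite /S /s1 !size_upd; lia.
apply: (@ext_seq B _ _ _ 1 s1 (10 * n + 11)); [by apply: ext_push => //; lia| |lia].
apply: (@ext_seq B _ _ _ (uphalf n * 6 + 1) (S (uphalf n)) (n./2 * 3 + 6)); last by lia.
  have s0 : s1 = S 0 by rewrite /S /s1 subn0 min0n ltn0; sto.
  rewrite [X in ext _ X]s0; apply: (@ext_while B _ _ _ _ _ 5) => [k kn|k kn||]; rewrite ?szS //; try lia.
  - rewrite {1}/S; stks; split; first by have -> : n - k.*2 = (n - k.*2).-1.+1 by lia.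
    apply: (@ext_seq B _ _ _ 1 (upd (S k) 5 (nseq (n - k.*2).-1 one)) 4); [| |lia].
      have -> : nseq (n - k.*2).-1 one = behead (stk (S k) 5) by rewrite /S; stks; case: (n - k.*2).
      by apply: ext_pop; rewrite ?szS //; lia.
    apply: (@ext_case B _ _ _ 3); rewrite ?size_upd ?szS; [lia| |lia].
    rewrite stk_updE eqxx; case E: (n - k.*2).-1 => [|q] /=.
      have -> : S k.+1 = let s2 := upd (S k) 5 [::] in upd s2 7 (one :: stk s2 7).
        rewrite /S /=; sto; try done.
        - have h1 : n < k.+1.*2 by lia.
          have h2 : (n < k.*2) = false by lia.
          by rewrite h1 h2.
        - by congr nseq; lia.
        - by have -> : n - k.+1.*2 = 0 by lia.
      by apply: ext_push => //; rewrite ?size_upd ?szS; lia.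
    apply: (@ext_seq B _ _ _ 1 (upd (upd (S k) 5 (one :: nseq q one)) 5 (nseq q one)) 1); [| |lia].
      have -> : upd (upd (S k) 5 (one :: nseq q one)) 5 (nseq q one) =
        let s2 := upd (S k) 5 (one :: nseq q one) in upd s2 5 (behead (stk s2 5)) by rewrite /= stk_updE eqxx.
      by apply: ext_pop; rewrite ?size_upd ?szS //; lia.
    have -> : S k.+1 = let s2 := upd (upd (S k) 5 (one :: nseq q one)) 5 (nseq q one) in upd s2 6 (one :: stk s2 6).
      rewrite /S /=; sto; try done.
      - have h1 : (n < k.+1.*2) = false by lia.
        have h2 : (n < k.*2) = false by lia.
        by rewrite h1 h2.
      - by have -> : minn k.+1 n./2 = (minn k n./2).+1 by lia.
      - by have -> : n - k.+1.*2 = q by lia.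
    by apply: ext_push => //; rewrite ?size_upd ?szS; lia.
  - by rewrite /S; stks; have -> : n - (uphalf n).*2 = 0 by lia.
set Sf := S (uphalf n).
apply: (@ext_seq B _ _ _ 4 (upd (upd Sf 7 [::]) 4 (inl (odd n) :: stk Sf 4)) (n./2 * 3 + 1)); last by lia.
  apply: (@ext_case B _ _ _ 2); rewrite ?szS; [lia| |lia].
  have -> : stk Sf 7 = nseq (odd n) one by rewrite /Sf /S; stks; have -> : n < (uphalf n).*2 = odd n by lia.
  case on: (odd n) => /=.
    apply: (@ext_seq B _ _ _ 1 (upd Sf 7 [::]) 1); [| |lia].
      have -> : [::] = behead (stk Sf 7).
        by rewrite /Sf /S; stks; have -> : n < (uphalf n).*2 = true by lia.
      by apply: ext_pop; rewrite ?szS //; lia.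
    have -> : upd (upd Sf 7 [::]) 4 (one :: stk Sf 4) = upd (upd Sf 7 [::]) 4 (one :: stk (upd Sf 7 [::]) 4).
      by stks.
    by apply: ext_push; rewrite ?size_upd ?szS //; lia.
  have -> : upd (upd Sf 7 [::]) 4 (inl false :: stk Sf 4) = upd Sf 4 (inl false :: stk Sf 4).
    rewrite /Sf /S; sto; try done.
    by have -> : n < (uphalf n).*2 = false by lia.
  by apply: ext_push; rewrite ?szS //; lia.
set s3 := upd (upd Sf _ _) _ _.
have -> : pushs 4 [:: true; odd n] (setv n./2 s) = upd (upd s3 6 [::]) 5 (nseq n./2 one ++ stk s3 5).
  rewrite /pushs /setv /s3 /Sf /S /s1; sto; rewrite ?s6 ?s7 //.
  by rewrite (_ : n - (uphalf n).*2 = 0) ?cats0 //; lia.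
apply: ext_pour; rewrite ?size_upd ?szS; try lia.
by rewrite /s3 /Sf /S; stks; congr nseq; lia.
Qed.

Lemma ext_halves n : forall fuel s, n <= fuel -> 8 < size s -> stk s 5 = nseq n one ->
  stk s 6 = [::] -> stk s 7 = [::] ->
  ext (While 5 isSome halve) s (40 * n + 1) (pushs 4 (enc_tail fuel n) (setv 0 s)).
Proof.
elim/ltn_ind: n => n IH fuel s le sz s5 s6 s7; case: (posnP n) => [n0|n0].
  have -> : pushs 4 (enc_tail fuel n) (setv 0 s) = s.
    by rewrite n0 in s5 *; case: (fuel) => [|f]; rewrite /= pushs0 /setv ?size_upd; try lia; sto; rewrite ?s5.
  exists 0, 1; split; first lia.
  by apply: XWhileF; [lia|rewrite s5 n0].
case: fuel le => [|f] le; first lia.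
have hs := ext_halve sz s5 s6 s7; set s1 := pushs _ _ _ in hs.
have szs : size s1 = size s by rewrite /s1 size_pushs /setv size_upd; lia.
have [||||||m2 [t2 [l2 e2]]] := IH n./2 _ f s1; rewrite ?szs //; try lia.
- by rewrite /s1 stk_pushs // /setv stk_updE.
- by rewrite /s1 stk_pushs // /setv stk_updE.
- by rewrite /s1 stk_pushs // /setv stk_updE.
have [m1 [t1 [l1 e1]]] := hs.
exists (m1 + m2), (t1 + t2).+1; split; first lia.
have -> : pushs 4 (enc_tail f.+1 n) (setv 0 s) = pushs 4 (enc_tail f n./2) (setv 0 s1).
  rewrite /= (gtn_eqF n0) -[true :: _]/([:: true; odd n] ++ enc_tail f n./2) -pushs_cat; congr pushs.
  by rewrite /s1 /pushs /setv; sto.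
apply: XWhileT (exec_mono _ e1) (exec_mono _ e2); [lia| |lia|lia].
by rewrite s5; case: (n) n0.
Qed.

Definition item_code (it : item) : prog :=
  match it with
  | Bit e => Seq (ecode B e [:: 2] 5 6) (Case 5 (fun o => if o is Some _ then Seq (clear B 5) (Push 4 one) else Push 4 (inl false)))
  | Nat e => Seq (ecode B e [:: 2] 5 6) (Seq halve (Seq (While 5 isSome halve) (Push 4 (inl false))))
  end.

Definition block_code (bl : expr * seq item) : prog :=
  Seq (ecode B bl.1 [::] 3 5)
    (Seq (For 3 (foldr (fun it c => Seq (item_code it) c) (Push 2 one) bl.2)) (clear B 2)).

Definition gen_code (bls : seq (expr * seq item)) : prog :=
  foldr (fun bl c => Seq (block_code bl) c) (Seq (clear B 0) (move B 4 0 None)) bls.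

(** The input, no oracle bits, the index of the current repetition, the repetitions left, and the
    output in reverse. *)
Definition gstate (w : seq bool) x c (o : seq bool) K : store B :=
  [:: [seq inl a | a <- w]; [::]; nseq x one; nseq c one; catrev [seq inl a | a <- o] [::]] ++ nseq K [::].

Lemma gstate_stk w x c o K i : 4 < i -> stk (gstate w x c o K) i = [::].
Proof. by case: i => [|[|[|[|[|i]]]]] //= _; rewrite /stk /= nth_nseq if_same. Qed.

Lemma gstate_represents (w : seq bool) x c (o : seq bool) K r : 4 < r -> represents w [::] [:: 2] [:: x] r (gstate w x c o K).
Proof.
move=> hr; split=> //; first by case=> [|i] //= _; split=> //; lia.
by move=> i hi; apply: gstate_stk; lia.
Qed.

Lemma gstate_represents0 (w : seq bool) x c (o : seq bool) K r : 4 < r -> represents w [::] [::] [::] r (gstate w x c o K).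
Proof. by move=> hr; split=> // i hi; apply: gstate_stk; lia. Qed.

Lemma size_gstate w x c o K : size (gstate w x c o K) = 5 + K.
Proof. by rewrite /gstate size_cat size_nseq. Qed.

Lemma gstate_pushs w x c o o' K : pushs 4 o' (gstate w x c o K) = gstate w x c (o ++ o') K.
Proof.
rewrite /pushs; apply: store_ext; rewrite ?size_upd ?size_gstate; first lia.
move=> j; rewrite stk_updE; case: eqP => [->|]; last by case: j => [|[|[|[|[|j]]]]].
rewrite /gstate /stk /= map_cat.
by elim: o [::] => //= a l IH q; rewrite IH.
Qed.

Lemma item_codeP it : exists k K0, forall w x c o K M, K0 <= K -> size w <= M -> x <= M ->
  ext (item_code it) (gstate w x c o K) (poly_bound k M) (gstate w x c (o ++ out_item w x it) K).
Proof.
case: it => e; have [k1 [n1 h1]] := ecodeP B e.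
- have [k hk] : polyb (fun M => poly_bound k1 M * 3 + 5) by pb.
  exists k, (n1 + 8) => w x c o K M hK hw hx; have hkM := hk M.
  have [||v1 e1] := h1 w [::] [:: x] M hw; rewrite /= ?hx //.
  have {}e1 := e1 [:: 2] 5 6 (gstate w x c o K) (@gstate_represents w x c o K 6 isT) isT isT ltac:(rewrite size_gstate; lia).
  rewrite gstate_stk // cats0 in e1; set v := eval _ _ _ _ in v1 e1 *.
  apply: (@ext_seq B _ _ _ _ _ (v * 2 + 5)); [exact: e1| |lia].
  apply: (@ext_case B _ _ _ (v * 2 + 4)); rewrite ?size_upd ?size_gstate; [lia| |lia].
  rewrite stk_updE eqxx -/v -gstate_pushs.
  have E : upd (upd (gstate w x c o K) 5 (nseq v one)) 5 [::] = gstate w x c o K.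
    have := gstate_stk w x c o K (isT : 4 < 5); have := size_gstate w x c o K.
    by move: (gstate w x c o K) => s hs h5; sto; rewrite ?h5.
  case v0: v => [|v'] /=.
    have -> : upd (gstate w x c o K) 5 [::] = gstate w x c o K by rewrite -[RHS]E v0; sto.
    by apply: ext_push; rewrite ?size_gstate; lia.
  apply: (@ext_seq B _ _ _ (v * 2 + 1) (gstate w x c o K) 1); [| |lia].
    rewrite -[X in ext _ _ _ X]E v0; apply: ext_clear; rewrite ?size_upd ?size_gstate; first lia.
    by rewrite stk_updE /= size_nseq; lia.
  by apply: ext_push; rewrite ?size_gstate; lia.
- have [k hk] : polyb (fun M => poly_bound k1 M * 80 + 20) by pb.
  exists k, (n1 + 8) => w x c o K M hK hw hx; have hkM := hk M.
  have [||v1 e1] := h1 w [::] [:: x] M hw; rewrite /= ?hx //.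
  have {}e1 := e1 [:: 2] 5 6 (gstate w x c o K) (@gstate_represents w x c o K 6 isT) isT isT ltac:(rewrite size_gstate; lia).
  rewrite gstate_stk // cats0 in e1; set v := eval _ _ _ _ in v1 e1 *.
  have E : setv 0 (gstate w x c o K) = gstate w x c o K.
    have := gstate_stk w x c o K (isT : 4 < 5); have := size_gstate w x c o K; rewrite /setv.
    by move: (gstate w x c o K) => s hs h5; sto; rewrite ?h5.
  have {}e1 : ext (ecode B e [:: 2] 5 6) (gstate w x c o K) (poly_bound k1 M) (setv v (gstate w x c o K)) by [].
  apply: (@ext_seq B _ _ _ _ _ (v * 50 + 20)); [exact: e1| |lia].
  have szg := size_gstate w x c o K; have g6 := gstate_stk w x c o K (isT : 4 < 6); have g7 := gstate_stk w x c o K (isT : 4 < 7).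
  have g5 := gstate_stk w x c o K (isT : 4 < 5).
  rewrite encode_natE -gstate_pushs; move: (gstate w x c o K) E szg g5 g6 g7 {e1} => s E szg g5 g6 g7.
  have sz1 q : size (setv q s) = size s by rewrite /setv size_upd; lia.
  apply: (@ext_seq B _ _ _ _ (pushs 4 [:: true; odd v] (setv v./2 s)) (v./2 * 40 + 2)).
  - have -> : setv v./2 s = setv v./2 (setv v s) by rewrite /setv; sto.
    by apply: ext_halve; rewrite ?sz1; try lia; rewrite /setv stk_updE.
  - apply: (@ext_seq B _ _ _ _ (pushs 4 ([:: true; odd v] ++ enc_tail v v./2) s) 1).
    + have <- : pushs 4 (enc_tail v v./2) (setv 0 (pushs 4 [:: true; odd v] (setv v./2 s))) =
        pushs 4 ([:: true; odd v] ++ enc_tail v v./2) s.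
        rewrite -pushs_cat; congr pushs; rewrite /pushs /setv; sto; by rewrite ?g5.
      apply: ext_halves; rewrite ?size_pushs ?sz1; try lia.
      * by rewrite stk_pushs // /setv stk_updE.
      * by rewrite stk_pushs // /setv stk_updE.
      * by rewrite stk_pushs // /setv stk_updE.
    + rewrite catA -(pushs_cat _ (_ ++ _) [:: false]); apply: ext_push => //; rewrite size_pushs; lia.
    + by lia.
  - by lia.
Qed.

Lemma items_codeP its : exists k K0, forall w x c o K M, K0 <= K -> size w <= M -> x <= M ->
  ext (foldr (fun it c => Seq (item_code it) c) (Push 2 one) its) (gstate w x c o K) (poly_bound k M)
    (gstate w x.+1 c (o ++ flatten [seq out_item w x it | it <- its]) K).
Proof.
elim: its => [|it its [k2 [K2 h2]]] /=.
  exists 1, 0 => w x c o K M _ _ _; rewrite cats0.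
  have -> : gstate w x.+1 c o K = upd (gstate w x c o K) 2 (one :: stk (gstate w x c o K) 2).
    apply: store_ext; rewrite ?size_upd ?size_gstate; first lia.
    by move=> j; rewrite stk_updE; case: j => [|[|[|[|[|j]]]]].
  by apply: ext_push; rewrite ?size_gstate // /poly_bound addn1.
have [k1 [K1 h1]] := item_codeP it.
have [k hk] : polyb (fun M => poly_bound k1 M + poly_bound k2 M) by pb.
exists k, (K1 + K2) => w x c o K M hK hw hx; rewrite catA.
by apply: ext_seq (h1 _ _ _ _ _ _ _ hw hx) (h2 _ _ _ _ _ _ _ hw hx) (hk M); lia.
Qed.

Lemma block_codeP bl : exists k K0, forall w o K, K0 <= K ->
  ext (block_code bl) (gstate w 0 0 o K) (poly_bound k (size w)) (gstate w 0 0 (o ++ out_block w bl) K).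
Proof.
case: bl => e its; have [k1 [n1 h1]] := ecodeP B e; have [k2 [K2 h2]] := items_codeP its.
have [k hk] : polyb (fun M => poly_bound k1 M + poly_bound k1 M * (poly_bound k2 (M + poly_bound k1 M) + 4) + 2) by pb.
exists k, (n1 + K2 + 8) => w o K hK; have hkM := hk (size w).
have [||v1 e1] := h1 w [::] [::] (size w) (leqnn _) => //.
have {}e1 := e1 [::] 3 5 (gstate w 0 0 o K) (@gstate_represents0 w 0 0 o K 5 isT) isT isT ltac:(rewrite size_gstate; lia).
rewrite {3}/gstate /stk /= cats0 in e1; rewrite /out_block /=; set v := eval _ _ _ _ in v1 e1 *.
have {}e1 : ext (ecode B e [::] 3 5) (gstate w 0 0 o K) (poly_bound k1 (size w)) (gstate w 0 v o K) by [].
set q := poly_bound k2 _ in hkM.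
apply: (@ext_seq B _ _ _ _ _ (v * (q + 4) + 2)); [exact: e1| |].
pose S j := gstate w j (v - j) (o ++ flatten [seq flatten [seq out_item w x it | it <- its] | x <- iota 0 j]) K.
apply: (@ext_seq B _ _ _ (v * q.+2 + 1) (S v) (v * 2 + 1)); [| |lia].
- have <- : S 0 = gstate w 0 v o K by rewrite /S subn0 cats0.
  apply: (@ext_for B _ _ _ _ q) => [j jn|j jn|]; [by rewrite size_gstate; split=> //; lia| |lia].
  have -> : upd (S j) 3 (nseq (v - j.+1) one) = gstate w j (v - j.+1) (o ++ flatten [seq flatten [seq out_item w x it | it <- its] | x <- iota 0 j]) K by [].
  have e0 : iota 0 j.+1 = iota 0 j ++ [:: j] by rewrite -addn1 iotaD.
  rewrite /S e0 map_cat flatten_cat /= cats0 catA.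
  by apply: h2; lia.
- have -> : gstate w 0 0 (o ++ flatten [seq flatten [seq out_item w x it | it <- its] | x <- iota 0 v]) K = upd (S v) 2 [::].
    by rewrite /S subnn.
  apply: ext_clear; rewrite ?size_gstate; first lia.
  by rewrite /S /gstate /stk /= size_nseq; lia.
- by have := leq_mul v1 (leqnn (q + 4)); lia.
Qed.

Lemma gen_codeP bls : transduces (gen_code bls) (out bls).
Proof.
suff [k [K0 h]] : exists k K0, forall w o K, K0 <= K ->
    ext (gen_code bls) (gstate w 0 0 o K) (poly_bound k (size w + size o)) (prog_init B (4 + K) (o ++ out bls w)).
  exists k, (K0 + 4) => w K hK; have K4 : 4 + (K - 4) = K by lia.
  have := h w [::] (K - 4) ltac:(lia); rewrite addn0 K4.
  by have -> : gstate w 0 0 [::] (K - 4) = prog_init B K w by rewrite /prog_init -{2}K4.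
elim: bls => [|bl bls [k2 [K2 h2]]] /=.
  have [k hk] : polyb (fun M => M * 8 + 2) by pb.
  exists k, 0 => w o K _; have hkM := hk (size w + size o).
  pose s1 := gstate [::] 0 0 o K.
  apply: (@ext_seq B _ _ _ (size w * 2 + 1) s1 (6 * size o + 1)); [| |lia].
    have -> : s1 = upd (gstate w 0 0 o K) 0 [::] by [].
    by apply: ext_clear; rewrite ?size_gstate // /gstate /stk /= size_map; lia.
  have -> : prog_init B (4 + K) (o ++ out [::] w) =
      oupd (upd (upd s1 4 [::]) 0 (catrev (stk s1 4) (stk s1 0))) None (size (stk s1 4)).
    by rewrite /prog_init /= cats0 /stk /upd /= !catrevE !cats0 revK.
  apply: ext_move; rewrite ?size_gstate //.
  by rewrite /s1 /gstate /stk /= catrevE cats0 size_rev size_map; lia.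
have [k1 [K1 h1]] := block_codeP bl.
have [k hk] : polyb (fun M => poly_bound k1 M + poly_bound k2 (M + poly_bound k1 M)) by pb.
exists k, (K1 + K2) => w o K hK; rewrite /out /= catA.
have e1 := h1 w o K ltac:(lia).
apply: (@ext_seq B _ _ _ _ _ (poly_bound k2 (size w + size (o ++ out_block w bl)))); [exact: e1|by apply: h2; lia|].
apply: leq_trans (hk (size w + size o)); apply: leq_add; apply: poly_bound_mono => //; first lia.
have [m [t [ht /exec_bound[_ /(_ 4)]]]] := e1.
rewrite /gstate /stk /= !catrevE !cats0 !size_rev !size_map => hsz.
by have := poly_bound_mono (leqnn k1) (leq_addr (size o) (size w)); lia.
Qed.
End Generator.

(** * Quantified formulas in polynomial space *)

Section Quantified.
Variables (N Q Phi : expr).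

(* The bits are quantified in order; the most recent bit comes first, and [k]
   bits remain to be chosen. [Q] computes from [k - 1] whether the quantifier
   is existential. *)
Fixpoint qval (w : seq bool) (k : nat) (b : seq bool) : bool :=
  if k is k'.+1 then
    if eval Q w [::] [:: k'] == 0
    then qval w k' (false :: b) || qval w k' (true :: b)
    else qval w k' (false :: b) && qval w k' (true :: b)
  else eval Phi w b [::] != 0.

Hypothesis Q_oracle : forall w b k, eval Q w b [:: k] = eval Q w [::] [:: k].

Variable B : finType.
Notation sym := (bool + B)%type.
Notation prog := (cmd B).
Notation Push := (@Push B).
Notation Pop := (@Pop B).
Notation Skip := (@Skip B).
Notation one := (inl true : sym).

(** [b] is the current branch of the quantifier tree, [D] the number of bits still to choose and [V]
    the value just returned. [G] keeps the loop running, [U] tells that the traversal is on its way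
    up, and [X] receives the kind of the quantifier. *)
Definition qstate (w b : seq bool) D V G U X K : store B :=
  [:: [seq inl a | a <- w]; [seq inl a | a <- b]; nseq D one; nseq V one; nseq G one; nseq U one; nseq X one]
    ++ nseq K [::].

Definition flip : prog := Seq (Pop 1) (Seq (Push 1 one) (Seq (Pop 5) (Seq (clear B 3) (clear B 6)))).
Definition ascend : prog := Seq (Pop 1) (Seq (Push 2 one) (clear B 6)).

(** On the way down a bit is first chosen [false], and the matrix is evaluated at a leaf. On the way
    up a bit [true] marks a finished second branch, whose value is passed on; the value of a first
    branch is passed on only if it decides the quantifier. An empty branch is the root, where the
    loop ends. *)
Definition qbody : prog :=
  Case 5 (fun o => if o is None then
      Case 2 (fun o => if o is Some _ then Seq (Pop 2) (Push 1 (inl false))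
                       else Seq (ecode B Phi [::] 3 7) (Push 5 one))
    else Case 1 (fun o => match o with
      | None => Pop 4
      | Some a => Seq (ecode B Q [:: 2] 6 7)
          (if a == one then ascend
           else Case 6 (fun q => Case 3 (fun v => if isSome q == isSome v then flip else ascend)))
      end)).

Definition qprog : prog :=
  Seq (ecode B N [::] 2 7) (Seq (Push 4 one) (Seq (While 4 isSome qbody)
    (Seq (clear B 0) (Case 3 (fun v => if v is Some _ then Push 0 one else Skip))))).

Lemma qstate_stk w b D V G U X K i : 6 < i -> stk (qstate w b D V G U X K) i = [::].
Proof. by case: i => [|[|[|[|[|[|[|i]]]]]]] //= _; rewrite /stk /= nth_nseq if_same. Qed.

Lemma size_qstate w b D V G U X K : size (qstate w b D V G U X K) = 7 + K.
Proof. by rewrite /qstate size_cat size_nseq. Qed.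

Lemma qstate_represents w b D V G U X K : represents w b [::] [::] 7 (qstate w b D V G U X K).
Proof. by split=> // i hi; apply: qstate_stk; lia. Qed.

Lemma qstate_representsD w b D V G U X K : represents w b [:: 2] [:: D] 7 (qstate w b D V G U X K).
Proof.
split=> //; first by case=> [|i] //= _; split=> //; lia.
by move=> i hi; apply: qstate_stk; lia.
Qed.

Lemma qstate_size_stk w b D V G U X K M i : size w <= M -> size b <= M -> D <= M -> V <= M ->
  G <= M -> U <= M -> X <= M -> size (stk (qstate w b D V G U X K) i) <= M.
Proof.
move=> hw hb hD hV hG hU hX.
case: i => [|[|[|[|[|[|[|i]]]]]]]; rewrite /stk /= ?size_map ?size_nseq //.
by rewrite nth_nseq if_same.
Qed.

Ltac qsz := rewrite ?size_qstate; lia.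

Lemma ext_up w a b D V X K : ext ascend (qstate w (a :: b) D V 1 1 X K) (X * 2 + 3)
  (qstate w b D.+1 V 1 1 0 K).
Proof.
apply: (@ext_seq B _ _ _ 1 (qstate w b D V 1 1 X K) (X * 2 + 2)); [|  |by lia].
  by apply: (@ext_pop B 1 (qstate w (a :: b) D V 1 1 X K)); rewrite // size_qstate.
apply: (@ext_seq B _ _ _ 1 (qstate w b D.+1 V 1 1 X K) (X * 2 + 1)); [| |by lia].
  by apply: (@ext_push B 2 one (qstate w b D V 1 1 X K)); rewrite // size_qstate.
apply: (@ext_clear B 6 (qstate w b D.+1 V 1 1 X K)); first qsz.
by rewrite /stk /= size_nseq; lia.
Qed.

Lemma ext_flip w b D V X K : ext flip (qstate w (false :: b) D V 1 1 X K) (X * 2 + V * 2 + 5)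
  (qstate w (true :: b) D 0 1 0 0 K).
Proof.
apply: (@ext_seq B _ _ _ 1 (qstate w b D V 1 1 X K) (X * 2 + V * 2 + 4)); [|  |by lia].
  by apply: (@ext_pop B 1 (qstate w (false :: b) D V 1 1 X K)); rewrite // size_qstate.
apply: (@ext_seq B _ _ _ 1 (qstate w (true :: b) D V 1 1 X K) (X * 2 + V * 2 + 3)); [| |by lia].
  by apply: (@ext_push B 1 one (qstate w b D V 1 1 X K)); rewrite // size_qstate.
apply: (@ext_seq B _ _ _ 1 (qstate w (true :: b) D V 1 0 X K) (X * 2 + V * 2 + 2)); [| |by lia].
  by apply: (@ext_pop B 5 (qstate w (true :: b) D V 1 1 X K)); rewrite // size_qstate.
apply: (@ext_seq B _ _ _ (V * 2 + 1) (qstate w (true :: b) D 0 1 0 X K) (X * 2 + 1)); [| |by lia].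
  apply: (@ext_clear B 3 (qstate w (true :: b) D V 1 0 X K)); first qsz.
  by rewrite /stk /= size_nseq; lia.
apply: (@ext_clear B 6 (qstate w (true :: b) D 0 1 0 X K)); first qsz.
by rewrite /stk /= size_nseq; lia.
Qed.

Lemma qbody_step : exists k1 k K0, forall w K M, K0 <= K -> size w <= M ->
  [/\ forall b D, size b <= M -> D < M ->
        ext qbody (qstate w b D.+1 0 1 0 0 K) (poly_bound k M) (qstate w (false :: b) D 0 1 0 0 K),
      forall b, size b <= M -> eval Phi w b [::] <= poly_bound k1 M /\
        ext qbody (qstate w b 0 0 1 0 0 K) (poly_bound k M) (qstate w b 0 (eval Phi w b [::]) 1 1 0 K),
      forall b D V a, size b < M -> D <= M -> V <= poly_bound k1 M ->
        a || ((eval Q w [::] [:: D] == 0) == (V != 0)) ->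
        ext qbody (qstate w (a :: b) D V 1 1 0 K) (poly_bound k M) (qstate w b D.+1 V 1 1 0 K),
      forall b D V, size b < M -> D <= M -> V <= poly_bound k1 M ->
        ~~ ((eval Q w [::] [:: D] == 0) == (V != 0)) ->
        ext qbody (qstate w (false :: b) D V 1 1 0 K) (poly_bound k M) (qstate w (true :: b) D 0 1 0 0 K)
    & forall D V, ext qbody (qstate w [::] D V 1 1 0 K) (poly_bound k M) (qstate w [::] D V 0 1 0 K)].
Proof.
have [k1 [n1 h1]] := ecodeP B Phi; have [k2 [n2 h2]] := ecodeP B Q.
have [k hk] : polyb (fun M => poly_bound k1 M * 6 + poly_bound k2 M * 6 + 20) by pb.
exists k1, k, (n1 + n2 + 8) => w K M hK hw; have hkM := hk M.
have asc b D V a s' : size b < M -> D <= M ->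
    let q := eval Q w [::] [:: D] in
    ext (if a then ascend else if (q != 0) == (V != 0) then flip else ascend) (qstate w (a :: b) D V 1 1 q K)
      (q * 2 + V * 2 + 5) s' -> V <= poly_bound k1 M ->
    ext qbody (qstate w (a :: b) D V 1 1 0 K) (poly_bound k M) s'.
  move=> hb hD q hx hV.
  have [||v2 e2] := h2 w (a :: b) [:: D] M hw; rewrite /= ?hD //.
  (* On the way up the oracle stack still holds the bits of the branch, whereas [qval] evaluates the
     quantifier without them. *)
  rewrite Q_oracle -/q in v2 e2.
  have {}e2 := e2 [:: 2] 6 7 (qstate w (a :: b) D V 1 1 0 K) (qstate_representsD _ _ _ _ _ _ _ _) isT isT ltac:(qsz).
  have {}e2 : ext (ecode B Q [:: 2] 6 7) (qstate w (a :: b) D V 1 1 0 K) (poly_bound k2 M) (qstate w (a :: b) D V 1 1 q K).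
    by move: e2; rewrite /stk /= cats0.
  apply: (@ext_case B _ _ _ (poly_bound k M).-1); [qsz| |lia].
  apply: (@ext_case B _ _ _ (poly_bound k M).-2); [qsz| |lia].
  apply: (@ext_seq B _ _ _ _ _ (q * 2 + V * 2 + 7)); [exact: e2| |lia].
  case: a hx {e2} => /= [hx|hx]; first by apply: ext_le hx _; lia.
  apply: (@ext_case B _ _ _ (q * 2 + V * 2 + 6)); [qsz| |lia].
  apply: (@ext_case B _ _ _ (q * 2 + V * 2 + 5)); [qsz| |lia].
  rewrite /stk /=; have oh n : isSome (ohead (nseq n one)) = (n != 0) by case: n.
  by rewrite !oh.
split.
- move=> b D hb hD.
  apply: (@ext_case B _ _ _ 3); [qsz| |lia]; apply: (@ext_case B _ _ _ 2); [qsz| |lia].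
  apply: (@ext_seq B _ _ _ 1 (qstate w b D 0 1 0 0 K) 1); [| |by []].
    by apply: (@ext_pop B 2 (qstate w b D.+1 0 1 0 0 K)); rewrite // size_qstate.
  by apply: (@ext_push B 1 (inl false) (qstate w b D 0 1 0 0 K)); rewrite // size_qstate.
- move=> b hb; have [//|v1 e1] := h1 w b [::] M hw hb.
  split=> //; set v := eval _ _ _ _ in v1 e1 *.
  have {}e1 := e1 [::] 3 7 (qstate w b 0 0 1 0 0 K) (qstate_represents _ _ _ _ _ _ _ _) isT isT ltac:(qsz).
  have {}e1 : ext (ecode B Phi [::] 3 7) (qstate w b 0 0 1 0 0 K) (poly_bound k1 M) (qstate w b 0 v 1 0 0 K).
    by move: e1; rewrite /stk /= cats0.
  apply: (@ext_case B _ _ _ (poly_bound k M).-1); [qsz| |lia].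
  apply: (@ext_case B _ _ _ (poly_bound k M).-2); [qsz| |lia].
  apply: (@ext_seq B _ _ _ _ _ 1); [exact: e1| |lia].
  by apply: (@ext_push B 5 one (qstate w b 0 v 1 0 0 K)); rewrite // size_qstate.
- move=> b D V a hb hD hV ha; apply: (asc) => //=.
  have -> : (if a then ascend else if (eval Q w [::] [:: D] != 0) == (V != 0) then flip else ascend) = ascend.
    by move: ha; case: (a) => //=; case: (eval Q w [::] [:: D] == 0); case: (V == 0).
  by apply: ext_le (ext_up _ _ _ _ _ _ _) _; lia.
- move=> b D V hb hD hV ha; apply: (asc) => //=.
  have -> : (if (eval Q w [::] [:: D] != 0) == (V != 0) then flip else ascend) = flip.
    by move: ha; case: (eval Q w [::] [:: D] == 0); case: (V == 0).
  by apply: ext_le (ext_flip _ _ _ _ _ _) _; lia.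
- move=> D V; apply: (@ext_case B _ _ _ 2); [qsz| |lia]; apply: (@ext_case B _ _ _ 1); [qsz| |lia].
  by apply: (@ext_pop B 4 (qstate w [::] D V 1 1 0 K)); rewrite // size_qstate.
Qed.

(** For the exponentially long traversal the stacks are bounded directly, not through the running
    time. *)
Definition exs m (c : prog) s s' := exists t, exec m c s t s'.

Lemma ext_exs m c s T s' : ext c s T s' -> (forall i, size (stk s i) + T <= m) -> exs m c s s'.
Proof.
move=> [m' [t [ht e]]] hm; exists t; have [eb _] := exec_bound e.
by apply: eb => i; have := hm i; lia.
Qed.

Theorem qval_PSPACE : PSPACE (fun w => qval w (eval N w [::] [::]) [::]).
Proof.
have [k1 [k [K0 step]]] := qbody_step; have [k0 [n0 h0]] := ecodeP B N.
pose Mf n := n + poly_bound k0 n + 3.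
pose mf n := Mf n + poly_bound k1 (Mf n) * 3 + poly_bound k (Mf n) + poly_bound k0 (Mf n) + Mf n * 2 + 3.
apply: (@prog_PSPACE B (7 + K0 + n0) qprog _ mf); first by rewrite /mf /Mf; pb.
  by move=> w; rewrite /mf /Mf; lia.
move=> w; set n := size w; set m := mf n; set M := Mf n.
have [//|v0 e0] := h0 w [::] [::] n (leqnn _) isT; set Nw := eval N _ _ _ in v0 e0 *.
have NM : Nw + 3 <= M by rewrite /M /Mf; lia.
have nM : size w + 3 <= M by rewrite /M /Mf -/n; lia.
have hm : M + poly_bound k1 M * 3 + poly_bound k M + poly_bound k0 M + M * 2 + 3 = m by [].
pose K := 1 + K0 + n0.
have [s1 s2 s3 s4 s5] := step w K M ltac:(rewrite /K; lia) ltac:(lia).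
pose loop := While 4 isSome qbody.
(* In continuation form, rounds of the loop compose without counting them: every completion of the
   loop from [s'] is one from [s]. *)
pose reach s s' := forall f, exs m loop s' f -> exs m loop s f.
have mk b D V U s' : size b <= M -> D <= M -> V <= poly_bound k1 M -> U <= 1 ->
    ext qbody (qstate w b D V 1 U 0 K) (poly_bound k M) s' -> reach (qstate w b D V 1 U 0 K) s'.
  move=> hb hD hV hU e f [t2 e2].
  have [|t1 e1] := ext_exs (m := m) e.
    by move=> i; have := @qstate_size_stk w b D V 1 U 0 K (M + poly_bound k1 M) i; lia.
  by exists (t1 + t2).+1; apply: XWhileT e1 e2; rewrite ?size_qstate.
have main kk : forall b, size b + kk <= Nw -> exists v,
    [/\ (v != 0) = qval w kk b, v <= poly_bound k1 M
      & reach (qstate w b kk 0 1 0 0 K) (qstate w b kk v 1 1 0 K)].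
  elim: kk => [|kk IH] b hb.
    have [hv ev] := s2 b ltac:(lia); exists (eval Phi w b [::]); split=> //.
    by apply: mk => //; lia.
  have [v1 [q1 l1 r1]] := IH (false :: b) ltac:(rewrite /=; lia).
  have d1 := mk _ _ _ _ _ _ _ _ _ (s1 b kk ltac:(lia) ltac:(lia)).
  have {d1} d1 : reach (qstate w b kk.+1 0 1 0 0 K) (qstate w (false :: b) kk v1 1 1 0 K).
    by move=> f /r1; apply: d1; lia.
  case dec : ((eval Q w [::] [:: kk] == 0) == (v1 != 0)).
    exists v1; split=> //.
      by rewrite /= -q1; move: dec; case: (eval Q w [::] [:: kk] == 0); case: (v1 == 0).
    move=> f hf; apply: d1; apply: mk hf => //=; try lia.
    by apply: s3 => //; lia.
  have [v2 [q2 l2 r2]] := IH (true :: b) ltac:(rewrite /=; lia).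
  exists v2; split=> //.
    by rewrite /= -q1 -q2; move: dec; case: (eval Q w [::] [:: kk] == 0); case: (v1 == 0).
  move=> f hf; apply: d1.
  have d2 : reach (qstate w (false :: b) kk v1 1 1 0 K) (qstate w (true :: b) kk 0 1 0 0 K).
    by apply: mk => //=; [lia|lia|apply: s4; rewrite ?dec //; lia].
  apply: d2; apply: r2; move: f hf; apply: mk => //=; [lia|lia|].
  by apply: s3 => //; lia.
have [v [qv lv rv]] := main Nw [::] ltac:(rewrite /=; lia).
have i0 : prog_init B (7 + K0 + n0) w = qstate w [::] 0 0 0 0 0 K by [].
have {}e0 := e0 [::] 2 7 (qstate w [::] 0 0 0 0 0 K) (qstate_represents _ _ _ _ _ _ _ _) isT isT ltac:(rewrite size_qstate /K; lia).
have {}e0 : ext (ecode B N [::] 2 7) (qstate w [::] 0 0 0 0 0 K) (poly_bound k0 n) (qstate w [::] Nw 0 0 0 0 K).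
  by move: e0; rewrite /stk /= cats0.
have k0M : poly_bound k0 n <= poly_bound k0 M by apply: poly_bound_mono => //; lia.
have bnd b D V G U X i T : size b <= M -> D <= M -> V <= poly_bound k1 M -> G <= 1 -> U <= 1 -> X = 0 ->
    T <= poly_bound k0 M + poly_bound k1 M * 2 + M * 2 + 3 -> size (stk (qstate w b D V G U X K) i) + T <= m.
  by move=> *; have := @qstate_size_stk w b D V G U X K (M + poly_bound k1 M) i; lia.
have [t1 x1] : exs m (ecode B N [::] 2 7) (prog_init B (7 + K0 + n0) w) (qstate w [::] Nw 0 0 0 0 K).
  by rewrite i0; apply: ext_exs e0 _ => i; apply: bnd => //; lia.
have [t2 x2] : exs m (Push 4 one) (qstate w [::] Nw 0 0 0 0 K) (qstate w [::] Nw 0 1 0 0 K).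
  have e := @ext_push B 4 one (qstate w [::] Nw 0 0 0 0 K) 1 ltac:(qsz) isT.
  by apply: (ext_exs e) => i; apply: bnd => //; lia.
have [t3 x3] : exs m loop (qstate w [::] Nw 0 1 0 0 K) (qstate w [::] Nw v 0 1 0 K).
  apply: rv; apply: (mk [::] Nw v 1 _ _ _ _ _ (s5 Nw v)) => //; first lia.
  by exists 1; apply: XWhileF; rewrite ?size_qstate.
have [t4 x4] : exs m (clear B 0) (qstate w [::] Nw v 0 1 0 K) (qstate [::] [::] Nw v 0 1 0 K).
  have e := @ext_clear B 0 (qstate w [::] Nw v 0 1 0 K) (M * 2 + 1) ltac:(qsz).
  apply: (ext_exs (e _)); first by rewrite /stk /= size_map; lia.
  by move=> i; apply: bnd => //; lia.
have bnd0 i : size (stk (qstate [::] [::] Nw v 0 1 0 K) i) + 2 <= m.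
  by have := @qstate_size_stk [::] [::] Nw v 0 1 0 K (M + poly_bound k1 M) i (leq0n _) (leq0n _); lia.
have [t5 [s [x5 sE]]] : exists t5 s, exec m (Case 3 (fun o => if o is Some _ then Push 0 one else Skip))
    (qstate [::] [::] Nw v 0 1 0 K) t5 s /\ (ohead (stk s 0) == Some one) = (v != 0).
  case: v bnd0 {qv lv rv x3 x4} => [|v] bnd0.
    exists 1, (qstate [::] [::] Nw 0 0 1 0 K); split=> //.
    by apply: XCase; [rewrite size_qstate|exact: XSkip].
  exists 2, (upd (qstate [::] [::] Nw v.+1 0 1 0 K) 0 [:: one]); split=> //.
  apply: XCase; [by rewrite size_qstate|].
  by apply: (@XPush B m 0 one (qstate [::] [::] Nw v.+1 0 1 0 K)); [rewrite size_qstate|have := bnd0 0; lia].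
exists (t1 + (t2 + (t3 + (t4 + t5)))), s; split; last by rewrite sE qv.
exact: XSeq x1 (XSeq x2 (XSeq x3 (XSeq x4 x5))).
Qed.
End Quantified.

(** * Derived arithmetic *)

Definition ENot e := EIf e (ELit 0) (ELit 1).
Definition ELeq e f := ENot (ESub e f).
Definition ELt e f := ELeq (EAdd e (ELit 1)) f.
Definition EEq e f := EMul (ELeq e f) (ELeq f e).
Definition ESum n d e := ERec n d (ELit 0) (EAdd (EVar 0) (EWk e)).
Definition EAll n e := ERec n (ELit 1) (ELit 1) (EIf (EVar 0) (EWk e) (ELit 0)).
Definition EDiv e f :=
  ESum e e (ELeq (EMul (EAdd (EVar 0) (ELit 1)) (EWk f)) (EWk e)).
Definition EMod e f := ESub e (EMul (EDiv e f) f).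

Section Eval.
Variables w b : seq bool.
Notation ev e env := (eval e w b env).

Lemma eval_Var i env : ev (EVar i) env = nth 0 env i. Proof. by []. Qed.
Lemma eval_Lit n env : ev (ELit n) env = n. Proof. by []. Qed.
Lemma eval_Len env : ev ELen env = size w. Proof. by []. Qed.
Lemma eval_Inp e env : ev (EInp e) env = getb w (ev e env). Proof. by []. Qed.
Lemma eval_Add e f env : ev (EAdd e f) env = ev e env + ev f env. Proof. by []. Qed.
Lemma eval_Sub e f env : ev (ESub e f) env = ev e env - ev f env. Proof. by []. Qed.
Lemma eval_Mul e f env : ev (EMul e f) env = ev e env * ev f env. Proof. by []. Qed.
Lemma eval_If e f g env : ev (EIf e f g) env = if ev e env == 0 then ev g env else ev f env.
Proof. by []. Qed.
Lemma eval_Let e f env : ev (ELet e f) env = ev f (ev e env :: env). Proof. by []. Qed.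
Lemma eval_Wk e env : ev (EWk e) env = ev e (behead env). Proof. by []. Qed.
Lemma eval_Rec n d a f env : ev (ERec n d a f) env =
  brec (ev n env) (ev d env) (ev a env) (fun i acc => ev f [:: acc, i & env]).
Proof. by []. Qed.

Lemma eval_Not e env : ev (ENot e) env = (ev e env == 0).
Proof. by rewrite /=; case: eqP. Qed.

Lemma eval_Leq e f env : ev (ELeq e f) env = (ev e env <= ev f env).
Proof. by rewrite /ELeq eval_Not. Qed.

Lemma eval_Lt e f env : ev (ELt e f) env = (ev e env < ev f env).
Proof. by rewrite /ELt eval_Leq /= addn1. Qed.

Lemma eval_Eq e f env : ev (EEq e f) env = (ev e env == ev f env).
Proof. by rewrite /EEq eval_Mul !eval_Leq mulnb eqn_leq. Qed.

Lemma brecS n bd a f : brec n.+1 bd a f = minn (f n (brec n bd a f)) bd.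
Proof. by []. Qed.

Lemma eval_Sum n d e env :
  ev (ESum n d e) env = minn (\sum_(0 <= i < ev n env) ev e (i :: env)) (ev d env).
Proof.
rewrite /=; elim: (ev n env) => [|k IH]; first by rewrite big_nil.
by rewrite brecS IH /= big_nat_recr //=; lia.
Qed.

Lemma eval_All n e env :
  ev (EAll n e) env = all (fun i => ev e (i :: env) != 0) (iota 0 (ev n env)).
Proof.
rewrite /=; elim: (ev n env) => [//|k IH].
have -> : iota 0 k.+1 = iota 0 k ++ [:: k] by rewrite -addn1 iotaD.
rewrite brecS IH all_cat /= andbT.
by case: all => //=; case: (ev e _) => // q; rewrite minn1.
Qed.

Lemma sum_leq_div a c : 0 < c -> \sum_(0 <= i < a) (i.+1 * c <= a) = a %/ c.
Proof.
move=> c0; suff h k : \sum_(0 <= i < k) (i.+1 * c <= a) = minn k (a %/ c).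
  by rewrite h; apply/minn_idPr; exact: leq_div.
elim: k => [|k IH]; first by rewrite big_nil min0n.
by rewrite big_nat_recr //= IH -leq_divRL //; lia.
Qed.

Lemma eval_Div e f env : 0 < ev f env -> ev (EDiv e f) env = ev e env %/ ev f env.
Proof.
move=> f0; rewrite /EDiv eval_Sum (eq_bigr (fun i => (i.+1 * ev f env <= ev e env) : nat)).
  by rewrite sum_leq_div //; apply/minn_idPl; exact: leq_div.
by move=> i _; rewrite eval_Leq /= addn1.
Qed.

Lemma eval_Mod e f env : 0 < ev f env -> ev (EMod e f) env = ev e env %% ev f env.
Proof.
move=> f0; rewrite /EMod eval_Sub eval_Mul eval_Div //.
by rewrite {1}(divn_eq (ev e env) (ev f env)) addKn.
Qed.

End Eval.
Arguments eval : simpl never.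

(* [ESub] of a truth value tests whether the bit read is [true]. *)
Definition EBit e := ESub (EInp e) (ELit 1).
Definition EOrb e := ESub (EOra e) (ELit 1).

Lemma getb_sub1 l i : getb l i - 1 = nth false l i.
Proof.
rewrite /getb; case: ltnP => h; last by rewrite nth_default.
by case: nth.
Qed.

Lemma eval_Bit e w b env : eval (EBit e) w b env = nth false w (eval e w b env).
Proof. exact: getb_sub1. Qed.

Lemma eval_Orb e w b env : eval (EOrb e) w b env = nth false b (eval e w b env).
Proof. exact: getb_sub1. Qed.

(* The end of the number that starts at position [EVar 0], and its value. *)
Definition EStop := ERec ELen (EAdd ELen ELen) (EVar 0)
  (EIf (EBit (EVar 0)) (EAdd (EVar 0) (ELit 2)) (EVar 0)).
Definition ENext := EAdd EStop (ELit 1).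
Definition EVal := ELet EStop (ERec ELen ELen (ELit 0)
  (EIf (ELt (EAdd (EVar 3) (EMul (ELit 2) (EVar 1))) (EVar 2))
    (EAdd (EMul (ELit 2) (EVar 0)) (EBit (ESub (EVar 2) (EAdd (EMul (ELit 2) (EVar 1)) (ELit 1)))))
    (EVar 0))).

Definition digits (ds : seq bool) : seq bool := flatten [seq [:: true; d] | d <- ds] ++ [:: false].

(** Even positions hold the continuation marks. Past the end mark the text is arbitrary, whence the
    alternative. *)
Lemma nth_digits ds rest i : nth false (digits ds ++ rest) i.*2 = (i < size ds) \/ size ds < i.
Proof.
elim: ds i => [|d ds IH] [|i] /=; [by left|by right|by left|].
by case: (IH i); rewrite /digits => h; [left|right].
Qed.

Lemma nth_digits_odd ds rest i : i < size ds -> nth false (digits ds ++ rest) i.*2.+1 = nth false ds i.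
Proof. by elim: ds i => [|d ds IH] [|i] //= /IH. Qed.

Lemma size_digits ds : size (digits ds) = (size ds).*2.+1.
Proof. by elim: ds => //= d ds; rewrite /digits => ->. Qed.

Definition binary n := [seq odd (n %/ 2 ^ i) | i <- iota 0 (trunc_log 2 n).+1].

Lemma encode_nat_digits n : encode_nat n = digits (binary n).
Proof. by rewrite /encode_nat /digits /binary -map_comp. Qed.

Section Parse.
Variables (w b : seq bool) (p : nat) (ds rest : seq bool).
Hypothesis pw : drop p w = digits ds ++ rest.
Hypothesis pw0 : p <= size w.

Let k := size ds.

Let size_le : p + k.*2.+1 <= size w.
Proof.
have := congr1 size pw; rewrite size_drop size_cat size_digits -/k; lia.
Qed.

Let bitE i : nth false w (p + i) = nth false (digits ds ++ rest) i.
Proof. by rewrite -pw nth_drop. Qed.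

Lemma eval_Stop env : eval EStop w b (p :: env) = p + k.*2.
Proof.
suff h j : brec j (size w + size w) p (fun i acc => eval (EIf (EBit (EVar 0)) (EAdd (EVar 0) (ELit 2)) (EVar 0)) w b [:: acc, i, p & env])
    = p + (minn j k).*2.
  by rewrite [LHS]h; congr (_ + _); lia.
elim: j => [|j IH]; first by rewrite /brec /= min0n; lia.
rewrite brecS IH eval_If eval_Bit eval_Add !eval_Var eval_Lit [nth 0 _ 0]/= bitE.
case: (nth_digits ds rest (minn j k)) => [->|]; last by rewrite -/k; lia.
by rewrite -/k; case: ltnP => h /=; lia.
Qed.

Lemma eval_Next env : eval ENext w b (p :: env) = p + size (digits ds).
Proof. by rewrite /ENext eval_Add eval_Stop eval_Lit size_digits -/k; lia. Qed.

Lemma drop_next env : drop (eval ENext w b (p :: env)) w = rest.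
Proof. by rewrite eval_Next addnC -drop_drop pw drop_size_cat. Qed.

Lemma next_le env : eval ENext w b (p :: env) <= size w.
Proof. by rewrite eval_Next size_digits -/k. Qed.

(** Digits are read backwards from the end mark, most significant first, so the accumulator runs
    through the quotients of [n] by powers of 2. These are at most [size w], hence never
    truncated. *)
Lemma eval_Val n env : ds = binary n -> n <= size w -> eval EVal w b (p :: env) = n.
Proof.
move=> dE nw; rewrite /EVal eval_Let eval_Stop eval_Rec !eval_Len eval_Lit.
set f := fun i acc => _.
have kE : k = (trunc_log 2 n).+1 by rewrite /k dE size_map size_iota.
have n2 : n < 2 ^ k by rewrite kE trunc_log_ltn.
suff h j : brec j (size w) 0 f = n %/ 2 ^ (k - j).
  by rewrite [LHS]h (_ : k - size w = 0) ?divn1 //; lia.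
elim: j => [|j IH]; first by rewrite /brec /= subn0 divn_small // min0n.
rewrite brecS IH /f; case: (ltnP j k) => jk; last first.
  rewrite eval_If eval_Lt !(eval_Add, eval_Mul, eval_Var, eval_Lit) /=.
  have -> : (p + 2 * j < p + k.*2) = false by lia.
  rewrite /=.
  rewrite (_ : k - j = k - j.+1); last lia.
  by apply/minn_idPl; apply: leq_trans nw; exact: leq_div.
rewrite eval_If eval_Lt !(eval_Bit, eval_Add, eval_Sub, eval_Mul, eval_Var, eval_Lit) /=.
have -> : (p + 2 * j < p + k.*2) = true by lia.
rewrite /=.
rewrite (_ : p + k.*2 - (2 * j + 1) = p + (k - j.+1).*2.+1); last lia.
rewrite bitE nth_digits_odd -/k; last lia.
rewrite dE (nth_map 0) ?size_iota ?nth_iota; [|lia|lia].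
rewrite add0n (_ : k - j = (k - j.+1).+1); last lia.
rewrite expnSr divnMA; set q := n %/ 2 ^ _.
have qw : q <= size w by apply: leq_trans nw; exact: leq_div.
by have := divn_eq q 2; rewrite modn2; lia.
Qed.
End Parse.

(** * Constraint logic as a quantified formula *)

(* Reachability by at most [2 ^ k] moves, as in Savitch's theorem. *)
Section Savitch.
Variables (T : finType) (r : rel T).

Fixpoint savitch k x y : Prop :=
  if k is k'.+1 then exists z, savitch k' x z /\ savitch k' z y else r x y.

Lemma savitch_connect k x y : savitch k x y -> connect r x y.
Proof.
elim: k x y => [|k IH] x y /=; first exact: connect1.
by case=> z [/IH h1 /IH h2]; exact: connect_trans h1 h2.
Qed.

(** The path is split after [2 ^ k] steps. If it is shorter, the second half stands still, which is
    possible because [r] is reflexive at every point reached. *)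
Lemma savitch_path k x s : (forall y z, r y z -> r z z) -> r x x -> path r x s ->
  size s <= 2 ^ k -> savitch k x (last x s).
Proof.
move=> rr; elim: k x s => [|k IH] x s rx.
  by case: s => [|y [|z s]] //= /andP[].
move=> ps le; exists (last x (take (2 ^ k) s)).
move: ps; rewrite -{1}(cat_take_drop (2 ^ k) s) cat_path => /andP[p1 p2].
split; first by apply: IH => //; rewrite size_take; case: ltnP.
rewrite -{2}(cat_take_drop (2 ^ k) s) last_cat; apply: IH => //.
  case: (lastP (take (2 ^ k) s)) p1 => [|l y]; first by [].
  by rewrite rcons_path last_rcons => /andP[_]; exact: rr.
by rewrite size_drop; rewrite expnS in le; lia.
Qed.

Lemma savitchP k x y : (forall y z, r y z -> r z z) -> r x x -> #|T| <= 2 ^ k ->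
  savitch k x y <-> connect r x y.
Proof.
move=> rr rx le; split; first exact: savitch_connect.
case/connectP=> s ps ->; case/shortenP: ps => s' ps' us' _.
apply: savitch_path => //; apply: leq_trans le.
by have := max_card (mem (x :: s')); rewrite (card_uniqP us') /=; exact: ltnW.
Qed.
End Savitch.

Section QuantifiedAssignments.
Variables (ex : nat -> bool) (leaf : (nat -> bool) -> Prop).

Definition put (f : nat -> bool) k v : nat -> bool := fun i => if i == k then v else f i.

(** Bit [k'] is the one chosen when [k'] others remain: indices count down, and the bits from [k] on
    are already fixed. This matches a list of bits whose most recent one comes first. *)
Fixpoint qprop k (f : nat -> bool) : Prop :=
  if k is k'.+1 then
    if ex k' then exists v, qprop k' (put f k' v) else forall v, qprop k' (put f k' v)
  else leaf f.

Lemma qprop_ext k f g : (forall i, k <= i -> f i = g i) -> qprop k f <-> qprop k g.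
Proof.
elim: k f g => [|k IH] f g h /=; first by have -> : f = g by apply: boolp.funext => i; exact: h.
have e v : qprop k (put f k v) <-> qprop k (put g k v).
  by apply: IH => i hi; rewrite /put; case: eqP => // ne; apply: h; lia.
by case: ifP => _; split; [case=> v /e hv; exists v|case=> v /e hv; exists v|move=> hv v; apply/e|move=> hv v; apply/e].
Qed.

Lemma qprop_block k n f : (forall i, k <= i < k + n -> ex i) ->
  qprop (k + n) f <-> exists2 g, (forall i, k + n <= i -> g i = f i) & qprop k g.
Proof.
elim: n f => [|n IH] f hex.
  rewrite addn0; split=> [h|[g /(qprop_ext (k := k)) e /e//]]; by exists f.
rewrite addnS /= hex; last lia.
have hex' i : k <= i < k + n -> ex i by move=> hi; apply: hex; lia.
split=> [[v /(IH _ hex')[g hg qg]]|[g hg qg]].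
- exists g => // i hi; rewrite hg; last lia.
  by rewrite /put; case: eqP => // e; lia.
- exists (g (k + n)); apply/(IH _ hex').
  exists g => // i hi; rewrite /put; case: eqP => [->//|ne]; apply: hg; lia.
Qed.
End QuantifiedAssignments.

Lemma qval_qprop Q Phi w ex leaf N :
  (forall k, k < N -> (eval Q w [::] [:: k] == 0) = ex k) ->
  (forall b, size b = N -> eval Phi w b [::] != 0 <-> leaf (nth false b)) ->
  qval Q Phi w N [::] <-> qprop ex leaf N (fun=> false).
Proof.
move=> hQ hP.
suff h k b : size b + k = N -> qval Q Phi w k b <-> qprop ex leaf k (fun i => nth false b (i - k)).
  have := h N [::] erefl; rewrite (_ : (fun i => nth false [::] (i - N)) = (fun=> false)) //.
  by apply: boolp.funext => i; rewrite nth_nil.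
elim: k b => [|k IH] b hb.
  rewrite addn0 in hb; rewrite [qval _ _ _ _ _]/= [qprop _ _ _ _]/= hP //.
  by rewrite (_ : (fun i => nth false b (i - 0)) = nth false b) //; apply: boolp.funext => i; rewrite subn0.
have e v : qval Q Phi w k (v :: b) <-> qprop ex leaf k (put (fun i => nth false b (i - k.+1)) k v).
  rewrite IH; last by rewrite /=; lia.
  apply: qprop_ext => i hi; rewrite /put; case: eqP => [->|ne]; first by rewrite subnn.
  by have -> : i - k = (i - k.+1).+1 by lia.
rewrite /= hQ; last lia.
case: ifP => _; split.
- by case/orP => /e h; [exists false|exists true].
- by case=> -[] /e ->; rewrite ?orbT.
- by case/andP => /e h1 /e h2 [].
- by move=> h; apply/andP; split; apply/e.
Qed.

(** * Reading an instance *)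

Arguments c2e_encode : simpl never.

(** The code of numbers is locked so that simplification does not unfold it inside the words to be
    parsed. *)
Fact enc_key : unit. Proof. exact: tt. Qed.
Definition enc := locked_with enc_key encode_nat.
Lemma encE : encode_nat = enc. Proof. by rewrite /enc unlock. Qed.

Definition ECall1 f e := ELet e f.
Definition ENext1 e := ECall1 ENext e.
Definition EVal1 e := ECall1 EVal e.

Definition ENv := EVal1 (ELit 0).
Definition ENe := EVal1 (ENext1 (ELit 0)).
Definition EPosV e := ERec (EAdd e (ELit 2)) ELen (ELit 0) (ENext1 (EVar 0)).
Definition EInflow e := EVal1 (EPosV e).
Definition EPosE e := ERec e ELen (EPosV ENv)
  (EAdd (ENext1 (ENext1 (ENext1 (EVar 0)))) (ELit 1)).
Definition ESrc e := EVal1 (EPosE e).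
Definition EDst e := EVal1 (ENext1 (EPosE e)).
Definition EWeight e := EVal1 (ENext1 (ENext1 (EPosE e))).
Definition EStart e := EBit (ENext1 (ENext1 (ENext1 (EPosE e)))).
Definition ETarget := EVal1 (EPosE ENe).

Section Instance.
Variables (x : c2e_instance) (b : seq bool).
Notation w := (c2e_encode x).
Notation ev e env := (eval e w b env).
Hypothesis inflow2 : forall v : 'I_(nv x), inflow v = 2.
Hypothesis weight2 : forall e : 'I_(ne x), weight e <= 2.

Let infl : seq (seq bool) := [seq enc (inflow v) | v <- enum 'I_(nv x)].
Let edge (e : 'I_(ne x)) : seq bool := enc (src e) ++ enc (dst e)
                  ++ enc (weight e) ++ [:: c2e_start x e].
Let edges : seq (seq bool) := [seq edge e | e <- enum 'I_(ne x)].
Let tail : seq bool := enc (c2e_target x).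

Lemma wE : w = enc (nv x) ++ enc (ne x) ++ flatten infl ++ flatten edges ++ tail.
Proof. by rewrite /infl /edges /edge /tail -encE. Qed.

Lemma size_infl : size infl = nv x. Proof. by rewrite size_map size_enum_ord. Qed.
Lemma size_edges : size edges = ne x. Proof. by rewrite size_map size_enum_ord. Qed.

Lemma size_encode_nat n : 2 < size (enc n).
Proof. by rewrite -encE encode_nat_digits size_digits size_map size_iota; lia. Qed.

Lemma size_flatten_ge (ss : seq (seq bool)) : all (fun s => 0 < size s) ss -> size ss <= size (flatten ss).
Proof. by elim: ss => //= s ss IH /andP[s0 /IH]; rewrite size_cat; lia. Qed.

(** Every vertex and every edge contributes symbols to the word. Together with the bound 2 on
    inflows and weights, this keeps all numbers of the instance within the range that [EVal] reads
    without truncation. *)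
Lemma w_bounds : [/\ 2 < size w, nv x <= size w & ne x <= size w].
Proof.
have h1 : size infl <= size (flatten infl).
  by apply: size_flatten_ge; apply/allP => s /mapP[v _ ->]; have := size_encode_nat (inflow v); lia.
have h2 : size edges <= size (flatten edges).
  apply: size_flatten_ge; apply/allP => s /mapP[e _ ->].
  by have := size_encode_nat (src e); rewrite /edge !size_cat; lia.
have := size_encode_nat (nv x); rewrite wE !size_cat.
by move: h1 h2; rewrite size_infl size_edges; split; lia.
Qed.

Lemma next_encode p n rest env : drop p w = enc n ++ rest -> p <= size w ->
  [/\ drop (ev ENext (p :: env)) w = rest, ev ENext (p :: env) <= size w
    & n <= size w -> ev EVal (p :: env) = n].
Proof.
rewrite -encE encode_nat_digits => h hp; split.
- exact: drop_next h hp env.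
- exact: next_le h hp env.
- by move=> hn; exact: (@eval_Val w b p _ rest h hp n env).
Qed.

Lemma eval_Val1 e env : ev (EVal1 e) env = ev EVal (ev e env :: env). Proof. by []. Qed.
Lemma eval_Next1 e env : ev (ENext1 e) env = ev ENext (ev e env :: env). Proof. by []. Qed.

(* [at_pos p s]: the word [s] remains to be read from position [p]. *)
Definition at_pos p s := drop p w = s /\ p <= size w.

Lemma at_next p n rest env : at_pos p (enc n ++ rest) -> at_pos (ev ENext (p :: env)) rest.
Proof. by move=> [h1 h2]; have [? ? _] := next_encode env h1 h2. Qed.

Lemma at_val p n rest env : at_pos p (enc n ++ rest) -> n <= size w -> ev EVal (p :: env) = n.
Proof. by move=> [h1 h2]; have [_ _] := next_encode env h1 h2. Qed.

Lemma at_bit p c rest : at_pos p (c :: rest) -> nth false w p = c /\ at_pos p.+1 rest.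
Proof.
move=> [h1 h2]; have : size (drop p w) = (size rest).+1 by rewrite h1.
rewrite size_drop => sz; split; first by rewrite -[p]addn0 -nth_drop h1.
by split; [rewrite -addn1 addnC -drop_drop h1 /= drop0|lia].
Qed.

Definition header : seq nat := [:: nv x, ne x & [seq inflow v | v <- enum 'I_(nv x)]].

Lemma at0 : at_pos 0 (flatten [seq enc n | n <- header] ++ flatten edges ++ tail).
Proof. by split=> //; rewrite drop0 wE /= -!catA -map_comp. Qed.

Lemma size_header : size header = (nv x).+2.
Proof. by rewrite /= size_map size_enum_ord. Qed.

Lemma at_posV e env : ev e env <= nv x ->
  at_pos (ev (EPosV e) env) (flatten [seq enc n | n <- drop (ev e env + 2) header] ++ flatten edges ++ tail).
Proof.
rewrite /EPosV eval_Rec eval_Add !eval_Lit eval_Len => hj.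
have {hj}: ev e env + 2 <= size header by rewrite size_header; lia.
elim: (ev e env + 2) => [|j IH] hj; first by rewrite drop0 /brec /= min0n; exact: at0.
have := IH (ltnW hj); rewrite brecS eval_Next1 eval_Var [nth 0 _ 0]/=.
rewrite (drop_nth 0 hj) map_cons [flatten (_ :: _)]/= -catA; set p := brec _ _ _ _ => /at_next h.
have hp := h [:: p, j & env]; have [_ lp] := hp.
by rewrite (minn_idPl lp).
Qed.

Lemma eval_Nv env : ev ENv env = nv x.
Proof.
have [s3 hv he] := w_bounds; rewrite /ENv eval_Val1 eval_Lit.
by apply: at_val hv; have := at0; rewrite /= -!catA; exact.
Qed.

Lemma eval_Ne env : ev ENe env = ne x.
Proof.
have [s3 hv he] := w_bounds; rewrite /ENe eval_Val1 eval_Next1 eval_Lit.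
have := at0; rewrite /= -!catA => /at_next h; exact: at_val (h _) he.
Qed.

Lemma eval_Inflow e env : ev e env < nv x -> ev (EInflow e) env = 2.
Proof.
have [s3 hv he] := w_bounds => hj; rewrite /EInflow eval_Val1.
have := at_posV (ltnW hj); rewrite (drop_nth 0) ?size_header ?addn2 //=.
rewrite -catA (nth_map (Ordinal hj)) ?size_enum_ord //= inflow2 => /at_val; apply; lia.
Qed.

Lemma at_posE e env : ev e env <= ne x ->
  at_pos (ev (EPosE e) env) (flatten (drop (ev e env) edges) ++ tail).
Proof.
rewrite /EPosE eval_Rec eval_Len; move: (ev e env) => j.
have p0 : at_pos (ev (EPosV ENv) env) (flatten edges ++ tail).
  have := @at_posV ENv env; rewrite eval_Nv leqnn => /(_ isT).
  by rewrite drop_oversize // size_header addn2.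
elim: j => [|j IH] hj; first by rewrite /brec /= (minn_idPl p0.2) drop0.
have := IH (ltnW hj); rewrite (drop_nth [::]) ?size_edges // [flatten (_ :: _)]/=.
rewrite (nth_map (Ordinal hj)) ?size_enum_ord // /edge -!catA brecS; move: (brec _ _ _ _) => p h.
have {}h : at_pos (ev (EAdd (ENext1 (ENext1 (ENext1 (EVar 0)))) (ELit 1)) [:: p, j & env])
    (flatten (drop j.+1 edges) ++ tail).
  rewrite eval_Add !eval_Next1 eval_Var eval_Lit addn1 [nth 0 _ 0]/=.
  have h3 := at_next [:: p, j & env] (at_next [:: p, j & env] (at_next [:: p, j & env] h)).
  by have [_] := @at_bit _ _ _ h3.
by rewrite (minn_idPl h.2).
Qed.

Lemma eval_edge e env (i : 'I_(ne x)) : ev e env = i ->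
  [/\ ev (ESrc e) env = src i, ev (EDst e) env = dst i, ev (EWeight e) env = weight i
    & ev (EStart e) env = c2e_start x i].
Proof.
have [s3 hv he] := w_bounds; move=> ei; have := @at_posE e env; rewrite ei => /(_ (ltnW (ltn_ord i))).
rewrite (drop_nth [::]) ?size_edges // [flatten (_ :: _)]/= (nth_map i) ?size_enum_ord // nth_ord_enum /edge -!catA.
set p := ev (EPosE e) env => h0; have h1 := at_next env h0; have h2 := at_next env h1.
have h3 := at_next env h2.
rewrite /ESrc /EDst /EWeight /EStart !eval_Val1 eval_Bit !eval_Next1 -/p; split.
- by apply: at_val h0 _; have := ltn_ord (src i); lia.
- by apply: at_val h1 _; have := ltn_ord (dst i); lia.
- by apply: at_val h2 _; have := weight2 i; lia.
- by have [-> _] := at_bit h3.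
Qed.

Lemma eval_Target env : ev ETarget env = c2e_target x.
Proof.
have [s3 hv he] := w_bounds; rewrite /ETarget eval_Val1.
have := @at_posE ENe env; rewrite eval_Ne leqnn => /(_ isT).
rewrite drop_oversize ?size_edges // [flatten _]/= => h.
apply: (@at_val _ _ [::]); first by rewrite cats0.
by have := ltn_ord (c2e_target x); lia.
Qed.
End Instance.

(** * The formula *)

(* Level [l] consists of the universal bit [(n + 1) l] and the [n] existential
   bits of the middle configuration; the final configuration comes last. *)
Definition EBitZ l := EOrb (EMul (EAdd ELen (ELit 1)) l).
Definition EBitM l e := EOrb (EAdd (EMul (EAdd ELen (ELit 1)) l) (EAdd (ELit 1) e)).
Definition EBitF e := EOrb (EAdd (EMul (EAdd ELen (ELit 1)) ELen) e).
Definition ELevel := ESub ELen (EAdd (EVar 1) (ELit 1)).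
(** A whole configuration is no polynomially bounded value, so it is recomputed edge by edge. The
    levels are descended from the outermost one, [size w - 1]; the universal bit selects a half, and
    the middle configuration becomes its start or its end. *)
Definition ECfgA e := ERec ELen (ELit 1) (EStart e)
  (EIf (EBitZ ELevel) (EBitM ELevel (EWk (EWk e))) (EVar 0)).
Definition ECfgB e := ERec ELen (ELit 1) (EBitF e)
  (EIf (EBitZ ELevel) (EVar 0) (EBitM ELevel (EWk (EWk e)))).
Definition ELegal (cfg : expr -> expr) := EAll ENv
  (ELeq (EInflow (EVar 0)) (ESum ENe (ELit 2)
    (EIf (EEq (EIf (cfg (EVar 0)) (EDst (EVar 0)) (ESrc (EVar 0))) (EVar 1)) (EWeight (EVar 0)) (ELit 0)))).
Definition EDiff := ELeq (ESum ENe (ELit 2) (ENot (EEq (ECfgA (EVar 0)) (ECfgB (EVar 0))))) (ELit 1).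
Definition EFlip := ENot (EEq (EBitF ETarget) (EStart ETarget)).
Definition EPhi := EMul (EMul EFlip EDiff) (EMul (ELegal ECfgA) (ELegal ECfgB)).
Definition ENbits := EAdd (EMul (EAdd ELen (ELit 1)) ELen) ELen.
Definition EQ := ESum ELen (ELit 1) (EEq (EVar 1) (EMul (EAdd ELen (ELit 1)) (EVar 0))).

Lemma eval_EQ w b k : eval EQ w b [:: k] = [exists l : 'I_(size w), k == l * (size w).+1].
Proof.
rewrite /EQ eval_Sum eval_Len eval_Lit.
under eq_bigr => i _ do rewrite eval_Eq eval_Mul eval_Add !eval_Var eval_Len eval_Lit addn1 /= mulnC.
case: existsP => [[l /eqP hl]|hn].
  by rewrite big_mkord (bigD1 l) //= -hl eqxx; lia.
rewrite big_mkord big1 ?min0n // => l _; case: eqP => // e.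
by case: hn; exists l; rewrite e.
Qed.

Section Formula.
Variable x : c2e_instance.
Notation w := (c2e_encode x).
Hypothesis inflow2 : forall v : 'I_(nv x), inflow v = 2.
Hypothesis weight2 : forall e : 'I_(ne x), weight e <= 2.
Variable n : nat.
Hypothesis wn : size w = n.
Notation conf := (config x).

Definition moveb : rel conf := fun C C' => [&& legal C, legal C' & #|[set e | C e != C' e]| <= 1].

Definition confM (f : nat -> bool) l : conf := [ffun e : 'I_(ne x) => f (n.+1 * l + (1 + e))].
Definition confF (f : nat -> bool) : conf := [ffun e : 'I_(ne x) => f (n.+1 * n + e)].

Fixpoint confA (f : nat -> bool) d : conf :=
  if d is d'.+1 then if f (n.+1 * (n - d)) then confM f (n - d) else confA f d' else c2e_start x.
Fixpoint confB (f : nat -> bool) d : conf :=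
  if d is d'.+1 then if f (n.+1 * (n - d)) then confB f d' else confM f (n - d) else confF f.

Definition leaf (f : nat -> bool) : Prop :=
  (confF f (c2e_target x) != c2e_start x (c2e_target x)) /\ moveb (confA f n) (confB f n).

Lemma eval_CfgA b e env (i : 'I_(ne x)) : eval e w b env = i ->
  eval (ECfgA e) w b env = confA (nth false b) n i.
Proof.
move=> ei; rewrite /ECfgA eval_Rec eval_Len wn eval_Lit; have [_ _ _ ->] := eval_edge weight2 ei.
suff h d : d <= n -> brec d 1 (c2e_start x i) (fun k acc => eval (EIf (EBitZ ELevel) (EBitM ELevel (EWk (EWk e))) (EVar 0)) w b [:: acc, k & env])
  = confA (nth false b) d i by exact: h.
elim: d => [|d IH] hd; first by rewrite /brec /=; case: (c2e_start x i).
rewrite brecS IH ?(ltnW hd) // eval_If /EBitZ /EBitM !eval_Orb /ELevel.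
rewrite !(eval_Mul, eval_Sub, eval_Add, eval_Wk, eval_Len, eval_Lit, eval_Var) !addn1 wn /= ei.
case: (nth false b (n.+1 * (n - d.+1))) => /=; last by case: (confA _ d i).
by rewrite /confM ffunE; case: (nth false b _).
Qed.

Lemma eval_CfgB b e env (i : 'I_(ne x)) : eval e w b env = i ->
  eval (ECfgB e) w b env = confB (nth false b) n i.
Proof.
move=> ei; rewrite /ECfgB eval_Rec eval_Len wn eval_Lit /EBitF eval_Orb.
rewrite !(eval_Mul, eval_Sub, eval_Add, eval_Wk, eval_Len, eval_Lit, eval_Var) addn1 ei wn.
set a := nth _ _ _; have aE : a = confF (nth false b) i :> nat by rewrite ffunE.
suff h d : d <= n -> brec d 1 a (fun k acc => eval (EIf (EBitZ ELevel) (EVar 0) (EBitM ELevel (EWk (EWk e)))) w b [:: acc, k & env])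
  = confB (nth false b) d i by exact: h.
elim: d => [|d IH] hd; first by rewrite /brec /= aE; case: (confF _ _).
rewrite brecS IH ?(ltnW hd) // eval_If /EBitZ /EBitM !eval_Orb /ELevel.
rewrite !(eval_Mul, eval_Sub, eval_Add, eval_Wk, eval_Len, eval_Lit, eval_Var) !addn1 wn /= ei.
case: (nth false b (n.+1 * (n - d.+1))) => /=; first by case: (confB _ d i).
by rewrite /confM ffunE; case: (nth false b _).
Qed.

Lemma eval_Legal b cfg (C : conf) :
  (forall e env (i : 'I_(ne x)), eval e w b env = i -> eval (cfg e) w b env = C i) ->
  eval (ELegal cfg) w b [::] = legal C.
Proof.
move=> hC; rewrite /ELegal eval_All eval_Nv //.
have body (v : 'I_(nv x)) : eval (ELeq (EInflow (EVar 0)) (ESum ENe (ELit 2)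
    (EIf (EEq (EIf (cfg (EVar 0)) (EDst (EVar 0)) (ESrc (EVar 0))) (EVar 1)) (EWeight (EVar 0)) (ELit 0))))
    w b [:: nat_of_ord v] = (inflow v <= \sum_(e | edge_head C e == v) weight e).
  have vE : eval (EInflow (EVar 0)) w b [:: nat_of_ord v] = 2.
    by apply: eval_Inflow => //; rewrite eval_Var /=.
  (* The sum is cut off at 2, which leaves the comparison intact because every inflow is 2. *)
  rewrite eval_Leq vE inflow2 eval_Sum eval_Ne // eval_Lit big_mkord.
  rewrite (eq_bigr (fun e => if edge_head C e == v then weight e else 0)).
    by rewrite -big_mkcond /= leq_min leqnn andbT.
  move=> e _; rewrite eval_If eval_Eq eval_If eval_Lit eval_Var [nth 0 _ 1]/=.
  rewrite (hC (EVar 0) [:: nat_of_ord e; nat_of_ord v] e erefl).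
  have [-> -> -> _] := @eval_edge x b weight2 (EVar 0) [:: nat_of_ord e; nat_of_ord v] e erefl.
  by rewrite /edge_head; case: (C e) => /=; rewrite val_eqE; case: (_ == v).
congr nat_of_bool; apply/allP/forallP => [h v|h i].
  by have := h v; rewrite mem_iota ltn_ord => /(_ isT); rewrite body; case: (_ <= _).
by rewrite mem_iota => hi; rewrite (body (Ordinal hi)) h.
Qed.

Lemma eval_Diff b : eval EDiff w b [::] =
  (#|[set e | confA (nth false b) n e != confB (nth false b) n e]| <= 1).
Proof.
rewrite /EDiff eval_Leq eval_Sum eval_Ne // !eval_Lit big_mkord.
rewrite (eq_bigr (fun e => (confA (nth false b) n e != confB (nth false b) n e) : nat)).
  rewrite -sum1_card [in RHS]big_mkcond /=.
  rewrite (eq_bigr (fun e => if e \in [set e | confA (nth false b) n e != confB (nth false b) n e] then 1 else 0)).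
    have h (S : nat) : (minn S 2 <= 1) = (S <= 1) by lia.
    by rewrite h.
  by move=> e _; rewrite inE; case: (_ == _).
move=> e _; rewrite eval_Not eval_Eq.
rewrite (@eval_CfgA b (EVar 0) [:: nat_of_ord e] e erefl) (@eval_CfgB b (EVar 0) [:: nat_of_ord e] e erefl).
by case: (confA (nth false b) n e); case: (confB (nth false b) n e).
Qed.

Lemma eval_Phi b : eval EPhi w b [::] != 0 <-> leaf (nth false b).
Proof.
rewrite /EPhi !eval_Mul (eval_Legal (@eval_CfgA b)) (eval_Legal (@eval_CfgB b)) eval_Diff.
have tE : eval ETarget w b [::] = c2e_target x by apply: eval_Target.
rewrite /EFlip eval_Not eval_Eq; have [_ _ _ ->] := eval_edge weight2 tE.
rewrite /EBitF eval_Orb !(eval_Mul, eval_Sub, eval_Add, eval_Wk, eval_Len, eval_Lit, eval_Var) addn1 wn.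
rewrite tE /leaf /moveb /confF ffunE.
case: (nth _ _ _); case: (c2e_start _ _); case: (legal (confA _ _)); case: (legal (confB _ _)); case: (_ <= 1);
  by split=> // -[].
Qed.

Lemma moveb_right C C' : moveb C C' -> moveb C' C'.
Proof.
case/and3P=> _ l _; apply/and3P; split=> //.
by rewrite (_ : [set _ | _] = set0) ?cards0 //; apply/setP => e; rewrite !inE eqxx.
Qed.

Lemma move_start : moveb (c2e_start x) (c2e_start x).
Proof.
apply/and3P; split; rewrite ?(c2e_start_legal x) //.
by rewrite (_ : [set _ | _] = set0) ?cards0 //; apply/setP => e; rewrite !inE eqxx.
Qed.

(** [moveb] also permits standing still, as the halving argument requires; such steps are dropped to
    obtain single reversals. *)
Lemma c2e_yes_connect : c2e_yes x <->
  exists2 C, connect moveb (c2e_start x) C & C (c2e_target x) != c2e_start x (c2e_target x).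
Proof.
split=> [[s [ps ls ne]]|[C + ne]].
  exists (last (c2e_start x) s) => //.
  have := c2e_start_legal x; move: (c2e_start x) ps ls {ne} => C0.
  elim: s C0 => [|C s IH] C0 //= /andP[h /IH {}IH] /andP[l /IH {}IH] l0.
  apply: connect_trans (IH l); apply: connect1; apply/and3P; split=> //.
  by rewrite (eqP h).
case/connectP=> s + CE; rewrite CE in ne * => {CE C}.
move=> ps.
suff [s' [p' l' e']] : exists s', [/\ path (@one_reversal x) (c2e_start x) s', all (@legal x) s'
    & last (c2e_start x) s' = last (c2e_start x) s].
  by exists s'; split=> //; rewrite e'.
move: (c2e_start x) ps {ne} => C0; elim: s C0 => [|C s IH] C0 /=; first by exists [::].
case/andP=> /and3P[l0 l d] /IH[s' [p' l' e']].
case: (leqP #|[set e | C0 e != C e]| 0) => d0; last first.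
  by exists (C :: s'); rewrite /= e' l l'; split=> //; rewrite p' andbT /one_reversal eqn_leq d.
have CE : C0 = C.
  apply/ffunP => e; move: d0; rewrite leqn0 cards_eq0 => /eqP/setP/(_ e).
  by rewrite !inE => /negbFE/eqP.
by exists s'; rewrite CE.
Qed.

Definition qex k := ~~ [exists l : 'I_n, k == l * n.+1].

Lemma qexM l i : i < n -> qex (n.+1 * l + (1 + i)).
Proof.
move=> hi; apply/existsP => -[l' /eqP h].
have := congr1 (modn^~ n.+1) h; rewrite modnMl mulnC modnMDl modn_small; lia.
Qed.

Lemma qexF i : qex (n.+1 * n + i).
Proof. by apply/existsP => -[l' /eqP h]; have := ltn_ord l'; nia. Qed.

Lemma qexZ l : l < n -> qex (n.+1 * l) = false.
Proof. by move=> hl; apply/negbF/existsP; exists (Ordinal hl); rewrite /= mulnC. Qed.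

Hypothesis ne_le : ne x <= n.

Lemma conf_ext f g d l : l + d = n -> (forall i, n.+1 * l <= i -> f i = g i) ->
  confA f d = confA g d /\ confB f d = confB g d.
Proof.
elim: d l => [|d IH] l hl h /=.
  split=> //; apply/ffunP => e; rewrite !ffunE; apply: h; nia.
have [-> ->] : confA f d = confA g d /\ confB f d = confB g d.
  by apply: (IH l.+1); [lia|move=> i hi; apply: h; nia].
rewrite (_ : n - d.+1 = l); last lia.
rewrite h //; have -> // : confM f l = confM g l.
by apply/ffunP => e; rewrite !ffunE; apply: h; lia.
Qed.

(** With [l] levels left, the bits from [n.+1 * l] on determine the two end configurations. Within a
    level the middle configuration has the larger indices and is chosen first; the universal bit
    then demands both halves. *)
Lemma qprop_savitch l f : l <= n ->
  qprop qex leaf (n.+1 * l) f <->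
  confF f (c2e_target x) != c2e_start x (c2e_target x) /\
  savitch moveb l (confA f (n - l)) (confB f (n - l)).
Proof.
elim: l f => [|l IH] f hl; first by rewrite muln0 subn0.
have e1 : n.+1 * l.+1 = (n.+1 * l).+1 + n by nia.
rewrite e1 qprop_block; last first.
  by move=> i hi; rewrite (_ : i = n.+1 * l + (1 + (i - (n.+1 * l).+1))); [apply: qexM; lia|lia].
have sub1 : n - l = (n - l.+1).+1 by lia.
have sub2 : n - (n - l.+1).+1 = l by lia.
have key g v : (forall i, (n.+1 * l).+1 + n <= i -> g i = f i) ->
    [/\ confF (put g (n.+1 * l) v) = confF f,
        confA (put g (n.+1 * l) v) (n - l) = (if v then confM g l else confA f (n - l.+1)) &
        confB (put g (n.+1 * l) v) (n - l) = (if v then confB f (n - l.+1) else confM g l)].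
  move=> hg; have pe i : (n.+1 * l).+1 + n <= i -> put g (n.+1 * l) v i = f i.
    by move=> hi; rewrite /put hg //; case: eqP => // e; lia.
  have [a1 a2] : confA (put g (n.+1 * l) v) (n - l.+1) = confA f (n - l.+1) /\
      confB (put g (n.+1 * l) v) (n - l.+1) = confB f (n - l.+1).
    by apply: (@conf_ext _ _ _ l.+1); [lia|move=> i hi; apply: pe; nia].
  have mE : confM (put g (n.+1 * l) v) l = confM g l.
    by apply/ffunP => e; rewrite !ffunE /put; case: eqP => //; lia.
  split; first by apply/ffunP => e; rewrite !ffunE; apply: pe; nia.
    by rewrite sub1 /= sub2 a1 mE /put eqxx.
  by rewrite sub1 /= sub2 a2 mE /put eqxx.
split=> [[g hg]|[ht [C [h1 h2]]]].
  rewrite /= qexZ // => hv.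
  have /IH[|t1 s1] := hv true; first lia.
  have /IH[|t0 s0] := hv false; first lia.
  have [k1 k2 k3] := key g true hg; have [k4 k5 k6] := key g false hg.
  rewrite k1 in t1; rewrite k2 k3 in s1; rewrite k5 k6 in s0.
  by split=> //; exists (confM g l).
pose g i := if (n.+1 * l < i) && (i < (n.+1 * l).+1 + n) then
  odflt false (omap (fun e : 'I_(ne x) => C e) (insub (i - (n.+1 * l).+1))) else f i.
have hg i : (n.+1 * l).+1 + n <= i -> g i = f i by rewrite /g => hi; case: ifP => //; lia.
have gC : confM g l = C.
  apply/ffunP => e; rewrite ffunE /g; have := ltn_ord e; case: ifP => [_ he|]; last by lia.
  have -> : n.+1 * l + (1 + e) - (n.+1 * l).+1 = e by lia.
  by rewrite valK.
exists g => //=; rewrite qexZ // => v; apply/IH; first lia.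
have [-> -> ->] := key g v hg; rewrite gC; split=> //.
by case: v.
Qed.

Theorem qval_c2e : qval EQ EPhi w (n.+1 * n + n) [::] <-> c2e_yes x.
Proof.
rewrite (@qval_qprop _ _ _ qex leaf); last first.
- by move=> b _; exact: eval_Phi.
- by move=> k _; rewrite eval_EQ wn /qex; case: [exists _, _].
rewrite qprop_block; last by move=> i hi; rewrite (_ : i = n.+1 * n + (i - n.+1 * n)); [exact: qexF|lia].
have sv C : savitch moveb n (c2e_start x) C <-> connect moveb (c2e_start x) C.
  apply: savitchP; [by move=> y z /moveb_right|exact: move_start|].
  by rewrite card_ffun card_bool card_ord leq_exp2l.
rewrite c2e_yes_connect; split=> [[g _ /qprop_savitch[]//]|[C hC ht]].
  by rewrite subnn /= => t /sv h; exists (confF g).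
pose g i := odflt false (omap (fun e : 'I_(ne x) => C e) (insub (i - n.+1 * n))).
have gC : confF g = C.
  by apply/ffunP => e; rewrite ffunE /g addKn valK.
exists (fun i => if i < n.+1 * n + n then g i else false).
  by move=> i hi; case: ifP => //; lia.
apply/qprop_savitch => //; rewrite subnn /=.
have -> : confF (fun i => if i < n.+1 * n + n then g i else false) = C.
  rewrite -gC; apply/ffunP => e; rewrite !ffunE; case: ifP => //; have := ltn_ord e; lia.
by split=> //; apply/sv.
Qed.
End Formula.

(** The language is the same for every [K]: the formula relies only on inflows 2 and weights at most
    2. It thus serves the class of bounded bandwidth as well as all AND/OR graphs. *)
Theorem c2e_in_PSPACE (K : c2e_instance -> Prop) :
  (forall x, K x -> (forall v : 'I_(nv x), inflow v = 2) /\ (forall e : 'I_(ne x), weight e <= 2)) ->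
  in_PSPACE (@restrict C2E_NCL K).
Proof.
move=> hK; exists (fun w => qval EQ EPhi w (eval ENbits w [::] [::]) [::]).
  apply: (@qval_PSPACE _ _ _ _ void) => w b k; by rewrite !eval_EQ.
move=> [x kx]; have [i2 w2] := hK x kx.
have NE : eval ENbits (c2e_encode x) [::] [::] =
    (size (c2e_encode x)).+1 * size (c2e_encode x) + size (c2e_encode x).
  by rewrite /ENbits !(eval_Add, eval_Mul, eval_Len, eval_Lit) addn1.
change (qval EQ EPhi (c2e_encode x) (eval ENbits (c2e_encode x) [::] [::]) [::] <-> c2e_yes x).
by rewrite NE; apply: qval_c2e => //; have [] := w_bounds x.
Qed.

(** * Tiles *)

(* A tile has four ports, 0 (left top), 1 (left bottom), 2 (right top) and 3
   (right bottom), each carrying one wire of weight 2. Read as a condition on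
   the wires that point into the tile, [TX] crosses two lines, [TXC] crosses
   two lines that may not both be advanced, [TOM] is a disjunction in a chain
   and [TOB] closes a chain and opens the next one; see [tile_ok]. *)
Inductive tile := TX | TXC | TOM | TOB.

Definition tile_ok (k : tile) (pt : nat -> bool) : bool :=
  match k with
  | TX => (pt 0 || pt 3) && (pt 1 || pt 2)
  | TXC => [&& pt 0 || pt 3, pt 1 || pt 2 & pt 2 || pt 3]
  | TOM => [|| pt 0, pt 1 | pt 3]
  | TOB => pt 1 && (pt 0 || pt 3)
  end.

(* The inner edges, as (source, target, weight); the vertices are numbered from
   0 to 19, and vertex [i < 4] is the end of port [i]. *)
Definition tile_edges (k : tile) : seq (nat * nat * nat) :=
  match k with
  | TX =>
    [:: (4, 5, 2); (6, 4, 2); (7, 4, 2); (8, 5, 2); (9, 5, 2); (0, 6, 1); (0,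
    8, 1); (3, 7, 1); (3, 9, 1); (1, 6, 1); (1, 7, 1); (2, 8, 1); (2, 9, 1);
    (10, 11, 2); (10, 12, 2); (10, 13, 2); (11, 12, 2); (11, 13, 2); (12, 13,
    2); (14, 15, 2); (15, 16, 2); (16, 14, 2); (17, 18, 2); (18, 19, 2); (19,
    17, 2); (14, 17, 2); (15, 18, 2); (16, 19, 2)]
  | TXC =>
    [:: (4, 5, 2); (6, 4, 2); (7, 4, 2); (8, 5, 2); (9, 5, 2); (0, 6, 1); (0,
    8, 1); (10, 7, 1); (10, 9, 1); (1, 6, 1); (1, 7, 1); (11, 8, 1); (11, 9,
    1); (11, 12, 2); (10, 13, 2); (12, 2, 1); (2, 3, 1); (3, 13, 1); (13, 14,
    1); (14, 12, 1); (14, 15, 2); (15, 16, 2); (15, 17, 2); (16, 18, 2); (16,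
    19, 2); (17, 18, 2); (17, 19, 2); (18, 19, 2)]
  | TOM =>
    [:: (0, 4, 1); (4, 5, 1); (5, 0, 1); (5, 6, 2); (6, 7, 2); (6, 8, 2); (2,
    7, 2); (2, 8, 2); (7, 8, 2); (4, 3, 2); (1, 3, 2); (1, 9, 2); (9, 10, 1);
    (10, 11, 1); (11, 12, 1); (12, 13, 1); (13, 9, 1); (10, 12, 2); (11, 13,
    2); (14, 15, 2); (15, 16, 2); (16, 14, 2); (17, 18, 2); (18, 19, 2); (19,
    17, 2); (14, 17, 2); (15, 18, 2); (16, 19, 2)]
  | TOB =>
    [:: (0, 3, 1); (3, 4, 1); (4, 0, 1); (4, 5, 2); (5, 6, 2); (5, 7, 2); (2,
    6, 2); (2, 7, 2); (6, 7, 2); (1, 8, 1); (8, 9, 1); (9, 10, 1); (10, 11,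
    1); (11, 1, 1); (8, 10, 2); (9, 11, 2); (12, 13, 2); (12, 14, 2); (12, 15,
    2); (13, 14, 2); (13, 15, 2); (14, 15, 2); (16, 17, 2); (16, 18, 2); (16,
    19, 2); (17, 18, 2); (17, 19, 2); (18, 19, 2)]
  end.

(* For each minimal set of incoming ports, the inner edges that are oriented
   from source to target in a legal state of the tile. *)
Definition tile_states (k : tile) : seq (seq nat * seq nat) :=
  match k with
  | TX =>
    [:: ([:: 2; 3], [:: 4; 7; 8; 11; 12; 13; 14; 16; 17; 18; 19; 20; 21; 22;
    23; 24; 25; 26; 27]); ([:: 1; 3], [:: 0; 2; 7; 8; 10; 13; 14; 16; 17; 18;
    19; 20; 21; 22; 23; 24; 25; 26; 27]); ([:: 0; 2], [:: 3; 6; 11; 12; 13;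
    14; 16; 17; 18; 19; 20; 21; 22; 23; 24; 25; 26; 27]); ([:: 0; 1], [:: 0;
    1; 5; 9; 13; 14; 16; 17; 18; 19; 20; 21; 22; 23; 24; 25; 26; 27])]
  | TXC =>
    [:: ([:: 2; 3], [:: 4; 7; 8; 11; 12; 16; 17; 19; 21; 23; 24; 25; 27]);
    ([:: 1; 3], [:: 0; 2; 7; 8; 10; 13; 15; 17; 19; 21; 23; 24; 25; 27]); ([::
    0; 2], [:: 3; 6; 11; 12; 14; 16; 19; 21; 23; 24; 25; 27])]
  | TOM =>
    [:: ([:: 3], [:: 1; 2; 4; 6; 8; 11; 12; 14; 15; 17; 19; 20; 21; 22; 23;
    24; 25; 26; 27]); ([:: 1], [:: 1; 2; 4; 6; 8; 10; 11; 12; 14; 15; 17; 19;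
    20; 21; 22; 23; 24; 25; 26; 27]); ([:: 0], [:: 0; 2; 4; 6; 8; 9; 11; 12;
    14; 15; 17; 19; 20; 21; 22; 23; 24; 25; 26; 27])]
  | TOB =>
    [:: ([:: 1; 3], [:: 1; 2; 4; 6; 8; 9; 11; 12; 14; 16; 17; 19; 20; 21; 22;
    23; 25; 26; 27]); ([:: 0; 1], [:: 0; 2; 4; 6; 8; 9; 11; 12; 14; 16; 17;
    19; 20; 21; 22; 23; 25; 26; 27])]
  end.

(* The inner edges to reverse, one after the other, to go from the [i]-th to
   the [j]-th of these states, for [i < j]. *)
Definition tpath (k : tile) (i j : nat) : seq nat :=
  match k, i, j with
  | TX, 0, 1 => [:: 10; 2; 0; 4; 11; 12]
  | TX, 0, 2 => [:: 6; 3; 4; 7; 8]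
  | TX, 0, 3 => [:: 5; 7; 9; 1; 0; 4; 8; 11; 12]
  | TX, 1, 2 => [:: 6; 8; 11; 3; 0; 2; 7; 10; 12]
  | TX, 1, 3 => [:: 5; 8; 9; 1; 2; 7; 10]
  | TX, 2, 3 => [:: 5; 9; 1; 0; 3; 6; 11; 12]
  | TXC, 0, 1 => [:: 10; 2; 0; 4; 11; 12; 13; 15; 16]
  | TXC, 0, 2 => [:: 6; 3; 4; 7; 8; 14; 17]
  | TXC, 1, 2 => [:: 6; 8; 15; 13; 11; 3; 0; 2; 7; 10; 12; 14; 16; 17]
  | TOM, 0, 1 => [:: 10]
  | TOM, 0, 2 => [:: 0; 1; 9]
  | TOM, 1, 2 => [:: 0; 1; 9; 10]
  | TOB, 0, 1 => [:: 0; 1]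
  | _, _, _ => [::]
  end.

Definition tsrc k a := (nth (0, 0, 0) (tile_edges k) a).1.1.
Definition tdst k a := (nth (0, 0, 0) (tile_edges k) a).1.2.
Definition twt k a := if a < 28 then (nth (0, 0, 0) (tile_edges k) a).2 else 2.

(* Locally, the wire of port [i] is edge [28 + i]. *)
Definition tinc (k : tile) (v : nat) : seq nat :=
  [seq a <- iota 0 28 | (tsrc k a == v) || (tdst k a == v)]
    ++ (if v < 4 then [:: 28 + v] else [::]).

Definition tinto k (st pt : nat -> bool) v a : bool :=
  if a < 28 then (if st a then tdst k a else tsrc k a) == v else pt (a - 28).

Definition tinflow k st pt v : nat :=
  sumn [seq if tinto k st pt v a then twt k a else 0 | a <- tinc k v].

Definition tlegal k st pt : bool := all (fun v => 2 <= tinflow k st pt v) (iota 0 20).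

Definition tminp k i : seq nat := (nth ([::], [::]) (tile_states k) i).1.
Definition tcanon k i (a : nat) : bool := a \in (nth ([::], [::]) (tile_states k) i).2.
(** The canonical state of a tile for given ports; it is out of range exactly when the ports are
    forbidden. *)
Definition tidx k (pt : nat -> bool) : nat :=
  find (fun x => all pt x.1) (tile_states k).

Lemma tile_okE k pt : tile_ok k pt = (tidx k pt < size (tile_states k)).
Proof.
rewrite /tidx -has_find; case: k => /=;
  by case: (pt 0) (pt 1) (pt 2) (pt 3) => [] [] [] [].
Qed.

Lemma tinflow_mono k st (pt pt' : nat -> bool) v : (forall i, pt i -> pt' i) ->
  tinflow k st pt v <= tinflow k st pt' v.
Proof.
move=> le; rewrite /tinflow; elim: (tinc k v) => //= a l IH.
apply: leq_add => //; rewrite /tinto; case: ltnP => // _.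
by case: (pt _) (le (a - 28)) => [->|_].
Qed.

Lemma tlegal_mono k st (pt pt' : nat -> bool) : (forall i, pt i -> pt' i) ->
  tlegal k st pt -> tlegal k st pt'.
Proof.
move=> le; apply: sub_all => v h; exact: leq_trans h (tinflow_mono _ _ _ le).
Qed.

Lemma tinflow_ext k (st st' pt pt' : nat -> bool) v :
  (forall a, a < 28 -> st a = st' a) -> (forall i, i < 4 -> pt i = pt' i) ->
  tinflow k st pt v = tinflow k st' pt' v.
Proof.
move=> es ep; rewrite /tinflow; congr sumn; apply/eq_in_map => a.
rewrite mem_cat => h; rewrite /tinto; case: ltnP => ha; first by rewrite es.
rewrite ep //; case/orP: h; first by rewrite mem_filter mem_iota; lia.
by case: ifP => //; rewrite inE => ? /eqP ->; lia.
Qed.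

Lemma tlegal_ext k (st st' pt pt' : nat -> bool) :
  (forall a, a < 28 -> st a = st' a) -> (forall i, i < 4 -> pt i = pt' i) ->
  tlegal k st pt = tlegal k st' pt'.
Proof. by move=> es ep; apply: eq_all => v; rewrite (tinflow_ext _ _ es ep). Qed.

(* Case analysis on the inner edges, with pruning as soon as some vertex cannot
   receive enough any more. *)
Definition tmaxin k (pa : seq (option bool)) (pt : seq bool) v : nat :=
  sumn [seq if a < 28 then
              if nth None pa a is Some b then
                if (if b then tdst k a else tsrc k a) == v then twt k a else 0
              else twt k a
            else if nth false pt (a - 28) then 2 else 0 | a <- tinc k v].

Fixpoint trefute k pt (pa : seq (option bool)) (todo : seq nat) : bool :=
  if has (fun v => tmaxin k pa pt v < 2) (iota 0 20) then true else
  if todo is a :: todo' then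
    trefute k pt (set_nth None pa a (Some true)) todo' &&
    trefute k pt (set_nth None pa a (Some false)) todo'
  else false.

Lemma trefuteP k pt pa todo st : trefute k pt pa todo ->
  (forall a b, nth None pa a = Some b -> st a = b) ->
  ~~ tlegal k st (nth false pt).
Proof.
have stuck q : has (fun v => tmaxin k q pt v < 2) (iota 0 20) ->
    (forall a b, nth None q a = Some b -> st a = b) -> ~~ tlegal k st (nth false pt).
  case/hasP=> v v20 mx cons; apply/allPn; exists v => //; rewrite -ltnNge.
  apply: leq_ltn_trans mx; rewrite /tinflow /tmaxin; elim: (tinc k v) => //= a l IHl.
  apply: leq_add => //; rewrite /tinto /twt; case: ltnP => // _.
  by case E: (nth None q a) => [b|]; [rewrite (cons _ _ E)|case: ifP].
elim: todo pa => [|a todo IH] pa /=; case: ifP => [/stuck//|_] //.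
case/andP=> r1 r2 cons; case E: (st a).
  by apply: IH r1 _ => a' b; rewrite nth_set_nth /=; case: eqP => [-> [<-]|_ /cons].
by apply: IH r2 _ => a' b; rewrite nth_set_nth /=; case: eqP => [-> [<-]|_ /cons].
Qed.

(* The maximal forbidden sets of incoming ports, each with an order of case
   analysis that refutes it quickly. *)
Definition tile_bad (k : tile) : seq (seq bool * seq nat) :=
  match k with
  | TX =>
    [:: ([:: false; true; true; false], [:: 7; 8; 6; 4; 2; 3; 5; 0; 1]);
        ([:: true; false; false; true], [:: 11; 12; 3; 10; 4; 9; 2; 0; 1])]
  | TXC =>
    [:: ([:: false; true; true; false], [:: 6; 17; 14; 5; 1; 3; 8; 4; 0; 2; 7]);
        ([:: true; false; false; true], [:: 9; 10; 2; 15; 1; 0; 13; 11; 3; 12; 4]);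
        ([:: true; true; false; false], [:: 16])]
  | TOM => [:: ([:: false; false; true; false], [:: 0; 9; 10; 11; 16; 18; 13; 17; 14])]
  | TOB =>
    [:: ([:: false; true; true; false], [:: 0]);
        ([:: true; false; true; true], [:: 9; 14; 11; 13; 15])]
  end.

(** For example, if ports 2 and 3 of [TXC] both point out, then vertices 2 and 3 each need both of
    their edges of weight 1, but they share edge 16. *)
Lemma trefute_check k :
  all (fun x => trefute k x.1 (nseq 28 None) x.2) (tile_bad k).
Proof. by case: k; vm_compute. Qed.

(** Further incoming wires never destroy legality, so it suffices to refute the maximal forbidden
    sets of ports. *)
Lemma tile_sound k st pt : tlegal k st pt -> tile_ok k pt.
Proof.
move=> lg; apply/negPn/negP=> nok.
have /hasP[x xb le] : has (fun x => all (fun i => pt i ==> nth false x.1 i) (iota 0 4))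
    (tile_bad k).
  by move: nok; case: (k) => /=; case: (pt 0) (pt 1) (pt 2) (pt 3) => [] [] [] [].
have /negP[] := trefuteP (allP (trefute_check k) x xb) (st := st)
  (fun a b => ltac:(by rewrite nth_nseq if_same)).
pose pt' i := (i < 4) && pt i.
apply: (tlegal_mono (pt := pt')) => [i /andP[i4 pi]|].
  by have := allP le i; rewrite mem_iota pi => /(_ i4).
by rewrite (tlegal_ext _ (st' := st) (pt' := pt)) // => i i4; rewrite /pt' i4.
Qed.

Fixpoint tpath_ok k pt (st : seq bool) (p : seq nat) (goal : seq bool) : bool :=
  if p is a :: p' then
    let st' := set_nth false st a (~~ nth false st a) in
    [&& a < 28, tlegal k (nth false st') (nth false pt) & tpath_ok k pt st' p' goal]
  else st == goal.

Definition tcanons k i := [seq tcanon k i a | a <- iota 0 28].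

(** Only the ports of the two minimal sets are assumed to point in; by monotonicity the same
    reversals are legal whenever both sets are available. *)
Lemma tpath_check k : all (fun i =>
  tlegal k (nth false (tcanons k i)) (mem (tminp k i)) &&
  all (fun j => (i < j) ==> tpath_ok k
      [seq (x \in tminp k i) || (x \in tminp k j) | x <- iota 0 4]
      (tcanons k i) (tpath k i j) (tcanons k j)) (iota 0 (size (tile_states k))))
    (iota 0 (size (tile_states k))).
Proof. by case: k; vm_compute. Qed.

(** Twenty vertices of degree three have 60 edge ends: 56 from the inner edges and 4 from the ports.
    Closed components of OR vertices, such as the complete graph on 10 to 13 and the prism on 14 to
    19 in [TX], pad the smaller gadgets to this common size. *)
Lemma tinc_check k : all (fun v => uniq (tinc k v) && (
    perm_eq [seq twt k a | a <- tinc k v] [:: 2; 2; 2] ||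
    perm_eq [seq twt k a | a <- tinc k v] [:: 1; 1; 2])) (iota 0 20)
  && all (fun a => [&& tsrc k a < 20, tdst k a < 20, tsrc k a != tdst k a, 0 < twt k a &
     all (fun b => (a == b) || ~~ (((tsrc k a == tsrc k b) && (tdst k a == tdst k b))
         || ((tsrc k a == tdst k b) && (tdst k a == tsrc k b)))) (iota 0 28)]) (iota 0 28).
Proof. by case: k; vm_compute. Qed.

Lemma tcanonsE k i a : a < 28 -> nth false (tcanons k i) a = tcanon k i a.
Proof. by move=> h; rewrite (nth_map 0) ?size_iota // nth_iota. Qed.

Lemma tcanon_legal k i pt : i < size (tile_states k) -> all pt (tminp k i) ->
  tlegal k (tcanon k i) pt.
Proof.
move=> lt al; have /allP/(_ i) := tpath_check k; rewrite mem_iota lt => /(_ isT)/andP[lg _].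
rewrite (tlegal_ext _ (st' := nth false (tcanons k i)) (pt' := pt)) //.
  by apply: tlegal_mono lg => x /(allP al).
by move=> a a28; rewrite tcanonsE.
Qed.

Lemma tminp_lt k i x : x \in tminp k i -> x < 4.
Proof.
have : all (fun y => y < 4) (tminp k i) by case: k; rewrite /tminp; move: i => [|[|[|[|[|i]]]]].
by move/allP; apply.
Qed.

Lemma tidx_ext k (pt pt' : nat -> bool) : (forall i, i < 4 -> pt i = pt' i) ->
  tidx k pt = tidx k pt'.
Proof. by move=> h; rewrite /tidx; case: k; rewrite /= !h. Qed.

(** * Constraint graphs made of tiles *)

Lemma sum_ord_seq N (l : seq nat) (F : nat -> nat) :
  uniq l -> all (fun x => x < N) l ->
  \sum_(e < N | (e : nat) \in l) F e = \sum_(x <- l) F x.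
Proof.
move=> ul lN; rewrite -(big_mkord (fun x => x \in l)) -big_filter /index_iota subn0.
apply: perm_big; apply: uniq_perm => //; first by rewrite filter_uniq ?iota_uniq.
move=> x; rewrite mem_filter mem_iota add0n /=; case: (boolP (x \in l)) => //= xl.
exact: (allP lN).
Qed.

Section TileGraph.
Variables (T : nat) (ty : nat -> tile).
(* [wend b t r] is the port, as (tile, number), at the source ([b = false]) or
   target ([b = true]) of the [r]-th wire of tile [t], and [pw] is its inverse. *)
Variables (wend : bool -> nat -> nat -> nat * nat) (pw : nat -> nat -> nat * nat * bool).
Hypothesis wendV : forall b t r, t < T -> r < 2 -> (wend b t r).1 < T /\ (wend b t r).2 < 4.
Hypothesis pwV : forall t i, t < T -> i < 4 -> (pw t i).1.1 < T /\ (pw t i).1.2 < 2.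
Hypothesis wendK : forall b t r, t < T -> r < 2 ->
  pw (wend b t r).1 (wend b t r).2 = (t, r, b).
Hypothesis pwK : forall t i, t < T -> i < 4 ->
  wend (pw t i).2 (pw t i).1.1 (pw t i).1.2 = (t, i).
Hypothesis wend_multi : forall t r a, t < T -> r < 2 -> a < 28 ->
  let p := wend false t r in let q := wend true t r in p.1 = q.1 ->
  ~~ [|| (tsrc (ty p.1) a == p.2) && (tdst (ty p.1) a == q.2)
       | (tsrc (ty p.1) a == q.2) && (tdst (ty p.1) a == p.2)].

(** A wire joins two of the four ports per tile, so there are two wires per tile and edges come in
    blocks of 28 + 2. That a wire belongs to a tile concerns its number only; its ends are given by
    [wend] and may lie elsewhere. *)
Definition vid (p : nat * nat) := p.1 * 20 + p.2.
Definition eend (b : bool) (e : nat) : nat * nat :=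
  if e %% 30 < 28 then
    (e %/ 30, (if b then tdst else tsrc) (ty (e %/ 30)) (e %% 30))
  else wend b (e %/ 30) (e %% 30 - 28).
Definition ewt (e : nat) := twt (ty (e %/ 30)) (e %% 30).

Lemma vid_inj p q : p.2 < 20 -> q.2 < 20 -> vid p = vid q -> p = q.
Proof. by case: p q => [a b] [c d]; rewrite /vid /= => *; congr (_, _); lia. Qed.

Lemma tend_lt k b a : a < 28 -> (if b then tdst else tsrc) k a < 20.
Proof.
move=> a28; have /andP[_ /allP/(_ a)] := tinc_check k.
by rewrite mem_iota a28 => /(_ isT)/and5P[? ? _ _ _]; case: b.
Qed.

Lemma eend_w b e : 28 <= e %% 30 -> eend b e = wend b (e %/ 30) (e %% 30 - 28).
Proof. by move=> h; rewrite /eend ltnNge h. Qed.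

Lemma eend_i b e : e %% 30 < 28 ->
  eend b e = (e %/ 30, (if b then tdst else tsrc) (ty (e %/ 30)) (e %% 30)).
Proof. by rewrite /eend => ->. Qed.

Lemma eendV b e : e < T * 30 -> (eend b e).1 < T /\ (eend b e).2 < 20.
Proof.
move=> eT; rewrite /eend; case: ifP => h /=; first by split; [lia|exact: tend_lt].
have [|//|? ?] := @wendV b (e %/ 30) (e %% 30 - 28); lia.
Qed.

Lemma eend_lt b (e : 'I_(T * 30)) : vid (eend b e) < T * 20.
Proof. have [] := eendV b (ltn_ord e); rewrite /vid; lia. Qed.

Definition tg_end b (e : 'I_(T * 30)) : 'I_(T * 20) := Ordinal (eend_lt b e).

Lemma eend_wire b b' e e' : e < T * 30 -> e' < T * 30 -> 28 <= e %% 30 -> 28 <= e' %% 30 ->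
  eend b e = eend b' e' -> e = e' /\ b = b'.
Proof.
move=> eT eT' he he'; rewrite !eend_w // => h.
have k1 := @wendK b (e %/ 30) (e %% 30 - 28); have k2 := @wendK b' (e' %/ 30) (e' %% 30 - 28).
rewrite -h in k2.
have : (e %/ 30, e %% 30 - 28, b) = (e' %/ 30, e' %% 30 - 28, b').
  by rewrite -k1 ?k2 //; lia.
by case=> ? ? ->; split=> //; lia.
Qed.

Lemma tg_end_eq b b' e e' : tg_end b e = tg_end b' e' -> eend b e = eend b' e'.
Proof.
move/(congr1 val); apply: vid_inj; [exact: (eendV _ (ltn_ord e)).2|].
exact: (eendV _ (ltn_ord e')).2.
Qed.

Lemma tg_no_loop e : tg_end false e != tg_end true e.
Proof.
apply/eqP=> /tg_end_eq; case: (ltnP (e %% 30) 28) => he.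
  rewrite !eend_i // => -[] /eqP; apply/negP.
  have /andP[_ /allP/(_ (e %% 30))] := tinc_check (ty (e %/ 30)).
  by rewrite mem_iota he => /(_ isT)/and5P[].
by move/(eend_wire (ltn_ord e) (ltn_ord e) he he) => [].
Qed.

Lemma set2_eq (A : finType) (a b c d : A) : [set a; b] = [set c; d] ->
  (a = c /\ b = d) \/ (a = d /\ b = c).
Proof.
move=> h; have := set21 c d; have := set22 c d; have := set21 a b; have := set22 a b.
rewrite h -{3 4}h !in_set2.
by do 4 case/orP=> /eqP ?; subst; auto.
Qed.

Lemma tg_no_multi : injective (fun e => [set tg_end false e; tg_end true e]).
Proof.
have mixed (e e' : 'I_(T * 30)) : 28 <= e %% 30 -> e' %% 30 < 28 ->
    (tg_end false e = tg_end false e' /\ tg_end true e = tg_end true e') \/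
    (tg_end false e = tg_end true e' /\ tg_end true e = tg_end false e') -> False.
  move=> he he' h; have hw := @wend_multi (e %/ 30) (e %% 30 - 28) (e' %% 30).
  have [q1 q2] : e %/ 30 < T /\ e %% 30 - 28 < 2 by have := ltn_ord e; lia.
  case: h => -[/tg_end_eq h1 /tg_end_eq h2]; move: hw h1 h2;
  by rewrite !(eend_w _ he) !(eend_i _ he') => hw h1 h2; have := hw q1 q2 he';
     rewrite h1 h2 /= !eqxx ?orbT => /(_ erefl).
move=> e e' /set2_eq h.
case: (ltnP (e %% 30) 28) => he; case: (ltnP (e' %% 30) 28) => he';
  [|by case: (mixed e' e) => //; case: h => -[-> ->]; [left|right]
  |by case: (mixed e e')
  |by case: h => -[/tg_end_eq/(eend_wire (ltn_ord e) (ltn_ord e') he he')[h1 h2] _] //;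
   exact: val_inj].
apply: val_inj => /=.
have h3 : e %/ 30 = e' %/ 30.
  by case: h => -[/tg_end_eq h1 _]; move: h1; rewrite !eend_i // => -[].
suff : e %% 30 = e' %% 30 by lia.
apply/eqP/negPn/negP=> ne.
have /andP[_ /allP/(_ (e %% 30))] := tinc_check (ty (e %/ 30)).
rewrite mem_iota he => /(_ isT)/and5P[_ _ _ _ /allP/(_ (e' %% 30))].
rewrite mem_iota he' (negbTE ne) /= => /(_ isT)/negP[].
by case: h => -[/tg_end_eq h1 /tg_end_eq h2]; move: h1 h2; rewrite !eend_i // h3 => -[->] [->];
  rewrite !eqxx ?orbT.
Qed.

Lemma ewt_gt0 (e : 'I_(T * 30)) : 0 < ewt e.
Proof.
rewrite /ewt; case: (ltnP (e %% 30) 28) => he; last by rewrite /twt ifN // -leqNgt.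
have /andP[_ /allP/(_ (e %% 30))] := tinc_check (ty (e %/ 30)).
by rewrite mem_iota he => /(_ isT)/and5P[].
Qed.

Definition tile_graph : cgraph :=
  @CGraph (T * 20) (T * 30) (tg_end false) (tg_end true) ewt (fun=> 2)
    tg_no_loop tg_no_multi ewt_gt0.

Notation G := tile_graph.

Definition cfg (F : nat -> bool) : config G := [ffun e : 'I_(T * 30) => F e].

(* The edge of the graph that tile [t] sees as its edge [a]. *)
Definition gl t a : nat :=
  if a < 28 then t * 30 + a else (pw t (a - 28)).1.1 * 30 + 28 + (pw t (a - 28)).1.2.

Definition lst (F : nat -> bool) t a := F (t * 30 + a).
Definition lpt (F : nat -> bool) t i :=
  F ((pw t i).1.1 * 30 + 28 + (pw t i).1.2) == (pw t i).2.

Lemma tinc_cases k v a : a \in tinc k v ->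
  (a < 28 /\ ((tsrc k a == v) || (tdst k a == v))) \/ (v < 4 /\ a = 28 + v).
Proof.
rewrite mem_cat mem_filter mem_iota add0n /= => /orP[/andP[h ->]|]; first by left.
by case: ifP => // v4; rewrite inE => /eqP ->; right.
Qed.

Lemma gl_w t i : gl t (28 + i) = (pw t i).1.1 * 30 + 28 + (pw t i).1.2.
Proof. by rewrite /gl (ltac:(lia) : (28 + i < 28) = false) addKn. Qed.

Lemma tinto_w k st pt v i : tinto k st pt v (28 + i) = pt i.
Proof. by rewrite /tinto (ltac:(lia) : (28 + i < 28) = false) addKn. Qed.

Lemma gl_wire t v : t < T -> v < 4 -> let e := gl t (28 + v) in
  [/\ e < T * 30, 28 <= e %% 30, e %/ 30 = (pw t v).1.1 & e %% 30 = 28 + (pw t v).1.2].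
Proof.
move=> tT v4; rewrite gl_w; have [h1 h2] := pwV tT v4.
by split; lia.
Qed.

Lemma gl_inner t a : t < T -> a < 28 -> let e := gl t a in
  [/\ e < T * 30, e %/ 30 = t & e %% 30 = a].
Proof.
by move=> tT a28; rewrite /gl a28; split; lia.
Qed.

Lemma gl_eend t v a : t < T -> a \in tinc (ty t) v -> forall b,
  (eend b (gl t a) == (t, v)) = tinto (ty t) (fun=> b) (fun i => b == (pw t i).2) v a.
Proof.
move=> tT /tinc_cases[[a28 h]|[v4 ->]] b.
  have [_ h1 h2] := gl_inner tT a28.
  by rewrite /eend /tinto h1 h2 a28 xpair_eqE eqxx; case: b.
have [h1 h2 h3 h4] := gl_wire tT v4; have [p1 p2] := pwV tT v4.
rewrite eend_w // h3 h4 addKn tinto_w; apply/eqP/eqP => [e|->].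
  by have := wendK b p1 p2; rewrite e /= => ->.
exact: pwK.
Qed.

Lemma gl_inj t v : t < T -> v < 20 -> {in tinc (ty t) v &, injective (gl t)}.
Proof.
move=> tT v20 a a' /tinc_cases[[h _]|[h ->]] /tinc_cases[[h' _]|[h' ->]] //.
- by have [_ _ e1] := gl_inner tT h; have [_ _ e2] := gl_inner tT h' => e; rewrite -e1 -e2 e.
- by have [_ _ e1] := gl_inner tT h; have [_ e2 _ _] := gl_wire tT h' => e; lia.
- by have [_ _ e1] := gl_inner tT h'; have [_ e2 _ _] := gl_wire tT h => e; lia.
Qed.

Lemma gl_uniq t v : t < T -> v < 20 -> uniq [seq gl t a | a <- tinc (ty t) v].
Proof.
move=> tT v20; rewrite map_inj_in_uniq; last exact: gl_inj.
by have /andP[/allP/(_ v) + _] := tinc_check (ty t); rewrite mem_iota v20 => /(_ isT)/andP[].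
Qed.

Lemma gl_lt t v : t < T -> all (fun x => x < T * 30) [seq gl t a | a <- tinc (ty t) v].
Proof.
move=> tT; apply/allP=> x /mapP[a /tinc_cases[[h _]|[h ->]] ->].
  by have [] := gl_inner tT h.
by have [] := gl_wire tT h.
Qed.

Lemma gl_mem t v e : t < T -> v < 20 -> e < T * 30 ->
  (e \in [seq gl t a | a <- tinc (ty t) v]) =
  (eend false e == (t, v)) || (eend true e == (t, v)).
Proof.
move=> tT v20 eT; apply/mapP/idP => [[a ai ->]|h].
  rewrite !gl_eend //; case/tinc_cases: ai => [[h1 h2]|[v4 ->]].
    by rewrite /tinto h1.
  by rewrite !tinto_w; case: (pw _ _).2.
case: (ltnP (e %% 30) 28) => he.
  exists (e %% 30); last first.
    by move: h; rewrite !eend_i // !xpair_eqE /gl he => /orP[]/andP[/eqP<- _]; lia.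
  move: h; rewrite !eend_i // !xpair_eqE mem_cat mem_filter mem_iota he /= => /orP[]/andP[/eqP-> ->];
  by rewrite ?orbT.
have [b hb] : exists b, wend b (e %/ 30) (e %% 30 - 28) = (t, v).
  by case/orP: h => /eqP; rewrite eend_w //; [exists false|exists true].
have [q1 q2] : e %/ 30 < T /\ e %% 30 - 28 < 2 by lia.
have [_ v4] := wendV b q1 q2; rewrite hb /= in v4.
exists (28 + v); first by rewrite mem_cat v4 mem_seq1 eqxx orbT.
rewrite gl_w.
by have := wendK b q1 q2; rewrite hb /= => -> /=; lia.
Qed.

Lemma ewt_gl t v a : t < T -> a \in tinc (ty t) v -> ewt (gl t a) = twt (ty t) a.
Proof.
move=> tT /tinc_cases[[h _]|[h ->]].
  by have [_ h1 h2] := gl_inner tT h; rewrite /ewt h1 h2.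
have [_ h1 _ _] := gl_wire tT h.
by rewrite /ewt /twt (ltac:(lia) : (28 + v < 28) = false) ltnNge h1.
Qed.

Definition vx t v (lt : t < T) (lv : v < 20) : 'I_(nv G) :=
  Ordinal (ltac:(rewrite /= /vid /=; lia) : vid (t, v) < T * 20).

Lemma tg_end_vx b (e : 'I_(T * 30)) t v (lt : t < T) (lv : v < 20) :
  (tg_end b e == vx lt lv) = (eend b e == (t, v)).
Proof.
apply/eqP/eqP => [/(congr1 val)|h]; last by apply: val_inj; rewrite /= h.
by apply: vid_inj => //; exact: (eendV _ (ltn_ord e)).2.
Qed.

Lemma vertexP (P : 'I_(nv G) -> Prop) :
  (forall t v (lt : t < T) (lv : v < 20), P (vx lt lv)) -> forall v, P v.
Proof.
move=> h u; have lt : u %/ 20 < T by have := ltn_ord u => /=; lia.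
have lv : u %% 20 < 20 by rewrite ltn_mod.
have -> : u = vx lt lv by apply: val_inj; rewrite /= /vid /=; lia.
exact: h.
Qed.

Lemma tinflowE F t v (lt : t < T) (lv : v < 20) :
  \sum_(e : 'I_(T * 30) | edge_head (cfg F : config G) e == vx lt lv) weight (c := G) e =
  tinflow (ty t) (lst F t) (lpt F t) v.
Proof.
pose l := [seq gl t a | a <- tinc (ty t) v].
pose f e := if eend (F e) e == (t, v) then ewt e else 0.
rewrite (eq_bigr (fun e : 'I_(T * 30) => f e)); last first.
  move=> e; rewrite /edge_head ffunE /f -(tg_end_vx _ _ lt lv) => /eqP <-.
  by rewrite [dst _]/= [src _]/=; case: (F e); rewrite eqxx.
rewrite big_mkcond /= (eq_bigr (fun e : 'I_(T * 30) => if (e : nat) \in l then f e else 0)).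
  rewrite -big_mkcond sum_ord_seq ?gl_uniq ?gl_lt // big_map /tinflow sumnE big_map.
  apply: eq_big_seq => a ai; rewrite /f gl_eend // (ewt_gl lt ai).
  congr (if _ then _ else _); case/tinc_cases: ai => [[h _]|[v4 ->]].
    by rewrite /tinto /lst /gl h.
  by rewrite !tinto_w /lpt gl_w.
move=> e _; rewrite gl_mem // /f /edge_head ffunE -!(tg_end_vx _ _ lt lv).
by rewrite [dst _]/= [src _]/=; case: (F e); case: eqP => //= _; rewrite ?orbT ?if_same.
Qed.

(** A vertex sees only the inner edges and the ports of its own tile, so legality of the graph
    splits into legality of the tiles. *)
Lemma legalE F : legal (cfg F) <->
  forall t, t < T -> tlegal (ty t) (lst F t) (lpt F t).
Proof.
split=> [/forallP h t lt|h].
  apply/allP=> v; rewrite mem_iota => lv; rewrite -(tinflowE F lt lv); exact: h.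
apply/forallP; apply: vertexP => t v lt lv; rewrite tinflowE.
by have /allP/(_ v) := h t lt; rewrite mem_iota; apply.
Qed.

Lemma card_incident t v (lt : t < T) (lv : v < 20) (P : pred nat) :
  #|[set e in incident (vx lt lv) | P (weight e)]| =
  count P [seq twt (ty t) a | a <- tinc (ty t) v].
Proof.
rewrite -sum1_card (eq_bigl (fun e : 'I_(T * 30) => ((e : nat) \in [seq gl t a | a <- tinc (ty t) v])
   && P (ewt e))).
  rewrite big_mkcondr /= (sum_ord_seq (fun x => if P (ewt x) then 1 else 0)) ?gl_uniq ?gl_lt //.
  rewrite big_map -sum1_count big_map [RHS]big_mkcond.
  by apply: eq_big_seq => a ai; rewrite (ewt_gl lt ai).
move=> e; rewrite !inE gl_mem // -!(tg_end_vx _ _ lt lv) [src _]/= [dst _]/=.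
by rewrite ![vx _ _ == _]eq_sym.
Qed.

Lemma tile_graph_and_or (v : 'I_(nv G)) : and_vertex v \/ or_vertex v.
Proof.
move: v; apply: vertexP => t v lt lv.
have card P := card_incident lt lv P.
have c3 : #|incident (vx lt lv)| = size (tinc (ty t) v).
  by rewrite -(size_map (twt (ty t))) -count_predT -card; apply: eq_card => e; rewrite !inE andbT.
have /andP[/allP/(_ v) + _] := tinc_check (ty t).
rewrite mem_iota lv => /(_ isT)/andP[_ /orP[]] pm.
  right; split=> //; first by rewrite c3 -(size_map (twt (ty t))) (perm_size pm).
  move=> e ei; have := card (predC1 2); rewrite (permP pm) /= => /eqP.
  by rewrite cards_eq0 => /eqP/setP/(_ e); rewrite !inE in ei *; rewrite ei /= => /negbFE/eqP.
left; split=> //; first by rewrite c3 -(size_map (twt (ty t))) (perm_size pm).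
  by rewrite (card (pred1 1)) (permP pm).
by rewrite (card (pred1 2)) (permP pm).
Qed.

(** * Reconfiguring tile by tile *)

Definition nstep : rel (config G) :=
  fun C C' => [&& legal C, legal C' & one_reversal C C'].

Lemma nstep_sym : symmetric nstep.
Proof.
move=> C C'; rewrite /nstep andbCA /one_reversal; congr [&& _, _ & _].
by congr (_ == _); apply: eq_card => e; rewrite !inE eq_sym.
Qed.

Lemma connect_nstep_sym : connect_sym nstep.
Proof. exact: sym_connect_sym nstep_sym. Qed.

Lemma nstep_flip F F' e : e < T * 30 -> legal (cfg F) -> legal (cfg F') ->
  (forall e', e' < T * 30 -> (F e' != F' e') = (e' == e)) -> nstep (cfg F) (cfg F').
Proof.
move=> eT l1 l2 h; rewrite /nstep l1 l2 /one_reversal /=.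
suff -> : [set x | cfg F x != cfg F' x] = [set Ordinal eT] by rewrite cards1.
by apply/setP=> x; rewrite !inE !ffunE h.
Qed.

Lemma cfg_ext F F' : (forall e, e < T * 30 -> F e = F' e) -> cfg F = cfg F'.
Proof. by move=> h; apply/ffunP=> e; rewrite !ffunE h. Qed.

(* [w t r] tells whether the [r]-th wire of tile [t] is oriented from its source
   to its target. *)
Definition wpt (w : nat -> nat -> bool) t i :=
  w (pw t i).1.1 (pw t i).1.2 == (pw t i).2.
Definition gst (w : nat -> nat -> bool) (I : nat -> nat) e :=
  if e %% 30 < 28 then tcanon (ty (e %/ 30)) (I (e %/ 30)) (e %% 30)
  else w (e %/ 30) (e %% 30 - 28).
Definition st_ok w (I : nat -> nat) t :=
  (I t < size (tile_states (ty t))) && all (wpt w t) (tminp (ty t) (I t)).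

Lemma lst_gst w I t a : a < 28 -> lst (gst w I) t a = tcanon (ty t) (I t) a.
Proof.
move=> h; rewrite /lst /gst; have -> : (t * 30 + a) %% 30 = a by lia.
by rewrite h; have -> : (t * 30 + a) %/ 30 = t by lia.
Qed.

Lemma gst_wire w I t r : r < 2 -> gst w I (t * 30 + 28 + r) = w t r.
Proof.
move=> h; rewrite /gst; have -> : (t * 30 + 28 + r) %% 30 = 28 + r by lia.
by rewrite (ltac:(lia) : (28 + r < 28) = false) addKn; congr w; lia.
Qed.

Lemma lpt_gst w I t i : t < T -> i < 4 -> lpt (gst w I) t i = wpt w t i.
Proof. by move=> tT i4; have [_ h] := pwV tT i4; rewrite /lpt gst_wire. Qed.

Lemma gst_legal w I : (forall t, t < T -> st_ok w I t) -> legal (cfg (gst w I)).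
Proof.
move=> ok; apply/legalE=> t tT; have /andP[h1 h2] := ok t tT.
rewrite (tlegal_ext _ (st' := tcanon (ty t) (I t)) (pt' := wpt w t)).
- exact: tcanon_legal.
- by move=> a; exact: lst_gst.
- by move=> i; exact: lpt_gst.
Qed.

(** With the wires fixed, [tpath] leads from one canonical state of [t0] to the other, because the
    wires supply the minimal ports of both. The paths are tabulated for increasing indices; the
    other direction follows by reversibility. *)
Lemma gst_move w I I' t0 : t0 < T -> (forall t, t < T -> st_ok w I t) ->
  (forall t, t < T -> st_ok w I' t) -> (forall t, t < T -> t != t0 -> I t = I' t) ->
  connect nstep (cfg (gst w I)) (cfg (gst w I')).
Proof.
move=> t0T.
wlog lt : I I' / I t0 <= I' t0.
  move=> wl ok ok' eI; case: (leqP (I t0) (I' t0)) => h; first exact: wl.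
  rewrite connect_nstep_sym; apply: wl => //; first exact: ltnW.
  by move=> t tT ne; rewrite eI.
move=> ok ok' eI; move: lt; rewrite leq_eqVlt => /orP[/eqP e0|lt].
  suff -> : cfg (gst w I) = cfg (gst w I') by [].
  apply: cfg_ext => e eT; rewrite /gst; case: ifP => // _; congr tcanon.
  by case: (eqVneq (e %/ 30) t0) => [->//|ne]; apply: eI => //; lia.
pose k := ty t0.
pose sst st e := if (e %/ 30 == t0) && (e %% 30 < 28) then nth false st (e %% 30)
                 else gst w I e.
have /andP[i1 i2] := ok t0 t0T; have /andP[j1 j2] := ok' t0 t0T.
have cI : cfg (gst w I) = cfg (sst (tcanons k (I t0))).
  apply: cfg_ext => e _; rewrite /sst; case: ifP => // /andP[/eqP h1 h2].
  by rewrite /gst h2 tcanonsE // h1.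
have cI' : cfg (gst w I') = cfg (sst (tcanons k (I' t0))).
  apply: cfg_ext => e eT; rewrite /sst; case: ifP => [/andP[/eqP h1 h2]|].
    by rewrite /gst h2 tcanonsE // h1.
  rewrite /gst; case: ifP => // _; rewrite andbT => /negbT ne.
  by rewrite eI //; lia.
have lgs st : tlegal k (nth false st) (wpt w t0) -> legal (cfg (sst st)).
  move=> lg; apply/legalE=> t tT.
  have pE i : i < 4 -> lpt (sst st) t i = wpt w t i.
    move=> i4; have [h1 h2] := pwV tT i4; rewrite /lpt /sst.
    rewrite (ltac:(lia) : (((pw t i).1.1 * 30 + 28 + (pw t i).1.2) %% 30 < 28) = false).
    by rewrite andbF gst_wire.
  case: (eqVneq t t0) => [tt|ne].
    rewrite tt in pE *; rewrite (tlegal_ext _ (st' := nth false st) (pt' := wpt w t0)) // => a a28.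
    rewrite /lst /sst (ltac:(lia) : (t0 * 30 + a) %% 30 = a) a28.
    by rewrite (ltac:(lia) : (t0 * 30 + a) %/ 30 = t0) eqxx.
  have /andP[h1 h2] := ok t tT.
  rewrite (tlegal_ext _ (st' := tcanon (ty t) (I t)) (pt' := wpt w t)) //; first exact: tcanon_legal.
  move=> a a28; rewrite -(lst_gst w I t a28) /lst /sst.
  by rewrite (ltac:(lia) : (t * 30 + a) %/ 30 = t) (negbTE ne).
have gen p st goal : tlegal k (nth false st) (wpt w t0) ->
    tpath_ok k [seq (x \in tminp k (I t0)) || (x \in tminp k (I' t0)) | x <- iota 0 4] st p goal ->
    connect nstep (cfg (sst st)) (cfg (sst goal)).
  elim: p st => [|a p IH] st lg /=; first by move=> /eqP->.
  case/and3P=> a28 lg1 ok1; set st1 := set_nth _ _ _ _ in lg1 ok1.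
  have lg2 : tlegal k (nth false st1) (wpt w t0).
    apply: tlegal_mono lg1 => -[|[|[|[|i]]]] /=; rewrite ?nth_nil //;
      (case/orP; [exact: (allP i2)|exact: (allP j2)]).
  apply: connect_trans (IH _ lg2 ok1); apply: connect1.
  apply: (@nstep_flip _ _ (t0 * 30 + a)); [lia|exact: lgs|exact: lgs|move=> e eT].
  rewrite /sst; case: ifP => [/andP[/eqP h1 h2]|h1]; last first.
    by rewrite eqxx; apply/esym/negbTE/eqP=> ee; move: h1; rewrite ee; lia.
  rewrite nth_set_nth /=; case: (eqVneq (e %% 30) a) => [h3|h3].
    have -> : (e == t0 * 30 + a) = true by apply/eqP; lia.
    by rewrite h3; case: (nth _ _ _).
  by rewrite eqxx; apply/esym/negbTE; move: h3; apply: contra => /eqP ->; apply/eqP; lia.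
rewrite cI cI'; apply: (gen (tpath k (I t0) (I' t0))).
  rewrite (tlegal_ext _ (st' := tcanon k (I t0)) (pt' := wpt w t0)) //; first exact: tcanon_legal.
  by move=> a; exact: tcanonsE.
have /allP/(_ (I t0)) := tpath_check k; rewrite mem_iota i1 => /(_ isT)/andP[_ /allP/(_ (I' t0))].
by rewrite mem_iota j1 lt; apply.
Qed.

(* Reversing one wire: first the tile that loses it, then the wire, then the
   tile that receives it. *)
Lemma wire_move w w' t0 r0 : t0 < T -> r0 < 2 ->
  (wend false t0 r0).1 != (wend true t0 r0).1 ->
  (forall t r, t < T -> r < 2 -> (w t r != w' t r) = ((t == t0) && (r == r0))) ->
  (forall t, t < T -> tile_ok (ty t) (wpt w t)) ->
  (forall t, t < T -> tile_ok (ty t) (wpt w' t)) ->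
  connect nstep (cfg (gst w (fun t => tidx (ty t) (wpt w t))))
                (cfg (gst w' (fun t => tidx (ty t) (wpt w' t)))).
Proof.
move=> t0T r02 ne df ok ok'.
pose I t := tidx (ty t) (wpt w t); pose I' t := tidx (ty t) (wpt w' t).
(* The wire points to its end [b], so [tl] is the tile about to lose it. *)
pose b := w t0 r0; pose tl := (wend b t0 r0).1.
have w0 : w' t0 r0 = ~~ b.
  by have := df t0 r0 t0T r02; rewrite !eqxx /b; case: (w _ _) (w' _ _) => [] [].
have idx_ok v t : tile_ok (ty t) (wpt v t) ->
    st_ok v (fun t => tidx (ty t) (wpt v t)) t.
  rewrite tile_okE /st_ok => lt; rewrite lt /tminp.
  apply: (@nth_find _ ([::], [::]) (fun x => all (wpt v t) x.1)); by rewrite has_find.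
have pE t i : t < T -> i < 4 -> wpt w t i != wpt w' t i ->
    (t, i) = wend b t0 r0 \/ (t, i) = wend (~~ b) t0 r0.
  move=> tT i4; have [h1 h2] := pwV tT i4; have := pwK tT i4; rewrite /wpt.
  case: (pw t i) h1 h2 => [[t1 r1] b1] /= h1 h2 <- hd.
  have /andP[/eqP-> /eqP->] : (t1 == t0) && (r1 == r0).
    by rewrite -df //; apply: contra hd => /eqP->.
  by case: (b) (b1) => [] []; auto.
have same t : t < T -> t != tl -> t != (wend (~~ b) t0 r0).1 ->
    forall i, i < 4 -> wpt w t i = wpt w' t i.
  move=> tT n1 n2 i i4; case: (eqVneq (wpt w t i) (wpt w' t i)) => [//|/(pE _ _ tT i4)[] e].
    by move: n1; rewrite /tl -e eqxx.
  by move: n2; rewrite -e eqxx.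
have tlne : tl != (wend (~~ b) t0 r0).1 by rewrite /tl; case: (b) ne => //; rewrite eq_sym.
have mono1 t x : t < T -> t != (wend (~~ b) t0 r0).1 -> x < 4 -> wpt w' t x -> wpt w t x.
  move=> tT n2 x4; apply: contraLR => nw; apply/negP=> h.
  have [|e|e] := pE t x tT x4; first by rewrite h; case: (wpt w t x) nw.
    move: h; rewrite /wpt; have := @wendK b t0 r0 t0T r02; rewrite -e /= => -> /=.
    by rewrite w0; case: (b).
  by move: n2; rewrite -e eqxx.
have mono2 t x : t < T -> t != tl -> x < 4 -> wpt w t x -> wpt w' t x.
  move=> tT n2 x4; apply: contraLR => nw; apply/negP=> h.
  have [|e|e] := pE t x tT x4; first by rewrite h; case: (wpt w' t x) nw.
    by move: n2; rewrite /tl -e eqxx.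
  move: h; rewrite /wpt; have := @wendK (~~ b) t0 r0 t0T r02; rewrite -e /= => -> /=.
  by rewrite -/b; case: (b).
(* In this intermediate state one end no longer relies on the wire and the other does not yet, so it
   is legal with either orientation. *)
pose I1 t := if t == tl then I' t else I t.
have okw1 t : t < T -> st_ok w I1 t.
  move=> tT; rewrite /st_ok /I1; case: (eqVneq t tl) => [e|n1]; last exact: idx_ok (ok t tT).
  have /andP[-> /allP h] := idx_ok w' t (ok' t tT); apply/allP=> x xm.
  by apply: mono1 (h x xm); rewrite // ?(tminp_lt xm) // e.
have okw2 t : t < T -> st_ok w' I1 t.
  move=> tT; rewrite /st_ok /I1; case: (eqVneq t tl) => [e|n1]; first exact: idx_ok (ok' t tT).
  have /andP[-> /allP h] := idx_ok w t (ok t tT); apply/allP=> x xm.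
  by apply: mono2 (h x xm); rewrite // (tminp_lt xm).
have [tlT _] := wendV b t0T r02.
have [tgT _] := wendV (~~ b) t0T r02.
have c1 : connect nstep (cfg (gst w I)) (cfg (gst w I1)).
  apply: (gst_move tlT) => // [t tT|t tT nt]; first exact: idx_ok (ok t tT).
  by rewrite /I1 (negbTE nt).
have c3 : connect nstep (cfg (gst w' I1)) (cfg (gst w' I')).
  apply: (gst_move tgT) => // [t tT|t tT nt]; first exact: idx_ok (ok' t tT).
  rewrite /I1; case: eqP => // /eqP n1; rewrite /I /I'; apply: tidx_ext.
  exact: same.
apply: connect_trans c1 (connect_trans _ c3); apply: connect1.
have e0T : t0 * 30 + 28 + r0 < T * 30 by lia.
apply: (nstep_flip e0T); [exact: gst_legal|exact: gst_legal|move=> e eT].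
rewrite /gst; case: ltnP => he; first by rewrite eqxx; apply/esym/negbTE/eqP; lia.
by rewrite df; [apply/andP/eqP => [[/eqP + /eqP]|]; lia|lia|lia].
Qed.

Definition bits (C : config G) e := if insub e is Some o then C o else false.
Definition wires (C : config G) t r := bits C (t * 30 + 28 + r).

Lemma cfg_bits C : cfg (bits C) = C.
Proof. by apply/ffunP=> e; rewrite ffunE /bits valK. Qed.

Lemma legal_tile_ok C t : legal C -> t < T -> tile_ok (ty t) (wpt (wires C) t).
Proof. by rewrite -{1}[C]cfg_bits => /legalE h /h /tile_sound. Qed.

(** If the reversed edge is an inner one, the truncated subtraction merely names some wire, and in
    fact no wire changes. *)
Lemma one_reversal_wires C C' : one_reversal C C' -> exists t0 r0, forall t r,
  t < T -> r < 2 -> (t != t0) || (r != r0) -> wires C t r = wires C' t r.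
Proof.
case/cards1P=> e0 h; exists (e0 %/ 30), (e0 %% 30 - 28) => t r tT r2 ne.
have eT : t * 30 + 28 + r < T * 30 by lia.
rewrite /wires /bits (insubT (fun x => x < T * 30) eT); apply/eqP/negPn.
have := in_set1 (Ordinal eT) e0; rewrite -h !inE => ->.
by apply: contraL ne => /eqP <- /=; lia.
Qed.

End TileGraph.

(** * The circuit of a word reconfiguration problem *)

Section Circuit.
Variables (n m : nat) (H : rel nat).
Hypothesis n3 : 3 <= n.

(** Lines of adjacent positions differ by less than [n.*2], so that [n.*2] crossings per line let
    all relevant pairs meet; the last tile serves the chains. The [3 * n] lines beyond [m * n] stand
    for no letter: they give the last lines room to come down and the last chain room to be
    closed. *)
Definition cD := n.*2.+1.
Definition cP := (m + 3) * n.
Definition cT := cP * cD.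
Definition mk p d := p * cD + d.

(* Line [p = i * n + a] stands for letter [a] at position [i]. It first passes
   through the tiles [mk p n.*2, ..., mk p 0] along their wires 0 and then
   through [mk p.+1 0, ..., mk (p + n.*2) n.*2.-1] along their wires 1, so
   that tile [mk p d] is the crossing of the lines [p] and [p - d.+1]. The
   wires 1 of the tiles [mk p n.*2] form the chains in which one line of every
   position must be selected. *)
Definition cwend (b : bool) (t r : nat) : nat * nat :=
  let p := t %/ cD in let d := t %% cD in
  if r == 0 then
    if ~~ b then (t, 2)
    else if 0 < d then (mk p d.-1, 1)
    else if p.+1 < cP then (mk p.+1 0, 0) else (t, 3)
  else if p.+1 < cP then
    if ~~ b then (t, 3) else if d.+1 < cD then (mk p.+1 d.+1, 0) else (mk p.+1 d, 1)
  else if odd d then (if b then mk p d.+1 else t, 3)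
  else if ~~ b then (mk 0 d, 0)
  else if d.+1 < cD then (mk 0 d.+1, 0) else (mk 0 d, 1).

Definition cpw (t i : nat) : nat * nat * bool :=
  let p := t %/ cD in let d := t %% cD in
  match i with
  | 0 => if 0 < p then if d == 0 then (mk p.-1 0, 0, true) else (mk p.-1 d.-1, 1, true)
         else if odd d then (mk cP.-1 d.-1, 1, true) else (mk cP.-1 d, 1, false)
  | 1 => if d.+1 < cD then (mk p d.+1, 0, true)
         else if 0 < p then (mk p.-1 d, 1, true) else (mk cP.-1 d, 1, true)
  | 2 => (t, 0, false)
  | _ => if (p.+1 < cP) || odd d then (t, 1, false)
         else if d == 0 then (t, 0, true) else (mk p d.-1, 1, true)
  end.

Arguments cwend : simpl never.
Arguments cpw : simpl never.

(** Line [q] arrives at the chain in row [q + cD], and [cD] is 1 modulo [n]. Hence the rows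
    congruent to 1 are those where a new position begins. *)
Definition cty (t : nat) : tile :=
  let p := t %/ cD in let d := t %% cD in
  if d.+1 == cD then if (cD <= p) && (p %% n == 1) then TOB else TOM
  else if [&& p < m * n, d.+1 <= p, ((p - d.+1) %/ n).+1 == p %/ n
            & ~~ H ((p - d.+1) %% n) (p %% n)] then TXC else TX.

Lemma mkp p d : d < cD -> mk p d %/ cD = p.
Proof. by move=> h; rewrite /mk divnMDl // divn_small ?addn0. Qed.
Lemma mkd p d : d < cD -> mk p d %% cD = d.
Proof. by move=> h; rewrite /mk modnMDl modn_small. Qed.
Lemma mk_lt p d : p < cP -> d < cD -> mk p d < cT.
Proof. by rewrite /mk /cT => hp hd; nia. Qed.
Lemma mkP t : t < cT -> exists p d, [/\ p < cP, d < cD & t = mk p d].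
Proof.
move=> h; exists (t %/ cD), (t %% cD); split; last exact: divn_eq.
  by rewrite ltn_divLR.
by rewrite ltn_mod.
Qed.
Lemma cP_gt : 8 < cP. Proof. by rewrite /cP; nia. Qed.
Lemma cD_odd : odd cD. Proof. by rewrite /cD /= odd_double. Qed.

Lemma cwendV b t r : t < cT -> r < 2 -> (cwend b t r).1 < cT /\ (cwend b t r).2 < 4.
Proof.
move=> /mkP[p [d [hp hd ->]]] _; rewrite /cwend mkp // mkd //; have := cP_gt => P8.
have oD := cD_odd.
do ?case: ifP => /= *; split=> //; try apply: mk_lt; try lia.
Qed.

Lemma cpwV t i : t < cT -> i < 4 -> (cpw t i).1.1 < cT /\ (cpw t i).1.2 < 2.
Proof.
move=> /mkP[p [d [hp hd ->]]]; rewrite /cpw mkp // mkd //; have := cP_gt => P8.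
by case: i => [|[|[|[|//]]]] _; do ?case: ifP => /= *; split=> //; apply: mk_lt; lia.
Qed.

Ltac mks := repeat (first [rewrite mkp; [|by lia] | rewrite mkd; [|by lia]]).

(** At the left border the ports 0 of tiles [d] and [d.+1] are joined for even [d], at the right
    border the ports 3 for odd [d]. As [cD] is odd, one port is left over on each side; it is joined
    to another port of its own tile. *)
Lemma cwendK b t r : t < cT -> r < 2 -> cpw (cwend b t r).1 (cwend b t r).2 = (t, r, b).
Proof.
move=> /mkP[p [d [hp hd ->]]]; have := cP_gt => P8; have oD := cD_odd.
case: r => [|[|//]] _; rewrite /cwend mkp // mkd //=; case: b => /=;
do ?case: ifP => /= *; rewrite /cpw /=; mks => //=;
do ?case: ifP => /= *; try lia.
all: try (congr (mk _ _, _, _); lia).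
Qed.

Lemma cpwK t i : t < cT -> i < 4 ->
  cwend (cpw t i).2 (cpw t i).1.1 (cpw t i).1.2 = (t, i).
Proof.
move=> /mkP[p [d [hp hd ->]]]; have := cP_gt => P8; have oD := cD_odd.
case: i => [|[|[|[|//]]]] _; rewrite /cpw /=; mks => //=;
do ?case: ifP => /= *; rewrite /cwend /=; mks => //=;
do ?case: ifP => /= *; try lia.
all: try (congr (mk _ _, _); lia).
Qed.

(** Only the two border wires that start and end on one tile could double an inner edge. They join
    ports 2 and 3 of a [TX] and ports 0 and 1 of a [TOM], which are not adjacent there. *)
Lemma cwend_multi t r a : t < cT -> r < 2 -> a < 28 ->
  let p := cwend false t r in let q := cwend true t r in p.1 = q.1 ->
  ~~ [|| (tsrc (cty p.1) a == p.2) && (tdst (cty p.1) a == q.2)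
       | (tsrc (cty p.1) a == q.2) && (tdst (cty p.1) a == p.2)].
Proof.
move=> /mkP[p [d [hp hd ->]]]; have := cP_gt => P8; have oD := cD_odd.
have inj p1 d1 p2 d2 : d1 < cD -> d2 < cD -> mk p1 d1 = mk p2 d2 -> p1 = p2 /\ d1 = d2.
  by move=> h1 h2 e; rewrite -(mkp p1 h1) -{2}(mkd p1 h1) e mkp // mkd.
have noX : forall a, a < 28 -> ~~ [|| (tsrc TX a == 2) && (tdst TX a == 3)
       | (tsrc TX a == 3) && (tdst TX a == 2)].
  by do 28 case=> //.
have noM : forall a, a < 28 -> ~~ [|| (tsrc TOM a == 0) && (tdst TOM a == 1)
       | (tsrc TOM a == 1) && (tdst TOM a == 0)].
  by do 28 case=> //.
move=> + a28; case: r => [|[|//]] _ /=; rewrite /cwend /=; mks => /=.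
  case: (posnP d) => [d0|d0] /=; last by move/inj => []; lia.
  case: ifP => /= hP; first by move/inj => []; lia.
  move=> _; suff -> : cty (mk p d) = TX by exact: noX.
  rewrite /cty; mks => /=.
  have -> : (d.+1 == cD) = false by apply/negbTE/eqP; rewrite /cD; lia.
  have -> // : (p < m * n) = false; move: hP; rewrite /cP; nia.
case: ifP => hP /=.
  by case: ifP => /= hd1 /inj[]; lia.
case: ifP => od /=.
  have d1 : d.+1 < cD by move: oD hd; rewrite /cD; lia.
  by move/inj => []; lia.
case: ifP => hd1 /=; first by move/inj => []; lia.
move=> _; suff -> : cty (mk 0 d) = TOM by exact: noM.
rewrite /cty; mks => /=; have -> : d.+1 == cD by lia.
by [].
Qed.

Definition cgr : cgraph :=
  tile_graph cwendV cwendK cwend_multi.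

Notation cfg := (cfg cwendV cwendK cwend_multi).

Definition up (w : nat -> nat -> bool) p d := w (mk p d) 0.
Definition down (w : nat -> nat -> bool) p d := w (mk p d) 1.
Notation pt w p d i := (wpt cpw w (mk p d) i).

Lemma pt0E w p d : 0 < p -> d < cD ->
  pt w p d 0 = if d == 0 then up w p.-1 0 else down w p.-1 d.-1.
Proof. by move=> hp hd; rewrite /wpt /cpw; mks; rewrite hp; case: ifP => /= _; rewrite eqb_id. Qed.

Lemma pt1E w p d : d.+1 < cD -> pt w p d 1 = up w p d.+1.
Proof. by move=> hd; rewrite /wpt /cpw; mks; rewrite hd /= eqb_id. Qed.

Lemma pt1D w p : 0 < p -> pt w p n.*2 1 = down w p.-1 n.*2.
Proof.
move=> hp; have hd : n.*2 < cD by []; rewrite /wpt /cpw; mks.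
by rewrite ltnn hp /= eqb_id.
Qed.

Lemma pt1_0 w : pt w 0 n.*2 1 = down w cP.-1 n.*2.
Proof.
have hd : n.*2 < cD by []; rewrite /wpt /cpw; mks.
by rewrite [_ < cD]ltnn /= eqb_id.
Qed.

Lemma pt2E w p d : pt w p d 2 = ~~ up w p d.
Proof. by rewrite /wpt /cpw /= eqbF_neg. Qed.

Lemma pt3E w p d : p.+1 < cP -> d < cD -> pt w p d 3 = ~~ down w p d.
Proof. by move=> hp hd; rewrite /wpt /cpw; mks; rewrite hp /= eqbF_neg. Qed.

Lemma ctyX p d : d.+1 < cD -> cty (mk p d) = TX \/ cty (mk p d) = TXC.
Proof.
move=> hd; rewrite /cty; mks; rewrite (ltn_eqF hd) /=.
by case: ifP; [right|left].
Qed.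

Lemma ctyM p : cty (mk p n.*2) = if (cD <= p) && (p %% n == 1) then TOB else TOM.
Proof. by have hd : n.*2 < cD by []; rewrite /cty; mks; rewrite eqxx. Qed.

Lemma tile_ok_cross k v : k = TX \/ k = TXC -> tile_ok k v ->
  (v 0 || v 3) && (v 1 || v 2).
Proof. by case=> -> //= /and3P[-> ->]. Qed.

(* A line is selected when its last wire points towards the end of the line. *)
Definition sel w p := down w (p + n.*2) n.*2.-1.

(** * Every legal state of the circuit contains a valid word *)

Section Sound.
Variable w : nat -> nat -> bool.
Hypothesis ok : forall t, t < cT -> tile_ok (cty t) (wpt cpw w t).

Lemma cross_ok p d : p < cP -> d.+1 < cD ->
  (pt w p d 0 || pt w p d 3) && (pt w p d 1 || pt w p d 2).
Proof.
move=> hp hd; apply: tile_ok_cross (ctyX p hd) (ok _).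
by apply: mk_lt => //; lia.
Qed.

Lemma mn_lt p : p < m * n -> p + n.*2 < cP.-2.
Proof. by rewrite /cP; nia. Qed.

(** A crossing that sends a line onwards must receive it, so a selected line is advanced everywhere:
    this is traced back from its end, here along the second half and in [sel_up] along the first. *)
Lemma sel_down p d : p < m * n -> sel w p -> d < n.*2 -> down w (p + d.+1) d.
Proof.
move=> /mn_lt hp sp hd.
suff gen k d1 : d1 + k = n.*2.-1 -> down w (p + d1.+1) d1.
  by apply: (gen (n.*2.-1 - d)); lia.
elim: k d1 => [|k IH] d1 dk.
  move: sp; rewrite /sel -dk addn0; congr (down _ _ _); lia.
have dn := IH d1.+1 ltac:(lia).
have /andP[] := @cross_ok (p + d1.+2) d1.+1 ltac:(lia) ltac:(rewrite /cD; lia).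
rewrite pt0E; [|lia|rewrite /cD; lia]; rewrite pt3E; [|lia|rewrite /cD; lia].
by rewrite dn orbF addnS.
Qed.

Lemma sel_up p d : p < m * n -> sel w p -> d < cD -> up w p d.
Proof.
move=> hp sp; elim: d => [_|d IH hd].
  have := sel_down hp sp; move: (mn_lt hp) => h /(_ 0 ltac:(lia)) dn.
  have /andP[] := @cross_ok p.+1 0 ltac:(lia) ltac:(rewrite /cD; lia).
  rewrite pt0E // pt3E //; last by lia.
  by rewrite -addn1 dn orbF addn1.
have := IH (ltnW hd) => u; have := mn_lt hp => h.
have /andP[_] := @cross_ok p d ltac:(lia) hd.
by rewrite pt1E // pt2E u orbF.
Qed.

Lemma sel_compat i a b : i.+1 < m -> a < n -> b < n ->
  sel w (i * n + a) -> sel w (i.+1 * n + b) -> H a b.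
Proof.
move=> hi ha hb sa sb; apply/negPn/negP=> nH.
(* The numbers of the two lines differ by [n + b - a], so they cross in tile [mk p d]. Both being
   advanced, its ports 2 and 3 point out, which [TXC] forbids. *)
pose p := i.+1 * n + b; pose d := n + b - a - 1.
have hq : i * n + a < m * n by nia.
have hp : p < m * n by rewrite /p; nia.
have hd : d < n.*2 by rewrite /d; lia.
have dD : d < cD by rewrite /cD; lia.
have pE : i * n + a + d.+1 = p by rewrite /d /p; nia.
have dn := sel_down hq sa hd; have u := sel_up hp sb dD.
have := mn_lt hp => hP.
have := @ok (mk p d) ltac:(apply: mk_lt => //; lia).
suff -> : cty (mk p d) = TXC.
  by rewrite /= pt2E pt3E ?u -?pE ?dn ?andbF //; lia.
rewrite /cty; mks; have -> : (d.+1 == cD) = false by rewrite /cD; lia.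
have -> : p - d.+1 = i * n + a by lia.
rewrite /p !modnMDl !divnMDl; try lia.
rewrite !modn_small // !divn_small // nH !addn0 eqxx hp.
by have -> : d < i.+1 * n + b by rewrite /d; nia.
Qed.

(** A forward chain wire is fed by the line that ends at its tile or by the preceding chain wire;
    tracing back stops at the [TOB] tile that opens the chain. *)
Lemma chain_sel i j : i < m -> j < n -> down w (i * n + cD + j) n.*2 ->
  exists2 a, a <= j & sel w (i * n + a).
Proof.
move=> hi; elim: j => [|j IH] hj dn.
  have P0 : i * n + cD + 0 < cP.-1 by rewrite /cP /cD; nia.
  have := @ok (mk (i * n + cD + 0) n.*2) ltac:(apply: mk_lt => //; lia).
  rewrite ctyM; have -> : (i * n + cD + 0) %% n = 1.
    have -> : i * n + cD + 0 = (i + 2) * n + 1 by rewrite /cD; nia.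
    by rewrite modnMDl modn_small //; lia.
  have -> : cD <= i * n + cD + 0 by lia.
  case/andP=> _; rewrite pt3E ?dn ?orbF //; last by lia.
  rewrite pt0E //; last by rewrite /cD; lia.
  have -> : (n.*2 == 0) = false by lia.
  move=> h; exists 0 => //; rewrite /sel; congr (down _ _ _): h; rewrite /cD; lia.
have P0 : i * n + cD + j.+1 < cP.-1 by rewrite /cP /cD; nia.
have := @ok (mk (i * n + cD + j.+1) n.*2) ltac:(apply: mk_lt => //; lia).
rewrite ctyM; have -> : ((i * n + cD + j.+1) %% n == 1) = false.
  have -> : i * n + cD + j.+1 = (i + 2) * n + j.+2 by rewrite /cD; nia.
  rewrite modnMDl; case: (ltnP j.+2 n) => [lt|ge]; first by rewrite modn_small.
  by have -> : j.+2 = n by [lia]; rewrite modnn.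
rewrite andbF /= pt3E ?dn ?orbF //; last by lia.
case/orP.
  rewrite pt0E; [|lia|by []]; have -> : (n.*2 == 0) = false by lia.
  move=> h; exists j.+1 => //; rewrite /sel; congr (down _ _ _): h; rewrite /cD; lia.
rewrite pt1D; last by lia.
rewrite addnS /= => /(IH (ltnW hj))[a la sa]; exists a => //; lia.
Qed.

(** The [TOB] tile that closes the chain insists on its last wire. *)
Lemma sel_some i : i < m -> exists2 a, a < n & sel w (i * n + a).
Proof.
move=> hi; have P0 : i.+1 * n + cD < cP.-1 by rewrite /cP /cD; nia.
have := @ok (mk (i.+1 * n + cD) n.*2) ltac:(apply: mk_lt => //; lia).
rewrite ctyM; have -> : (i.+1 * n + cD) %% n = 1.
  have -> : i.+1 * n + cD = (i + 3) * n + 1 by rewrite /cD; nia.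
  by rewrite modnMDl modn_small //; lia.
rewrite leq_addl /= => /andP[]; rewrite pt1D; last by lia.
have -> : (i.+1 * n + cD).-1 = i * n + cD + n.-1 by nia.
move=> /chain_sel h _; have [||a la sa] := h => //; first by lia.
by exists a => //; lia.
Qed.

End Sound.

(* A line has [full] wires; [fr p] is the number of initial wires of line [p]
   that point forward, and [ac p] the state of the chain wire of tile [p]. *)
Definition full := n.*2 + n.*2 + 1.
Definition wfr (fr : nat -> nat) (ac : nat -> bool) (t r : nat) : bool :=
  let p := t %/ cD in let d := t %% cD in
  if r == 0 then n.*2 - d < fr p
  else if d == n.*2 then ac p else (d < p) && (cD + d < fr (p - d.+1)).

Lemma up_wfr fr ac p d : d < cD -> up (wfr fr ac) p d = (n.*2 - d < fr p).
Proof. by move=> hd; rewrite /up /wfr; mks. Qed.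

Lemma down_wfr fr ac p d : d < n.*2 ->
  down (wfr fr ac) p d = (d < p) && (cD + d < fr (p - d.+1)).
Proof.
move=> hd; have hd' : d < cD by rewrite /cD; lia.
by rewrite /down /wfr; mks; rewrite (ltn_eqF hd).
Qed.

Lemma chain_wfr fr ac p : down (wfr fr ac) p n.*2 = ac p.
Proof. by have hd : n.*2 < cD by []; rewrite /down /wfr; mks; rewrite eqxx. Qed.

(** A line may be advanced partially, and so may several lines of one position; only what single
    tiles can see is demanded. This is what makes each single advance a legal move. *)
Definition okst (fr : nat -> nat) (ac : nat -> bool) : Prop :=
  [/\ forall p, m * n <= p -> fr p = full,
      forall p, (p < cD) || (m * n + cD <= p) -> ac p,
      forall p q, p < m * n -> (q %/ n).+1 = p %/ n -> ~~ H (q %% n) (p %% n) ->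
        fr p = 0 \/ fr q = 0,
      forall q, q < m * n -> ac (q + cD) ->
        fr q = full \/ (q %% n != 0 /\ ac (q + cD).-1)
    & forall i, i < m -> ac (i * n + cD + n.-1)].

Lemma okst_ok fr ac : okst fr ac ->
  forall t, t < cT -> tile_ok (cty t) (wpt cpw (wfr fr ac) t).
Proof.
case=> gh gac cf ca ca' _ /mkP[p [d [hp hd ->]]].
have PE : cP = m * n + 3 * n by rewrite /cP mulnDl.
set w := wfr fr ac.
have endL q : q + cD < cP -> fr q = full -> pt w (q + cD) n.*2 0.
  move=> hq fq; rewrite pt0E; [|rewrite /cD; lia|by []].
  have -> : (n.*2 == 0) = false by lia.
  rewrite down_wfr; last by lia.
  have -> : (q + cD).-1 - n.*2.-1.+1 = q by rewrite /cD; lia.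
  by rewrite fq /full /cD; lia.
case: (ltnP d.+1 cD) => hd2; last first.
  have -> : d = n.*2 by move: hd hd2; rewrite /cD; lia.
  have om : tile_ok TOM (wpt cpw w (mk p n.*2)).
    rewrite /=; case: (posnP p) => [->|p0].
      by rewrite pt1_0 chain_wfr gac ?orbT //; apply/orP; right; rewrite /cD; lia.
    rewrite pt1D // chain_wfr; case: (ltnP p cD) => pD; first by rewrite gac ?orbT //; lia.
    have pE : p = (p - cD) + cD by lia.
    case: (ltnP (p - cD) (m * n)) => hq; last first.
      by rewrite {1}pE endL ?gh //; lia.
    have hP : p.+1 < cP by move: hq; rewrite PE /cD; lia.
    rewrite pt3E // chain_wfr; case acp : (ac p); last by rewrite !orbT.
    have [|fq|[_ h]] := ca _ hq; first by rewrite -pE.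
      by rewrite {1}pE endL //; lia.
    by rewrite -pE in h; rewrite h orbT.
  rewrite ctyM; case: ifP => // /andP[pD /eqP p1].
  have [i pE] : exists i, p = i * n + cD.
    have e := divn_eq p n; rewrite p1 in e; exists (p %/ n - 2).
    by move: pD e; rewrite /cD -mul2n mulnBl; nia.
  have p0 : 0 < p by lia.
  rewrite /= pt1D // chain_wfr; apply/andP; split.
    case: i pE => [|i] pE; first by rewrite gac // pE; lia.
    have -> : p.-1 = i * n + cD + n.-1 by rewrite pE mulSn; lia.
    case: (ltnP i m) => him; first exact: ca'.
    by rewrite gac //; apply/orP; right; nia.
  have iq : (i * n) %% n = 0 by rewrite modnMl.
  case: (ltnP (i * n) (m * n)) => hq; last by rewrite {1}pE endL ?gh //; lia.
  have hP : p.+1 < cP by rewrite pE PE /cD; lia.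
  rewrite pt3E // chain_wfr; case acp : (ac p); last by rewrite orbT.
  have [|fq|[+ _]] := ca _ hq; [by rewrite -pE| |by rewrite iq].
  by rewrite {1}pE endL //; lia.
have dn2 : d < n.*2 by move: hd2; rewrite /cD; lia.
have A : pt w p d 0 || pt w p d 3.
  case dn : (down w p d).
    move: dn; rewrite down_wfr // => /andP[dp df].
    rewrite pt0E //; last by lia.
    case: eqP => [d0|d0].
      rewrite up_wfr //; have -> : p.-1 = p - d.+1 by lia.
      by apply/orP; left; move: df; rewrite /cD; lia.
    rewrite down_wfr; last by lia.
    have -> : p.-1 - d.-1.+1 = p - d.+1 by lia.
    by apply/orP; left; lia.
  suff -> : pt w p d 3 by rewrite orbT.
  rewrite /wpt /cpw; mks; case: ifP => [_|/norP[hp1 od]] /=; first by rewrite -/(down w p d) dn.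
  have pP : p = cP.-1 by lia.
  case: ifP => [/eqP d0|d0] /=; rewrite eqb_id.
    rewrite -/(up w p d) up_wfr // gh /full; last by rewrite pP PE; lia.
    by lia.
  rewrite -/(down w p d.-1) down_wfr; last by lia.
  by rewrite gh /full pP PE /cD; lia.
have B : pt w p d 1 || pt w p d 2.
  by rewrite pt1E // pt2E !up_wfr //; lia.
case: (ctyX p hd2) => kE; rewrite kE /= A B //=.
move: kE; rewrite /cty; mks; case: ifP => //; case: ifP => // /and4P[pm dp adj nH] _ _.
have hP : p.+1 < cP by rewrite PE; lia.
rewrite pt2E pt3E // up_wfr // down_wfr //.
by have [->|->] := cf _ _ pm (eqP adj) nH; rewrite ?orbT // ltn0 andbF orbT.
Qed.

Notation cf fr ac := (cfg (gst cty (wfr fr ac)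
  (fun t => tidx (cty t) (wpt cpw (wfr fr ac) t)))).

Notation nstep := (@nstep _ _ _ _ cwendV cwendK cwend_multi).

Lemma mk_inj p1 d1 p2 d2 : d1 < cD -> d2 < cD ->
  (mk p1 d1 == mk p2 d2) = (p1 == p2) && (d1 == d2).
Proof.
move=> h1 h2; apply/eqP/andP => [e|[/eqP-> /eqP->] //].
have := congr1 (fun x => x %/ cD) e; have := congr1 (fun x => x %% cD) e.
by rewrite !mkp // !mkd // => -> ->; rewrite !eqxx.
Qed.

Lemma step_fr fr fr' ac p : okst fr ac -> okst fr' ac -> p < m * n -> fr p < full ->
  fr' p = (fr p).+1 -> (forall q, q != p -> fr' q = fr q) ->
  connect nstep (cf fr ac) (cf fr' ac).
Proof.
move=> ok ok' hp hk fp fq; set k := fr p in hk fp.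
have PE : cP = m * n + 3 * n by rewrite /cP mulnDl.
(* The first [cD] wires of a line are the wires 0 of its own tiles, in decreasing order of [d]; the
   others are wires 1, one in each of the following rows. *)
pose up' := k < cD; pose p0 := if up' then p else p + (k - cD).+1.
pose d0 := if up' then n.*2 - k else k - cD.
pose r0 := if up' then 0 else 1.
have d0D : d0 < cD by rewrite /d0 /up' /cD; case: ifP; move: hk; rewrite /full; lia.
have p0P : p0.+1 < cP by rewrite /p0 /up' /cD PE; case: ifP; move: hk; rewrite /full; lia.
apply: (@wire_move _ _ _ _ cwendV cpwV cwendK cpwK cwend_multi _ _ (mk p0 d0) r0).
- by apply: mk_lt => //; lia.
- by rewrite /r0; case: ifP.
- rewrite /cwend; mks; rewrite p0P /r0; case: (up') => /=.
    by case: ifP => h /=; rewrite mk_inj; lia.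
  by case: ifP => h /=; rewrite mk_inj; lia.
- move=> t r /mkP[p1 [d1 [hp1 hd1 ->]]]; rewrite mk_inj //.
  case: r => [|[|//]] _.
    rewrite -/(up _ _ _) -/(up _ p1 d1) !up_wfr // /r0 /p0 /d0.
    case: (eqVneq p1 p) => [->|ne].
      rewrite -/k fp; case: ifP => h; move: h hd1; rewrite /up' /cD => h hd1.
        by rewrite eqxx andbT /=; apply/idP/idP; lia.
      by rewrite andbF; lia.
    rewrite fq // eqxx; case: ifP => h; first by rewrite (negbTE ne).
    by rewrite andbF.
  rewrite -/(down _ _ _) -/(down _ p1 d1).
  case: (ltnP d1 n.*2) => hd2; last first.
    have -> : d1 = n.*2 by move: hd1 hd2; rewrite /cD; lia.
    rewrite !chain_wfr eqxx /r0 /d0; case: ifP => h; first by rewrite andbF.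
    by apply/esym/negbTE; move: hk; rewrite /full /cD; lia.
  rewrite !down_wfr // /r0 /p0 /d0; case: (ltnP d1 p1) => hdp /=; last first.
    by case: ifP => h; rewrite ?andbF //; apply/esym/negbTE; lia.
  case: (eqVneq (p1 - d1.+1) p) => [e|ne].
    rewrite e -/k fp; case: ifP => h; move: h; rewrite /up' => h.
      by rewrite andbF; lia.
    by rewrite andbT; apply/idP/idP; lia.
  rewrite fq // eqxx; case: ifP => h; rewrite ?andbF //.
  by apply/esym/negbTE; move: ne; lia.
- exact: okst_ok.
- exact: okst_ok.
Qed.

Lemma step_ac fr ac ac' p : okst fr ac -> okst fr ac' -> p < m * n + cD ->
  (forall q, (ac q != ac' q) = (q == p)) -> connect nstep (cf fr ac) (cf fr ac').
Proof.
move=> ok ok' hp ap.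
have PE : cP = m * n + 3 * n by rewrite /cP mulnDl.
have hD : n.*2 < cD by [].
have pP : p.+1 < cP by rewrite PE; move: hp; rewrite /cD; lia.
apply: (@wire_move _ _ _ _ cwendV cpwV cwendK cpwK cwend_multi _ _ (mk p n.*2) 1) => //.
- by apply: mk_lt => //; lia.
- by rewrite /cwend; mks; rewrite pP ltnn /= mk_inj; lia.
- move=> t r /mkP[p1 [d1 [hp1 hd1 ->]]]; rewrite mk_inj //.
  case: r => [|[|//]] _; first by rewrite andbF -/(up _ _ _) -/(up _ p1 d1) !up_wfr // eqxx.
  rewrite -/(down _ _ _) -/(down _ p1 d1).
  case: (ltnP d1 n.*2) => hd2; first by rewrite !down_wfr // eqxx (ltn_eqF hd2) andbF.
  have -> : d1 = n.*2 by move: hd1 hd2; rewrite /cD; lia.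
  by rewrite !chain_wfr eqxx !andbT.
- exact: okst_ok.
- exact: okst_ok.
Qed.

(** * Changing one letter of a word *)

Definition frW (W : nat -> nat) p :=
  if p < m * n then if p %% n == W (p %/ n) then full else 0 else full.
(** Within a position, the chain is on from the tile where the chosen line arrives up to the closing
    tile. *)
Definition acW (W : nat -> nat) p :=
  if p < cD then true
  else if p - cD < m * n then W ((p - cD) %/ n) <= (p - cD) %% n else true.
Definition validW (W : nat -> nat) : Prop :=
  (forall i, i < m -> W i < n) /\ (forall i, i.+1 < m -> H (W i) (W i.+1)).

Lemma div_lt p : p < m * n -> p %/ n < m.
Proof. by move=> h; rewrite ltn_divLR //; lia. Qed.

Lemma divE i a : a < n -> (i * n + a) %/ n = i.
Proof. by move=> h; rewrite divnMDl ?divn_small ?addn0 //; lia. Qed.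
Lemma modE i a : a < n -> (i * n + a) %% n = a.
Proof. by move=> h; rewrite modnMDl modn_small. Qed.

(** While the letter at [i0] changes, lines of its old and its new letter may both be advanced. The
    neighbouring positions keep their letters, and since both words are valid these fit either
    letter. *)
Lemma okst_mixed (W W' : nat -> nat) (i0 : nat) fr (ac : nat -> bool) : validW W -> validW W' ->
  (forall i, i != i0 -> W' i = W i) ->
  (forall p, m * n <= p -> fr p = full) ->
  (forall p, p < m * n -> fr p != 0 -> (p %% n == W (p %/ n)) || (p %% n == W' (p %/ n))) ->
  (forall p, (p < cD) || (m * n + cD <= p) -> ac p) ->
  (forall q, q < m * n -> ac (q + cD) ->
        fr q = full \/ (q %% n != 0 /\ ac (q + cD).-1)) ->
  (forall i, i < m -> ac (i * n + cD + n.-1)) -> okst fr ac.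
Proof.
move=> [_ v] [_ v'] e gh sl gac ca cl; split=> // p q pm adj nH.
case: (posnP (fr p)) => [|fp]; first by left.
case: (posnP (fr q)) => [|fq]; first by right.
have pi := div_lt pm; have qm : q < m * n by have := divn_eq q n; have := ltn_pmod q (ltac:(lia) : 0 < n); nia.
exfalso; move: nH => /negP; apply.
have := sl p pm; have := sl q qm; rewrite -!lt0n fp fq => /(_ isT) sq /(_ isT).
rewrite -adj in pi *; case: (eqVneq (q %/ n) i0) sq => [qi|nq].
  by rewrite (e (q %/ n).+1) -?qi; [rewrite orbb => /orP[]/eqP-> /eqP->|lia];
    [exact: v|rewrite -(e (q %/ n).+1) -?qi; [exact: v'|lia]].
rewrite e // orbb => /eqP-> /orP[]/eqP->; first exact: v.
by rewrite -(e (q %/ n)) //; exact: v'.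
Qed.

Lemma acW_chain W (fr : nat -> nat) q : (forall i, i < m -> W i < n) ->
  (forall p, p < m * n -> p %% n == W (p %/ n) -> fr p = full) ->
  q < m * n -> acW W (q + cD) -> fr q = full \/ (q %% n != 0 /\ acW W (q + cD).-1).
Proof.
move=> Wn sl qm; rewrite {1}/acW addnK qm ltnNge leq_addl /= leq_eqVlt => /orP[/eqP h|h].
  by left; apply: sl => //; rewrite h.
right; split; first by lia.
have qE := divn_eq q n; have qn : 0 < q %% n by lia.
have q0 : 0 < q by case: (posnP q) qn => // ->; rewrite mod0n.
have e1 : q.-1 %/ n = q %/ n.
  by rewrite {1}qE -subn1 -addnBA // divE //; have := ltn_pmod q (ltac:(lia) : 0 < n); lia.
have e2 : q.-1 %% n = (q %% n).-1.
  by rewrite {1}qE -subn1 -addnBA // modE ?subn1 //; have := ltn_pmod q (ltac:(lia) : 0 < n); lia.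
rewrite /acW; case: ifP => // _; have -> : (q + cD).-1 - cD = q.-1 by lia.
by case: ifP => // _; rewrite e1 e2; lia.
Qed.

Lemma acW_last W i : (forall i, i < m -> W i < n) -> i < m -> acW W (i * n + cD + n.-1).
Proof.
move=> Wn im; rewrite /acW; case: ifP => // _.
have -> : i * n + cD + n.-1 - cD = i * n + n.-1 by lia.
case: ifP => // _; rewrite divE ?modE; try lia.
by have := Wn i im; lia.
Qed.

Lemma acW_ghost W p : (p < cD) || (m * n + cD <= p) -> acW W p.
Proof. by rewrite /acW => /orP[->//|h]; case: ifP => // _; case: ifP => //; lia. Qed.

Lemma okst_word W : validW W -> okst (frW W) (acW W).
Proof.
move=> v; apply: (okst_mixed (W := W) (W' := W) (i0 := 0)) => //.
- by move=> p h; rewrite /frW ltnNge h.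
- by move=> p h; rewrite /frW h; case: ifP.
- by move=> p; exact: acW_ghost.
- move=> q; apply: acW_chain; first by case: v.
  by move=> p h1 h2; rewrite /frW h1 h2.
- by move=> i; apply: acW_last; case: v.
Qed.

Section WordMove.
Variables (W W' : nat -> nat) (i0 : nat).
Hypotheses (vW : validW W) (vW' : validW W') (i0m : i0 < m) (neW : W i0 != W' i0).
Hypothesis eW : forall i, i != i0 -> W' i = W i.

Definition frU p := if p == i0 * n + W' i0 then full else frW W p.

Lemma lineE p i a : a < n -> (p == i * n + a) = (p %/ n == i) && (p %% n == a).
Proof.
move=> h; apply/eqP/andP => [->|[/eqP <- /eqP <-]]; first by rewrite divE // modE // !eqxx.
exact: divn_eq.
Qed.

Lemma frUE p : p < m * n -> frU p =
  if (p %% n == W (p %/ n)) || (p %% n == W' (p %/ n)) then full else 0.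
Proof.
move=> h; rewrite /frU lineE; last exact: vW'.1.
rewrite /frW h; case: (eqVneq (p %/ n) i0) => [->|ne] /=; last by rewrite eW // orbb.
by case: eqP; case: eqP.
Qed.

Lemma raise : connect nstep (cf (frW W) (acW W)) (cf frU (acW W)).
Proof.
have lt' : W' i0 < n by exact: vW'.1.
pose lb := i0 * n + W' i0; pose g k p := if p == lb then k else frW W p.
have lbm : lb < m * n by rewrite /lb; nia.
have g0 : frW W lb = 0 by rewrite /frW lbm /lb divE // modE // eq_sym (negbTE neW).
have okg k : okst (g k) (acW W).
  apply: (okst_mixed (W := W) (W' := W') (i0 := i0)) => //.
  - move=> p h; rewrite /g; have -> : (p == lb) = false by lia.
    by rewrite /frW ltnNge h.
  - move=> p h; rewrite /g lineE //; case: (eqVneq (p %/ n) i0) => [e|ne] /=.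
      by rewrite e; case: (eqVneq (p %% n) (W' i0)); rewrite ?orbT // /frW h e; case: ifP.
    by rewrite /frW h; case: ifP.
  - by move=> p; exact: acW_ghost.
  - move=> q; apply: acW_chain; first by case: vW.
    move=> p h1 h2; rewrite /g /frW h1 h2; case: eqP => // pl.
    by move: g0; rewrite /frW -pl h1 h2 /full; lia.
  - by move=> i; apply: acW_last; case: vW.
have step k : k <= full -> connect nstep (cf (g 0) (acW W)) (cf (g k) (acW W)).
  elim: k => [_|k IH hk]; first exact: connect0.
  apply: connect_trans (IH (ltnW hk)) _; apply: (step_fr (p := lb)) => //.
  - by rewrite /g eqxx.
  - by rewrite /g eqxx.
  - by move=> q /negbTE ne; rewrite /g ne.
have := step full (leqnn _).
have -> : g 0 = frW W.
  by apply: boolp.funext => p; rewrite /g; case: eqP => // ->; rewrite g0.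
by have -> : g full = frU by [].
Qed.

(** The path is built backwards: starting from the chain of [W'], the wires between the two lines
    are switched on one by one, beginning at the line of [W], so that each is fed by its
    predecessor. *)
Lemma rechain_lt : W i0 < W' i0 -> connect nstep (cf frU (acW W)) (cf frU (acW W')).
Proof.
move=> lo; have hi : W' i0 < n by exact: vW'.1.
pose b := i0 * n + cD.
pose g c p := if (b <= p) && (p < b + n) then (W' i0 <= p - b) || ((W i0 <= p - b) && (p - b < c))
  else acW W p.
have gin p : (b <= p) && (p < b + n) -> exists2 j, j < n & p = i0 * n + j + cD.
  by move=> h; exists (p - b); rewrite /b in h *; lia.
have acin j V : j < n -> acW V (i0 * n + j + cD) = (V i0 <= j).
  move=> jn; rewrite /acW addnK ltnNge leq_addl /=.
  have -> : i0 * n + j < m * n by nia.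
  by rewrite divE // modE.
have acout p V V' : (forall i, i != i0 -> V i = V' i) -> ~~ ((b <= p) && (p < b + n)) ->
    acW V p = acW V' p.
  move=> eV h; rewrite /acW; case: ltnP => // hD; case: ifP => // hm; rewrite eV //.
  apply/eqP=> e; have := divn_eq (p - cD) n; have := ltn_pmod (p - cD) (ltac:(lia) : 0 < n).
  by move: h; rewrite e /b; lia.
have okg c : W i0 <= c -> c <= W' i0 -> okst frU (g c).
  move=> c1 c2; apply: (okst_mixed (W := W) (W' := W') (i0 := i0)) => //.
  - move=> p h; rewrite /frU /frW ltnNge h /=.
    by case: ifP.
  - by move=> p h; rewrite frUE //; case: ifP.
  - move=> p h; rewrite /g; case: ifP => [|_]; last exact: acW_ghost.
    by move: h; rewrite /b; nia.
  - move=> q hq; rewrite {1}/g; case: ifP => [hb|hb].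
      have qn : q = i0 * n + (q - i0 * n) by move: hb; rewrite /b; lia.
      set j := q - i0 * n in qn; have jn : j < n by move: hb; rewrite /b /j; lia.
      have -> : q + cD - b = j by rewrite /b /j; lia.
      move=> h; rewrite frUE // qn divE // modE //; case: (eqVneq j (W i0)) => [|n1]; first by left.
      case: (eqVneq j (W' i0)) => [|n2]; first by left.
      right; split; first by move: h; lia.
      rewrite /g; have -> : (i0 * n + j + cD).-1 - b = j.-1 by move: h; rewrite /b; lia.
      have -> : (b <= (i0 * n + j + cD).-1 < b + n) by move: h; rewrite /b; lia.
      by move: h; lia.
    move=> h; case: (acW_chain (fr := frU) _ _ hq h); [by case: vW| |by left|].
      by move=> p hp hs; rewrite frUE // hs.
    move=> [q0 h2]; right; split=> //; rewrite /g; case: ifP => // hb2.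
    exfalso; move: hb2 hb q0; have := divn_eq q n; have := ltn_pmod q (ltac:(lia) : 0 < n).
    rewrite /b => h3 h4 h5 h6; suff qe : q = i0.+1 * n by rewrite qe modnMl.
    by rewrite mulSn; lia.
  - move=> i im; rewrite /g; case: ifP => h; last by apply: acW_last => //; case: vW.
    have := vW'.1 _ i0m; move: h; rewrite /b => h ?; have -> : i = i0 by nia.
    by apply/orP; left; lia.
have step k : W i0 + k <= W' i0 ->
    connect nstep (cf frU (g (W i0))) (cf frU (g (W i0 + k))).
  elim: k => [|k IH] hk; first by rewrite addn0; exact: connect0.
  apply: connect_trans (IH _) _; first by lia.
  apply: (step_ac (p := b + (W i0 + k))).
  - by apply: okg; lia.
  - by apply: okg; lia.
  - by rewrite /b; nia.
  - move=> q; rewrite /g; case: ifP => h.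
      by apply/idP/idP; lia.
    by rewrite eqxx; apply/esym/negbTE; lia.
have := step (W' i0 - W i0) ltac:(lia); rewrite subnKC; last exact: ltnW.
have -> : g (W' i0) = acW W.
  apply: boolp.funext => p; rewrite /g; case: ifP => // /gin[j jn ->].
  rewrite acin //; have -> : i0 * n + j + cD - b = j by rewrite /b; lia.
  by apply/idP/idP; lia.
have -> : g (W i0) = acW W'.
  apply: boolp.funext => p; rewrite /g; case: ifP => [/gin[j jn ->]|/negbT h].
    rewrite acin //; have -> : i0 * n + j + cD - b = j by rewrite /b; lia.
    by apply/idP/idP; lia.
  by apply: acout => // i /eW.
by rewrite (@connect_nstep_sym _ _ _ _ cwendV cwendK cwend_multi).
Qed.

End WordMove.

(** The new line is raised, the chain is handed over, and the old line is lowered. Lowering is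
    raising read backwards, since the state with both lines raised is symmetric in [W] and [W']. *)
Lemma word_move W W' i0 : validW W -> validW W' -> i0 < m ->
  (forall i, i != i0 -> W' i = W i) ->
  connect nstep (cf (frW W) (acW W)) (cf (frW W') (acW W')).
Proof.
move=> v v' im e; case: (eqVneq (W i0) (W' i0)) => [e0|ne].
  suff -> : W = W' by exact: connect0.
  by apply: boolp.funext => i; case: (eqVneq i i0) => [->//|/e->].
have e' i : i != i0 -> W i = W' i by move/e.
have fE : frU W' W i0 = frU W W' i0.
  apply: boolp.funext => p; case: (ltnP p (m * n)) => hp.
    by rewrite (frUE v im e') // (frUE v' im e) // orbC.
  by rewrite /frU /frW ltnNge hp /=; do 2 case: ifP => _.
apply: connect_trans (raise v v' im ne e) _.
rewrite (@connect_nstep_sym _ _ _ _ cwendV cwendK cwend_multi).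
apply: connect_trans (raise v' v im _ e') _; first by rewrite eq_sym.
rewrite fE; case: (ltngtP (W i0) (W' i0)) ne => // lt _.
  rewrite (@connect_nstep_sym _ _ _ _ cwendV cwendK cwend_multi).
  by apply: (rechain_lt v v' im _ e lt); rewrite (ltn_eqF lt).
by rewrite -fE; apply: (rechain_lt v' v im _ e' lt); rewrite (ltn_eqF lt).
Qed.

(** * Reachable words and reachable states of the circuit *)

Inductive wconn (W : nat -> nat) : (nat -> nat) -> Prop :=
| wconn0 : wconn W W
| wconnS W1 W2 i0 : wconn W W1 -> validW W2 -> i0 < m ->
    (forall i, i != i0 -> W2 i = W1 i) -> wconn W W2.

Notation cwires C := (@wires _ _ _ _ cwendV cwendK cwend_multi C).
Notation start W := (cf (frW W) (acW W)).

Lemma sel_wire p : p < m * n -> mk (p + n.*2) n.*2.-1 < cT.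
Proof. by move/mn_lt => h; apply: mk_lt; [lia|rewrite /cD; lia]. Qed.

Lemma wconn_valid W W' : validW W -> wconn W W' -> validW W'.
Proof. by move=> v; case. Qed.

Lemma wconn_start W W' : validW W -> wconn W W' -> connect nstep (start W) (start W').
Proof.
move=> v; elim=> [|W1 W2 i0 c1 IH v2 im e]; first exact: connect0.
exact: connect_trans IH (word_move (wconn_valid v c1) v2 im e).
Qed.

Lemma sel_start W p : p < m * n ->
  sel (cwires (start W)) p = (p %% n == W (p %/ n)).
Proof.
move=> hp; have e2 : mk (p + n.*2) n.*2.-1 * 30 + 28 + 1 < cT * 30.
  by have := sel_wire hp; lia.
rewrite /sel /down /wires /bits (insubT (fun x => x < cT * 30) e2) ffunE.
rewrite gst_wire // -/(down _ _ _) down_wfr; last by lia.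
have -> : p + n.*2 - n.*2.-1.+1 = p by lia.
rewrite /frW hp; case: ifP => _; last by rewrite andbF.
by rewrite /full /cD; lia.
Qed.

(** Several lines of one position can be selected simultaneously, so the invariant speaks of every
    choice [V] of one selected line per position. A move changes at most one selection. If it
    creates the line [V i0], another line was selected at [i0] before; the choice with that line is
    reachable by induction, and [V] differs from it in one letter. *)
Lemma sel_reach W C : validW W -> connect nstep (start W) C ->
  forall V, (forall i, i < m -> V i < n /\ sel (cwires C) (i * n + V i)) ->
  exists2 W1, wconn W W1 & forall i, i < m -> W1 i = V i.
Proof.
move=> v /connectP[s]; elim/last_ind: s C => [|s C' IH] C /=.
  move=> _ -> V hV; exists W; first exact: wconn0.
  move=> i im; have [vn] := hV i im; rewrite sel_start ?divE ?modE //; last by nia.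
  by move/eqP.
rewrite rcons_path last_rcons => /andP[ps /and3P[l1 l2 rv]] -> V hV.
set C1 := last _ _ in l1 rv.
have okC t : t < cT -> tile_ok (cty t) (wpt cpw (cwires C1) t).
  exact: (legal_tile_ok cpwV cpwK l1).
have okC' t : t < cT -> tile_ok (cty t) (wpt cpw (cwires C') t).
  exact: (legal_tile_ok cpwV cpwK l2).
have vV : (forall i, i < m -> V i < n) /\ (forall i, i.+1 < m -> H (V i) (V i.+1)).
  split=> [i /hV[]//|i im]; have [h1 h2] := hV i (ltnW im); have [h3 h4] := hV _ im.
  exact: (sel_compat okC' im).
have [t0 [r0 eqw]] := one_reversal_wires rv.
have same p : p < m * n -> (mk (p + n.*2) n.*2.-1 != t0) || (1 != r0) ->
    sel (cwires C1) p = sel (cwires C') p.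
  by move=> hp; apply: eqw => //; exact: sel_wire.
case: (boolP [forall i : 'I_m, sel (cwires C1) (i * n + V i)]) => [/forallP al|].
  apply: (IH C1 ps erefl) => i im; have [h _] := hV i im; split=> //.
  exact: (al (Ordinal im)).
rewrite negb_forall => /existsP[[i0 im] /= ns].
have [hn hs] := hV i0 im.
have hp : i0 * n + V i0 < m * n by nia.
have /norP[/negPn/eqP et /negPn/eqP er] :
    ~~ ((mk (i0 * n + V i0 + n.*2) n.*2.-1 != t0) || (1 != r0)).
  by apply/negP => /(same _ hp) e; move: ns; rewrite e hs.
have [a an sa] := sel_some okC im.
pose U i := if i == i0 then a else V i.
have [|W1 c1 eU] := IH C1 ps erefl U.
  move=> i jm; rewrite /U; case: eqP => [->//|/eqP ne]; have [h1 h2] := hV i jm.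
  split=> //; rewrite same //; first by nia.
  rewrite -et mk_inj; [|by rewrite /cD; lia..]; rewrite eqxx andbT eqn_add2r.
  rewrite lineE // divE // (negbTE ne) //.
pose W2 i := if i == i0 then V i0 else W1 i.
have e2 i : i < m -> W2 i = V i.
  by move=> jm; rewrite /W2; case: eqP => [->//|/eqP ne]; rewrite eU // /U (negbTE ne).
exists W2 => //; apply: (wconnS c1 _ im) => [|i ne]; last by rewrite /W2 (negbTE ne).
split=> [i jm|i jm]; first by rewrite e2 //; case: vV => h _; exact: h.
by rewrite !e2 ?(ltnW jm) //; case: vV => _; apply.
Qed.

Lemma start_legal W : validW W -> legal (start W).
Proof.
move=> v; apply: (gst_legal cwendV cpwV cwendK cpwK cwend_multi) => t tT.
have := okst_ok (okst_word v) tT; rewrite tile_okE /st_ok => lt; rewrite lt /=.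
by apply: (@nth_find _ ([::], [::]) (fun x => all _ x.1)); rewrite has_find.
Qed.

Lemma path_nstep (C : config cgr) s : legal C -> path (@one_reversal cgr) C s ->
  all (@legal cgr) s -> path nstep C s.
Proof.
elim: s C => // C1 s IH C l0 /= /andP[r1 ps] /andP[l1 al].
by rewrite /nstep IH // andbT; apply/and3P; split.
Qed.

Lemma nstep_path (C : config cgr) s : path nstep C s ->
  path (@one_reversal cgr) C s /\ all (@legal cgr) s.
Proof.
elim: s C => // C1 s IH C /= /andP[/and3P[_ l1 r1] /IH[p1 a1]].
by split; apply/andP; split.
Qed.

Variable (acc : nat).
Hypotheses (acc_lt : acc < n) (m_gt0 : 0 < m).

Lemma target_lt : mk (acc + n.*2) n.*2.-1 * 30 + 29 < cT * 30.
Proof. by have := @sel_wire acc ltac:(nia); lia. Qed.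

(** The target is the last wire of the line for [acc] at position 0; its orientation tells whether
    this line is selected. *)
Definition circuit W (v : validW W) : c2e_instance :=
  @C2EInstance cgr (Ordinal target_lt) (start W) (start_legal v).

Lemma circuit_yes W (v : validW W) : W 0 != acc ->
  c2e_yes (circuit v) <-> exists2 W', wconn W W' & W' 0 = acc.
Proof.
move=> ne0; have am : acc < m * n by nia.
have selE (C : config cgr) : C (Ordinal target_lt) = sel (cwires C) acc.
  rewrite /sel /down /wires /bits (insubT (fun x => x < cT * 30) (ltac:(have := target_lt; lia) :
    mk (acc + n.*2) n.*2.-1 * 30 + 28 + 1 < cT * 30)).
  by congr (C _); apply: val_inj => /=; lia.
have s0 : start W (Ordinal target_lt) = false.
  by rewrite selE sel_start // modn_small // divn_small // eq_sym (negbTE ne0).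
split=> [[s [ps al]]|[W' c1 e0]].
  rewrite [c2e_target _]/= [c2e_start _]/= s0 => tg.
  have {}tg : sel (cwires (last (start W) s)) acc by rewrite -selE; move: tg; rewrite eqbF_neg negbK.
  have cn : connect nstep (start W) (last (start W) s).
    apply/connectP; exists s => //.
    exact: (path_nstep (start_legal v) ps al).
  have lg : legal (last (start W) s).
    case/lastP: (s) al => [_|s1 C1]; first exact: start_legal.
    by rewrite all_rcons last_rcons => /andP[].
  have okC t : t < cT -> tile_ok (cty t) (wpt cpw (cwires (last (start W) s)) t).
    exact: (legal_tile_ok cpwV cpwK lg).
  pose P i a := (a < n) && sel (cwires (last (start W) s)) (i * n + a).
  have hP i : exists a, (i < m) ==> P i a.
    case: (ltnP i m) => [im|_]; last by exists 0.
    by have [a h1 h2] := sel_some okC im; exists a; rewrite /P h1 h2.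
  pose V i := if i == 0 then acc else xchoose (hP i).
  have [|W1 c1 eV] := sel_reach v cn (V := V).
    move=> i im; rewrite /V; case: eqP => [->|_]; first by rewrite mul0n add0n.
    by have /implyP := xchooseP (hP i) => /(_ im)/andP[].
  by exists W1 => //; rewrite eV.
have /connectP[s ps ls] := wconn_start v c1.
exists s; split.
- by case: (nstep_path ps).
- by case: (nstep_path ps).
- rewrite [c2e_start _]/= -ls [c2e_target _]/= s0 selE sel_start //.
  by rewrite modn_small // divn_small // e0 eqxx.
Qed.

End Circuit.

Import Order.TTheory GRing.Theory Num.Theory numFieldNormedType.Exports.

(** * Planarity *)

(* Straight-line drawings of the tiles in the square of side 16, with the four
   port vertices at the corners. *)
Definition tile_pos (k : tile) : seq (nat * nat) :=
  match k with
  | TX =>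
    [:: (0, 0); (0, 16); (16, 0); (16, 16); (9, 14); (13, 13); (4, 14); (12,
    15); (8, 1); (13, 7); (1, 3); (6, 7); (4, 1); (4, 2); (11, 9); (6, 12);
    (7, 10); (9, 4); (5, 11); (9, 8)]
  | TXC =>
    [:: (0, 0); (0, 16); (16, 0); (16, 16); (1, 13); (10, 14); (1, 1); (15,
    15); (2, 1); (10, 11); (7, 6); (8, 9); (5, 2); (11, 9); (9, 7); (6, 3);
    (14, 10); (11, 5); (15, 3); (10, 6)]
  | TOM =>
    [:: (0, 0); (0, 16); (16, 0); (16, 16); (15, 4); (13, 3); (10, 1); (9, 0);
    (15, 2); (1, 15); (10, 14); (6, 10); (5, 8); (3, 8); (14, 13); (12, 10);
    (15, 9); (14, 15); (12, 13); (6, 8)]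
  | TOB =>
    [:: (0, 0); (0, 16); (16, 0); (16, 16); (8, 7); (7, 6); (15, 13); (12,
    10); (1, 8); (6, 12); (7, 8); (9, 13); (11, 4); (4, 0); (6, 4); (9, 3);
    (10, 1); (13, 3); (13, 0); (6, 0)]
  end.

Section Separation.
Local Open Scope nat_scope.

(* Twice the signed area of a triangle, as a difference of two naturals. *)
Definition area_pos (a b c : nat * nat) := b.1 * c.2 + a.1 * b.2 + c.1 * a.2.
Definition area_neg (a b c : nat * nat) := b.1 * a.2 + a.1 * c.2 + c.1 * b.2.

(** The segment from [c] to [d] lies weakly on one side of the line through [a] and [b] and is not
    contained in it, so its interior points avoid that line. *)
Definition line_sep (a b c d : nat * nat) : bool :=
  ((area_pos a b c <= area_neg a b c) && (area_pos a b d <= area_neg a b d)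
   || (area_neg a b c <= area_pos a b c) && (area_neg a b d <= area_pos a b d))
  && ((area_pos a b c != area_neg a b c) || (area_pos a b d != area_neg a b d)).

Definition key_sep (u0 u1 v0 v1 : nat) : bool :=
  (maxn u0 u1 <= minn v0 v1) && (minn u0 u1 < maxn v0 v1)
  || (maxn v0 v1 <= minn u0 u1) && (minn v0 v1 < maxn u0 u1).

(** The third direction is constant along the oblique rows in which the tiles [mk p d] with fixed
    [p] are placed. *)
Definition box_sep (a b c d : nat * nat) : bool :=
  key_sep a.1 b.1 c.1 d.1 || key_sep a.2 b.2 c.2 d.2
  || key_sep (a.1 + 2 * a.2) (b.1 + 2 * b.2) (c.1 + 2 * c.2) (d.1 + 2 * d.2).

Definition tpos k i := nth (0, 0) (tile_pos k) i.

Definition tile_drawing_ok k : bool :=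
  let l := iota 0 28 in
  [&& all (fun a => all (fun b => (a == b) ||
        line_sep (tpos k (tsrc k a)) (tpos k (tdst k a)) (tpos k (tsrc k b)) (tpos k (tdst k b)) ||
        line_sep (tpos k (tsrc k b)) (tpos k (tdst k b)) (tpos k (tsrc k a)) (tpos k (tdst k a))) l) l,
      all (fun a => all (fun i => let p := tpos k i in
        let q := tpos k (tsrc k a) in let r := tpos k (tdst k a) in
        (area_pos q r p != area_neg q r p) || box_sep q r p p) (iota 0 20)) l,
      uniq (take 20 (tile_pos k)) && (size (tile_pos k) == 20),
      all (fun i => let p := tpos k i in
        [&& p.1 <= 16, p.2 <= 16, (0 < p.1) || (i < 2),
            (p.1 < 16) || (i == 2) || (i == 3), (0 < p.1 + 2 * p.2) || (i == 0) &
            (p.1 + 2 * p.2 < 48) || (i == 3)]) (iota 0 20) &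
      (* No inner edge joins ports 0 and 1, and none of [TX] joins ports 2 and 3: the two border
         wires that close on a single tile are drawn there. *)
      all (fun a => ((1 < tsrc k a) || (1 < tdst k a)) &&
             ((if k is TX then false else true) || (tsrc k a < 2) || (3 < tsrc k a) || (tdst k a < 2) || (3 < tdst k a))) l].

End Separation.

Lemma tile_drawing_check k : tile_drawing_ok k.
Proof. by case: k; vm_compute. Qed.

Section Segments.
Variable R : realType.
Import classical_sets set_interval.
Local Open Scope ring_scope.
Local Open Scope classical_set_scope.

Definition segment (a b : nat * nat) (s : R) : R * R :=
  ((1 - s) * a.1%:R + s * b.1%:R, (1 - s) * a.2%:R + s * b.2%:R).

Lemma conv_lt (s u0 u1 c : R) : 0 < s < 1 -> u0 <= c -> u1 <= c -> (u0 < c) || (u1 < c) ->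
  (1 - s) * u0 + s * u1 < c.
Proof. by move=> /andP[s0 s1] h0 h1 /orP[] h; nra. Qed.

Lemma conv_le (s u0 u1 c : R) : 0 < s < 1 -> u0 <= c -> u1 <= c ->
  (1 - s) * u0 + s * u1 <= c.
Proof. by move=> /andP[s0 s1] h0 h1; nra. Qed.

Lemma key_sep1 (s t : R) (u0 u1 v0 v1 : nat) : 0 < s < 1 -> 0 < t < 1 ->
  ((maxn u0 u1 <= minn v0 v1) && (minn u0 u1 < maxn v0 v1))%N ->
  (1 - s) * u0%:R + s * u1%:R < (1 - t) * v0%:R + t * v1%:R.
Proof.
move=> hs ht /andP[h1 h2].
have [c [a1 a2 b1 b2]] : exists c, [/\ u0 <= c, u1 <= c, c <= v0 & c <= v1]%N.
  by exists (maxn u0 u1); split; lia.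
have ht' : (0 : R) < 1 - t < 1 by move: ht => /andP[? ?]; apply/andP; split; lra.
case: (ltnP (minn u0 u1) c) => hc.
  apply: (@lt_le_trans _ _ c%:R).
    by apply: conv_lt; rewrite ?ler_nat ?ltr_nat //; lia.
  have := @conv_le t (- v0%:R) (- v1%:R) (- c%:R) ht; rewrite !lerN2 !ler_nat => /(_ b1 b2); lra.
apply: (@le_lt_trans _ _ c%:R); first by apply: conv_le; rewrite ?ler_nat.
have := @conv_lt t (- v0%:R) (- v1%:R) (- c%:R) ht; rewrite !lerN2 !ltrN2 !ler_nat !ltr_nat.
by move=> /(_ b1 b2 ltac:(lia)); lra.
Qed.

Lemma key_sepP (s t : R) (u0 u1 v0 v1 : nat) : 0 < s < 1 -> 0 < t < 1 ->
  key_sep u0 u1 v0 v1 -> (1 - s) * u0%:R + s * u1%:R <> (1 - t) * v0%:R + t * v1%:R.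
Proof.
by move=> hs ht /orP[] h e; [have := key_sep1 hs ht h|have := key_sep1 ht hs h]; rewrite e ltxx.
Qed.

Lemma box_sepP a b c d s t : 0 < s < 1 -> 0 < t < 1 -> box_sep a b c d ->
  segment a b s <> segment c d t.
Proof.
move=> hs ht /orP[/orP[]|] h [e1 e2]; [exact: (key_sepP hs ht h)|exact: (key_sepP hs ht h)|].
have kE (x : nat * nat) : (x.1 + 2 * x.2)%:R = x.1%:R + 2 * x.2%:R :> R.
  by rewrite natrD natrM.
by apply: (key_sepP hs ht h); rewrite !kE; lra.
Qed.

Definition area (a b : nat * nat) (p : R * R) : R :=
  (b.1%:R - a.1%:R) * (p.2 - a.2%:R) - (b.2%:R - a.2%:R) * (p.1 - a.1%:R).

Lemma area_segment a b s : area a b (segment a b s) = 0.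
Proof. by rewrite /area /=; ring. Qed.

Lemma area_nat a b (c : nat * nat) : area a b (c.1%:R, c.2%:R) =
  (area_pos a b c)%:R - (area_neg a b c)%:R.
Proof. by rewrite /area /area_pos /area_neg !natrD !natrM /=; ring. Qed.

Lemma area_conv a b c d t : area a b (segment c d t) =
  (1 - t) * area a b (c.1%:R, c.2%:R) + t * area a b (d.1%:R, d.2%:R).
Proof. by rewrite /area /=; ring. Qed.

Lemma line_sepP a b c d s t : 0 < t < 1 -> line_sep a b c d ->
  segment a b s <> segment c d t.
Proof.
move=> /andP[t0 t1] /andP[h1 h2] e; have := area_segment a b s; rewrite e area_conv !area_nat.
move: h1 h2; rewrite -!(ler_nat R) -!(eqr_nat R).
move: (area_pos _ _ _)%:R (area_neg _ _ _)%:R (area_pos _ _ _)%:R (area_neg _ _ _)%:R => x y z w.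
move=> h1 h2; case/orP: h2 => /eqP h2; case/orP: h1 => /andP[h3 h4] h5; apply: h2; nra.
Qed.

Lemma segment_point a b (c : nat * nat) s :
  (area_pos a b c != area_neg a b c) -> segment a b s <> (c.1%:R, c.2%:R).
Proof.
move=> h e; have := area_segment a b s; rewrite e area_nat => /eqP.
by rewrite subr_eq0 eqr_nat; exact/negP.
Qed.

Lemma segmentxx (c : nat * nat) s : segment c c s = (c.1%:R, c.2%:R).
Proof. by rewrite /segment; congr pair; ring. Qed.

Lemma segment_continuous a b : {within `[0, 1], continuous (segment a b)}.
Proof.
have lin (u v : R) : continuous (fun s : R => (1 - s) * u + s * v).
  move=> s; apply: (@cvgD _ R^o _ (nbhs s) _ (fun x : R => (1 - x) * u) (fun x => x * v)).
    apply: (@cvgM _ _ (nbhs s) _ (fun x : R => 1 - x) (fun=> u)); last exact: cvg_cst.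
    by apply: (@cvgB _ R^o _ (nbhs s) _ (fun=> 1) id); [exact: cvg_cst|exact: cvg_id].
  by apply: (@cvgM _ _ (nbhs s) _ id (fun=> v)); [exact: cvg_id|exact: cvg_cst].
apply: continuous_subspaceT => s.
exact: (cvg_pair (lin a.1%:R b.1%:R s) (lin a.2%:R b.2%:R s)).
Qed.

Lemma segment_inj a b : a != b -> injective (segment a b).
Proof.
move=> ne s t [e1 e2].
have h (u v : nat) : u != v -> (1 - s) * u%:R + s * v%:R = (1 - t) * u%:R + t * v%:R -> s = t.
  move=> nuv e; have : (s - t) * (v%:R - u%:R : R) = 0 by lra.
  move/eqP; rewrite mulf_eq0 !subr_eq0 eqr_nat eq_sym [v == u]eq_sym (negbTE nuv) orbF.
  by move/eqP.
case: a b ne e1 e2 => [a1 a2] [b1 b2]; rewrite xpair_eqE negb_and => /orP[] ne /= e1 e2;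
  [exact: h e1|exact: h e2].
Qed.
End Segments.

Section Drawing.
Variables (R : realType) (n m : nat) (H : rel nat).
Hypothesis n3 : 3 <= n.
Notation D := (cD n).
Notation P := (cP n m).
Notation ty p d := (cty n m H (mk n p d)).

Ltac mks := repeat (first [rewrite mkp; [|by lia] | rewrite mkd; [|by lia]]).

(** The grid is sheared so that every wire off the border becomes a horizontal segment. [KLeft] and
    [KRight] run along lines of constant [x + 2 y], and [KLast] and [KCap] are vertical sides of a
    tile. *)
Definition gpos (p d : nat) (q : nat * nat) : nat * nat :=
  (32 * (2 * p + n.*2 - d) + q.1, 16 * d + q.2).

Definition vpos (v : nat) : nat * nat :=
  let t := v %/ 20 in gpos (t %/ D) (t %% D) (tpos (cty n m H t) (v %% 20)).

Inductive ekind :=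
| KInner of nat & nat & nat
| KWire of nat & nat & nat
| KLeft of nat
| KRight of nat
| KLast
| KCap.

Definition kfst (k : ekind) : nat * nat :=
  match k with
  | KInner p d a => gpos p d (tpos (ty p d) (tsrc (ty p d) a))
  | KWire p d r => gpos p d (16, 16 * r)
  | KLeft d => gpos 0 d (0, 0)
  | KRight d => gpos P.-1 d (16, 16)
  | KLast => gpos 0 n.*2 (0, 0)
  | KCap => gpos P.-1 0 (16, 0)
  end.

Definition ksnd (k : ekind) : nat * nat :=
  match k with
  | KInner p d a => gpos p d (tpos (ty p d) (tdst (ty p d) a))
  | KWire p d r => gpos p d (if (d == 0) && (r == 0) || (d == n.*2) && (r == 1) then 64 else 32, 16 * r)
  | KLeft d => gpos 0 d.+1 (0, 0)
  | KRight d => gpos P.-1 d.+1 (16, 16)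
  | KLast => gpos 0 n.*2 (0, 16)
  | KCap => gpos P.-1 0 (16, 16)
  end.

Definition kvalid (k : ekind) : Prop :=
  match k with
  | KInner p d a => [/\ p < P, d < D & a < 28]
  | KWire p d r => [/\ p < P, d < D, r < 2 & (p.+1 < P) || (0 < d) && (r == 0)]
  | KLeft d => d < n.*2 /\ ~~ odd d
  | KRight d => d < n.*2 /\ odd d
  | KLast | KCap => True
  end.

Definition kcode (k : ekind) : nat :=
  match k with
  | KInner p d a => mk n p d * 30 + a
  | KWire p d r => mk n p d * 30 + 28 + r
  | KLeft d | KRight d => mk n P.-1 d * 30 + 29
  | KLast => mk n P.-1 n.*2 * 30 + 29
  | KCap => mk n P.-1 0 * 30 + 28
  end.

Lemma vpos_vid p d i : d < D -> i < 20 ->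
  vpos (vid (mk n p d, i)) = gpos p d (tpos (ty p d) i).
Proof.
move=> hd hi; rewrite /vpos /vid /=.
have -> : (mk n p d * 20 + i) %/ 20 = mk n p d by lia.
have -> : (mk n p d * 20 + i) %% 20 = i by lia.
by rewrite mkp // mkd.
Qed.

Lemma tpos_port k i : i < 4 -> tpos k i = (if i < 2 then 0 else 16, if odd i then 16 else 0).
Proof. by case: k; case: i => [|[|[|[|]]]]. Qed.

Lemma edge_kind e : e < cT n m * 30 -> exists k, [/\ kvalid k, kcode k = e,
  vpos (vid (eend (cty n m H) (cwend n m) false e)) = kfst k &
  vpos (vid (eend (cty n m H) (cwend n m) true e)) = ksnd k].
Proof.
move=> eT; have /mkP[p [d [hp hd tE]]] : e %/ 30 < cT n m by lia.
have P8 := @cP_gt n m n3; have oD := cD_odd n.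
have eE := divn_eq e 30; case: (ltnP (e %% 30) 28) => he.
  exists (KInner p d (e %% 30)); split=> //=; first by rewrite -tE; lia.
    by rewrite eend_i // tE vpos_vid //; exact: (@tend_lt _ false).
  by rewrite eend_i // tE vpos_vid //; exact: (@tend_lt _ true).
have pP : p.+1 < P \/ p = P.-1 by lia.
rewrite !eend_w // tE.
have [r0|r1] : e %% 30 = 28 \/ e %% 30 = 29 by lia.
  rewrite r0 /cwend; mks => /=; case: (posnP d) => [d0|d0] /=.
    case: ifP => hP.
      exists (KWire p d 0); split=> /=; first by rewrite hP.
      - by rewrite -tE; lia.
      - by rewrite vpos_vid // tpos_port.
      - by rewrite vpos_vid; [|lia|by []]; rewrite tpos_port // d0 /gpos /=; congr pair; lia.
    exists KCap; have -> : p = P.-1 by lia.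
    split=> //=; [|by rewrite vpos_vid // d0 tpos_port..].
    by rewrite eE tE r0 d0; congr (mk _ _ _ * _ + _); lia.
  exists (KWire p d 0); split=> /=; first by rewrite d0 orbT.
  - by rewrite -tE; lia.
  - by rewrite vpos_vid // tpos_port.
  - rewrite vpos_vid; [|lia|by []]; rewrite tpos_port // (gtn_eqF d0) andbF /gpos /=.
    by move: hd; rewrite /cD => hd; congr pair; lia.
rewrite r1 /cwend; mks => /=; case: ifP => hP.
  exists (KWire p d 1); split=> /=; first by rewrite hP.
  - by rewrite -tE; lia.
  - by rewrite vpos_vid // tpos_port.
  - rewrite andbF /=; case: ifP => hd2 /=.
      rewrite vpos_vid //; rewrite tpos_port // /gpos /=.
      have -> : (d == n.*2) = false by move: hd2; rewrite /cD; lia.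
      by rewrite /=; congr pair; move: hd2; rewrite /cD; lia.
    have dE : d = n.*2 by move: hd hd2; rewrite /cD; lia.
    by rewrite vpos_vid // tpos_port // dE eqxx /gpos /=; congr pair; lia.
have {pP}pE : p = P.-1 by lia.
case: ifP => od /=.
  have d1 : d < n.*2 by move: od hd; rewrite /cD; lia.
  exists (KRight d); split=> //=; first by rewrite eE tE r1 pE.
    by rewrite pE vpos_vid // tpos_port.
  by rewrite pE vpos_vid; [rewrite tpos_port|rewrite /cD; lia|by []].
case: ifP => hd2 /=.
  exists (KLeft d); split=> /=; first by split; [move: hd2; rewrite /cD; lia|rewrite od].
  - by rewrite eE tE r1 pE.
  - by rewrite vpos_vid // tpos_port.
  - by rewrite vpos_vid // tpos_port.
have dE : d = n.*2 by move: hd hd2; rewrite /cD; lia.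
exists KLast; split=> //=; first by rewrite eE tE r1 pE dE.
- by rewrite vpos_vid // tpos_port // dE.
- by rewrite vpos_vid // tpos_port // dE.
Qed.

Lemma inner_pos k a : a < 28 -> let q := tpos k (tsrc k a) in let r := tpos k (tdst k a) in
  [/\ q.1 <= 16 /\ q.2 <= 16, r.1 <= 16 /\ r.2 <= 16, 0 < q.1 + r.1,
      0 < q.1 + r.1 + 2 * (q.2 + r.2) &
      (q.1 + r.1 + 2 * (q.2 + r.2) < 96) /\ (k = TX -> q.1 + r.1 < 32)].
Proof.
move=> a28 q r; have /and5P[_ _ _ /allP hp /allP/(_ a)] := tile_drawing_check k.
rewrite mem_iota a28 => /(_ isT)/andP[h1 h2].
have /andP[_ /allP/(_ a)] := tinc_check k; rewrite mem_iota a28 => /(_ isT)/and5P[s20 d20 ne _ _].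
have := hp (tsrc k a); rewrite mem_iota s20 => /(_ isT) /and5P[q1 q2 q3 q4 /andP[q5 q6]].
have := hp (tdst k a); rewrite mem_iota d20 => /(_ isT) /and5P[t1 t2 t3 t4 /andP[t5 t6]].
rewrite -/q -/r in q1 q2 q3 q4 q5 q6 t1 t2 t3 t4 t5 t6 *; split=> //; try lia.
by split; [lia|move=> kX; move: h2; rewrite kX in q4 t4 *; lia].
Qed.

Lemma vert_pos k i : i < 20 -> let q := tpos k i in
  [/\ q.1 <= 16, q.2 <= 16, (q.1 = 0 \/ q.1 = 16) -> (q.2 = 0 \/ q.2 = 16) & True].
Proof.
move=> i20 q; have /and5P[_ _ _ /allP/(_ i)] := tile_drawing_check k.
rewrite mem_iota i20 => /(_ isT) /and5P[q1 q2 q3 q4 _] _; split=> //.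
case: (ltnP i 4) => i4; first by rewrite /q tpos_port //=; case: (odd i); auto.
by move: q3 q4; rewrite -/q; lia.
Qed.

Definition disjoint (a b c d : nat * nat) : Prop := forall s t : R, (0 < s < 1)%R ->
  (0 < t < 1)%R -> segment a b s <> segment c d t.

Lemma disjointC a b c d : disjoint a b c d -> disjoint c d a b.
Proof. by move=> h s t hs ht e; apply: (h t s). Qed.

Lemma sepx a b c d : a.1 <= c.1 -> a.1 <= d.1 -> b.1 <= c.1 -> b.1 <= d.1 ->
  a.1 + b.1 < c.1 + d.1 -> disjoint a b c d.
Proof.
move=> *; move=> s t hs ht; apply: box_sepP => //; apply/orP; left; apply/orP; left.
by rewrite /key_sep; apply/orP; left; lia.
Qed.

Lemma sepy a b c d : a.2 <= c.2 -> a.2 <= d.2 -> b.2 <= c.2 -> b.2 <= d.2 ->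
  a.2 + b.2 < c.2 + d.2 -> disjoint a b c d.
Proof.
move=> *; move=> s t hs ht; apply: box_sepP => //; apply/orP; left; apply/orP; right.
by rewrite /key_sep; apply/orP; left; lia.
Qed.

Lemma sepw a b c d : a.1 + 2 * a.2 <= c.1 + 2 * c.2 -> a.1 + 2 * a.2 <= d.1 + 2 * d.2 ->
  b.1 + 2 * b.2 <= c.1 + 2 * c.2 -> b.1 + 2 * b.2 <= d.1 + 2 * d.2 ->
  a.1 + 2 * a.2 + (b.1 + 2 * b.2) < c.1 + 2 * c.2 + (d.1 + 2 * d.2) -> disjoint a b c d.
Proof.
move=> *; move=> s t hs ht; apply: box_sepP => //; apply/orP; right.
by rewrite /key_sep; apply/orP; left; lia.
Qed.

Ltac kx := apply: sepx; rewrite /gpos /=; lia.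
Ltac ky := apply: sepy; rewrite /gpos /=; lia.
Ltac kw := apply: sepw; rewrite /gpos /=; lia.
Ltac kxC := apply: disjointC; kx.
Ltac kyC := apply: disjointC; ky.
Ltac kwC := apply: disjointC; kw.

Definition krank k := match k with
  | KInner _ _ _ => 0 | KWire _ _ _ => 1 | KLeft _ => 2 | KRight _ => 3 | KLast => 4 | KCap => 5 end.

Lemma gpos_shift p d q : gpos p d q = ((gpos p d (0, 0)).1 + q.1, (gpos p d (0, 0)).2 + q.2).
Proof. by rewrite /gpos /= !addn0. Qed.

Lemma area_shift (u v : nat) (a b c : nat * nat) : let f p := (u + p.1, v + p.2) in
  (area_pos (f a) (f b) (f c) <= area_neg (f a) (f b) (f c)) =
    (area_pos a b c <= area_neg a b c) /\
  (area_neg (f a) (f b) (f c) <= area_pos (f a) (f b) (f c)) =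
    (area_neg a b c <= area_pos a b c).
Proof. by rewrite /area_pos /area_neg /=; split; apply/idP/idP => h; nia. Qed.

Lemma line_sep_shift p d a b c e :
  line_sep (gpos p d a) (gpos p d b) (gpos p d c) (gpos p d e) = line_sep a b c e.
Proof.
rewrite [gpos p d a]gpos_shift [gpos p d b]gpos_shift [gpos p d c]gpos_shift [gpos p d e]gpos_shift.
rewrite /line_sep !eqn_leq; move: (gpos p d _).1 (gpos p d _).2 => u v.
have [h1 h2] := area_shift u v a b c; have [h3 h4] := area_shift u v a b e.
by rewrite /= in h1 h2 h3 h4; rewrite h1 h2 h3 h4.
Qed.

Lemma kinds_disjoint k k' : kvalid k -> kvalid k' -> kcode k <> kcode k' ->
  disjoint (kfst k) (ksnd k) (kfst k') (ksnd k').
Proof.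
have P8 := @cP_gt n m n3; have oD := cD_odd n.
wlog le : k k' / krank k <= krank k'.
  move=> wl v v' ne; case: (leqP (krank k) (krank k')) => h; first exact: wl.
  by apply: disjointC; apply: wl => //; [exact: ltnW|move=> e; apply: ne].
case: k le => [p d a|p d r|d|d||]; case: k' => [p' d' a'|p' d' r'|d'|d'||] //= _; rewrite /cD.
- move=> [hp hd ha] [hp' hd' ha'] ne.
  have [[q1 q2] [r1 r2] f1 f2 [f3 f4]] := inner_pos (ty p d) ha.
  have [[s1 s2] [t1 t2] g1 g2 [g3 g4]] := inner_pos (ty p' d') ha'.
  case: (ltngtP (2 * p + n.*2 - d) (2 * p' + n.*2 - d')) => hX; [kx|kxC|].
  case: (ltngtP d d') => hd3; [ky|kyC|]; have hp3 : p = p' by lia.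
  subst p' d'; move=> s t hs ht.
  have /and5P[/allP/(_ a) + _ _ _ _] := tile_drawing_check (ty p d).
  rewrite mem_iota ha => /(_ isT)/allP/(_ a'); rewrite mem_iota ha' => /(_ isT).
  have -> : (a == a') = false by apply/eqP => e; apply: ne; rewrite e.
  rewrite /= => /orP[] h; first by apply: line_sepP ht _; rewrite line_sep_shift.
  by move/esym; apply: line_sepP hs _; rewrite line_sep_shift.
- move=> [hp hd ha] [hp' hd' hr' hv'] _.
  have [[q1 q2] [r1 r2] f1 f2 [f3 f4]] := inner_pos (ty p d) ha.
  case: (leqP (2 * p + n.*2 - d) (2 * p' + n.*2 - d')) => hX; first by case: ifP => _; kx.
  case: ifP => hs; last by kxC.
  (* A long wire passes by one column of tiles. Its row is [0] or [n.*2], and by parity that column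
     has tiles only in odd rows, all on one side of the wire. *)
  case: (ltnP (2 * p' + n.*2 - d').+1 (2 * p + n.*2 - d)) => hX2; first by kxC.
  by case/orP: hs => /andP[/eqP e1 /eqP e2]; [kyC|ky].
- move=> [hp hd ha] [hd' od'] _.
  have [[q1 q2] [r1 r2] f1 f2 [f3 f4]] := inner_pos (ty p d) ha.
  by kwC.
- move=> [hp hd ha] [hd' od'] _.
  have [[q1 q2] [r1 r2] f1 f2 [f3 f4]] := inner_pos (ty p d) ha.
  by kw.
- move=> [hp hd ha] _ _.
  have [[q1 q2] [r1 r2] f1 f2 [f3 f4]] := inner_pos (ty p d) ha.
  by kxC.
- move=> [hp hd ha] _ _.
  have [[q1 q2] [r1 r2] f1 f2 [f3 f4]] := inner_pos (ty p d) ha.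
  case: (ltnP (2 * p + n.*2 - d) (2 * P.-1 + n.*2)) => hX; first by kx.
  have pE : p = P.-1 by lia.
  have dE : d = 0 by lia.
  have tX : ty p d = TX.
    rewrite /cty pE dE; mks => /=; have -> : (1 == D) = false by rewrite /cD; lia.
    by have -> // : (P.-1 < m * n) = false; rewrite /cP; nia.
  by have f5 := f4 tX; kx.
- move=> [hp hd hr hv] [hp' hd' hr' hv'] ne.
  have {}ne : ~ [/\ p = p', d = d' & r = r'] by case=> *; apply: ne; subst.
  case: (ltngtP (d + r) (d' + r')) => hy; [ky|kyC|].
  case: (ltngtP (2 * p + n.*2 - d) (2 * p' + n.*2 - d')) => hX.
  + by do ?case: ifP => ?; kx.
  + by do ?case: ifP => ?; kxC.
  + by exfalso; apply: ne; split; lia.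
- by move=> [hp hd hr hv] [hd' od'] _; case: ifP => ?; kwC.
- by move=> [hp hd hr hv] [hd' od'] _; case: ifP => ?; kw.
- by move=> [hp hd hr hv] _ _; case: ifP => ?; kxC.
- by move=> [hp hd hr hv] _ _; case: ifP => ?; kx.
- move=> [hd od] [hd' od'] ne; case: (ltngtP d d') => h; [ky|kyC|].
  by exfalso; apply: ne; rewrite h.
- by move=> [hd od] [hd' od'] _; kw.
- by move=> [hd od] _ _; kw.
- by move=> [hd od] _ _; kw.
- move=> [hd od] [hd' od'] ne; case: (ltngtP d d') => h; [ky|kyC|].
  by exfalso; apply: ne; rewrite h.
- by move=> [hd od] _ _; kwC.
- by move=> [hd od] _ _; kwC.
by move=> _ _ _; kx.
Qed.

Lemma kind_vertex k p d i : kvalid k -> p < P -> d < D -> i < 20 ->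
  let q := gpos p d (tpos (ty p d) i) in forall s : R, (0 < s < 1)%R ->
  segment (kfst k) (ksnd k) s <> (q.1%:R, q.2%:R)%R.
Proof.
have P8 := @cP_gt n m n3; have oD := cD_odd n.
move=> v hp hd hi q s hs; rewrite -(segmentxx q (2%:R^-1)%R).
suff : segment (kfst k) (ksnd k) s <> (q.1%:R, q.2%:R)%R by rewrite segmentxx.
have half : (0 < 2%:R^-1 :> R)%R && (2%:R^-1 < 1 :> R)%R by apply/andP; split; lra.
have box : disjoint (kfst k) (ksnd k) q q ->
    segment (kfst k) (ksnd k) s <> (q.1%:R, q.2%:R)%R.
  by move=> h; have := h s _ hs half; rewrite segmentxx.
have [b1 b2 b3 _] := vert_pos (ty p d) hi.
rewrite /cD in hd; case: k v box => [p' d' a|p' d' r|d'|d'||]; rewrite /= /cD.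
- move=> [hp' hd' ha] box.
  have [[s1 s2] [t1 t2] g1 g2 [g3 g4]] := inner_pos (ty p' d') ha.
  case: (ltngtP (2 * p + n.*2 - d) (2 * p' + n.*2 - d')) => hX; [by apply: box; kxC|by apply: box; kx|].
  case: (ltngtP d d') => hd3; [by apply: box; kyC|by apply: box; ky|]; have hp3 : p = p' by lia.
  subst p' d'.
  have /and5P[_ /allP/(_ a) + _ _ _] := tile_drawing_check (ty p d).
  rewrite mem_iota ha => /(_ isT)/allP/(_ i); rewrite mem_iota hi => /(_ isT) /orP[h|h].
    apply: (@segment_point R _ _ q); rewrite /= /q [gpos p d _]gpos_shift [gpos p d (tpos _ (tdst _ _))]gpos_shift.
    rewrite [gpos p d (tpos _ i)]gpos_shift; move: h; rewrite !eqn_leq.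
    set u := (gpos _ _ _).1; set w := (gpos _ _ _).2.
    have /= [-> ->] := area_shift u w (tpos (ty p d) (tsrc (ty p d) a))
      (tpos (ty p d) (tdst (ty p d) a)) (tpos (ty p d) i).
    by [].
  apply: box => s1' t1' hs1 ht1; apply: box_sepP => //.
  move: h; rewrite /box_sep /key_sep /q /gpos /=; lia.
- move=> [hp' hd' hr hv] box; apply: box.
  case: (leqP (2 * p + n.*2 - d) (2 * p' + n.*2 - d')) => hX; first by case: ifP => ?; kxC.
  case: ifP => hs'; last by kx.
  case: (ltnP (2 * p' + n.*2 - d').+1 (2 * p + n.*2 - d)) => hX2; first by kx.
  by case/orP: hs' => /andP[/eqP e1 /eqP e2]; [ky|kyC].
- move=> [hd' od'] box; apply: box.
  case: (leqP (16 * d + (tpos (ty p d) i).2) (16 * d')) => h1; first by kyC.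
  case: (leqP (16 * d'.+1) (16 * d + (tpos (ty p d) i).2)) => h2; first by ky.
  by kw.
- move=> [hd' od'] box; apply: box.
  case: (leqP (16 * d + (tpos (ty p d) i).2) (16 * d' + 16)) => h1; first by kyC.
  case: (leqP (16 * d' + 32) (16 * d + (tpos (ty p d) i).2)) => h2; first by ky.
  by kwC.
- move=> _ box; apply: box.
  case: (posnP (32 * (2 * p + n.*2 - d) + (tpos (ty p d) i).1)) => h; last by kx.
  have [|h3|h3] := b3; [by left; lia|by kyC|by ky].
- move=> _ box; apply: box.
  case: (ltnP (32 * (2 * p + n.*2 - d) + (tpos (ty p d) i).1) (32 * (2 * P.-1 + n.*2) + 16)) => h; first by kxC.
  have [|h3|h3] := b3; [by right; lia|by kyC|by ky].
Qed.

Lemma kcode_inj_disjoint e f : e < cT n m * 30 -> f < cT n m * 30 -> e <> f ->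
  disjoint (vpos (vid (eend (cty n m H) (cwend n m) false e)))
    (vpos (vid (eend (cty n m H) (cwend n m) true e)))
    (vpos (vid (eend (cty n m H) (cwend n m) false f)))
    (vpos (vid (eend (cty n m H) (cwend n m) true f))).
Proof.
move=> /edge_kind[k [vk ck -> ->]] /edge_kind[k' [vk' ck' -> ->]] ne.
by apply: kinds_disjoint => // e'; apply: ne; rewrite -ck -ck'.
Qed.

Lemma vpos_inj u v : u < cT n m * 20 -> v < cT n m * 20 -> vpos u = vpos v -> u = v.
Proof.
move=> hu hv; have /mkP[p [d [hp hd tu]]] : u %/ 20 < cT n m by lia.
have /mkP[p' [d' [hp' hd' tv]]] : v %/ 20 < cT n m by lia.
have -> : u = vid (mk n p d, u %% 20) by rewrite /vid -tu /=; lia.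
have -> : v = vid (mk n p' d', v %% 20) by rewrite /vid -tv /=; lia.
have iu : u %% 20 < 20 by lia.
have iv : v %% 20 < 20 by lia.
rewrite !vpos_vid //; move: (u %% 20) (v %% 20) iu iv => i i' hi hi' {tu tv}.
have [a1 a2 _ _] := vert_pos (ty p d) hi; have [b1 b2 _ _] := vert_pos (ty p' d') hi'.
have oD := cD_odd n.
rewrite /cD in hd hd' *; rewrite /gpos => -[e1 e2].
have dd : d = d' by lia.
have pp : p = p' by lia.
subst d' p'; congr (vid (_, _)).
have /and5P[_ _ /andP[uq /eqP sz] _ _] := tile_drawing_check (ty p d).
apply/eqP; rewrite -(nth_uniq (0, 0) _ _ uq) ?size_take ?sz //= !nth_take //.
by rewrite -pair_eqE /= -!/(tpos _ _); apply/andP; split; apply/eqP; lia.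
Qed.

Lemma cgr_planar : planar R (cgr m H n3).
Proof.
exists (fun v => ((vpos v).1%:R, (vpos v).2%:R)%R).
exists (fun e => @segment R (vpos (src e)) (vpos (dst e))).
have in01 (s : R) : (s \in `]0, 1[ -> 0 < s < 1)%R by rewrite in_itv.
have ptI (u v : 'I_(nv (cgr m H n3))) : vpos u = vpos v -> u = v.
  by move=> e; apply: val_inj; exact: vpos_inj (ltn_ord u) (ltn_ord v) e.
split.
- move=> u v [] /eqP; rewrite eqr_nat => /eqP e1 /eqP; rewrite eqr_nat => /eqP e2.
  by apply: ptI; apply/eqP; rewrite -pair_eqE /= e1 e2 !eqxx.
- move=> e; split; first exact: segment_continuous.
  + move=> s t _ _; apply: segment_inj; apply/eqP => /ptI; exact/eqP/no_loop.
  + by rewrite /segment subr0 !mul0r !mul1r !addr0.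
  + by rewrite /segment subrr !mul0r !mul1r !add0r.
- move=> e v s /in01 hs; have [k [vk _ k1 k2]] := edge_kind (ltn_ord e).
  have vT : v %/ 20 < cT n m by have := ltn_ord v; rewrite /=; lia.
  have /mkP[p [d [hp hd tE]]] := vT.
  have i20 : v %% 20 < 20 by lia.
  have vE : vpos v = gpos p d (tpos (ty p d) (v %% 20)).
    by rewrite -vpos_vid //; congr vpos; rewrite /vid -tE /=; lia.
  have kv := @kind_vertex k p d (v %% 20) vk hp hd i20 s hs.
  by rewrite /= k1 k2; rewrite -vE in kv.
- move=> e f s t nef /in01 hs /in01 ht; apply: kcode_inj_disjoint => //.
  by move=> /val_inj; exact/eqP.
Qed.
End Drawing.

(** * Bandwidth and treewidth *)

Section PathDecomposition.
Variables (T : finType) (adj : rel T).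

Lemma enum_rank_injectiveb : injectiveb [ffun x : T => enum_rank x].
Proof. by apply/injectiveP => x y; rewrite !ffunE; exact: enum_rank_inj. Qed.

Lemma bandwidth_le (f : {ffun T -> 'I_#|T|}) : injectiveb f -> bandwidth adj <= stretch adj f.
Proof.
move=> h; rewrite /bandwidth; case: arg_minnP => [|g _ hg]; first exact: enum_rank_injectiveb.
exact: hg.
Qed.

Lemma bandwidth_witness : exists2 f : {ffun T -> 'I_#|T|}, injective f & bandwidth adj = stretch adj f.
Proof.
rewrite /bandwidth; case: arg_minnP => [|g /injectiveP hg _]; first exact: enum_rank_injectiveb.
by exists g.
Qed.

Lemma stretchP (f : {ffun T -> 'I_#|T|}) c : reflect (forall x y, adj x y -> `|f x - f y|%N <= c) (stretch adj f <= c).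
Proof.
apply: (iffP idP) => [/bigmax_leqP h x y a|h]; first exact: (h (x, y)).
by apply/bigmax_leqP => -[x y] /= a; exact: h.
Qed.

Definition path_rel k : rel 'I_k := [rel i j : 'I_k | (i.+1 == j) || (j.+1 == i)].

Lemma path_rel_connect k (P : pred 'I_k) (i j : 'I_k) :
  (forall l : 'I_k, minn i j <= l <= maxn i j -> P l) ->
  connect [rel a b | [&& path_rel a b, P a & P b]] i j.
Proof.
have sym : connect_sym [rel a b | [&& path_rel a b, P a & P b]].
  by apply: sym_connect_sym => a b; rewrite /path_rel /= orbC [P a && _]andbC.
wlog le : i j / i <= j => [wl hP|].
  case: (leqP i j) => h; first exact: wl h hP.
  by rewrite sym; apply: wl (ltnW h) _; rewrite minnC maxnC.
rewrite (minn_idPl le) (maxn_idPr le).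
have [d dE] : exists d, j = i + d :> nat by exists (j - i); lia.
elim: d i {le} dE => [|d IH] i dE hP.
  by have -> : i = j by apply: val_inj => /=; lia.
have hi : i.+1 < k by have := ltn_ord j; lia.
apply: (@connect_trans _ _ (Ordinal hi)).
  by apply: connect1; rewrite /path_rel /= eqxx !hP //=; lia.
by apply: IH => /= [|l hl]; [lia|apply: hP; lia].
Qed.

(** In a cycle, both neighbours of the largest element would be its predecessor, so the cycle
    repeats a vertex. *)
Lemma path_tree k : is_tree (@path_rel k.+1).
Proof.
split.
- by rewrite card_ord.
- by move=> i j; rewrite /path_rel /= orbC.
- by move=> i; rewrite /path_rel /=; lia.
- move=> i j; have := @path_rel_connect k.+1 predT i j (fun _ _ => isT).
  by apply: connect_sub => a b /=; rewrite !andbT; exact: connect1.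
move=> s s2 us; case: s s2 us => [//|x0 s] s2 us.
have [x xs xmax] : exists2 x, x \in x0 :: s & forall y, y \in x0 :: s -> y <= x.
  by case: (arg_maxnP (fun y : 'I_k.+1 => val y) (mem_head x0 s)) => x h1 h2; exists x.
case: (rot_to xs) => i r rE; have := us; rewrite -(rot_ucycle i) rE.
move: s2; rewrite -(size_rot i) rE => s2.
have {}xmax y : y \in r -> y <= x by move=> h; apply: xmax; rewrite -(mem_rot i) rE inE h orbT.
case: r xmax s2 {rE us} => [//|y r]  xmax; case/lastP: r xmax => [//|r z] xmax _.
rewrite /ucycle /cycle rcons_path last_cons last_rcons => /andP[/andP[/andP[xy _] zx]].
have hy : y.+1 = x by have := xmax y (mem_head _ _); move: xy; rewrite /path_rel /=; lia.
have hz : z.+1 = x by have := xmax z; rewrite inE mem_rcons mem_head orbT => /(_ isT); move: zx; rewrite /path_rel /=; lia.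
have -> : z = y by apply: val_inj => /=; lia.
by rewrite /= mem_rcons mem_head andbF.
Qed.

(** The windows of [c.+1] consecutive positions in an optimal numbering form a path
    decomposition. *)
Lemma bandwidth_treewidth c : bandwidth adj <= c -> treewidth_at_most adj c.
Proof.
have [f fI ->] := bandwidth_witness => /stretchP hf.
(* One window more than there are vertices keeps the tree nonempty for the empty graph. *)
exists 'I_#|T|.+1, (@path_rel _), (fun i : 'I_#|T|.+1 => [set x | i <= f x <= i + c]); split; last first.
  move=> i; rewrite cardE -(size_map (fun x => val (f x))).
  rewrite -(size_iota i c.+1); apply: uniq_leq_size.
    by rewrite map_inj_uniq ?enum_uniq // => x y /val_inj/fI.
  by move=> _ /mapP[x hx ->]; move: hx; rewrite mem_enum inE mem_iota /=; lia.
split; first exact: path_tree.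
- by move=> x; exists (widen_ord (leqnSn _) (f x)); rewrite inE /=; lia.
- move=> x y /hf h.
  wlog le : x y h / f x <= f y.
    move=> wl; case: (leqP (f x) (f y)) => l; first exact: wl.
    by case: (wl y x) => [||i]; [rewrite distnC|exact: ltnW|rewrite andbC; exists i].
  exists (widen_ord (leqnSn _) (f x)); move: h; rewrite distnEr // !inE /= leq_subLR => h.
  by rewrite leqnn leq_addr le h.
- move=> x i j; rewrite !inE => hi hj.
  by apply: (@path_rel_connect _ (fun k => x \in [set x | k <= f x <= k + c])) => l; rewrite inE; lia.
Qed.
End PathDecomposition.

Section CircuitBandwidth.
Variables (n m : nat) (H : rel nat).
Hypothesis n3 : 3 <= n.

(** Joined tiles have numbers at most [cD + 1] apart. The borders cause no longer edges, as their
    wires are closed within the first or within the last row. *)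
Lemma cgr_edge_length e : e < cT n m * 30 ->
  let u := vid (eend (cty n m H) (cwend n m) false e) in
  let v := vid (eend (cty n m H) (cwend n m) true e) in
  (u <= v + 20 * (n.*2 + 3)) && (v <= u + 20 * (n.*2 + 3)).
Proof.
move=> eT; rewrite /vid /=.
suff [h1 h2 h3 h4] : [/\ (eend (cty n m H) (cwend n m) false e).2 < 20,
    (eend (cty n m H) (cwend n m) true e).2 < 20,
    (eend (cty n m H) (cwend n m) false e).1 <= (eend (cty n m H) (cwend n m) true e).1 + n.*2.+2 &
    (eend (cty n m H) (cwend n m) true e).1 <= (eend (cty n m H) (cwend n m) false e).1 + n.*2.+2].
  by move: h1 h2 h3 h4; move: (eend _ _ _ _) (eend _ _ _ _) => [a b] [c d] /=; lia.
case: (ltnP (e %% 30) 28) => he.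
  by rewrite !eend_i //=; split; rewrite ?leq_addr //; [exact: (@tend_lt _ false)|exact: (@tend_lt _ true)].
have [a1 a2] := @cwendV n m n3 false (e %/ 30) (e %% 30 - 28) ltac:(lia) ltac:(lia).
have [b1 b2] := @cwendV n m n3 true (e %/ 30) (e %% 30 - 28) ltac:(lia) ltac:(lia).
rewrite !eend_w //; split; [lia|lia|..]; have : e %/ 30 < cT n m by lia.
all: move: (e %/ 30) (e %% 30 - 28) => t r /mkP[p [d [hp hd ->]]]; rewrite /cwend.
all: repeat (first [rewrite mkp; [|by lia] | rewrite mkd; [|by lia]]).
all: do ?case: ifP => /= *; rewrite /mk /cD in hd *; try nia.
Qed.

Lemma cgr_bandwidth : bandwidth (@adjacent (cgr m H n3)) <= 20 * (n.*2 + 3).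
Proof.
apply: leq_trans (bandwidth_le _ (enum_rank_injectiveb _)) _.
apply/stretchP => x y /existsP[e /eqP]; rewrite !ffunE !enum_rank_ord /= => h.
have /andP := cgr_edge_length (ltn_ord e).
have /orP : (x == src e) && (y == dst e) || (x == dst e) && (y == src e).
  have ne := no_loop e.
  have : src e \in [set x; y] by rewrite -h set21.
  have : dst e \in [set x; y] by rewrite -h set22.
  by rewrite !inE => /orP[]/eqP d1 /orP[]/eqP s1; move: ne; rewrite s1 d1 ?eqxx ?orbT.
by case=> /andP[/eqP-> /eqP->] /=; lia.
Qed.
End CircuitBandwidth.

(** * Rewriting words one letter at a time *)

Section Letters.
Variable X : finType.

(* A word [x] of symbols is represented by its overlapping pairs
   [LP (x j, x j.+1)]. Rewriting the pair at [j] passes through [LT] (before)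
   and [LT'] (after), which are locked by [LL] on the left and [LR] on the
   right, so that only one letter changes at a time. *)
Inductive letter :=
| LP of X & X | LT of X & X | LT' of X & X | LL of X & (X * X) | LR of (X * X) & X | LA.

Definition letter_code (a : letter) : X * X + X * X + (X * X + X * (X * X)) + ((X * X) * X + unit) :=
  match a with
  | LP x y => inl (inl (inl (x, y))) | LT x y => inl (inl (inr (x, y)))
  | LT' x y => inl (inr (inl (x, y))) | LL z p => inl (inr (inr (z, p)))
  | LR p t => inr (inl (p, t)) | LA => inr (inr tt)
  end.
Definition letter_decode x : letter :=
  match x with
  | inl (inl (inl (x, y))) => LP x y | inl (inl (inr (x, y))) => LT x y
  | inl (inr (inl (x, y))) => LT' x y | inl (inr (inr (z, p))) => LL z p
  | inr (inl (p, t)) => LR p t | inr (inr tt) => LA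
  end.
Lemma letter_codeK : cancel letter_code letter_decode. Proof. by case. Qed.
End Letters.

Module LetterFinite.
HB.instance Definition _ (X : finType) := Equality.copy (letter X) (can_type (@letter_codeK X)).
HB.instance Definition _ (X : finType) := Choice.copy (letter X) (can_type (@letter_codeK X)).
HB.instance Definition _ (X : finType) := Countable.copy (letter X) (can_type (@letter_codeK X)).
HB.instance Definition _ (X : finType) : isFinite (letter X) := CanIsFinite (@letter_codeK X).
End LetterFinite.
Export LetterFinite.

Section LetterNumbers.
Variable X : finType.
Notation letter := (letter X).
Arguments LA {X}.

Definition lenc (a : letter) : nat := index a (enum {: letter}).
Definition ldec (k : nat) : letter := nth LA (enum {: letter}) k.

Lemma lencK : cancel lenc ldec.
Proof. by move=> a; rewrite /ldec nth_index // mem_enum. Qed.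

Lemma lenc_lt a : lenc a < #|{: letter}|.
Proof. by rewrite cardE index_mem mem_enum. Qed.

End LetterNumbers.
Arguments LA {X}.

Section Rewriting.
Variables (X : finType) (f : X * X -> X * X) (lm rm : X) (hd acc : pred X).
Notation active x y := (f (x, y) != (x, y)).
Definition plain x := (x != lm) && (x != rm).

Hypothesis lrm : lm != rm.
Hypothesis active_hd : forall x y, active x y ->
  [/\ hd x (+) hd y, plain x, plain y, hd (f (x, y)).1 (+) hd (f (x, y)).2
    & plain (f (x, y)).1 && plain (f (x, y)).2].
Hypothesis active_det : forall x h y, hd h -> active x h -> ~~ active h y.
Hypothesis acc_hd : forall h, acc h -> hd h.
Hypothesis hd_plain : forall h, hd h -> plain h.
Hypothesis acc_stop : forall h x, acc h -> ~~ active x h /\ ~~ active h x.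

Variables (m : nat).
Hypothesis m4 : 4 < m.

(** The conditions on end marks let them propagate outwards, so that the outermost letters are
    determined by their single neighbour. *)
Definition lvalid (a : letter X) : bool :=
  match a with
  | LP u v => ((v == lm) ==> (u == lm)) && ((u == rm) ==> (v == rm))
  | LT x y | LT' x y => active x y
  | LL z p => active p.1 p.2 && (z != rm)
  | LR p t => active p.1 p.2 && (t != lm)
  | LA => true
  end.

(** A lock shows the pair being rewritten and fits it before and after; an unlocked neighbour shows
    the old or the new symbol. So [LT] and [LT'] can be exchanged only if each side is locked or its
    symbol does not change. [LA] stands only to the left of an accepting head or of another [LA],
    and thus spreads to the left end, where it is tested. *)
Definition lcompat (a b : letter X) : bool :=
  match a, b with
  | LP u v, LP x y => v == x
  | LP u v, LT x y => v == x
  | LP u v, LT' x y => v == (f (x, y)).1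
  | LP u v, LL z _ => v == z
  | LL _ p, LT x y | LL _ p, LT' x y => p == (x, y)
  | LT x y, LP u v => y == u
  | LT' x y, LP u v => (f (x, y)).2 == u
  | LT x y, LR p _ | LT' x y, LR p _ => p == (x, y)
  | LR _ t, LP u v => t == u
  | LP u v, LA => v != rm
  | LA, LA => true
  | LA, LP h _ => acc h
  | _, _ => false
  end.

Definition Hl a b := [&& lvalid a, lvalid b & lcompat a b].

Definition upd2 (c : nat -> X) j (p : X * X) i := if i == j then p.1 else if i == j.+1 then p.2 else c i.
Definition rw (c : nat -> X) j := upd2 c j (f (c j, c j.+1)).

Record wf (c : nat -> X) : Prop := Wf {
  wf_l : c 0 = lm /\ c 1 = lm;
  wf_r : c m.-1 = rm /\ c m = rm;
  wf_in : forall i, 1 < i < m.-1 -> plain (c i);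
  wf_hd : exists p, forall i, hd (c i) = (i == p) }.

Variable cT : nat -> X.

(** Unlike the words of a run, the words leading to [cT] are closed under backward steps, which a
    reversible system cannot exclude. *)
Inductive leads : (nat -> X) -> Prop :=
| leads0 : leads cT
| leadsS c j : j < m -> active (c j) (c j.+1) -> leads (rw c j) -> leads c.

(** An active pair contains the only head. Two different ones would lie on either side of it, which
    [active_det] rules out. *)
Lemma active_uniq c i j : wf c -> active (c i) (c i.+1) -> active (c j) (c j.+1) -> i = j.
Proof.
move=> /wf_hd[p hp] ai aj; have [hi _ _ _ _] := active_hd ai; have [hj _ _ _ _] := active_hd aj.
rewrite !hp in hi hj.
have [->//|ne] := eqVneq i j; exfalso.
have [[e1 e2]|[e1 e2]] : (i.+1 = p /\ j = p) \/ (i = p /\ j.+1 = p) by lia.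
  move: ai aj; rewrite e1 e2 => ai aj.
  by have := @active_det (c i) (c p) (c p.+1) _ ai; rewrite aj hp eqxx => /(_ isT).
move: ai aj; rewrite e2 e1 => ai aj.
by have := @active_det (c j) (c p) (c p.+1) _ aj; rewrite ai hp eqxx => /(_ isT).
Qed.

Lemma active_range c j : wf c -> j < m -> active (c j) (c j.+1) -> 1 < j /\ j.+2 < m.
Proof.
move=> [[l0 l1] [r0 r1] _ _] jm /active_hd[_ /andP[p1 p2] /andP[p3 p4] _ _].
have j0 : j <> 0 by move=> e; rewrite e l0 eqxx in p1.
have j1 : j <> 1 by move=> e; rewrite e l1 eqxx in p1.
have jr : j <> m.-1 by move=> e; rewrite e r0 eqxx in p2.
have jr' : j.+1 <> m.-1 by move=> e; rewrite e r0 eqxx in p4.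
by lia.
Qed.

Lemma upd2_wf c j p : wf c -> 1 < j -> j.+2 < m -> hd (c j) (+) hd (c j.+1) -> hd p.1 (+) hd p.2 ->
  plain p.1 -> plain p.2 -> wf (upd2 c j p).
Proof.
move=> [[l0 l1] [r0 r1] hin [q hq]] j1 jm hc hp p1 p2; split.
- by rewrite /upd2; do 4 (case: eqP; first lia); move=> *.
- by rewrite /upd2; do 4 (case: eqP; first lia); move=> *.
- by move=> i hi; rewrite /upd2; case: eqP => // _; case: eqP => // _; exact: hin.
- rewrite !hq in hc; exists (if hd p.1 then j else j.+1) => i; rewrite /upd2.
  case: eqP => [->|ij]; first by case: (hd p.1) => //; rewrite ?eqxx //; lia.
  case: eqP => [->|ij1]; last by rewrite hq; case: (hd p.1); lia.
  by move: hp; case: (hd p.1); case: (hd p.2) => //= _; lia.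
Qed.

Lemma rw_wf c j : wf c -> j < m -> active (c j) (c j.+1) -> wf (rw c j).
Proof.
move=> wc jm a; have [j1 j2] := active_range wc jm a.
by have [h1 h2 h3 h4 /andP[h5 h6]] := active_hd a; apply: upd2_wf.
Qed.

Lemma rw_leads c j : wf c -> j < m -> (forall i, i < m -> ~~ active (cT i) (cT i.+1)) ->
  active (c j) (c j.+1) -> leads c -> leads (rw c j).
Proof.
move=> wc jm stop a l; case: l wc a => [|c' j' jm' a' l'] wc a; first by rewrite (negbTE (stop j jm)) in a.
by rewrite (active_uniq wc a a').
Qed.

Hypothesis cT_stop : forall i, i < m -> ~~ active (cT i) (cT i.+1).

Definition cur (c : nat -> X) j (b : bool) := if b then f (c j, c j.+1) else (c j, c j.+1).
Definition pword (c : nat -> X) i : letter X := LP (c i) (c i.+1).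
(** The word during the rewriting of the pair at [j]: [b] tells whether the exchange has been made,
    [l] and [r] which locks are set. *)
Definition form (c : nat -> X) j (b l r : bool) i : letter X :=
  if i == j then (if b then LT' (c j) (c j.+1) else LT (c j) (c j.+1))
  else if i.+1 == j then (if l then LL (c i) (c j, c j.+1) else LP (c i) (cur c j b).1)
  else if i == j.+1 then (if r then LR (c j, c j.+1) (c i.+1) else LP (cur c j b).2 (c i.+1))
  else LP (c i) (c i.+1).

Definition lword (V : nat -> letter X) := forall i, i.+1 < m -> Hl (V i) (V i.+1).

Inductive good (V : nat -> letter X) : Prop :=
| GoodP c of wf c & leads c & (forall i, i < m -> V i = pword c i)
| GoodF c j b l r of wf c & leads c & j < m & active (c j) (c j.+1)
    & (forall i, i < m -> V i = form c j b l r i).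

Lemma curc_good c j b : wf c -> leads c -> j < m -> active (c j) (c j.+1) ->
  let e := if b then rw c j else c in wf e /\ leads e.
Proof. by case: b => wc lc jm a /=; split=> //; [exact: rw_wf|exact: rw_leads]. Qed.

Lemma form_pword c j b i : i != j ->
  form c j b false false i = pword (if b then rw c j else c) i.
Proof.
move=> ij; rewrite /form /pword (negbTE ij) /cur; case: b; rewrite /rw /upd2 ?(negbTE ij).
  by case: eqP => [e|]; case: eqP => // e2; rewrite ?eqSS ?(negbTE ij) //; do ?case: eqP => //; try lia; move=> *; subst.
by case: eqP => [<-|_] //; case: eqP => [->|_].
Qed.

Lemma plain_range c i : wf c -> i < m -> plain (c i) -> plain (c i.+1) -> 1 < i /\ i.+2 < m.
Proof.
move=> [[l0 l1] [r0 r1] _ _] im /andP[p1 p2] /andP[p3 p4].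
have j0 : i <> 0 by move=> e; rewrite e l0 eqxx in p1.
have j1 : i <> 1 by move=> e; rewrite e l1 eqxx in p1.
have jr : i <> m.-1 by move=> e; rewrite e r0 eqxx in p2.
have jr' : i.+1 <> m.-1 by move=> e; rewrite e r0 eqxx in p4.
by lia.
Qed.

Lemma wf_lm c k : wf c -> k <= m -> c k = lm -> k <= 1.
Proof.
move=> [_ [r0 r1] hin _] km ck; case: (leqP k 1) => // k1.
have [e|[e|h]] : k = m \/ k = m.-1 \/ 1 < k < m.-1 by lia.
- by move: lrm; rewrite -ck e r1 eqxx.
- by move: lrm; rewrite -ck e r0 eqxx.
- by have := hin k h; rewrite /plain ck eqxx.
Qed.

Lemma wf_rm c k : wf c -> k <= m -> c k = rm -> m.-1 <= k.
Proof.
move=> [[l0 l1] _ hin _] km ck; case: (leqP m.-1 k) => // k1.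
have [e|[e|h]] : k = 0 \/ k = 1 \/ 1 < k < m.-1 by lia.
- by move: lrm; rewrite -ck e l0 eqxx.
- by move: lrm; rewrite -ck e l1 eqxx.
- by have := hin k h; rewrite /plain ck eqxx andbF.
Qed.

Lemma good_pchange e V i : wf e -> leads e -> i < m -> lword V -> V i <> LA ->
  (forall k, k < m -> k != i -> V k = pword e k) -> good V.
Proof.
move=> we le im vV nA hV; have [[l0 l1] [r0 r1] hin [q hq]] := we.
have hl : 0 < i -> exists z, Hl (LP z (e i)) (V i).
  move=> i0; exists (e i.-1); have := vV i.-1; rewrite prednK // => /(_ im).
  by rewrite hV; [rewrite /pword prednK|lia|lia].
have hr : i.+1 < m -> exists t, Hl (V i) (LP (e i.+1) t).
  by move=> i1; exists (e i.+2); have := vV i i1; rewrite (hV i.+1) //; lia.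
have i0m : 0 < i \/ i = 0 /\ i.+1 < m by lia.
have imm : i.+1 < m \/ i = m.-1 /\ 0 < i by lia.
have em : i = m.-1 -> e i.+1 = rm by move=> ->; rewrite prednK //; lia.
have done_form c b : wf c -> leads c -> active (c i) (c i.+1) -> (if b then rw c i else c) = e ->
    V i = form c i b false false i -> good V.
  move=> wc lc a ce Vi; apply: (@GoodF _ c i b false false) => //.
  by move=> k km; case: (eqVneq k i) => [->//|ki]; rewrite hV // form_pword // ce.
have lvV : lvalid (V i) by case: imm => [/hr[t /and3P[]]//|[_ /hl[z /and3P[]]]].
case Vi : (V i) nA lvV => [u v|u v|u v|z p|p t|] // _ lvV; rewrite Vi in hl hr done_form.
- have eu : u = e i.
    case: i0m => [/hl[z /and3P[_ _ /eqP->]]//|[i0 /hr[t /and3P[_ _ /eqP ev]]]].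
    by move: lvV; rewrite /= ev i0 l1 eqxx /= l0 => /andP[/eqP-> _].
  have ev : v = e i.+1.
    case: imm => [/hr[t /and3P[_ _ /eqP->]]//|[im1 _]]; rewrite em //.
    by move: lvV; rewrite /= eu im1 r0 eqxx /= => /andP[_ /eqP->].
  apply: (@GoodP _ e) => // k km; case: (eqVneq k i) => [->|ki]; last exact: hV.
  by rewrite Vi eu ev.
- have [_ /andP[u1 u2] /andP[v1 v2] _ _] := active_hd lvV.
  have eu : u = e i.
    case: i0m => [/hl[z /and3P[_ _ /eqP->]]//|[i0 /hr[t /and3P[_ _ /eqP ev]]]].
    by rewrite ev i0 l1 eqxx in v1.
  have ev : v = e i.+1.
    case: imm => [/hr[t /and3P[_ _ /eqP->]]//|[im1 /hl[z /and3P[_ _ /eqP eu']]]].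
    by rewrite -eu' im1 r0 eqxx in u2.
  by rewrite eu ev in lvV done_form; apply: (done_form e false) => //; rewrite /form eqxx.
- have [x1 pu pv x2 /andP[p1 p2]] := active_hd lvV.
  have eu : e i = (f (u, v)).1.
    case: i0m => [/hl[z /and3P[_ _ /eqP->]]//|[i0 /hr[t /and3P[_ _ /eqP ev]]]].
    by move: p2; rewrite ev i0 l1 /plain eqxx.
  have ev : e i.+1 = (f (u, v)).2.
    case: imm => [/hr[t /and3P[_ _ /eqP->]]//|[im1 /hl[z /and3P[_ _ /eqP eu']]]].
    by move: p1; rewrite -eu' im1 r0 /plain eqxx andbF.
  have [j1 j2] : 1 < i /\ i.+2 < m by apply: (plain_range we im); rewrite ?eu ?ev.
  (* A new [LT'] begins a rewriting read backwards: [c] is the word before it, and it leads to [cT]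
     through [e]. *)
  pose c := upd2 e i (u, v).
  have ci : c i = u by rewrite /c /upd2 eqxx.
  have ci1 : c i.+1 = v by rewrite /c /upd2 eqxx (gtn_eqF (ltnSn i)).
  have rwE : rw c i = e.
    apply: boolp.funext => k; rewrite /rw ci ci1 /upd2; case: eqP => [->//|n1].
    by case: eqP => [->//|n2]; rewrite /c /upd2 (introF eqP n1) (introF eqP n2).
  have wc : wf c by apply: upd2_wf => //; rewrite eu ev.
  have ac : active (c i) (c i.+1) by rewrite ci ci1.
  apply: (done_form c true) => //; first by apply: leadsS ac _ => //; rewrite rwE.
  by rewrite /form eqxx ci ci1.
- case: imm => [/hr[t /and3P[]]//|[im1 /hl[y /and3P[_ _ /eqP ez]]]].
  by move: lvV; rewrite /= -ez im1 r0 eqxx andbF.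
- case: i0m => [/hl[z /and3P[]]//|[i0 /hr[y /and3P[_ _ /eqP ez]]]].
  by move: lvV; rewrite /= ez i0 l1 eqxx andbF.
Qed.

Lemma pword_lvalid c i : wf c -> i < m -> lvalid (pword c i).
Proof.
move=> wc im; have [[l0 l1] [r0 r1] _ _] := wc; rewrite /=; apply/andP; split; apply/implyP => /eqP h.
  have := wf_lm wc im h; case: i im h => [|i] //; first by rewrite l0.
have := wf_rm wc (ltnW im) h => h2; have -> : i.+1 = m by lia.
by rewrite r1.
Qed.

Lemma pword_valid c : wf c -> lword (pword c).
Proof. by move=> wc i im; rewrite /Hl !pword_lvalid //= ?eqxx //; lia. Qed.

Lemma cur_plain c j b : active (c j) (c j.+1) -> plain (cur c j b).1 /\ plain (cur c j b).2.
Proof. by case/active_hd => _ p1 p2 _ /andP[p3 p4]; case: b. Qed.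

Lemma form_valid c j b l r : wf c -> j < m -> active (c j) (c j.+1) -> lword (form c j b l r).
Proof.
move=> wc jm a i im; have [j1 j2] := active_range wc jm a.
have [/andP[p1 p2] /andP[p3 p4]] := cur_plain b a.
have nrm k : k < m.-1 -> c k != rm by move=> hk; apply/eqP => /(wf_rm wc); lia.
have nlm k : 1 < k <= m -> c k != lm by move=> hk; apply/eqP => /(wf_lm wc); lia.
have lvP k : k < m -> lvalid (LP (c k) (c k.+1)) by exact: pword_lvalid.
have lv k : k < m -> lvalid (form c j b l r k).
  move=> km; rewrite /form; case: eqP => [e|_]; first by case: (b).
  case: eqP => [e|_]; first by case: (l) => /=; rewrite ?a ?nrm ?(negbTE p1) ?(negbTE (nrm _ _)) //; lia.
  case: eqP => [e|_]; last exact: lvP.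
  by case: (r) => /=; rewrite ?a ?nlm ?(negbTE p4) ?(negbTE (nlm _ _)) //; lia.
rewrite /Hl !lv //=; last lia.
rewrite /form; have [h|[h|[h|[h|[h|h]]]]] : i.+2 < j \/ i.+2 = j \/ i.+1 = j \/ i = j \/ i = j.+1 \/ j.+1 < i by lia.
all: eqs; try (by rewrite /= eqxx).
- by case: (l); rewrite /= eqxx.
- by rewrite ?h; case: (l); case: (b); rewrite /= ?eqxx.
- by rewrite ?h; case: (r); case: (b); rewrite /= ?eqxx.
- by case: (r); rewrite /= eqxx.
Qed.

(** During a rewriting at [j], a change at [j] can only exchange [LT] and [LT'], or end the
    rewriting when no lock is set; a change beside [j] only sets or releases a lock. Elsewhere the
    letter is forced, for a second rewriting would need a second head. *)
Lemma good_step V V' i : good V -> lword V' -> i < m -> V' i <> LA ->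
  (forall k, k != i -> V' k = V k) -> good V'.
Proof.
move=> gV vV' im nA hV; case: gV => [c wc lc h|c j b l r wc lc jm a h].
  by apply: (good_pchange wc lc im vV' nA) => k km ki; rewrite hV // h.
have [j1 j2] := active_range wc jm a.
have [we le] := curc_good b wc lc jm a.
have vk k : k < m -> k != i -> V' k = form c j b l r k by move=> km ki; rewrite hV // h.
have hl k : k.+1 = i -> Hl (form c j b l r k) (V' i).
  by move=> e; rewrite -vk; [rewrite -e; apply: vV'; lia|lia|lia].
have hr : i.+1 < m -> Hl (V' i) (form c j b l r i.+1).
  by move=> i1; rewrite -vk; [exact: vV'|lia|lia].
have [ij|ij] := eqVneq i j.
  have [lr|lr] := boolP (l || r); last first.
    have [l0 r0] : l = false /\ r = false by case: (l) lr; case: (r).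
    apply: (good_pchange we le im vV' nA) => k km ki.
    by rewrite vk // l0 r0 form_pword // -ij.
  have := hl j.-1; rewrite ij prednK; last lia.
  move/(_ erefl); rewrite /form; eqs => {}hl; move: hr; rewrite ij /form; eqs => /(_ ltac:(lia)) {}hr.
  have [b' [Vj c1 c2]] : exists b', [/\ V' j = (if b' then LT' (c j) (c j.+1) else LT (c j) (c j.+1)),
      l || ((cur c j b').1 == (cur c j b).1) & r || ((cur c j b').2 == (cur c j b).2)].
    case Vj : (V' j) nA hl hr => [u v|u v|u v|z p|p t|] nA /and3P[_ _ hl] /and3P[_ _ hr]; move: hl hr lr.
    + by case: (l); case: (r).
    + case: (l); case: (r) => //=.
      * by move=> /eqP[-> ->] _ _; exists false.
      * by move=> /eqP[<- <-] hr _; exists false.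
      * by move=> hl /eqP[eu ev] _; exists false; rewrite -eu -ev in hl *; split=> //; rewrite eq_sym; exact: hl.
    + case: (l); case: (r) => //=.
      * by move=> /eqP[-> ->] _ _; exists true.
      * by move=> /eqP[<- <-] hr _; exists true.
      * by move=> hl /eqP[eu ev] _; exists true; rewrite -eu -ev in hl *; split=> //; rewrite eq_sym; exact: hl.
    + by case: (l); case: (r).
    + by case: (l); case: (r).
    + by move: nA; rewrite ij Vj.
  apply: (@GoodF _ c j b' l r) => // k km; case: (eqVneq k j) => [->|kj]; first by rewrite Vj /form eqxx.
  rewrite vk ?ij // /form (negbTE kj); case: ifP => _; first by case: (l) c1 => //= /eqP->.
  by case: ifP => // _; case: (r) c2 => //= /eqP->.
have plainj := cur_plain b a.
have [ij1|ij1] := eqVneq i.+1 j.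
  have := hr; rewrite ij1 => /(_ jm); rewrite /form eqxx => {}hr.
  have := hl i.-1; rewrite prednK; last lia.
  move/(_ erefl); rewrite /form; eqs => {}hl.
  have {hl} hl : Hl (LP (c i.-1) (c i)) (V' i) by move: hl; rewrite prednK //; lia.
  have [l' Vi] : exists l', V' i = if l' then LL (c i) (c j, c j.+1) else LP (c i) (cur c j b).1.
    case: (V' i) hl hr => [u v|u v|u v|z p|p t|] /and3P[_ _ hl] /and3P[_ _]; rewrite /cur.
    + by move: hl => /= /eqP <-; case: (b) => /= /eqP->; exists false.
    + by case: (b).
    + by case: (b).
    + by move: hl => /= /eqP <-; case: (b) => /= /eqP->; exists true.
    + by case: (b).
    + by case: (b).
  apply: (@GoodF _ c j b l' r) => // k km; case: (eqVneq k i) => [->|ki].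
    by rewrite Vi /form; eqs.
  by rewrite vk // /form; case: eqP => //; case: eqP => //; lia.
have [ij2|ij2] := eqVneq i j.+1.
  have := hl j; rewrite ij2 => /(_ erefl); rewrite /form eqxx => {}hl.
  have := hr; rewrite ij2 => /(_ j2); rewrite /form; eqs => {}hr.
  have [r' Vi] : exists r', V' i = if r' then LR (c j, c j.+1) (c j.+2) else LP (cur c j b).2 (c j.+2).
    rewrite ij2; case: (V' j.+1) hl hr => [u v|u v|u v|z p|p t|] /and3P[_ _ hl] /and3P[_ _]; move: hl; rewrite /cur.
    + by case: (b) => /= /eqP<- /eqP->; exists false.
    + by case: (b).
    + by case: (b).
    + by case: (b).
    + by case: (b) => /= /eqP-> /eqP->; exists true.
    + by case: (b).
  apply: (@GoodF _ c j b l r') => // k km; case: (eqVneq k i) => [->|ki].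
    by rewrite Vi /form ij2; eqs.
  by rewrite vk // /form; case: eqP => //; case: eqP => //; case: eqP => //; lia.
have [[l0 l1] [r0 r1] _ [q hq]] := wc.
have jq : j = q \/ j.+1 = q by have [x _ _ _ _] := active_hd a; move: x; rewrite !hq; lia.
have nohd : ~~ hd (c i) /\ ~~ hd (c i.+1) by rewrite !hq; split; lia.
have i0m : 0 < i \/ i = 0 /\ i.+1 < m by lia.
have imm : i.+1 < m \/ i = m.-1 /\ 0 < i by lia.
have fl : 0 < i -> (exists z, Hl (LP z (c i)) (V' i)) \/ Hl (LR (c j, c j.+1) (c i)) (V' i).
  move=> i0; have := hl i.-1 ltac:(lia); rewrite /form prednK //.
  by eqs; case: eqP => _; [case: (r) => h1; [right|left; eexists; exact: h1]|move=> h1; left; eexists; exact: h1].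
have fr : i.+1 < m -> (exists t, Hl (V' i) (LP (c i.+1) t)) \/ Hl (V' i) (LL (c i.+1) (c j, c j.+1)).
  move=> i1; have := hr i1; rewrite /form.
  by eqs; case: eqP => _; [case: (l) => h1; [right|left; eexists; exact: h1]|move=> h1; left; eexists; exact: h1].
suff Vi : V' i = LP (c i) (c i.+1).
  apply: (@GoodF _ c j b l r) => // k km; case: (eqVneq k i) => [->|]; last exact: vk.
  by rewrite Vi /form; eqs.
have lvV : lvalid (V' i).
  by case: imm => [/fr[[t]|]/and3P[]//|[_ /fl[[z]|]/and3P[]]].
case: (V' i) nA lvV fl fr => [u v|u v|u v|z p|p t|] // _ lvV fl fr.
- have eu : u = c i.
    case: i0m => [/fl[[z]|]/and3P[_ _ /eqP->]//|[i0 /fr hh]].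
    have ev : v = c i.+1 by case: hh => [[t]|]/and3P[_ _ /eqP->].
    by move: lvV; rewrite /= ev i0 l1 eqxx /= l0 => /andP[/eqP-> _].
  rewrite eu; congr LP; case: imm => [/fr[[t]|]/and3P[_ _ /eqP->]//|[im1 _]].
  move: lvV; rewrite /= eu im1 r0 eqxx /= => /andP[_ /eqP->].
  by rewrite (_ : m.-1.+1 = m) ?r1 //; lia.
- have [x /andP[u1 u2] /andP[v1 v2] _ _] := active_hd lvV; exfalso.
  have eu : u = c i.
    case: i0m => [/fl[[z]|]/and3P[_ _]//= /eqP->//|[i0 /fr[[t]|]/and3P[_ _]//= /eqP ev]].
    by rewrite ev i0 l1 eqxx in v1.
  have ev : v = c i.+1.
    case: imm => [/fr[[t]|]/and3P[_ _]//= /eqP->//|[im1 _]].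
    by rewrite eu im1 r0 eqxx in u2.
  by move: x; rewrite eu ev (negbTE nohd.1) (negbTE nohd.2).
- have [_ _ _ x /andP[p1 p2]] := active_hd lvV; exfalso.
  have eu : (f (u, v)).1 = c i.
    case: i0m => [/fl[[z]|]/and3P[_ _]//= /eqP->//|[i0 /fr[[t]|]/and3P[_ _]//= /eqP ev]].
    by move: p2; rewrite ev i0 l1 /plain eqxx.
  have ev : (f (u, v)).2 = c i.+1.
    case: imm => [/fr[[t]|]/and3P[_ _]//= /eqP->//|[im1 _]].
    by move: p1; rewrite eu im1 r0 /plain eqxx andbF.
  by move: x; rewrite eu ev (negbTE nohd.1) (negbTE nohd.2).
- exfalso; case: imm => [/fr[[t]|]/and3P[]//|[im1 /fl[[y]|]/and3P[_ _]//= /eqP ez]].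
  by move: lvV; rewrite /= -ez im1 r0 eqxx andbF.
- exfalso; case: i0m => [/fl[[z]|]/and3P[]//|[i0 /fr[[y]|]/and3P[_ _]//= /eqP ez]].
  by move: lvV; rewrite /= ez i0 l1 eqxx andbF.
Qed.

Lemma good_noacc V i : good V -> i < m -> V i <> LA.
Proof.
case=> [c _ _ h|c j b l r _ _ _ _ h] im; rewrite h // /form; do ?case: ifP => // _.
Qed.

(** An accepting head blocks every step, so a word containing it leads to [cT] only by being
    [cT]. *)
Lemma acc_final e i : wf e -> leads e -> acc (e i) -> acc (cT i).
Proof.
move=> we le; case: le we => [//|c j jm a _] /wf_hd[p hp] hi.
have hi' : i = p by apply/eqP; rewrite -hp; exact: acc_hd.
have [x _ _ _ _] := active_hd a; rewrite !hp -hi' in x.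
have [ji|ji] : j = i \/ j.+1 = i by lia.
  by have [_] := acc_stop (c j.+1) hi; rewrite -ji a.
by have [] := acc_stop (c j) hi; rewrite -ji a.
Qed.

Lemma good_accept V i h x : good V -> i < m -> V i = LP h x -> acc h -> exists2 k, k <= m & acc (cT k).
Proof.
case=> [c wc lc hV|c j b l r wc lc jm a hV] im.
  by rewrite hV // => -[<- _] hc; exists i; [exact: ltnW|exact: acc_final hc].
have [we le] := curc_good b wc lc jm a.
have [j1 j2] := active_range wc jm a.
rewrite hV // /form; case: eqP => [_|ij]; first by case: (b).
suff E : forall y z, LP y z = LP h x -> y = (if b then rw c j else c) i -> acc h -> exists2 k, k <= m & acc (cT k).
  case: eqP => [e|e1]; first case: (l) => // q; first apply: E q _.
    by case: (b); rewrite // /rw /upd2; eqs.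
  case: eqP => [e|e2]; first case: (r) => // q; first apply: E q _.
    by rewrite /cur e; case: (b); rewrite // /rw /upd2; eqs.
  by move=> q; apply: E q _; case: (b); rewrite // /rw /upd2; eqs.
by move=> y z [-> _] e hh; exists i; [exact: ltnW|apply: acc_final we le _; rewrite -e].
Qed.

(** * The word problem over numbered letters *)

Variable n : nat.
Hypothesis nE : n = #|{: letter X}|.
Notation Hn := (fun a b => Hl (ldec X a) (ldec X b)).
Notation wconn := (wconn n m Hn).
Definition wenc (V : nat -> letter X) i := lenc (V i).

Lemma wenc_valid V : lword V -> validW n m Hn (wenc V).
Proof.
move=> vV; split=> i im; first by rewrite nE; exact: lenc_lt.
by rewrite /wenc !lencK; exact: vV.
Qed.

Lemma wconn_trans W1 W2 W3 : wconn W1 W2 -> wconn W2 W3 -> wconn W1 W3.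
Proof. by move=> h; elim=> // V V' i h1 h2 h3 h4 h5; exact: wconnS h2 h3 h4 h5. Qed.

Lemma wconn_step V V' i : lword V' -> i < m -> (forall k, k != i -> V' k = V k) ->
  wconn (wenc V) (wenc V').
Proof.
move=> vV' im hV; apply: (wconnS (W1 := wenc V) (i0 := i)) => //; first exact: wconn0.
  exact: wenc_valid.
by move=> k ki; rewrite /wenc hV.
Qed.

(** Seven moves: the pair is marked, both locks are set, the pair is exchanged, both locks are
    released, and the mark is removed. *)
Lemma wconn_rw c j : wf c -> j < m -> active (c j) (c j.+1) ->
  wconn (wenc (pword c)) (wenc (pword (rw c j))).
Proof.
move=> wc jm a; have [j1 j2] := active_range wc jm a.
have st b l r b' l' r' i : i < m -> (forall k, k != i -> form c j b' l' r' k = form c j b l r k) ->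
    wconn (wenc (form c j b l r)) (wenc (form c j b' l' r')).
  by move=> im h; apply: wconn_step im h; exact: form_valid.
have p0 b : forall k, k != j -> form c j b false false k = pword (if b then rw c j else c) k.
  by move=> k kj; exact: form_pword.
apply: (@wconn_trans _ (wenc (form c j false false false))).
  by apply: (@wconn_step _ _ j) => //; [exact: form_valid|exact: p0].
apply: (@wconn_trans _ (wenc (form c j false true false))).
  by apply: (st _ _ _ _ _ _ j.-1); [lia|move=> k kj; rewrite /form; case: eqP => // _; eqs].
apply: (@wconn_trans _ (wenc (form c j false true true))).
  by apply: (st _ _ _ _ _ _ j.+1); [lia|move=> k kj; rewrite /form (negbTE kj)].
apply: (@wconn_trans _ (wenc (form c j true true true))).
  by apply: (st _ _ _ _ _ _ j) => // k kj; rewrite /form (negbTE kj).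
apply: (@wconn_trans _ (wenc (form c j true false true))).
  by apply: (st _ _ _ _ _ _ j.-1); [lia|move=> k kj; rewrite /form; case: eqP => // _; eqs].
apply: (@wconn_trans _ (wenc (form c j true false false))).
  by apply: (st _ _ _ _ _ _ j.+1); [lia|move=> k kj; rewrite /form (negbTE kj)].
apply: (@wconn_step _ _ j) => //; first by apply: pword_valid; exact: rw_wf.
by move=> k kj; rewrite (p0 true).
Qed.

Lemma wconn_leads c : wf c -> leads c -> wconn (wenc (pword c)) (wenc (pword cT)).
Proof.
move=> + l; elim: l => [|c' j jm a _ IH] wc; first exact: wconn0.
exact: wconn_trans (wconn_rw wc jm a) (IH (rw_wf wc jm a)).
Qed.

Lemma leads_wf c : wf c -> leads c -> wf cT.
Proof. by move=> + l; elim: l => [|c' j jm a _ IH] wc //; apply: IH; exact: rw_wf. Qed.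

Lemma wconn_accept i : wf cT -> acc (cT i) -> i <= m -> exists2 W, wconn (wenc (pword cT)) W & W 0 = lenc (@LA X).
Proof.
move=> we hi im; have hdi := acc_hd hi.
have [[l0 l1] [r0 r1] hin [q hq]] := we.
have /andP[pl pr] := hd_plain hdi.
have [i1 i2] : 1 < i /\ i.+1 < m.
  have j0 : i <> 0 by move=> e; rewrite e l0 eqxx in pl.
  have j1 : i <> 1 by move=> e; rewrite e l1 eqxx in pl.
  have jr : i <> m.-1 by move=> e; rewrite e r0 eqxx in pr.
  have jr' : i <> m by move=> e; rewrite e r1 eqxx in pr.
  by lia.
pose aw k := fun j => if (k <= j) && (j < i) then @LA X else pword cT j.
have awV k : lword (aw k).
  move=> j jm; rewrite /aw; case: (ltnP j i) => ji; last first.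
    rewrite !andbF (_ : (j.+1 < i) = false) ?andbF; last lia.
    exact: (pword_valid we jm).
  rewrite andbT; case: (leqP k j) => kj.
    have -> : k <= j.+1 by lia.
    rewrite /=; case: ltnP => ji1 //.
    by rewrite /Hl pword_lvalid //= (_ : j.+1 = i) //; lia.
  case: (ltnP j.+1 i) => ji1; last by rewrite andbF; exact: (pword_valid we jm).
  rewrite andbT; case: ifP => kj1; last exact: (pword_valid we jm).
  rewrite /Hl pword_lvalid //=; last lia.
  by apply/eqP => /(wf_rm we); lia.
have aw0 : aw i = pword cT.
  by apply: boolp.funext => j; rewrite /aw; case: ifP => //; lia.
suff h k : k <= i -> wconn (wenc (pword cT)) (wenc (aw (i - k))).
  exists (wenc (aw 0)); first by have := h i (leqnn i); rewrite subnn.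
  by rewrite /wenc /aw /=; have -> : 0 < i by lia.
elim: k => [|k IH] ki; first by rewrite subn0 aw0; exact: wconn0.
apply: wconn_trans (IH (ltnW ki)) _.
apply: (@wconn_step _ _ (i - k.+1)) => //; first lia.
by move=> j jk; rewrite /aw; have -> : (i - k.+1 <= j) = (i - k <= j) by lia.
Qed.

(** This excludes an [LA] at the right end, where no letter follows that could show an accepting
    head. *)
Lemma good_last V u v : good V -> V m.-2 = LP u v -> v = rm.
Proof.
have m2 : m.-2 < m by lia.
case=> [c [_ [r0 _] _ _] _ h|c j b l r wc lc jm a h]; rewrite h //.
  by move=> [_ <-]; rewrite -r0; congr c; lia.
have [j1 j2] := active_range wc jm a; have [_ [r0 _] _ _] := wc.
have cr : c m.-2.+1 = rm by rewrite -r0; congr c; lia.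
rewrite /form; case: eqP => [e|_]; first lia.
case: eqP => [e|_]; first lia.
by case: eqP => [e|_]; [case: (r) => // -[_ <-]|move=> [_ <-]].
Qed.

Lemma good_wconn c W : wf c -> leads c -> wconn (wenc (pword c)) W ->
  (exists2 k, k <= m & acc (cT k)) \/ good (fun i => ldec X (W i)).
Proof.
move=> wc lc; elim=> [|W1 W2 i0 _ IH [Wn vW2] im hW].
  by right; apply: (@GoodP _ c) => // i _; rewrite /wenc lencK.
case: IH => [h|g]; first by left.
have lV : lword (fun i => ldec X (W2 i)) by exact: vW2.
have nA k : k < m -> k != i0 -> ldec X (W2 k) <> @LA X.
  by move=> km ki; rewrite hW //; have := good_noacc g km.
case: (eqVneq (ldec X (W2 i0)) (@LA X)) => [eA|nA0]; last first.
  by right; apply: (good_step g lV im); [exact/eqP|move=> k ki; rewrite hW].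
left; case: (ltnP i0.+1 m) => i1.
  have := lV i0 i1; rewrite eA => /and3P[_ _].
  case E : (ldec X (W2 i0.+1)) (nA i0.+1 i1 (ltac:(lia) : i0.+1 != i0)) => [h x|x y|x y|z p|p t|] // _ /= hh.
  have E1 : ldec X (W1 i0.+1) = LP h x by rewrite -E hW //; lia.
  exact: good_accept g i1 E1 hh.
have := lV m.-2; rewrite (_ : m.-2.+1 = i0); last lia.
move=> /(_ im); rewrite eA => /and3P[_ _].
have e2 : W2 m.-2 = W1 m.-2 by rewrite hW //; lia.
case E : (ldec X (W2 m.-2)) => [u v|x y|x y|z p|p t|] //= hv.
  by rewrite e2 in E; move: hv; rewrite (good_last g E) eqxx.
by have := nA m.-2; rewrite E => /(_ ltac:(lia) ltac:(lia)).
Qed.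

Theorem word_problem c : wf c -> leads c ->
  (exists2 W, wconn (wenc (pword c)) W & W 0 = lenc (@LA X)) <-> (exists2 i, i <= m & acc (cT i)).
Proof.
move=> wc lc; split=> [[W hW W0]|[i im hi]]; last first.
  have [W hW W0] := wconn_accept (leads_wf wc lc) hi im.
  by exists W => //; exact: wconn_trans (wconn_leads wc lc) hW.
have [//|g] := good_wconn wc lc hW.
have m0 : 0 < m by lia.
by have := good_noacc g m0; rewrite /= W0 lencK.
Qed.
End Rewriting.

(** * Printing the circuit *)

(** The expression must work for every oracle and below further variables, so that definable
    functions can be substituted into each other. *)
Definition definable (g : seq bool -> nat -> nat) : Prop :=
  exists e, forall w b x env, eval e w b (x :: env) = g w x.
Definition definableb (g : seq bool -> nat -> bool) : Prop := definable (fun w x => g w x).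

Lemma definable_ext g h : (forall w x, g w x = h w x) -> definable g -> definable h.
Proof. by move=> e [E hE]; exists E => *; rewrite -e. Qed.

Lemma definable_var : definable (fun _ x => x).
Proof. by exists (EVar 0). Qed.
Lemma definable_lit n : definable (fun _ _ => n).
Proof. by exists (ELit n). Qed.
Lemma definable_len : definable (fun w _ => size w).
Proof. by exists ELen. Qed.
Lemma definable_getb g : definable g -> definable (fun w x => getb w (g w x)).
Proof. by move=> [e h]; exists (EInp e) => *; rewrite eval_Inp h. Qed.
Lemma definable_add g h : definable g -> definable h -> definable (fun w x => g w x + h w x).
Proof. by move=> [e h1] [f h2]; exists (EAdd e f) => *; rewrite eval_Add h1 h2. Qed.
Lemma definable_sub g h : definable g -> definable h -> definable (fun w x => g w x - h w x).
Proof. by move=> [e h1] [f h2]; exists (ESub e f) => *; rewrite eval_Sub h1 h2. Qed.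
Lemma definable_mul g h : definable g -> definable h -> definable (fun w x => g w x * h w x).
Proof. by move=> [e h1] [f h2]; exists (EMul e f) => *; rewrite eval_Mul h1 h2. Qed.
Lemma definable_exp g k : definable g -> definable (fun w x => g w x ^ k).
Proof.
move=> hg; elim: k => [|k IH]; first exact: definable_lit.
by apply: definable_ext (definable_mul hg IH) => w x; rewrite expnS.
Qed.
Lemma definable_succ g : definable g -> definable (fun w x => (g w x).+1).
Proof. by move=> hg; apply: definable_ext (definable_add hg (definable_lit 1)) => w x; rewrite addn1. Qed.
Lemma definable_pred g : definable g -> definable (fun w x => (g w x).-1).
Proof. by move=> hg; apply: definable_ext (definable_sub hg (definable_lit 1)) => w x; rewrite subn1. Qed.
Lemma definable_double g : definable g -> definable (fun w x => (g w x).*2).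
Proof. by move=> hg; apply: definable_ext (definable_add hg hg) => w x; rewrite addnn. Qed.
Lemma definable_div g c : 0 < c -> definable g -> definable (fun w x => g w x %/ c).
Proof. by move=> c0 [e h]; exists (EDiv e (ELit c)) => *; rewrite eval_Div // h. Qed.
Lemma definable_mod g c : 0 < c -> definable g -> definable (fun w x => g w x %% c).
Proof. by move=> c0 [e h]; exists (EMod e (ELit c)) => *; rewrite eval_Mod // h. Qed.
Lemma definable_if c g h : definableb c -> definable g -> definable h -> definable (fun w x => if c w x then g w x else h w x).
Proof.
move=> [e h1] [f h2] [k h3]; exists (EIf e f k) => w b x env.
by rewrite eval_If h1 h2 h3; case: (c w x).
Qed.
Lemma definableb_if c g h : definableb c -> definableb g -> definableb h -> definableb (fun w x => if c w x then g w x else h w x).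
Proof. by move=> h1 h2 h3; apply: definable_ext (definable_if h1 h2 h3) => w x; case: ifP. Qed.
Lemma definableb_leq g h : definable g -> definable h -> definableb (fun w x => g w x <= h w x).
Proof. by move=> [e h1] [f h2]; exists (ELeq e f) => *; rewrite eval_Leq h1 h2. Qed.
Lemma definableb_eq g h : definable g -> definable h -> definableb (fun w x => g w x == h w x).
Proof. by move=> [e h1] [f h2]; exists (EEq e f) => *; rewrite eval_Eq h1 h2. Qed.
Lemma definableb_not g : definableb g -> definableb (fun w x => ~~ g w x).
Proof. by move=> [e h]; exists (ENot e) => w b x env; rewrite eval_Not h; case: (g w x). Qed.
Lemma definableb_and g h : definableb g -> definableb h -> definableb (fun w x => g w x && h w x).
Proof. by move=> [e h1] [f h2]; exists (EMul e f) => *; rewrite eval_Mul h1 h2 mulnb. Qed.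
Lemma definableb_or g h : definableb g -> definableb h -> definableb (fun w x => g w x || h w x).
Proof.
by move=> h1 h2; apply: definable_ext (definableb_not (definableb_and (definableb_not h1) (definableb_not h2))) => w x; case: (g w x); case: (h w x).
Qed.
Lemma definableb_lit b : definableb (fun _ _ => b).
Proof. exact: (definable_lit (nat_of_bool b)). Qed.
Lemma definableb_odd g : definable g -> definableb (fun w x => odd (g w x)).
Proof. by move=> h; apply: definable_ext (definable_mod (isT : 0 < 2) h) => w x; rewrite modn2. Qed.
Lemma definable_bool g : definableb g -> definable (fun w x => nat_of_bool (g w x)).
Proof. by []. Qed.
Lemma definable_subst g h : definable g -> definable h -> definable (fun w x => g w (h w x)).
Proof. by move=> [e h1] [f h2]; exists (ELet f e) => *; rewrite eval_Let h2 h1. Qed.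
Lemma definableb_subst g h : definableb g -> definable h -> definableb (fun w x => g w (h w x)).
Proof. exact: definable_subst. Qed.
(** A function on a bounded range is a nest of case distinctions. In this way the compatibility of
    letters and the data of the tiles become part of the program. *)
Lemma definable_tab (G : nat -> nat) N g : (forall w x, g w x < N) -> definable g -> definable (fun w x => G (g w x)).
Proof.
move=> hN hg; suff h : definable (fun w x => if g w x < N then G (g w x) else 0).
  by apply: definable_ext h => w x; rewrite hN.
elim: N {hN} => [|N IH]; first exact: definable_lit.
apply: definable_ext (definable_if (definableb_eq hg (definable_lit N)) (definable_lit (G N)) IH) => w x.
by rewrite ltnS (leq_eqVlt (g w x) N); case: (eqVneq (g w x) N) => [->|_].
Qed.
Lemma definableb_tab (G : nat -> bool) N g : (forall w x, g w x < N) -> definable g -> definableb (fun w x => G (g w x)).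
Proof. exact: (@definable_tab (fun i => G i)). Qed.

Ltac def1 := match goal with
  | h : definable ?g |- definable ?g => exact h
  | h : definableb ?g |- definableb ?g => exact h
  | |- definable (fun _ x => x) => exact definable_var
  | |- definable (fun _ _ => ?n) => exact (definable_lit n)
  | |- definableb (fun _ _ => ?n) => exact (definableb_lit n)
  | |- definable (fun w x => nat_of_bool (@?g w x)) => apply (@definable_bool g)
  | |- definable (fun w x => (@?g w x).+1) => apply (@definable_succ g)
  | |- definable (fun w x => (@?g w x).-1) => apply (@definable_pred g)
  | |- definable (fun w x => (@?g w x).*2) => apply (@definable_double g)
  | |- definable (fun w x => @?g w x + @?h w x) => apply (@definable_add g h)
  | |- definable (fun w x => @?g w x - @?h w x) => apply (@definable_sub g h)
  | |- definable (fun w x => @?g w x * @?h w x) => apply (@definable_mul g h)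
  | |- definable (fun w x => @?g w x %/ ?c) => apply (@definable_div g c); [by []|]
  | |- definable (fun w x => @?g w x %% ?c) => apply (@definable_mod g c); [by []|]
  | |- definableb (fun w x => @?g w x <= @?h w x) => apply (@definableb_leq g h)
  | |- definableb (fun w x => @?g w x == @?h w x) => apply (@definableb_eq g h)
  | |- definableb (fun w x => ~~ @?g w x) => apply (@definableb_not g)
  | |- definableb (fun w x => @?g w x && @?h w x) => apply (@definableb_and g h)
  | |- definableb (fun w x => odd (@?g w x)) => apply (@definableb_odd g)
  | |- definable _ => apply: definable_if
  | |- definableb _ => apply: definableb_if
  | h : definable _ |- definable _ => apply: (definable_subst h)
  | h : definableb _ |- definableb _ => apply: (definableb_subst h)
  end.
Ltac defs := repeat def1.

Section Print.
Variables (n : nat) (H : rel nat) (mf : seq bool -> nat) (Wf : seq bool -> nat -> nat) (acc : nat).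
Hypothesis n3 : 3 <= n.
Hypothesis definable_m : definable (fun w _ => mf w).
Hypothesis definable_W : definable Wf.
Notation D := (cD n).

Let n0 : 0 < n. Proof. by lia. Qed.
Let D0 : 0 < D. Proof. by []. Qed.

Ltac defd := repeat first [def1 | apply: definable_mod n0 _ | apply: definable_div n0 _ | apply: definable_mod D0 _ | apply: definable_div D0 _ ].

Definition tcode (k : tile) := match k with TX => 0 | TXC => 1 | TOM => 2 | TOB => 3 end.
Definition tile_of i := nth TX [:: TX; TXC; TOM; TOB] i.
Lemma tcodeK k : tile_of (tcode k) = k. Proof. by case: k. Qed.
Lemma tcode_lt k : tcode k < 4. Proof. by case: k. Qed.

Lemma definable_ty : definable (fun w t => tcode (cty n (mf w) H t)).
Proof.
(* The two letters are packed into one number below [n * n], which turns [H] into a table with one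
   argument. *)
apply: (@definable_ext (fun w t =>
  if (t %% D).+1 == D then if (D <= t %/ D) && (t %/ D %% n == 1) then 3 else 2
  else if [&& t %/ D < mf w * n, (t %% D).+1 <= t %/ D, ((t %/ D - (t %% D).+1) %/ n).+1 == t %/ D %/ n
    & ~~ H ((((t %/ D - (t %% D).+1) %% n) * n + (t %/ D) %% n) %/ n) ((((t %/ D - (t %% D).+1) %% n) * n + (t %/ D) %% n) %% n)] then 1 else 0)).
  move=> w t; rewrite /cty; case: ifP => _; first by case: ifP.
  rewrite divnMDl // modnMDl modn_mod [_ %% n %/ n]divn_small ?ltn_pmod // addn0.
  by case: ifP.
have hH : definableb (fun w t => H ((((t %/ D - (t %% D).+1) %% n) * n + (t %/ D) %% n) %/ n)
     ((((t %/ D - (t %% D).+1) %% n) * n + (t %/ D) %% n) %% n)).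
  apply: (@definableb_tab (fun i => H (i %/ n) (i %% n)) (n * n)
    (fun w t => ((t %/ D - (t %% D).+1) %% n) * n + (t %/ D) %% n)).
    move=> w x; have := ltn_pmod (x %/ D - (x %% D).+1) n0; have := ltn_pmod (x %/ D) n0; nia.
  by defd.
by defd.
Qed.

Lemma definable_P : definable (fun w _ => cP n (mf w)).
Proof. by rewrite /cP; defd. Qed.

Lemma definable_wend b r : r < 2 -> definable (fun w t => vid (cwend n (mf w) b t r)).
Proof.
have hP := definable_P.
case: r => [|[|//]] _; case: b.
- apply: (@definable_ext (fun w t => if 0 < t %% D then (t %/ D * D + (t %% D).-1) * 20 + 1
    else if (t %/ D).+1 < cP n (mf w) then ((t %/ D).+1 * D + 0) * 20 + 0 else t * 20 + 3)); last by defd.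
  by move=> w t; rewrite /cwend /=; do ?case: ifP.
- by apply: (@definable_ext (fun w t => t * 20 + 2)); defd.
- apply: (@definable_ext (fun w t => if (t %/ D).+1 < cP n (mf w) then
      if (t %% D).+1 < D then ((t %/ D).+1 * D + (t %% D).+1) * 20 + 0 else ((t %/ D).+1 * D + t %% D) * 20 + 1
    else if odd (t %% D) then (t %/ D * D + (t %% D).+1) * 20 + 3
    else if (t %% D).+1 < D then (0 * D + (t %% D).+1) * 20 + 0 else (0 * D + t %% D) * 20 + 1)); last by defd.
  by move=> w t; rewrite /cwend /=; do ?case: ifP.
- apply: (@definable_ext (fun w t => if (t %/ D).+1 < cP n (mf w) then t * 20 + 3
    else if odd (t %% D) then t * 20 + 3 else (0 * D + t %% D) * 20 + 0)); last by defd.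
  by move=> w t; rewrite /cwend /=; do ?case: ifP.
Qed.

Lemma definable_fr : definable (fun w p => frW n (mf w) (Wf w) p).
Proof. by rewrite /frW; defd. Qed.

Lemma definable_ac : definableb (fun w p => acW n (mf w) (Wf w) p).
Proof. by rewrite /acW; defd. Qed.

Notation wf w := (wfr n (frW n (mf w) (Wf w)) (acW n (mf w) (Wf w))).

Lemma definable_wfr r : definableb (fun w t => wf w t r).
Proof.
have hf := definable_fr; have ha := definable_ac.
by rewrite /wfr; case: r => [|r] /=; defd.
Qed.

Lemma definable_wpt i : definableb (fun w t => wpt (cpw n (mf w)) (wf w) t i).
Proof.
have hP := definable_P; have h0 := definable_wfr 0; have h1 := definable_wfr 1.
have s0 g : definable g -> definableb (fun w t => wf w (g w t) 0) by move=> h; apply: (definableb_subst h0 h).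
have s1 g : definable g -> definableb (fun w t => wf w (g w t) 1) by move=> h; apply: (definableb_subst h1 h).
have t1 g : definableb g -> definableb (fun w t => g w t == true) by move=> h; apply: definable_ext h => w t; rewrite eqb_id.
have f1 g : definableb g -> definableb (fun w t => g w t == false).
  by move=> h; apply: definable_ext (definableb_not h) => w t; rewrite eqbF_neg.
case: i => [|[|[|i]]].
- apply: (@definable_ext (fun w t => if 0 < t %/ D then
      if t %% D == 0 then wf w ((t %/ D).-1 * D + 0) 0 == true else wf w ((t %/ D).-1 * D + (t %% D).-1) 1 == true
    else if odd (t %% D) then wf w ((cP n (mf w)).-1 * D + (t %% D).-1) 1 == true
    else wf w ((cP n (mf w)).-1 * D + t %% D) 1 == false)).
    by move=> w t; rewrite /wpt /cpw; do ?case: ifP.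
  change (definableb (fun w t => if 0 < t %/ D then
      if t %% D == 0 then wf w ((t %/ D).-1 * D + 0) 0 == true else wf w ((t %/ D).-1 * D + (t %% D).-1) 1 == true
    else if odd (t %% D) then wf w ((cP n (mf w)).-1 * D + (t %% D).-1) 1 == true
    else wf w ((cP n (mf w)).-1 * D + t %% D) 1 == false)).
  apply: definableb_if; [by defd|apply: definableb_if; [by defd|apply: t1; apply: s0; by defd|apply: t1; apply: s1; by defd]|].
  by apply: definableb_if; [by defd|apply: t1; apply: s1; by defd|apply: f1; apply: s1; by defd].
- have hh : definableb (fun w t => if (t %% D).+1 < D then wf w (t %/ D * D + (t %% D).+1) 0 == true
    else if 0 < t %/ D then wf w ((t %/ D).-1 * D + t %% D) 1 == true
    else wf w ((cP n (mf w)).-1 * D + t %% D) 1 == true).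
    apply: definableb_if; [by defd|apply: t1; apply: s0; by defd|].
    by apply: definableb_if; [by defd|apply: t1; apply: s1; by defd|apply: t1; apply: s1; by defd].
  by apply: definable_ext hh => w t; rewrite /wpt /cpw; do ?case: ifP.
- have hh : definableb (fun w t => wf w t 0 == false) by apply: f1.
  by apply: definable_ext hh => w t; rewrite /wpt /cpw.
- have hh : definableb (fun w t => if ((t %/ D).+1 < cP n (mf w)) || odd (t %% D) then wf w t 1 == false
    else if t %% D == 0 then wf w t 0 == true else wf w (t %/ D * D + (t %% D).-1) 1 == true).
    apply: definableb_if; [by apply: definableb_or; defd|apply: f1; apply: s1; by defd|].
    by apply: definableb_if; [by defd|apply: t1; apply: s0; by defd|apply: t1; apply: s1; by defd].
  by apply: definable_ext hh => w t; rewrite /wpt /cpw; do ?case: ifP.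
Qed.

Notation ty w t := (cty n (mf w) H t).
Notation gs w := (gst (cty n (mf w) H) (wf w) (fun t => tidx (ty w t) (wpt (cpw n (mf w)) (wf w) t))).

Definition pbits (pt : nat -> bool) : nat := pt 0 + 2 * pt 1 + 4 * pt 2 + 8 * pt 3.

Lemma pbits_lt pt : pbits pt < 16.
Proof. by rewrite /pbits; case: (pt 0); case: (pt 1); case: (pt 2); case: (pt 3). Qed.

Lemma pbitsK pt i : i < 4 -> odd (pbits pt %/ 2 ^ i) = pt i.
Proof.
by case: i => [|[|[|[|//]]]] _; rewrite /pbits; case: (pt 0); case: (pt 1); case: (pt 2); case: (pt 3).
Qed.

(** The initial orientation of an inner edge depends only on the type of its tile, its four port
    bits and its local number, which makes a table of [4 * 16 * 30] entries. *)
Lemma definable_start : definableb (fun w e => gs w e).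
Proof.
have hty := definable_ty; have h0 := definable_wfr 0; have h1 := definable_wfr 1.
have p0 := definable_wpt 0; have p1 := definable_wpt 1; have p2 := definable_wpt 2; have p3 := definable_wpt 3.
pose key w e := (tcode (ty w (e %/ 30)) * 16 + pbits (wpt (cpw n (mf w)) (wf w) (e %/ 30))) * 30 + e %% 30.
have hk : definable key.
  rewrite /key /pbits; apply: definable_add; last by defd.
  apply: definable_mul; last by defd.
  apply: definable_add; first by apply: definable_mul; [apply: (definable_subst hty); defd|defd].
  have sb p : definableb p -> definable (fun w e => p w (e %/ 30) : nat) by move=> h; apply: (definable_subst h); defd.
  apply: definable_add; [apply: definable_add; [apply: definable_add; [exact: (sb _ p0)|]|]|].
  - by apply: definable_mul; [defd|exact: (sb _ p1)].
  - by apply: definable_mul; [defd|exact: (sb _ p2)].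
  - by apply: definable_mul; [defd|exact: (sb _ p3)].
have kl w e : key w e < 4 * 16 * 30.
  rewrite /key; have := tcode_lt (ty w (e %/ 30)); have := pbits_lt (wpt (cpw n (mf w)) (wf w) (e %/ 30)).
  have := ltn_pmod e (isT : 0 < 30); lia.
pose G i := tcanon (tile_of (i %/ 30 %/ 16)) (tidx (tile_of (i %/ 30 %/ 16)) (fun j => odd (i %/ 30 %% 16 %/ 2 ^ j))) (i %% 30).
have hG := @definableb_tab G _ _ kl hk.
have hh : definableb (fun w e => if e %% 30 < 28 then G (key w e) else if e %% 30 == 28 then wf w (e %/ 30) 0 else wf w (e %/ 30) 1).
  apply: definableb_if; [by defd|exact: hG|].
  by apply: definableb_if; [by defd|apply: (definableb_subst h0); defd|apply: (definableb_subst h1); defd].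
apply: definable_ext hh => w e; rewrite /gst; case: ifP => he.
  rewrite /G /key; set a := tcode _; set c := pbits _.
  have c16 : c < 16 by exact: pbits_lt.
  have e30 := ltn_pmod e (isT : 0 < 30).
  have -> : ((a * 16 + c) * 30 + e %% 30) %/ 30 = a * 16 + c by lia.
  have -> : ((a * 16 + c) * 30 + e %% 30) %% 30 = e %% 30 by lia.
  have -> : (a * 16 + c) %/ 16 = a by lia.
  have -> : (a * 16 + c) %% 16 = c by lia.
  rewrite /a tcodeK; congr (nat_of_bool (tcanon _ _ _)).
  by apply: tidx_ext => i i4; rewrite pbitsK.
case: ifP => e28.
  by have -> : e %% 30 - 28 = 0 by lia.
by have -> : e %% 30 - 28 = 1 by have := ltn_pmod e (isT : 0 < 30); lia.
Qed.

Lemma definable_end b : definable (fun w e => vid (eend (cty n (mf w) H) (cwend n (mf w)) b e)).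
Proof.
have hty := definable_ty; have w0 := @definable_wend b 0 isT; have w1 := @definable_wend b 1 isT.
pose key w e := tcode (ty w (e %/ 30)) * 30 + e %% 30.
have hk : definable key by rewrite /key; apply: definable_add; [apply: definable_mul; [apply: (definable_subst hty)|]|]; defd.
have kl w e : key w e < 4 * 30.
  by rewrite /key; have := tcode_lt (ty w (e %/ 30)); have := ltn_pmod e (isT : 0 < 30); lia.
have hG := @definable_tab (fun i => (if b then tdst else tsrc) (tile_of (i %/ 30)) (i %% 30)) _ _ kl hk.
have hh : definable (fun w e => if e %% 30 < 28 then e %/ 30 * 20 + (if b then tdst else tsrc) (tile_of (key w e %/ 30)) (key w e %% 30)
    else if e %% 30 == 28 then vid (cwend n (mf w) b (e %/ 30) 0) else vid (cwend n (mf w) b (e %/ 30) 1)).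
  apply: definable_if; [by defd|apply: definable_add; [by defd|exact: hG]|].
  by apply: definable_if; [by defd|apply: (definable_subst w0); defd|apply: (definable_subst w1); defd].
apply: definable_ext hh => w e; rewrite /eend; case: ifP => he.
  rewrite /key /vid /=; have e30 := ltn_pmod e (isT : 0 < 30).
  have -> : (tcode (ty w (e %/ 30)) * 30 + e %% 30) %/ 30 = tcode (ty w (e %/ 30)) by lia.
  have -> : (tcode (ty w (e %/ 30)) * 30 + e %% 30) %% 30 = e %% 30 by lia.
  by rewrite tcodeK.
case: ifP => e28.
  by have -> : e %% 30 - 28 = 0 by lia.
by have -> : e %% 30 - 28 = 1 by have := ltn_pmod e (isT : 0 < 30); lia.
Qed.

Lemma definable_wt : definable (fun w e => ewt (cty n (mf w) H) e).
Proof.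
have hty := definable_ty; pose key w e := tcode (ty w (e %/ 30)) * 30 + e %% 30.
have hk : definable key by rewrite /key; apply: definable_add; [apply: definable_mul; [apply: (definable_subst hty)|]|]; defd.
have kl w e : key w e < 4 * 30.
  by rewrite /key; have := tcode_lt (ty w (e %/ 30)); have := ltn_pmod e (isT : 0 < 30); lia.
have hG := @definable_tab (fun i => twt (tile_of (i %/ 30)) (i %% 30)) _ _ kl hk.
apply: definable_ext hG => w e; rewrite /ewt /key; have e30 := ltn_pmod e (isT : 0 < 30).
have -> : (tcode (ty w (e %/ 30)) * 30 + e %% 30) %/ 30 = tcode (ty w (e %/ 30)) by lia.
have -> : (tcode (ty w (e %/ 30)) * 30 + e %% 30) %% 30 = e %% 30 by lia.
by rewrite tcodeK.
Qed.

Hypothesis acc_lt : acc < n.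
Hypothesis mf_gt0 : forall w, 0 < mf w.
Hypothesis vW : forall w, validW n (mf w) H (Wf w).

Theorem circuit_printer B : exists c : cmd B,
  transduces c (fun w => c2e_encode (circuit n3 acc_lt (mf_gt0 w) (vW w))).
Proof.
have hP := definable_P.
have [eT hT] : definable (fun w _ => cT n (mf w)) by rewrite /cT; defd.
have [es hs] := definable_end false; have [ed hd] := definable_end true.
have [ew hw] := definable_wt; have [eb hb] := definable_start.
pose tgt := mk n (acc + n.*2) n.*2.-1 * 30 + 29.
pose bls := [:: (ELit 1, [:: Nat (EMul eT (ELit 20)); Nat (EMul eT (ELit 30))]);
  (* Repetition counts are evaluated in the empty environment, while [eT] is specified below a
     variable; [ELet] supplies a dummy one. *)
  (ELet (ELit 0) (EMul eT (ELit 20)), [:: Nat (ELit 2)]);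
  (ELet (ELit 0) (EMul eT (ELit 30)), [:: Nat es; Nat ed; Nat ew; Bit eb]);
  (ELit 1, [:: Nat (ELit tgt)])].
exists (gen_code B bls).
suff e : out bls = fun w => c2e_encode (circuit n3 acc_lt (mf_gt0 w) (vW w)) by rewrite -e; exact: gen_codeP.
apply: boolp.funext => w.
have mapf (N : nat) (F : 'I_N -> seq bool) (F' : nat -> seq bool) : (forall i, F i = F' i) ->
    flatten [seq F' x | x <- iota 0 N] = flatten [seq F i | i <- enum 'I_N].
  by move=> h; rewrite -val_enum_ord -map_comp; congr flatten; apply: eq_map => i /=; rewrite h.
have blk e its N F : eval e w [::] [::] = N -> (forall x, flatten [seq out_item w x it | it <- its] = F x) ->
    out_block w (e, its) = flatten [seq F x | x <- iota 0 N].
  by move=> e1 e2; rewrite /out_block e1; congr flatten; apply: eq_map.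
have nat e x v : eval e w [::] [:: x] = v -> out_item w x (Nat e) = encode_nat v by move=> <-.
have bit e x (v : bool) : eval e w [::] [:: x] = v -> out_item w x (Bit e) = [:: v].
  by move=> h; rewrite /out_item h; case: v {h}.
rewrite {1}/out /bls map_cons [map _ [:: _; _; _]]map_cons [map _ [:: _; _]]map_cons [map _ [:: _]]map_cons.
rewrite /c2e_encode.
pose c (b : bool) e := vid (eend (cty n (mf w) H) (cwend n (mf w)) b e).
rewrite (@blk _ _ 1 (fun=> encode_nat (cT n (mf w) * 20) ++ encode_nat (cT n (mf w) * 30)) (eval_Lit _ _ _ _)); last first.
  move=> x; rewrite !map_cons.
  rewrite (nat _ _ (cT n (mf w) * 20)); last by rewrite eval_Mul hT eval_Lit.
  by rewrite (nat _ _ (cT n (mf w) * 30)) ?eval_Mul ?hT ?eval_Lit // /flatten /foldr cats0.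
have cnt k : eval (ELet (ELit 0) (EMul eT (ELit k))) w [::] [::] = cT n (mf w) * k.
  by rewrite eval_Let eval_Mul hT eval_Lit.
rewrite (@blk _ _ _ (fun=> encode_nat 2) (cnt 20)); last first.
  by move=> x; rewrite !map_cons (nat _ _ 2) ?eval_Lit // /flatten /foldr cats0.
rewrite (@blk _ _ _ (fun e => encode_nat (c false e) ++ encode_nat (c true e)
   ++ encode_nat (ewt (cty n (mf w) H) e) ++ [:: gs w e]) (cnt 30)); last first.
  move=> x; rewrite !map_cons (nat _ _ _ (hs _ _ _ _)) (nat _ _ _ (hd _ _ _ _)) (nat _ _ _ (hw _ _ _ _)).
  by rewrite (bit _ _ _ (hb _ _ _ _)) /flatten /foldr cats0.
rewrite (@blk _ _ 1 (fun=> encode_nat tgt) (eval_Lit _ _ _ _)); last first.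
  by move=> x; rewrite !map_cons (nat _ _ tgt) ?eval_Lit // /flatten /foldr cats0.
have one A : flatten [seq A | x <- iota 0 1] = A :> seq bool by rewrite /iota /flatten /= cats0.
rewrite !one.
rewrite (@mapf (cT n (mf w) * 20) (fun=> encode_nat 2)) //.
set cc := circuit _ _ _ _.
rewrite (@mapf (ne cc) (fun e => encode_nat (src e) ++ encode_nat (dst e) ++ encode_nat (weight e) ++ [:: c2e_start cc e])).
  by rewrite /flatten /foldr cats0 -!catA.
by move=> i; rewrite /cc /circuit /c2e_start ffunE.
Qed.

End Print.

(** * Turing machine computations as word rewriting *)

Section Machine.
Variable M : tm.

(* The letters [inl true] and [inl false] mark the left and right end. *)
Definition tsymb : finType := (bool + (tm_sym M + tm_state M * tm_sym M))%type.
Notation lm := (inl true : tsymb).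
Notation rm := (inl false : tsymb).
Definition cell (a : tm_sym M) : tsymb := inr (inl a).
Definition scan (q : tm_state M) (a : tm_sym M) : tsymb := inr (inr (q, a)).

(** A right move is assigned to the head and its right neighbour, a left or stationary move to the
    head and its left neighbour, so that at most one pair is active. *)
Definition trule (p : tsymb * tsymb) : tsymb * tsymb :=
  match p with
  | (inr (inr (q, a)), inr (inl c)) =>
      if tm_delta q a is Some (q', b, GoRight) then (cell b, scan q' c) else p
  | (inr (inl c), inr (inr (q, a))) =>
      match tm_delta q a with
      | Some (q', b, GoLeft) => (scan q' c, cell b)
      | Some (q', b, Stay) => (cell c, scan q' b)
      | _ => p
      end
  | _ => p
  end.

Definition thd (x : tsymb) : bool := if x is inr (inr _) then true else false.
Definition tacc (x : tsymb) : bool :=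
  if x is inr (inr (q, a)) then tm_accept q && ~~ isSome (tm_delta q a) else false.

Notation active x y := (trule (x, y) != (x, y)).

Lemma trule_active_hd x y : active x y ->
  [/\ thd x (+) thd y, plain lm rm x, plain lm rm y, thd (trule (x, y)).1 (+) thd (trule (x, y)).2
    & plain lm rm (trule (x, y)).1 && plain lm rm (trule (x, y)).2].
Proof.
case: x => [?|[c|[q a]]]; case: y => [?|[c'|[q' a']]]; rewrite /trule ?eqxx //.
  by case: (tm_delta q' a') => [[[q1 b] []]|]; rewrite ?eqxx.
by case: (tm_delta q a) => [[[q1 b] []]|]; rewrite ?eqxx.
Qed.

Lemma trule_det x h y : thd h -> active x h -> ~~ active h y.
Proof.
case: h => [//|[//|[q a]]] _.
case: x => [?|[c|[q1 a1]]]; rewrite /trule ?eqxx //.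
by case: y => [?|[c'|[q2 a2]]]; rewrite ?eqxx //; case: (tm_delta q a) => [[[q3 b] []]|]; rewrite ?eqxx.
Qed.

Lemma tacc_hd h : tacc h -> thd h. Proof. by case: h => [|[|[]]]. Qed.
Lemma thd_plain h : thd h -> plain lm rm h. Proof. by case: h => [|[|[]]]. Qed.

Lemma tacc_stop h x : tacc h -> ~~ active x h /\ ~~ active h x.
Proof.
case: h => [//|[//|[q a]]] /andP[_]; rewrite /trule.
case: (tm_delta q a) => // _.
by case: x => [?|[c|[q1 a1]]]; rewrite ?eqxx.
Qed.

Variables (S : nat).
(** The head strays by less than [S] from its initial position [S + 3] in either direction; the
    margins keep it away from the doubled end marks. *)
Notation m := (S.*2 + 10).
Notation p0 := (S + 3).

Definition conf_word (c : tm_conf M) (p i : nat) : tsymb :=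
  if i <= 1 then lm else if m.-1 <= i then rm
  else if i == p then scan (conf_state c) (tape_head c)
  else if i < p then cell (nth None (tape_left c) (p - i.+1))
  else cell (nth None (tape_right c) (i - p.+1)).

(** A configuration carries no absolute coordinate. A move to the right lengthens the left half and
    a move to the left the right half, so the lengths of the halves bound the displacement. *)
Definition head_at (c : tm_conf M) (p : nat) : Prop :=
  [/\ p <= p0 + size (tape_left c), p0 <= p + size (tape_right c) & tm_space c <= S].

Lemma head_at_range c p : head_at c p -> 3 < p /\ p.+4 < m.
Proof. by case; rewrite /tm_space /tm_tape size_cat size_rev /=; lia. Qed.

Lemma conf_word_wf c p : head_at c p -> wf lm rm thd m (conf_word c p).
Proof.
move=> /head_at_range[h1 h2]; split.
- by [].
- by rewrite /conf_word leqnn leq_pred; case: ifP => [|_]; [lia|]; case: ifP => [|_]; [lia|].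
- move=> i /andP[i1 im]; rewrite /conf_word leqNgt i1 leqNgt im /=.
  by case: eqP => // _; case: ifP.
- exists p => i; rewrite /conf_word; case: ifP => [i1|_]; first by rewrite /=; lia.
  case: ifP => [im|_]; first by rewrite /=; lia.
  by case: eqP => // _; case: ifP.
Qed.

Definition tstep (c : tm_conf M) := odflt c (tm_next c).

Lemma rw_id (c : nat -> tsymb) j : ~~ active (c j) (c j.+1) -> rw trule c j = c.
Proof.
rewrite negbK /rw => /eqP ->; apply: boolp.funext => i; rewrite /upd2.
by case: eqP => [->|_] //; case: eqP => [->|].
Qed.

Lemma conf_word_step c p : head_at c p -> tm_space (tstep c) <= S ->
  exists p', head_at (tstep c) p' /\
    (conf_word (tstep c) p' = conf_word c p \/
     exists2 j, j < m & conf_word (tstep c) p' = rw trule (conf_word c p) j).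
Proof.
move=> hc; have [h1 h2] := head_at_range hc; case: hc.
case: c => q l a r; rewrite /tstep /=.
case E : (tm_delta q a) => [[[q' b] d]|] /= hl hr hs hs'; last by exists p; split => //; left.
have cw k : k != p -> 1 < k -> k < m.-1 -> exists c, conf_word (TMConf q l a r) p k = cell c.
  move=> kp k1 km; rewrite /conf_word leqNgt k1 leqNgt km /= (negbTE kp).
  by case: ifP => _; eexists.
have cp : conf_word (TMConf q l a r) p p = scan q a.
  rewrite /conf_word eqxx; case: ifP => [|_]; first by lia.
  by case: ifP => [|_]; first by lia.
have cl : conf_word (TMConf q l a r) p p.-1 = cell (head None l).
  rewrite /conf_word; case: ifP => [|_]; first by lia.
  case: ifP => [|_]; first by lia.
  case: eqP => [|_]; first by lia.
  by rewrite (_ : p.-1 < p); last lia; rewrite /= prednK ?subnn ?nth0 //; lia.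
have cr : conf_word (TMConf q l a r) p p.+1 = cell (head None r).
  rewrite /conf_word; case: ifP => [|_]; first by lia.
  case: ifP => [|_]; first by lia.
  case: eqP => [|_]; first by lia.
  by case: ifP => [|_]; [lia|rewrite /= subnn nth0].
have nl (s : seq (tm_sym M)) i : nth None (behead s) i = nth None s i.+1 by rewrite nth_behead.
case: d E hs' => E hs'.
- exists p.-1; split.
    split=> //=; first by rewrite size_behead; lia.
    by lia.
  right; exists p.-1; first by lia.
  apply: boolp.funext => i; rewrite /rw /upd2 prednK; last by lia.
  rewrite cl cp /trule /= E; have [->|ip] := eqVneq i p.-1.
    rewrite {1}/conf_word eqxx; case: ifP => [|_]; first by lia.
    by case: ifP => [|_] //; first by lia.
  rewrite [LHS]/conf_word [in RHS]/conf_word /= (negbTE ip).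
  case: ifP => [|_]; first by case: eqP => //; lia.
  case: ifP => [|_]; first by case: eqP => //; lia.
  have [->|ip'] := eqVneq i p.
    by rewrite ltnNge leq_pred /=; congr cell; rewrite prednK ?subnn //; lia.
  case: (ltnP i p) => ipl.
    rewrite (_ : i < p.-1) ?nl; last by lia.
    by congr (cell (nth _ _ _)); lia.
  rewrite (_ : i < p.-1 = false); last by lia.
  rewrite (_ : i - p.-1.+1 = (i - p.+1).+1) //; lia.
- exists p.+1; split.
    split=> //=; last by rewrite size_behead; lia.
    by lia.
  right; exists p; first by lia.
  apply: boolp.funext => i; rewrite /rw /upd2 cr cp /trule /= E; have [->|ip] := eqVneq i p.
    rewrite {1}/conf_word /=; case: ifP => [|_]; first by lia.
    case: ifP => [|_]; first by lia.
    by case: eqP => [|_]; [lia|rewrite ltnSn subnn].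
  have [->|ip'] := eqVneq i p.+1.
    rewrite {1}/conf_word eqxx; case: ifP => [|_]; first by lia.
    by case: ifP => [|_] //; first by lia.
  rewrite [LHS]/conf_word [in RHS]/conf_word /= (negbTE ip) (negbTE ip').
  case: ifP => // _; case: ifP => // _.
  case: (ltnP i p) => ipl.
    rewrite (_ : i < p.+1); last by lia.
    by rewrite (_ : p.+1 - i.+1 = (p - i.+1).+1) //; lia.
  rewrite (_ : i < p.+1 = false) ?nl; last by lia.
  by congr (cell (nth _ _ _)); lia.
- exists p; split; first by split.
  right; exists p.-1; first by lia.
  apply: boolp.funext => i; rewrite /rw /upd2 prednK; last by lia.
  rewrite cl cp /trule /= E; have [->|ip] := eqVneq i p.-1.
    rewrite {1}/conf_word /=; case: ifP => [|_]; first by lia.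
    case: ifP => [|_]; first by lia.
    case: eqP => [|_]; first by lia.
    by rewrite (_ : p.-1 < p); last lia; rewrite prednK ?subnn ?nth0 //; lia.
  have [->|ip'] := eqVneq i p.
    rewrite {1}/conf_word eqxx; case: ifP => [|_]; first by lia.
    by case: ifP => [|_] //; first by lia.
  by rewrite [LHS]/conf_word [in RHS]/conf_word /= (negbTE ip').
Qed.

Lemma conf_word_leads t c p : (forall i, i <= t -> tm_space (iter i tstep c) <= S) -> head_at c p ->
  exists2 p', head_at (iter t tstep c) p' &
    leads trule m (conf_word (iter t tstep c) p') (conf_word c p).
Proof.
elim: t c p => [|t IH] c p hs hc; first by exists p => //; exact: leads0.
have [p1 [h1 e1]] := conf_word_step hc (hs 1 isT).
have [i it|p' h' l'] := IH (tstep c) p1 _ h1; first by rewrite -iterSr; exact: hs.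
rewrite iterSr; exists p' => //.
(* A machine step may leave the word unchanged, in which case it is no rewriting step. *)
case: e1 => [<- //|[j jm e1]]; case: (boolP (active (conf_word c p j) (conf_word c p j.+1))) => ac.
  by apply: leadsS jm ac _; rewrite -e1.
by rewrite rw_id // in e1; rewrite -e1.
Qed.

Lemma halted_stop c p i : head_at c p -> tm_halted c -> ~~ active (conf_word c p i) (conf_word c p i.+1).
Proof.
move=> hc hh; have wc := conf_word_wf hc.
have D : tm_delta (conf_state c) (tape_head c) = None.
  by move: hh; rewrite /tm_halted; case: c {hc wc} => q l a r /=; case: (tm_delta q a) => [[[]]|].
have hx j q a : conf_word c p j = scan q a -> tm_delta q a = None.
  rewrite /conf_word; do 2 (case: ifP => // _); case: eqP => _; first by case=> <- <-.
  by case: ifP.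
rewrite negbK /trule; case E1 : (conf_word c p i) => [?|[c1|[q1 a1]]] //;
  case E2 : (conf_word c p i.+1) => [?|[c2|[q2 a2]]] //; first by rewrite (hx _ _ _ E2).
by rewrite (hx _ _ _ E1).
Qed.

Lemma halted_accept c p : head_at c p -> tm_halted c ->
  (exists2 i, i <= m & tacc (conf_word c p i)) <-> tm_accept (conf_state c).
Proof.
move=> hc hh; have [h1 h2] := head_at_range hc.
have D : tm_delta (conf_state c) (tape_head c) = None.
  by move: hh; rewrite /tm_halted; case: c {hc} => q l a r /=; case: (tm_delta q a) => [[[]]|].
split=> [[i _]|ha].
  rewrite /conf_word; do 2 (case: ifP => // _); case: eqP => _; first by case/andP.
  by case: ifP.
exists p; first by lia.
rewrite /conf_word eqxx; case: ifP => [|_]; first by lia.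
case: ifP => [|_]; first by lia.
by rewrite /= ha D.
Qed.

Lemma init_head w : tm_space (tm_init M w) <= S -> head_at (tm_init M w) p0.
Proof. by move=> h; split=> //=; lia. Qed.

End Machine.

(** * From a space-bounded machine to a circuit *)

Section Reduction.
Variables (M : tm) (k : nat).
Notation X := (tsymb M).
Notation lm := (inl true : X).
Notation rm := (inl false : X).
Notation Sp w := (poly_bound k (size w)).
Notation len w := ((Sp w).*2 + 10).
Notation nl := #|{: letter X}|.
Definition tcompat (a b : nat) := Hl (@trule M) lm rm (@tacc M) (ldec X a) (ldec X b).

Definition init_word w := conf_word (Sp w) (tm_init M w) (Sp w + 3).
Definition init_code w := wenc (pword (init_word w)).

Definition sym_of (i : nat) : tm_sym M :=
  match i with 0 => None | 1 => Some (inl false) | _ => Some (inl true) end.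
(** Only eight symbols occur in an initial word: the two marks, and the start state or a plain cell
    with each of three contents. Hence its letters come from a table of 64 pairs. *)
Definition symb_of (i : nat) : X :=
  match i with 0 => lm | 1 => rm | i'.+2 => if i' < 3 then scan (tm_start M) (sym_of i') else cell (sym_of (i' - 3)) end.
Definition init_num (w : seq bool) (i : nat) : nat :=
  if i <= 1 then 0 else if (len w).-1 <= i then 1
  else if i == Sp w + 3 then 2 + getb w 0 else if i < Sp w + 3 then 5 else 5 + getb w (i - (Sp w + 3)).

Lemma getb_lt w i : getb w i < 3.
Proof. by rewrite /getb; case: ifP => _ //; case: nth. Qed.

Lemma getb_sym w i : sym_of (getb w i) = nth None (tm_word M w) i.
Proof.
rewrite /getb /tm_word; case: ltnP => h; last by rewrite nth_default ?size_map.
by rewrite (nth_map false) //; case: nth.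
Qed.

Lemma init_num_lt w i : init_num w i < 8.
Proof.
rewrite /init_num; case: ifP => // _; case: ifP => // _; have := getb_lt w 0; have := getb_lt w (i - (Sp w + 3)).
by case: ifP => _; [lia|case: ifP => _; lia].
Qed.

Lemma init_numE w i : init_word w i = symb_of (init_num w i).
Proof.
rewrite /init_word /conf_word /init_num; case: ifP => // _; case: ifP => // _; case: eqP => ip.
  have -> : tape_head (tm_init M w) = sym_of (getb w 0) by rewrite getb_sym /= nth0.
  by have := getb_lt w 0; case: (getb w 0) => [|[|[|//]]].
case: ifP => h; first by rewrite nth_nil.
have -> : nth None (tape_right (tm_init M w)) (i - (Sp w + 3).+1) = sym_of (getb w (i - (Sp w + 3))).
  by rewrite getb_sym /= nth_behead; congr nth; lia.
by have := getb_lt w (i - (Sp w + 3)); case: (getb w _) => [|[|[|//]]].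
Qed.

Lemma definable_poly : definable (fun w _ => Sp w).
Proof. by apply: definable_add; [apply: definable_mul; [|apply: definable_exp]|]; defs; exact: definable_len. Qed.

Lemma definable_init_num : definable init_num.
Proof.
have hS := definable_poly; have g0 : definable (fun w _ => getb w 0) by apply: definable_getb; defs.
have gi : definable (fun w i => getb w (i - (Sp w + 3))) by apply: definable_getb; defs.
by rewrite /init_num; defs.
Qed.

Lemma definable_init : definable init_code.
Proof.
have hi := definable_init_num.
have hk : definable (fun w i => init_num w i * 8 + init_num w i.+1).
  by apply: definable_add; [apply: definable_mul; [exact: hi|]|apply: (definable_subst hi)]; defs.
have kl w i : init_num w i * 8 + init_num w i.+1 < 64.
  by have := init_num_lt w i; have := init_num_lt w i.+1; lia.
apply: definable_ext (@definable_tab (fun a => lenc (LP (symb_of (a %/ 8)) (symb_of (a %% 8)))) _ _ kl hk) => w i.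
have h1 := init_num_lt w i.+1.
by rewrite divnMDl // divn_small // addn0 modnMDl modn_small // /init_code /wenc /pword !init_numE.
Qed.

Lemma letters_gt2 : 2 < nl.
Proof.
pose s : seq (letter X) := [:: LP lm lm; LP lm rm; LP rm rm].
have u : uniq s by [].
by have /card_uniqP e := u; rewrite -[3]/(size s) -e max_card.
Qed.

Hypothesis halts : forall w, exists t : nat,
    [/\ tm_halted (tm_run M w t) & forall i, i <= t -> tm_space (tm_run M w i) <= Sp w].

Lemma len_gt4 (w : seq bool) : 4 < len w. Proof. by rewrite addnC. Qed.
Lemma len_gt0 (w : seq bool) : 0 < len w. Proof. by rewrite addnC. Qed.

Lemma init_wf w : wf lm rm (@thd M) (len w) (init_word w).
Proof.
apply: conf_word_wf; apply: init_head.
by have [t [_ h]] := halts w; exact: (h 0).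
Qed.

Lemma init_valid w : validW nl (len w) tcompat (init_code w).
Proof. exact: wenc_valid (pword_valid _ _ _ (len_gt4 w) (init_wf w)). Qed.

Definition machine_circuit w := circuit letters_gt2 (lenc_lt LA) (len_gt0 w) (init_valid w).

Lemma machine_circuit_yes w t : tm_halted (tm_run M w t) ->
  (forall i, i <= t -> tm_space (tm_run M w i) <= Sp w) ->
  c2e_yes (machine_circuit w) <-> tm_accept (conf_state (tm_run M w t)).
Proof.
move=> hh hs; have h0 := init_head (hs 0 isT).
have [p hp lp] := conf_word_leads hs h0.
have e : iter t (@tstep M) (tm_init M w) = tm_run M w t by [].
rewrite e in hp lp.
rewrite /machine_circuit circuit_yes.
  rewrite /tcompat /init_code.
  rewrite (word_problem _ (@trule_active_hd M) (@trule_det M) (@tacc_hd M) (@thd_plain M) (@tacc_stop M)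
    (len_gt4 w) _ (erefl _) (init_wf w) lp) //.
    exact: halted_accept.
  by move=> i _; exact: halted_stop hp hh.
by rewrite /init_code /wenc; apply/eqP => /(can_inj (@lencK _)).
Qed.

Lemma machine_printer (B : finType) : exists c : cmd B, transduces c (fun w => c2e_encode (machine_circuit w)).
Proof.
have hS := definable_poly.
have hm : definable (fun w _ => len w) by defs.
exact: (circuit_printer letters_gt2 hm definable_init (lenc_lt LA) len_gt0 init_valid B).
Qed.

End Reduction.

(** * Composing two reductions through a fixed machine *)

Definition and_or (x : c2e_instance) := forall v : 'I_(nv x), and_vertex v \/ or_vertex v.

Lemma and_or_bounds (x : c2e_instance) : and_or x ->
  (forall v : 'I_(nv x), inflow v = 2) /\ (forall e : 'I_(ne x), weight e <= 2).
Proof.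
move=> h; split=> [v|e]; first by case: (h v) => -[].
have ie : e \in incident (src e) by rewrite !inE eqxx.
case: (h (src e)) => [[_ c3 c1 c2]|[_ _ /(_ e ie) -> //]].
pose S j := [set f in incident (src e) | weight f == j].
have : e \in S 1 :|: S 2.
  suff -> : S 1 :|: S 2 = incident (src e) by [].
  apply/eqP; rewrite eqEcard /S !setIdE subUset !subsetIl /= -!setIdE cardsU c1 c2 c3.
  rewrite (_ : _ :&: _ = set0) ?cards0 //; apply/setP => f; rewrite !inE.
  by case: (weight f) => [|[|k]]; rewrite ?andbF.
by rewrite !inE => /orP[] /andP[_ /eqP ->].
Qed.

Lemma cgr_and_or n m H (n3 : 3 <= n) (v : 'I_(nv (cgr m H n3))) : and_vertex v \/ or_vertex v.
Proof. exact: (tile_graph_and_or (cpwV n3) (cpwK n3)). Qed.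

Section Hardness.
Variables (R : realType) (M : tm) (k : nat) (L : language).
Hypothesis ML : forall w, exists t : nat,
    [/\ tm_halted (tm_run M w t), tm_accept (conf_state (tm_run M w t)) <-> L w
      & forall i, i <= t -> tm_space (tm_run M w i) <= poly_bound k (size w)].

(** The bound depends on the alphabet and the states of [M] alone, neither on the input nor on the
    space bound. *)
Definition circuit_width := 20 * (#|{: letter (tsymb M)}|.*2 + 3).

Lemma circuit_reduction (B : finType) : exists (c : cmd B) f, transduces c f /\
  forall w, exists x : c2e_instance, [/\ c2e_encode x = f w, L w <-> c2e_yes x, planar R x,
    bandwidth (@adjacent x) <= circuit_width & and_or x].
Proof.
have h w : exists t, tm_halted (tm_run M w t) /\ (forall i, i <= t -> tm_space (tm_run M w i) <= poly_bound k (size w)).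
  by have [t [h1 _ h2]] := ML w; exists t.
have [c hc] := machine_printer h B; exists c, (fun w => c2e_encode (machine_circuit h w)); split=> // w.
exists (machine_circuit h w); split=> //.
- have [t [h1 h2 h3]] := ML w.
  exact: iff_trans (iff_sym h2) (iff_sym (machine_circuit_yes h h1 h3)).
- exact: cgr_planar.
- exact: cgr_bandwidth.
- exact: cgr_and_or.
Qed.
End Hardness.

Theorem theorem10 (R : realType) :
  exists c : nat,
    PSPACE_complete
      (@restrict C2E_NCL (fun x : c2e_instance =>
         [/\ planar R x,
             bandwidth (@adjacent x) <= c
           & forall v : 'I_(nv x), and_vertex v \/ or_vertex v])) /\
    (forall G : cgraph,
       bandwidth (@adjacent G) <= c -> treewidth_at_most (@adjacent G) c).
Proof.
(* The machine [MU] is obtained before any language is given, so the width of its circuits is a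
   constant. *)
have [LU [MU [kU hU]] decU] := c2e_in_PSPACE and_or_bounds.
exists (circuit_width MU); split; last by move=> G; exact: bandwidth_treewidth.
split; first by apply: c2e_in_PSPACE => x [_ _ /and_or_bounds].
move=> L [M [k hM]].
(* The width of this first circuit varies with [L]. It matters only as an input word for [MU], which
   is correct on all AND/OR graphs. *)
have [c1 [f1 [h1 r1]]] := circuit_reduction R hM void.
have [c2 [f2 [h2 r2]]] := circuit_reduction R hU void.
exists (f2 \o f1); first exact: transduces_poly_time (transduces_comp h1 h2).
move=> w; have [x [ex yx _ _ ax]] := r1 w; have [y [ey yy py by_ ay]] := r2 (f1 w).
exists (exist _ y (And3 py by_ ay)) => //=.
by rewrite yx -yy -ex; apply: iff_sym; exact: (decU (exist _ x ax)).
Qed.
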